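(* Let $\underline s=(s_1,\dots,s_N)$ be a vector of positive integers and $n=\sum_{t=1}^N s_t$. Then the scheme $\mathcal M^{\underline s}_n$ is isomorphic to the Lafforgue space $\overline{\Omega}^{\mathbb V^{\underline s},E}$ over $\mathrm{Spec}\,\mathbb Z$.
   Context: **Setup.** $\underline s=(s_1,\dots,s_N)$ is a vector of positive integers, $n=\sum_t s_t$ (with $n\ge 2$, so that $G(2,n)\neq\emptyset$). $E=E_1\oplus\cdots\oplus E_N$ with $E_t$ a free $\mathbb Z$-module of rank $s_t$ with a fixed basis, so $E=\mathbb Z^n$. $G(2,n)=\mathrm{Gr}^{2,E}$ is the Grassmannian over $\mathrm{Spec}\,\mathbb Z$ parametrizing rank $(n-2)$ quotients of $E$ (equivalently rank $2$ subbundles $F$), $e:G(2,n)\hookrightarrow\mathbb P^{N_{2,n}}$, $N_{2,n}=\frac{n(n-1)}2-1$, is the Plücker embedding, and $z_I$, $I\in\mathbb I_{2,n}:=\{(i_1,i_2)\in\mathbb Z^2: 1\le i_1<i_2\le n\}$, are the homogeneous coordinates of $\mathbb P^{N_{2,n}}$. All projective spaces are over $\mathrm{Spec}\,\mathbb Z$. Let $\Delta_t(\underline s)=\{1+\sum_{i<t}s_i,\dots,\sum_{i\le t}s_i\}$ be the $t$-th block of $\{1,\dots,n\}$. $\mathbb V^{\underline s}$ is the set of $\underline v=(v_1,\dots,v_N)\in\mathbb Z^N$ with $\sum_t v_t=2$ and $0\le v_t\le s_t$. For $\underline v\in\mathbb V^{\underline s}$, $\mathbb I^{\underline s}_{\underline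 v}$ is the set of $(i_1,i_2)\in\mathbb I_{2,n}$ such that $\{i_1,i_2\}\cap\Delta_t(\underline s)$ has exactly $v_t$ elements for every $t$. For $\underline w\in\mathbb Z^N$, $G^{\underline s}_{\underline w}$ is the set of all monomials $z_{I_1}\cdots z_{I_k}$ for which there is a decomposition $\underline w=\underline v_1+\cdots+\underline v_k$ with $\underline v_i\in\mathbb V^{\underline s}$ and $I_i\in\mathbb I^{\underline s}_{\underline v_i}$. $\mathscr I^{\underline s}_{\underline w}$ is the inverse image ideal sheaf on $G(2,n)$ (under $e$) of the ideal sheaf on $\mathbb P^{N_{2,n}}$ given by the homogeneous ideal generated by $G^{\underline s}_{\underline w}$. **The index set $C^{\underline s}$.** $C^{\underline s}$ consists of the vectors $\underline w\in\mathbb Z^N$ of the following kinds: (1) $w_{i_1}=w_{i_2}=1$ for some $i_1<i_2$, other entries $0$; (2) $w_{i_1}=2$ for some $i_1$ with $s_{i_1}\ge2$, other entries $0$; (3) $w_{i_1}=w_{i_2}=w_{i_3}=w_{i_4}=1$ for some $i_1<i_2<i_3<i_4$, other entries $0$. **The scheme $\mathcal M^{\underline s}_n$.** For $\underline w\in C^{\underline s}$ let $N^{\underline s}_{\underline w}=\mathrm{card}(G^{\underline s}_{\underline w})-1$ and let $F^{\underline s}_{\underline w}:\mathbb P^{N_{2,n}}\dashrightarrow\mathbb P^{N^{\underline s}_{\underline w}}$ be the rational map whose homogeneous coordinates are the monomials in $G^{\underline s}_{\underline w}$. The blow-up of $G(2,n)$ along the product ideal sheaf $\prod_{\underline w\in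 C^{\underline s}}\mathscr I^{\underline s}_{\underline w}$ is identified with the closure of the graph of $(F^{\underline s}_{\underline w}\circ e)_{\underline w\in C^{\underline s}}$, a closed subscheme of $\mathbb P^{N_{2,n}}\times\prod_{\underline w\in C^{\underline s}}\mathbb P^{N^{\underline s}_{\underline w}}$. $\mathcal M^{\underline s}_n$ is the image of this blow-up under the projection to $\prod_{\underline w\in C^{\underline s}}\mathbb P^{N^{\underline s}_{\underline w}}$, with its reduced closed subscheme structure. **The Lafforgue space.** An *entire convex* is a set of the form $S^{(d_I)}=\{x\in(\mathbb Z_{\ge0})^N:\sum_i x_i=2,\ \sum_{i\in I}x_i\ge d_I\ \forall I\subset\{1,\dots,N\}\}$, where $(d_I)_{I\subset\{1,\dots,N\}}$ are non-negative integers with $d_\emptyset=0$, $d_{\{1,\dots,N\}}=2$ and $d_I+d_J\le d_{I\cup J}+d_{I\cap J}$ for all $I,J$. $S_{\mathbb R}$ denotes the convex hull of $S$ in $\mathbb R^N$. Let $S=\mathbb V^{\underline s}$ (an entire convex). An *entire convex paving* of $S$ is a set $\underline S$ of entire convexes contained in $S$ such that the convex hulls $S'_{\mathbb R}$, $S'\in\underline S$, have the same dimension as $S_{\mathbb R}$ and form a paving (polyhedral subdivision) of $S_{\mathbb R}$, and such that the convex cone $\mathcal C^S_{\underline S}\subset\mathbb R^S$ is nonempty; here $\mathcal C^S_{\underline S}$ is the set of functions $v:S\to\mathbb R$ such that for every $S'\in\underline S$ there is an affine function $\ell_{S'}:S\to\mathbb R$ with $\ell_{S'}\le v$ and $S'=\{i\in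 S:\ell_{S'}(i)=v(i)\}$. Let $\mathcal C^S_\emptyset$ be the space of affine functions on $S$ (the cone of the trivial paving $\{S\}$). The cones $\overline{\mathcal C}^S_{\underline S}/\mathcal C^S_\emptyset$ (closure in $\mathbb R^S$), over all entire convex pavings $\underline S$, form a fan in $\mathbb R^S/\mathcal C^S_\emptyset$; let $\mathcal A^S$ be the associated toric variety over $\mathrm{Spec}\,\mathbb Z$, with torus $\mathcal A^S_\emptyset=\mathbb G_m^S/(\mathbb G_m^S)_\emptyset$, where $\mathbb G_m^S$ is the torus of functions $S\to\mathbb G_m$ and $(\mathbb G_m^S)_\emptyset$ the subtorus of affine functions $i\mapsto c\prod_j t_j^{i_j}$. Write $\wedge^{\underline v}E_\bullet=\wedge^{v_1}E_1\otimes\cdots\otimes\wedge^{v_N}E_N$, so $\wedge^2E=\bigoplus_{\underline v\in S}\wedge^{\underline v}E_\bullet$. Let $\{P\}$ be the Plücker relations defining $\mathrm{Gr}^{2,E}$; $(\mathbb G_m^S)_\emptyset$ acts on each $P$ by a character. For an entire convex paving $\underline S$ and $S'\in\underline S$ choose a family $e_{S'}$ of $\dim S_{\mathbb R}+1$ points of $S'$ generating the lattice of integer points of the affine span of $S$; let $b_{e_{S'}}:\mathbb G_m^S/(\mathbb G_m^S)_\emptyset\to\mathbb G_m^S$ be the splitting sending a class to its unique representative equal to $1$ on $e_{S'}$. The function $P_{e_{S'}}(\lambda,(x_{\underline v}))=P(b_{e_{S'}}(\lambda)\cdot(x_{\underline v}))$ on $\mathcal A^S_\emptyset\times\prod_{\underline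 v\in S}\wedge^{\underline v}E_\bullet$ extends over $\mathcal A'\times\prod_{\underline v\in S}\wedge^{\underline v}E_\bullet$, where $\mathcal A'$ is the affine open toric chart of $\mathcal A^S$ attached to $\underline S$. $\Omega^{S,E}$ is the closed subscheme of $\mathcal A^S\times\mathbb G_m\backslash\prod_{\underline v\in S}(\wedge^{\underline v}E_\bullet-\{0\})$ which over each chart $\mathcal A'$ is defined by the vanishing of all $P_{e_{S'}}$ ($P\in\{P\}$, $S'\in\underline S$). The torus $\mathbb G_m^S/\mathbb G_m$ ($\mathbb G_m$ = constant functions) acts freely on $\Omega^{S,E}$ by $\mu\cdot(\lambda,(x_{\underline v}))=([\mu]^{-1}\lambda,(\mu_{\underline v}x_{\underline v}))$, and $\overline\Omega^{S,E}$ is the quotient, a projective scheme over $\mathrm{Spec}\,\mathbb Z$. *)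

(* Defs.v *)
From HB Require Import structures.
From Stdlib Require Import Relation_Operators.
From mathcomp Require Import all_boot all_order all_algebra.
From mathcomp Require Import mpoly.
From mathcomp Require Import boolp classical_sets reals topology.

Set Implicit Arguments.
Unset Strict Implicit.
Unset Printing Implicit Defensive.

Import Order.TTheory GRing.Theory Num.Theory.
Import numFieldTopology.Exports.

Local Open Scope ring_scope.

(* Schemes over Spec Z are represented by their functors of points on nonzero
   commutative rings (every scheme has exactly one point over the zero ring).
   [comUnitRingType] only adds to a nonzero commutative ring the decision of
   which elements are invertible.  A set-valued functor is given as a
   setoid-valued one: [zeq] is the equality of points, so that quotients are
   taken by changing [zeq]. *)

Record zfun := Zfun {
  zpt :> comUnitRingType -> Type;
  zeq : forall R, zpt R -> zpt R -> Prop;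
  zres : forall R T : comUnitRingType, {rmorphism R -> T} -> zpt R -> zpt T;
  zeq_refl : forall R (x : zpt R), zeq x x;
  zeq_sym : forall R (x y : zpt R), zeq x y -> zeq y x;
  zeq_trans : forall R (x y z : zpt R), zeq x y -> zeq y z -> zeq x z;
  zres_eq : forall (R T : comUnitRingType) (c : {rmorphism R -> T}) x y,
    zeq x y -> zeq (zres c x) (zres c y);
  zres_id : forall (R : comUnitRingType) (c : {rmorphism R -> R}) x,
    c =1 id -> zeq (zres c x) x;
  zres_comp : forall (R T U : comUnitRingType) (c : {rmorphism R -> T})
      (d : {rmorphism T -> U}) (e : {rmorphism R -> U}) x,
    e =1 d \o c -> zeq (zres e x) (zres d (zres c x))
}.

Record zmor (F G : zfun) := Zmor {
  zapp :> forall R, F R -> G R;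
  zapp_eq : forall R (x y : F R), zeq x y -> zeq (zapp x) (zapp y);
  zapp_res : forall (R T : comUnitRingType) (c : {rmorphism R -> T}) (x : F R),
    zeq (zapp (zres c x)) (zres c (zapp x))
}.

Definition ziso (F G : zfun) : Prop :=
  exists (a : zmor F G) (b : zmor G F),
    (forall R (x : F R), zeq (b R (a R x)) x) /\
    (forall R (y : G R), zeq (a R (b R y)) y).

Section Constructions.

Program Definition zprod (I : Type) (F : I -> zfun) : zfun :=
  @Zfun (fun R => forall i, F i R) (fun R x y => forall i, zeq (x i) (y i))
        (fun R T c x i => zres c (x i)) _ _ _ _ _ _.
Next Obligation. by move=> I F R x i; apply: zeq_refl. Qed.
Next Obligation. by move=> I F R x y h i; apply: zeq_sym. Qed.
Next Obligation. by move=> I F R x y z h k i; apply: zeq_trans (h i) (k i). Qed.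
Next Obligation. by move=> I F R T c x y h i; apply: zres_eq. Qed.
Next Obligation. by move=> I F R c x h i; apply: zres_id. Qed.
Next Obligation. by move=> I F R T U c d e x h i; apply: zres_comp. Qed.

Program Definition zprod2 (F G : zfun) : zfun :=
  @Zfun (fun R => F R * G R)%type
        (fun R x y => zeq x.1 y.1 /\ zeq x.2 y.2)
        (fun R T c x => (zres c x.1, zres c x.2)) _ _ _ _ _ _.
Next Obligation. by move=> F G R x; split; apply: zeq_refl. Qed.
Next Obligation. by move=> F G R x y [? ?]; split; apply: zeq_sym. Qed.
Next Obligation.
by move=> F G R x y z [a b] [c d]; split; [apply: zeq_trans a c|apply: zeq_trans b d].
Qed.
Next Obligation. by move=> F G R T c x y [? ?]; split; apply: zres_eq. Qed.
Next Obligation. by move=> F G R c x h; split; apply: zres_id. Qed.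
Next Obligation. by move=> F G R T U c d e x h; split; apply: zres_comp. Qed.

Program Definition zsub (F : zfun) (P : forall R, F R -> Prop)
    (PR : forall (R T : comUnitRingType) (c : {rmorphism R -> T}) (x : F R),
       P R x -> P T (zres c x)) : zfun :=
  @Zfun (fun R => {x : F R | P R x})
        (fun R x y => zeq (proj1_sig x) (proj1_sig y))
        (fun R T c x => exist _ (zres c (proj1_sig x)) (PR R T c _ (proj2_sig x)))
        _ _ _ _ _ _.
Next Obligation. by move=> F P PR R x; apply: zeq_refl. Qed.
Next Obligation. by move=> F P PR R x y; apply: zeq_sym. Qed.
Next Obligation. by move=> F P PR R x y z; apply: zeq_trans. Qed.
Next Obligation. by move=> F P PR R T c x y; apply: zres_eq. Qed.
Next Obligation. by move=> F P PR R c x; apply: zres_id. Qed.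
Next Obligation. by move=> F P PR R T U c d e x; apply: zres_comp. Qed.

End Constructions.

Section Sheafification.

(* The Zariski cover of Spec R by the D(g), g in f.  A ring morphism c : R -> T
   belongs to the sieve of this cover when Spec T -> Spec R factors through
   some D(g); since R -> R[1/g] is universal among such c, giving compatible
   points over the sieve amounts to giving compatible points over the R[1/g]. *)
Definition unit_ideal (R : comUnitRingType) (f : seq R) : Prop :=
  exists a : seq R, \sum_(i < size f) a`_i * f`_i = 1.

Definition in_cover (R T : comUnitRingType) (f : seq R)
    (c : {rmorphism R -> T}) : bool :=
  has (fun g => c g \is a GRing.unit) f.

Lemma unit_ideal_map (R T : comUnitRingType) (c : {rmorphism R -> T}) f :
  unit_ideal f -> unit_ideal (map c f).
Proof.
have nthc (g : seq R) i : (map c g)`_i = c g`_i.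
  have [lt|ge] := ltnP i (size g); first by rewrite (nth_map 0).
  by rewrite !nth_default ?size_map ?rmorph0.
move=> [a h]; exists (map c a); rewrite size_map -(rmorph1 c) -h rmorph_sum /=.
by apply: eq_bigr => i _; rewrite rmorphM !nthc.
Qed.

Lemma in_cover_map (R T U : comUnitRingType) (c : {rmorphism R -> T})
    (d : {rmorphism T -> U}) (e : {rmorphism R -> U}) f :
  e =1 d \o c -> in_cover (map c f) d = in_cover f e.
Proof. by move=> h; rewrite /in_cover has_map; apply: eq_has => g /=; rewrite h. Qed.

Lemma in_cover_comp (R T U : comUnitRingType) (c : {rmorphism R -> T})
    (d : {rmorphism T -> U}) (e : {rmorphism R -> U}) f :
  e =1 d \o c -> in_cover f c -> in_cover f e.
Proof.
move=> h /hasP [g gf gu]; apply/hasP; exists g => //.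
by rewrite h /=; apply: rmorph_unit.
Qed.

Variable F : zfun.

(* Equality of points locally for the Zariski topology. *)
Inductive loc_eq : forall R : comUnitRingType, F R -> F R -> Prop :=
| loc_base (R : comUnitRingType) (x y : F R) : zeq x y -> loc_eq x y
| loc_cover (R : comUnitRingType) (x y : F R) (f : seq R) : unit_ideal f ->
    (forall (T : comUnitRingType) (c : {rmorphism R -> T}), in_cover f c ->
       loc_eq (zres c x) (zres c y)) ->
    loc_eq x y.

Lemma loc_eq_zeq R (x y : F R) : loc_eq x y ->
  forall x' y', zeq x' x -> zeq y y' -> loc_eq x' y'.
Proof.
elim=> {R x y} [R x y h|R x y f uf _ IH] x' y' hx hy.
  by apply: loc_base; apply: zeq_trans hx (zeq_trans h hy).
by apply: (loc_cover uf) => T c cf; apply: (IH T c cf); apply: zres_eq.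
Qed.

Lemma loc_sym R (x y : F R) : loc_eq x y -> loc_eq y x.
Proof.
elim=> {R x y} [R x y h|R x y f uf _ IH]; first exact/loc_base/zeq_sym.
exact: (loc_cover uf).
Qed.

Lemma loc_res R (x y : F R) : loc_eq x y ->
  forall (T : comUnitRingType) (c : {rmorphism R -> T}),
    loc_eq (zres c x) (zres c y).
Proof.
elim=> {R x y} [R x y h|R x y f uf H _] T c; first exact/loc_base/zres_eq.
apply: (loc_cover (unit_ideal_map c uf)) => U d df.
have h : (d \o c : {rmorphism R -> U}) =1 d \o c by [].
rewrite (in_cover_map f h) in df.
apply: loc_eq_zeq (H _ _ df) _ _ _ _; first exact/zeq_sym/zres_comp.
exact/zres_comp.
Qed.

Lemma loc_trans R (x y z : F R) : loc_eq x y -> loc_eq y z -> loc_eq x z.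
Proof.
move=> h; elim: h z => {R x y} [R x y h|R x y f uf _ IH] z hz.
  by apply: loc_eq_zeq hz _ _ h (zeq_refl _).
by apply: (loc_cover uf) => T c cf; apply: (IH T c cf); apply: loc_res.
Qed.

(* Points of the associated Zariski sheaf: matching families over a cover. *)
Record shpt (R : comUnitRingType) := Shpt {
  sh_cov : seq R;
  sh_covP : unit_ideal sh_cov;
  sh_val : forall (T : comUnitRingType) (c : {rmorphism R -> T}),
    in_cover sh_cov c -> F T;
  sh_match : forall (T U : comUnitRingType) (c : {rmorphism R -> T})
      (d : {rmorphism T -> U}) (e : {rmorphism R -> U})
      (p : in_cover sh_cov c) (q : in_cover sh_cov e),
    e =1 d \o c -> loc_eq (zres d (sh_val p)) (sh_val q)
}.

Definition sheq R (x y : shpt R) : Prop :=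
  forall (T : comUnitRingType) (c : {rmorphism R -> T})
    (p : in_cover (sh_cov x) c) (q : in_cover (sh_cov y) c),
  loc_eq (sh_val p) (sh_val q).

Lemma in_cover_map1 (R T U : comUnitRingType) (c : {rmorphism R -> T})
    (d : {rmorphism T -> U}) f :
  in_cover (map c f) d -> in_cover f (d \o c : {rmorphism R -> U}).
Proof. by rewrite (@in_cover_map _ _ _ c d (d \o c)). Qed.

Program Definition shres (R T : comUnitRingType) (c : {rmorphism R -> T})
    (x : shpt R) : shpt T :=
  @Shpt T (map c (sh_cov x)) (unit_ideal_map c (sh_covP x))
    (fun U d p => sh_val (in_cover_map1 p)) _.
Next Obligation.
by move=> R T c x U V d d' e p q h; apply: sh_match => a /=; rewrite h.
Qed.

Lemma sh_indep R (x : shpt R) (T : comUnitRingType) (c e : {rmorphism R -> T})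
    (p : in_cover (sh_cov x) c) (q : in_cover (sh_cov x) e) :
  e =1 c -> loc_eq (sh_val p) (sh_val q).
Proof.
move=> h; have := @sh_match R x T T c idfun e p q h.
by move=> k; apply: (loc_eq_zeq k) (zeq_refl _); apply/zeq_sym/zres_id.
Qed.

Program Definition sheafify : zfun :=
  @Zfun shpt sheq shres _ _ _ _ _ _.
Next Obligation.
by move=> R x T c p q; apply: sh_indep.
Qed.
Next Obligation. by move=> R x y h T c p q; apply: loc_sym; apply: h. Qed.
Next Obligation.
move=> R x y z h k T c p q.
apply: (loc_cover (unit_ideal_map c (sh_covP y))) => U d df.
have e1 : (d \o c : {rmorphism R -> U}) =1 d \o c by [].
have py := in_cover_map1 df.
have px := in_cover_comp e1 p; have pz := in_cover_comp e1 q.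
apply: loc_trans (sh_match p px e1) _.
apply: loc_trans (h _ _ px py) _.
apply: loc_trans (k _ _ py pz) _.
exact: loc_sym (sh_match q pz e1).
Qed.
Next Obligation. by move=> R T c x y h U d p q; apply: h. Qed.
Next Obligation. by move=> R c x h T d p q; apply: (@sh_indep R x) => a /=; rewrite h. Qed.
Next Obligation.
by move=> R T U c d e x h V b p q; apply: (@sh_indep R x) => a /=; rewrite h.
Qed.

(* The canonical morphism from F to its associated sheaf. *)
Lemma unit_ideal1 (R : comUnitRingType) : unit_ideal [:: 1 : R].
Proof. by exists [:: 1]; rewrite big_ord1 mulr1. Qed.

Program Definition zunit (R : comUnitRingType) (x : F R) : sheafify R :=
  @Shpt R [:: 1] (unit_ideal1 R) (fun T c _ => zres c x) _.
Next Obligation.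
by move=> R x T U c d e p q h; apply/loc_base/zeq_sym/zres_comp.
Qed.

(* Extension to the associated sheaf of a natural endomorphism of the
   restriction of F to R-algebras. *)
Record endo (R : comUnitRingType) := Endo {
  en_app :> forall (T : comUnitRingType), {rmorphism R -> T} -> F T -> F T;
  en_eq : forall (T : comUnitRingType) (c : {rmorphism R -> T}) x y,
    zeq x y -> zeq (en_app c x) (en_app c y);
  en_res : forall (T U : comUnitRingType) (c : {rmorphism R -> T})
     (d : {rmorphism T -> U}) (e : {rmorphism R -> U}) x,
    e =1 d \o c -> zeq (zres d (en_app c x)) (en_app e (zres d x))
}.

Lemma en_loc R (a : endo R) (T : comUnitRingType) (x y : F T) :
  loc_eq x y -> forall c : {rmorphism R -> T}, loc_eq (a T c x) (a T c y).
Proof.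
elim=> {T x y} [T x y h|T x y f uf _ IH] c; first exact/loc_base/en_eq.
apply: (loc_cover uf) => U d df.
have e1 : (d \o c : {rmorphism R -> U}) =1 d \o c by [].
apply: loc_eq_zeq (IH U d df (d \o c)) _ _ _ _.
  exact: en_res.
exact/zeq_sym/en_res.
Qed.

Program Definition sh_endo R (a : endo R) (x : sheafify R) : sheafify R :=
  @Shpt R (sh_cov x) (sh_covP x) (fun T c p => a T c (sh_val p)) _.
Next Obligation.
move=> R a x T U c d e p q h.
apply: loc_eq_zeq (en_loc a (sh_match p q h) e) _ _ _ (zeq_refl _).
exact: en_res.
Qed.

Lemma sh_endo_eq R (a : endo R) (x y : sheafify R) :
  zeq x y -> zeq (sh_endo a x) (sh_endo a y).
Proof. by move=> h T c p q; apply: en_loc; apply: h. Qed.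

Lemma sh_endo_id R (a : endo R) (x : sheafify R) :
  (forall (T : comUnitRingType) (c : {rmorphism R -> T}) z, zeq (a T c z) z) ->
  zeq (sh_endo a x) x.
Proof.
move=> h T c p q; have k := @sh_indep R x T c c p q (fun=> erefl).
exact: loc_eq_zeq k _ _ (h _ _ _) (zeq_refl _).
Qed.

Lemma sh_endo_comp R (a1 a2 a3 : endo R) (x : sheafify R) :
  (forall (T : comUnitRingType) (c : {rmorphism R -> T}) z,
     zeq (a3 T c z) (a2 T c (a1 T c z))) ->
  zeq (sh_endo a3 x) (sh_endo a2 (sh_endo a1 x)).
Proof.
move=> h T c p q; have k := @sh_indep R x T c c p q (fun=> erefl).
exact: loc_eq_zeq (en_loc a3 k c) _ _ (zeq_refl _) (h _ _ _).
Qed.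

Lemma sh_endo_res (R T : comUnitRingType) (c : {rmorphism R -> T})
    (a : endo R) (b : endo T) (x : sheafify R) :
  (forall (U : comUnitRingType) (d : {rmorphism T -> U}) z,
     zeq (a U (d \o c) z) (b U d z)) ->
  zeq (zres c (sh_endo a x)) (sh_endo b (zres c x)).
Proof.
move=> h U d p q; apply: (@loc_trans U _ (a U (d \o c)
   (@sh_val R x U (d \o c) (in_cover_map1 q)))); last exact/loc_base/h.
by apply: en_loc; apply: sh_indep.
Qed.

End Sheafification.

Section ProjectiveSpaces.

(* The presheaf quotient by G_m of the scheme of vectors y : J -> R none of whose
   blocks vanishes at any point of Spec R; [blk] gives the blocks of J.  When J
   is infinite, [unimodular] still means that the entries in the block generate
   the unit ideal. *)
Variables (J B : Type) (blk : B -> pred J).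

Definition unimodular (R : comUnitRingType) (Q : pred J) (y : J -> R) : Prop :=
  exists (l : seq J) (a : J -> R), \sum_(j <- l | Q j) a j * y j = 1.

Definition nzvec (R : comUnitRingType) :=
  {y : J -> R | forall b, unimodular (blk b) y}.

Lemma nzvec_resP (R T : comUnitRingType) (c : {rmorphism R -> T}) (y : J -> R) :
  (forall b, unimodular (blk b) y) -> forall b, unimodular (blk b) (c \o y).
Proof.
move=> h b; have [l [a e]] := h b; exists l, (c \o a).
by rewrite -(rmorph1 c) -e rmorph_sum; apply: eq_bigr => j _; rewrite rmorphM.
Qed.

Definition nzvec_res (R T : comUnitRingType) (c : {rmorphism R -> T})
  (y : nzvec R) : nzvec T := exist _ _ (nzvec_resP c (proj2_sig y)).

Definition nzvec_eq (R : comUnitRingType) (y z : nzvec R) : Prop :=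
  exists2 u : R, u \is a GRing.unit &
    forall j, proj1_sig z j = u * proj1_sig y j.

Program Definition nzvec_mod : zfun :=
  @Zfun nzvec nzvec_eq nzvec_res _ _ _ _ _ _.
Next Obligation. by move=> R x; exists 1; rewrite ?unitr1 // => j; rewrite mul1r. Qed.
Next Obligation.
move=> R x y [u uu h]; exists u^-1; rewrite ?unitrV // => j.
by rewrite h mulKr.
Qed.
Next Obligation.
move=> R x y z [u uu h] [v vu k]; exists (v * u); first by rewrite unitrM uu vu.
by move=> j; rewrite k h mulrA.
Qed.
Next Obligation.
move=> R T c x y [u uu h]; exists (c u); first exact: rmorph_unit.
by move=> j /=; rewrite h rmorphM.
Qed.
Next Obligation.
by move=> R c x h; exists 1; rewrite ?unitr1 // => j /=; rewrite h mul1r.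
Qed.
Next Obligation.
by move=> R T U c d e x h; exists 1; rewrite ?unitr1 // => j /=; rewrite h mul1r.
Qed.

End ProjectiveSpaces.

(* The projective space over Z with homogeneous coordinates indexed by the
   finite set J. *)
Definition Pr_pre (J : Type) : zfun := nzvec_mod (fun (_ : unit) (_ : J) => true).
Definition Pr (J : Type) : zfun := sheafify (Pr_pre J).

Section MultiProjective.

(* Closed subsets of the product over w of the projective spaces Pr (J w). *)
Variables (W : eqType) (J : W -> Type).

Definition mcoords (R : Type) := forall w, J w -> R.

(* Forms over Z, homogeneous separately in each group of variables. *)
Record mform := Mform {
  mf_n : nat;
  mf_var : 'I_mf_n -> {w : W & J w};
  mf_pol : {mpoly int[mf_n]};
  mf_hom : forall w, exists d : nat, forall m, m \in msupp mf_pol ->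
    (\sum_(i < mf_n | tag (mf_var i) == w) m i)%N = d
}.

Definition mf_eval (f : mform) (R : comUnitRingType) (y : mcoords R) : R :=
  mmap (fun z : int => z%:~R) (fun i => y _ (tagged (mf_var i))) (mf_pol f).

Definition nzcoords (K : fieldType) (y : mcoords K) : Prop :=
  forall w, exists j, y w j != 0.

(* A set of field-valued points, given by homogeneous coordinates. *)
Definition mpoints := forall K : fieldType, mcoords K -> Prop.

Definition mf_vanish (A : mpoints) (f : mform) : Prop :=
  forall (K : fieldType) (y : mcoords K), A K y -> mf_eval f y = 0.

Definition zclosure (A : mpoints) : mpoints := fun K y =>
  nzcoords y /\ forall f, mf_vanish A f -> mf_eval f y = 0.

(* The reduced closed subscheme whose underlying set is (the closure of) A. *)
Definition reduced_pt (A : mpoints) (R : comUnitRingType)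
    (x : zprod (fun w => Pr (J w)) R) : Prop :=
  forall (T : comUnitRingType) (c : {rmorphism R -> T})
    (y : forall w, Pr_pre (J w) T),
    (forall w, zeq (zres c (x w)) (zunit (y w))) ->
  forall f, mf_vanish A f -> mf_eval f (fun w => proj1_sig (y w)) = 0.

Lemma reduced_pt_res A (R T : comUnitRingType) (c : {rmorphism R -> T}) x :
  @reduced_pt A R x -> @reduced_pt A T (zres c x).
Proof.
move=> h U d y hy; apply: (h U (d \o c)) => w.
by apply: zeq_trans (hy w); apply: zres_comp.
Qed.

Definition reduced_closed (A : mpoints) : zfun := zsub (@reduced_pt_res A).

End MultiProjective.

Section Setup.

Variables (N : nat) (s : 'I_N -> nat).

Definition tot : nat := \sum_(t < N) s t.

(* Indices are numbered from 0. *)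
Definition idx2 := {p : 'I_tot * 'I_tot | (p.1 < p.2)%N}.

Definition pr2 (i j : 'I_tot) (h : (i < j)%N) : idx2 :=
  exist (fun p : 'I_tot * 'I_tot => (p.1 < p.2)%N) (i, j) h.

Definition block (t : 'I_N) : {set 'I_tot} :=
  [set i : 'I_tot | (\sum_(r < N | (r < t)%N) s r <= i
                       < \sum_(r < N | (r <= t)%N) s r)%N].

(* The points of (Z_{>=0})^N with sum of coordinates 2; the bound on each
   coordinate is automatic. *)
Definition lpt := {x : {ffun 'I_N -> 'I_3} | (\sum_t x t == 2)%N}.

Definition Vset : {set lpt} := [set x : lpt | [forall t, sval x t <= s t]%N].
Definition VS := {x : lpt | x \in Vset}.

Definition vco (v : VS) (t : 'I_N) : nat := sval (sval v) t.

Definition inI (v : VS) (I : idx2) : bool :=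
  [forall t, #|[set (sval I).1; (sval I).2] :&: block t| == vco v t].

(* The three-term Pluecker relations, the term in x_I x_J being multiplied by
   [chi I J]. *)
Definition pluecker (R : comUnitRingType) (chi : idx2 -> idx2 -> R)
    (x : idx2 -> R) : Prop :=
  forall (i j k l : 'I_tot) (ij : (i < j)%N) (jk : (j < k)%N) (kl : (k < l)%N),
  let ik := ltn_trans ij jk in
  let jl := ltn_trans jk kl in
  let il := ltn_trans ik kl in
  let term I J := chi I J * (x I * x J) in
  term (pr2 ij) (pr2 kl) - term (pr2 ik) (pr2 jl) + term (pr2 il) (pr2 jk) = 0.

Section SchemeM.

(* The monomial \prod_I z_I ^ m_I lies in G_w. *)
Definition inG (w : {ffun 'I_N -> nat}) (m : {ffun idx2 -> nat}) : Prop :=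
  exists l : seq (VS * idx2),
    [/\ all (fun p => inI p.1 p.2) l,
        forall t, w t = (\sum_(p <- l) vco p.1 t)%N
      & m = [ffun I => count (fun p => p.2 == I) l]].

Definition inC (w : {ffun 'I_N -> nat}) : Prop :=
  [\/ exists i1 i2 : 'I_N, (i1 < i2)%N /\
        w = [ffun t => nat_of_bool (t \in [:: i1; i2])],
      exists i1 : 'I_N, (2 <= s i1)%N /\ w = [ffun t => if t == i1 then 2%N else 0%N]
    | exists i1 i2 i3 i4 : 'I_N, [/\ i1 < i2, i2 < i3 & i3 < i4]%N /\
        w = [ffun t => nat_of_bool (t \in [:: i1; i2; i3; i4])]].

Definition Cset := {w : {ffun 'I_N -> nat} | `[< inC w >]}.
Definition Gset (w : Cset) := {m : {ffun idx2 -> nat} | `[< inG (sval w) m >]}.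

Definition mono (R : comUnitRingType) (z : idx2 -> R) (m : {ffun idx2 -> nat}) : R :=
  \prod_I z I ^+ m I.

(* Coordinates of P^{N_{2,n}} ([None]) and of the P^{N_w} ([Some w]). *)
Definition Jgraph (o : option Cset) : Type :=
  match o with None => idx2 | Some w => Gset w end.

(* The graph, over the open part of G(2,n) where all the families of monomials
   are defined, of the rational maps F_w. *)
Definition graphF : mpoints Jgraph := fun K y =>
  [/\ nzcoords y,
      pluecker (fun _ _ => 1) (y None)
    & forall w, exists2 a : K, a != 0 &
        forall m, y (Some w) m = a * mono (y None) (sval m)].

(* The blow-up of G(2,n) along the product of the ideals I_w, as the closure of
   this graph. *)
Definition blowup : mpoints Jgraph := zclosure graphF.

Definition imageM : mpoints Gset := fun K y =>
  exists z : idx2 -> K,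
    blowup (fun o : option Cset => match o return Jgraph o -> K with
                                   | None => z | Some w => y w end).

Definition Mn : zfun := reduced_closed imageM.

End SchemeM.

Section Lafforgue.

Variable K : realType.

Definition entire_convex (A : {set lpt}) : Prop :=
  exists d : {set 'I_N} -> nat,
    [/\ d finset.set0 = 0%N, d finset.setT = 2%N,
        forall I J, (d I + d J <= d (I :|: J) + d (I :&: J))%N
      & A = [set x : lpt | [forall I, d I <= \sum_(i in I) sval x i]%N]].

Definition hull (A : {set VS}) : set ('I_N -> K) := fun x =>
  exists a : VS -> K,
    [/\ forall v, 0 <= a v, forall v, v \notin A -> a v = 0, \sum_v a v = 1
      & forall t, x t = \sum_v a v * (vco v t)%:R].

(* One plus the dimension of the affine span of A. *)
Definition adim1 (A : {set VS}) : nat :=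
  \rank (\matrix_(k < #|A|)
     row_mx (1%:M : 'M[K]_1) (\row_t (vco (enum_val k) t)%:R)).

(* F is a (possibly empty) face of P. *)
Definition is_face (F P : set ('I_N -> K)) : Prop :=
  (forall x, ~ F x) \/
  exists a : 'I_N -> K, forall x, F x <->
    P x /\ forall y, P y -> \sum_t a t * y t <= \sum_t a t * x t.

Definition subdivision (S : {set {set VS}}) : Prop :=
  (forall x, hull [set: VS] x <-> exists2 A, A \in S & hull A x) /\
  (forall A B, A \in S -> B \in S ->
     is_face (fun x => hull A x /\ hull B x) (hull A)).

Definition is_affine (l : VS -> K) : Prop :=
  exists (c : K) (a : 'I_N -> K), forall v, l v = c + \sum_t a t * (vco v t)%:R.

Definition cone (S : {set {set VS}}) : set {ptws VS -> K} := fun v =>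
  forall A, A \in S -> exists l : VS -> K,
    [/\ is_affine l, forall i, l i <= v i & forall i, (i \in A) = (l i == v i)].

Definition paving (S : {set {set VS}}) : Prop :=
  [/\ forall A, A \in S ->
        entire_convex (sval @: A) /\ adim1 A = adim1 [set: VS],
      subdivision S
    & exists v, cone S v].

(* Characters of G_m^S trivial on the affine functions i |-> c \prod_j t_j^{i_j}. *)
Definition charA (m : {ffun VS -> int}) : Prop :=
  \sum_v m v = 0 /\ forall t, \sum_v m v * (vco v t)%:Z = 0.

Definition dualcone (S : {set {set VS}}) (m : {ffun VS -> int}) : Prop :=
  charA m /\ forall v, closure (cone S) v -> 0 <= \sum_i (m i)%:~R * v i.

(* R-points of the disjoint union of the charts Spec Z[dualcone S].  Only the
   values of [tp_val] on the dual cone are meaningful. *)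
Record tpt (R : comUnitRingType) := Tpt {
  tp_pav : {set {set VS}};
  tp_ok : paving tp_pav;
  tp_val : {ffun VS -> int} -> R;
  tp_0 : tp_val 0 = 1;
  tp_D : forall m m', dualcone tp_pav m -> dualcone tp_pav m' ->
    tp_val (m + m') = tp_val m * tp_val m'
}.

Program Definition tres (R T : comUnitRingType) (c : {rmorphism R -> T})
    (x : tpt R) : tpt T :=
  @Tpt T (tp_pav x) (tp_ok x) (c \o tp_val x) _ _.
Next Obligation. by move=> R T c x /=; rewrite tp_0 rmorph1. Qed.
Next Obligation. by move=> R T c x m m' h h' /=; rewrite tp_D // rmorphM. Qed.

(* x and y come from a point of the chart of the intersection of their cones. *)
Definition tglue (R : comUnitRingType) (x y : tpt R) : Prop :=
  exists z : tpt R,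
    [/\ closure (cone (tp_pav z)) =
          (closure (cone (tp_pav x)) `&` closure (cone (tp_pav y)))%classic,
        forall m, dualcone (tp_pav x) m -> tp_val z m = tp_val x m
      & forall m, dualcone (tp_pav y) m -> tp_val z m = tp_val y m].

Definition teq (R : comUnitRingType) := clos_refl_sym_trans (tpt R) (@tglue R).

Lemma tglue_ext (R : comUnitRingType) (x y : tpt R) :
  tp_pav x = tp_pav y -> tp_val x =1 tp_val y -> tglue x y.
Proof.
by move=> h k; exists x; split=> //; rewrite -h setIid.
Qed.

Program Definition toric_pre : zfun := @Zfun tpt teq tres _ _ _ _ _ _.
Next Obligation. by move=> R x; apply: rst_refl. Qed.
Next Obligation. by move=> R x y; apply: rst_sym. Qed.
Next Obligation. by move=> R x y z; apply: rst_trans. Qed.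
Next Obligation.
move=> R T c x y; elim=> {x y} [x y [z [h1 h2 h3]]|x|x y _|x y z _ h _ k].
- apply: rst_step; exists (tres c z); split=> //= m hm.
    by rewrite h2.
  by rewrite h3.
- exact: rst_refl.
- exact: rst_sym.
- exact: rst_trans h k.
Qed.
Next Obligation.
by move=> R c x h; apply: rst_step; apply: tglue_ext => //= m /=; rewrite h.
Qed.
Next Obligation.
by move=> R T U c d e x h; apply: rst_step; apply: tglue_ext => //= m /=; rewrite h.
Qed.

Definition toric : zfun := sheafify toric_pre.

(* G_m \ \prod_v (wedge^v E - {0}): the coordinates x_I with I in I_v are those
   of the component in wedge^v E. *)
Definition wedge_pre : zfun := nzvec_mod inI.
Definition wedge : zfun := sheafify wedge_pre.

Definition delta (v : VS) : {ffun VS -> int} := [ffun i => (i == v)%:Z].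

(* e is a family of dim S + 1 points of A generating the lattice of integer
   points of the affine span of S. *)
Definition affine_basis (A e : {set VS}) : Prop :=
  [/\ e \subset A, #|e| = adim1 [set: VS]
    & forall x : 'I_N -> int,
        (exists a : VS -> K, \sum_v a v = 1 /\
           forall t, (x t)%:~R = \sum_v a v * (vco v t)%:R) ->
        exists a : VS -> int, \sum_(v in e) a v = 1 /\
           forall t, x t = \sum_(v in e) a v * (vco v t)%:Z].

(* b v is the v-th component of b_e, as a character of G_m^S / (G_m^S)_0:
   lambda = b_e(lambda) * (affine function), and b_e(lambda) = 1 on e. *)
Definition splitting (e : {set VS}) (b : VS -> {ffun VS -> int}) : Prop :=
  [/\ forall v, charA (b v),
      exists (c : {ffun VS -> int}) (d : 'I_N -> {ffun VS -> int}),
        forall v, delta v = b v + (c + \sum_t d t *+ vco v t)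
    & forall v, v \in e -> b v = 0].

(* The sum has exactly one term: each I lies in a single I_v. *)
Definition chi_idx (b : VS -> {ffun VS -> int}) (I : idx2) : {ffun VS -> int} :=
  \sum_(v | inI v I) b v.

(* The equations P_e(lambda, x) = 0 of Omega over a chart.  They are imposed for
   all admissible e: two choices of e change P_e by an invertible function. *)
Definition chart_eqs (R : comUnitRingType) (z : tpt R) (x : idx2 -> R) : Prop :=
  forall (A e : {set VS}) (b : VS -> {ffun VS -> int}),
    A \in tp_pav z -> affine_basis A e -> splitting e b ->
  pluecker (fun I J => tp_val z (chi_idx b I + chi_idx b J)) x.

Definition omega_pt (R : comUnitRingType) (p : zprod2 toric wedge R) : Prop :=
  forall (T : comUnitRingType) (c : {rmorphism R -> T})
    (z : toric_pre T) (x : wedge_pre T),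
    zeq (zres c p.1) (zunit z) -> zeq (zres c p.2) (zunit x) ->
  chart_eqs z (proj1_sig x).

Lemma omega_pt_res (R T : comUnitRingType) (c : {rmorphism R -> T}) p :
  @omega_pt R p -> @omega_pt T (zres c p).
Proof.
move=> h U d z x hz hx; apply: (h U (d \o c)).
  by apply: zeq_trans hz; apply: zres_comp.
by apply: zeq_trans hx; apply: zres_comp.
Qed.

Definition Omega : zfun := zsub omega_pt_res.

Definition torus (R : comUnitRingType) :=
  {mu : VS -> R | forall v, mu v \is a GRing.unit}.

Definition torus_res (R T : comUnitRingType) (c : {rmorphism R -> T})
    (mu : torus R) : torus T :=
  exist (fun nu : VS -> T => forall v, nu v \is a GRing.unit)
    (c \o proj1_sig mu) (fun v => rmorph_unit c (proj2_sig mu v)).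

Definition chareval (R : comUnitRingType) (mu : torus R) (m : {ffun VS -> int}) : R :=
  \prod_v proj1_sig mu v ^ m v.

Lemma chareval0 (R : comUnitRingType) (mu : torus R) : chareval mu 0 = 1.
Proof. by rewrite /chareval big1 // => v _; rewrite ffunE expr0z. Qed.

Lemma charevalD (R : comUnitRingType) (mu : torus R) m m' :
  chareval mu (m + m') = chareval mu m * chareval mu m'.
Proof.
rewrite /chareval -big_split; apply: eq_bigr => v _ /=.
by rewrite ffunE exprzDr //; exact: (proj2_sig mu v).
Qed.

(* lambda |-> [mu]^{-1} lambda *)
Program Definition tact (R : comUnitRingType) (mu : torus R) (x : tpt R) : tpt R :=
  @Tpt R (tp_pav x) (tp_ok x) (fun m => chareval mu (- m) * tp_val x m) _ _.
Next Obligation. by move=> R mu x /=; rewrite oppr0 chareval0 tp_0 mulr1. Qed.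
Next Obligation.
by move=> R mu x m m' h h' /=; rewrite tp_D // opprD charevalD mulrACA.
Qed.

(* x |-> mu x; the product has exactly one factor. *)
Definition wscale (R : comUnitRingType) (mu : torus R) (I : idx2) : R :=
  \prod_(v | inI v I) proj1_sig mu v.

Lemma wscale_unit (R : comUnitRingType) (mu : torus R) I :
  wscale mu I \is a GRing.unit.
Proof. by apply: rpred_prod => v _; apply: (proj2_sig mu v). Qed.

Program Definition wact (R : comUnitRingType) (mu : torus R)
    (x : wedge_pre R) : wedge_pre R :=
  exist _ (fun I => wscale mu I * proj1_sig x I) _.
Next Obligation.
move=> R mu [x h] /= b; have [l [a e]] := h b.
exists l, (fun I => a I * (wscale mu I)^-1); rewrite -e; apply: eq_bigr => I _.
by rewrite mulrA mulrVK // wscale_unit.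
Qed.

Program Definition tact_endo (R : comUnitRingType) (mu : torus R) :
    endo toric_pre R :=
  @Endo toric_pre R (fun T c x => tact (torus_res c mu) x) _ _.
Next Obligation.
move=> R mu T c x y; elim=> {x y} [x y [z [h1 h2 h3]]|x|x y _|x y z _ h _ k].
- apply: rst_step; exists (tact (torus_res c mu) z); split=> //= m hm.
    by rewrite h2.
  by rewrite h3.
- exact: rst_refl.
- exact: rst_sym.
- exact: rst_trans h k.
Qed.
Next Obligation.
move=> R mu T U c d e x h; apply: rst_step; apply: tglue_ext => //= m /=.
rewrite rmorphM; congr (_ * _); rewrite /chareval rmorph_prod.
apply: eq_bigr => v _; rewrite rmorphXz /= ?h //.
exact/rmorph_unit/(proj2_sig mu).
Qed.

Program Definition wact_endo (R : comUnitRingType) (mu : torus R) :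
    endo wedge_pre R :=
  @Endo wedge_pre R (fun T c x => wact (torus_res c mu) x) _ _.
Next Obligation.
move=> R mu T c x y [u uu h]; exists u => // I /=; by rewrite h mulrCA.
Qed.
Next Obligation.
move=> R mu T U c d e x h; exists 1; rewrite ?unitr1 // => I /=.
rewrite mul1r rmorphM; congr (_ * _); rewrite /wscale rmorph_prod.
by apply: eq_bigr => v _ /=; rewrite h.
Qed.

(* The orbits of the action of G_m^S / G_m on Omega; G_m^S / G_m is split, so
   its points all lift to G_m^S. *)
Definition orbit_eq (R : comUnitRingType) (p q : Omega R) : Prop :=
  exists mu : torus R,
    zeq (proj1_sig q).1 (sh_endo (tact_endo mu) (proj1_sig p).1) /\
    zeq (proj1_sig q).2 (sh_endo (wact_endo mu) (proj1_sig p).2).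

Lemma torus1P (R : comUnitRingType) (v : VS) : (1 : R) \is a GRing.unit.
Proof. exact: unitr1. Qed.
Definition torus1 (R : comUnitRingType) : torus R :=
  exist _ (fun=> 1) (@torus1P R).

Program Definition torusM (R : comUnitRingType) (mu nu : torus R) : torus R :=
  exist _ (fun v => proj1_sig mu v * proj1_sig nu v) _.
Next Obligation.
by move=> R [mu h] [nu k] v /=; rewrite unitrM h k.
Qed.

Program Definition torusV (R : comUnitRingType) (mu : torus R) : torus R :=
  exist _ (fun v => (proj1_sig mu v)^-1) _.
Next Obligation. by move=> R [mu h] v /=; rewrite unitrV. Qed.

Lemma chareval_ext (R : comUnitRingType) (mu nu : torus R) m :
  proj1_sig mu =1 proj1_sig nu -> chareval mu m = chareval nu m.
Proof. by move=> h; apply: eq_bigr => v _; rewrite h. Qed.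

Lemma charevalM (R : comUnitRingType) (mu nu : torus R) m :
  chareval (torusM mu nu) m = chareval mu m * chareval nu m.
Proof.
rewrite /chareval -big_split; apply: eq_bigr => v _ /=; rewrite exprMz_comm //.
- exact: (proj2_sig mu v).
- exact: (proj2_sig nu v).
- exact: mulrC.
Qed.

Lemma wscaleM (R : comUnitRingType) (mu nu : torus R) I :
  wscale (torusM mu nu) I = wscale mu I * wscale nu I.
Proof. by rewrite /wscale -big_split. Qed.

Lemma tact_comp (R T : comUnitRingType) (c : {rmorphism R -> T}) mu nu ka
    (z : toric_pre T) :
  (forall v, proj1_sig ka v = proj1_sig nu v * proj1_sig mu v) ->
  zeq (tact_endo ka T c z) (tact_endo nu T c (tact_endo mu T c z)).
Proof.
move=> h; apply: rst_step; apply: tglue_ext => //= m /=.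
rewrite mulrA -charevalM; congr (_ * _); apply: chareval_ext => v /=.
by rewrite h rmorphM.
Qed.

Lemma wact_comp (R T : comUnitRingType) (c : {rmorphism R -> T}) mu nu ka
    (z : wedge_pre T) :
  (forall v, proj1_sig ka v = proj1_sig nu v * proj1_sig mu v) ->
  zeq (wact_endo ka T c z) (wact_endo nu T c (wact_endo mu T c z)).
Proof.
move=> h; exists 1; rewrite ?unitr1 // => I /=.
rewrite mul1r mulrA -wscaleM; congr (_ * _); apply: eq_bigr => v _ /=.
by rewrite h rmorphM.
Qed.

Lemma tact_id (R T : comUnitRingType) (c : {rmorphism R -> T}) mu
    (z : toric_pre T) :
  (forall v, proj1_sig mu v = 1) -> zeq (tact_endo mu T c z) z.
Proof.
move=> h; apply: rst_step; apply: tglue_ext => //= m /=.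
rewrite /chareval big1 ?mul1r // => v _ /=.
by rewrite h rmorph1 exp1rz.
Qed.

Lemma wact_id (R T : comUnitRingType) (c : {rmorphism R -> T}) mu
    (z : wedge_pre T) :
  (forall v, proj1_sig mu v = 1) -> zeq (wact_endo mu T c z) z.
Proof.
move=> h; exists 1; rewrite ?unitr1 // => I /=.
rewrite mul1r /wscale big1 ?mul1r // => v _ /=.
by rewrite h rmorph1.
Qed.

Lemma tact_res (R T U : comUnitRingType) (c : {rmorphism R -> T})
    (d : {rmorphism T -> U}) mu (z : toric_pre U) :
  zeq (tact_endo mu U (d \o c) z) (tact_endo (torus_res c mu) U d z).
Proof.
by apply: rst_step; apply: tglue_ext.
Qed.

Lemma wact_res (R T U : comUnitRingType) (c : {rmorphism R -> T})
    (d : {rmorphism T -> U}) mu (z : wedge_pre U) :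
  zeq (wact_endo mu U (d \o c) z) (wact_endo (torus_res c mu) U d z).
Proof. by exists 1; rewrite ?unitr1 // => I /=; rewrite mul1r. Qed.

Program Definition Omega_mod : zfun :=
  @Zfun Omega orbit_eq (fun R T c p => zres c p) _ _ _ _ _ _.
Next Obligation.
move=> R p; exists (torus1 R); split; apply: zeq_sym; apply: sh_endo_id => T c z.
  exact: tact_id.
exact: wact_id.
Qed.
Next Obligation.
move=> R p q [mu [h1 h2]]; exists (torusV mu).
have e v : proj1_sig (torus1 R) v = proj1_sig (torusV mu) v * proj1_sig mu v.
  by rewrite /= mulVr //; apply: (proj2_sig mu v).
split.
  apply: (@zeq_trans toric R _ _ _ _ (zeq_sym (@sh_endo_eq _ R (tact_endo (torusV mu)) _ _ h1))).
  have k := @sh_endo_comp _ R (tact_endo mu) _ _ (proj1_sig p).1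
    (fun T c z => tact_comp c z e).
  by apply: (@zeq_trans toric R _ _ _ _ k); apply/zeq_sym/sh_endo_id => T c z; apply: tact_id.
apply: (@zeq_trans wedge R _ _ _ _ (zeq_sym (@sh_endo_eq _ R (wact_endo (torusV mu)) _ _ h2))).
have k := @sh_endo_comp _ R (wact_endo mu) _ _ (proj1_sig p).2
  (fun T c z => wact_comp c z e).
by apply: (@zeq_trans wedge R _ _ _ _ k); apply/zeq_sym/sh_endo_id => T c z; apply: wact_id.
Qed.
Next Obligation.
move=> R p q r [mu [h1 h2]] [nu [k1 k2]]; exists (torusM nu mu); split.
  apply: zeq_trans k1 _; apply: zeq_trans (@sh_endo_eq _ R (tact_endo nu) _ _ h1) _.
  by apply: zeq_sym; apply: sh_endo_comp => T c z; apply: tact_comp.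
apply: zeq_trans k2 _; apply: zeq_trans (@sh_endo_eq _ R (wact_endo nu) _ _ h2) _.
by apply: zeq_sym; apply: sh_endo_comp => T c z; apply: wact_comp.
Qed.
Next Obligation.
move=> R T c p q [mu [h1 h2]]; exists (torus_res c mu); split.
  apply: zeq_trans (zres_eq c h1) _.
  by apply: sh_endo_res => U d z; apply: tact_res.
apply: zeq_trans (zres_eq c h2) _.
by apply: sh_endo_res => U d z; apply: wact_res.
Qed.
Next Obligation.
move=> R c p h; exists (torus1 R); split.
  apply: zeq_trans (zeq_sym (zres_id (proj1_sig p).1 h)) _.
  by apply: zeq_sym; apply: sh_endo_id => T d z; apply: tact_id.
apply: zeq_trans (zeq_sym (zres_id (proj1_sig p).2 h)) _.
by apply: zeq_sym; apply: sh_endo_id => T d z; apply: wact_id.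
Qed.
Next Obligation.
move=> R T U c d e p h; exists (torus1 U); split.
  apply: zeq_trans (zeq_sym (zres_comp (proj1_sig p).1 h)) _.
  by apply: zeq_sym; apply: sh_endo_id => V b z; apply: tact_id.
apply: zeq_trans (zeq_sym (zres_comp (proj1_sig p).2 h)) _.
by apply: zeq_sym; apply: sh_endo_id => V b z; apply: wact_id.
Qed.

Definition Omega_bar : zfun := sheafify Omega_mod.

End Lafforgue.
End Setup.

(* Main.v *)
(* Near a given point, a point z of the toric variety lies in the chart of one paving,
   and the height function of a paving, normalised along a block oo, is an ultrametric
   on the set of blocks: its balls form a tree, and the dual cone of the chart is
   generated by the cross ratios ab + cd - ac - bd that are nonnegative on it.  In this
   chart the equations of Omega at (z, x) amount to the three-term Pluecker relations
   with coefficients in z, each divided by its smallest coefficient.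

   The two sides are compared through the relation theta z x y: for every w in C, the
   coordinates y_w are, up to a common unit, the monomials of G_w in x multiplied by the
   characters of their degrees in z, divided by the smallest one.  This relation is
   invariant under a change of chart, under scaling of x and under the torus.

   From (z, x) to y: frames of rank 2 attached to the vertices of the tree present
   (z, x, y) as the specialisation of a point of the open part of the Grassmannian where
   all the rational maps are defined, so that y satisfies the equations of M.  From y to
   (z, x): the cross ratios of z are quotients of coordinates of y, or of 2 x 2 minors of
   them when a block is repeated; the pattern of those vanishing at a given point comes
   from an ultrametric, whose paving carries a point z, and every other z related to y
   agrees with it near that point.  Both functors are Zariski sheaves, so theta
   descends to an isomorphism. *)
From HB Require Import structures.
From Stdlib Require Import Relation_Operators.
From mathcomp Require Import all_boot all_order all_algebra.
From mathcomp Require Import mpoly.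
From mathcomp Require Import boolp classical_sets reals topology.
From mathcomp Require Import zify ring lra.
Require Import Defs.

Set Implicit Arguments.
Unset Strict Implicit.
Unset Printing Implicit Defensive.

Import Order.TTheory GRing.Theory Num.Theory.

Local Open Scope ring_scope.

(** Two obstacles shape the proof. The base ring is arbitrary, possibly non-reduced, while [Mn] is
    known only through the multihomogeneous forms that vanish on certain field-valued points.
    Membership in [Mn] is therefore proved by exhibiting the data as a specialisation of a generic
    point over a polynomial ring over the integers, a domain in which nonzero factors can be
    cancelled. Conversely, an identity between coordinates of a point of [Mn] is homogenised into a
    form and checked over fields, where the coordinates are quotients of Pluecker monomials. The
    second obstacle is that the fan consists of closures of cones of real functions. In rank 2 a
    height satisfies the three-term tropical Pluecker relations, which become the ultrametric
    inequality once affine functions are subtracted; Abel summation along the tree then gives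
    generators of the dual cone over the integers, without general fan theory. Quadratic coordinates
    on four distinct blocks suffice because every other cross ratio repeats a block, and is then
    trivial or determined by a Pluecker relation between linear coordinates. *)

Module LocalRings.
(** * Local rings of functions *)

(** An alias that can carry a unit structure chosen classically: quotient rings come only as nonzero
    commutative rings, whereas points are taken over [comUnitRingType]. *)
Definition cunit (A : Type) : Type := A.

Section ClassicalUnits.
Variable A : comNzRingType.

HB.instance Definition _ := GRing.ComNzRing.on (cunit A).

Definition cunit_pred (x : cunit A) : bool := `[< exists y : cunit A, y * x = 1 >].
Definition cunit_inv (x : cunit A) : cunit A :=
  if pselect (exists y : cunit A, y * x = 1) is left h then projT1 (cid h) else x.

Fact cunit_mulVr : {in cunit_pred, left_inverse 1 cunit_inv *%R}.
Proof.
move=> x /asboolP h; rewrite /cunit_inv.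
by case: pselect => // h'; exact: (projT2 (cid h')).
Qed.
Fact cunit_unitP (x y : cunit A) : y * x = 1 -> cunit_pred x.
Proof. by move=> h; apply/asboolP; exists y. Qed.
Fact cunit_out : {in [predC cunit_pred], cunit_inv =1 id}.
Proof.
move=> x /asboolPn h; rewrite /cunit_inv.
by case: pselect => // h'; case: h.
Qed.

HB.instance Definition _ := GRing.ComNzRing_hasMulInverse.Build (cunit A)
  cunit_mulVr cunit_unitP cunit_out.
End ClassicalUnits.

Section QuotientRing.
Variables (A : comNzRingType) (I : A -> Prop).
Hypotheses (I0 : I 0) (I1 : ~ I 1) (IB : forall a b, I a -> I b -> I (a - b))
  (IM : forall a b, I b -> I (a * b)).

Lemma quotient_ring : exists (Q : comUnitRingType) (p : {rmorphism A -> Q}),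
  (forall q, exists a, q = p a) /\ (forall a, p a = 0 <-> I a).
Proof.
pose S : {pred A} := fun a => `[< I a >].
have Sid : idealr_closed S.
  split; first exact/asboolP.
    by apply/asboolP.
  move=> a u v /asboolP hu /asboolP hv; apply/asboolP.
  rewrite -[v]opprK; apply: IB; first exact: IM.
  by rewrite -sub0r; apply: IB.
pose F := isIdealr.Build A S Sid.
pose S' : idealr A := HB.pack S F.
pose Q : comUnitRingType := cunit {ideal_quot S'}.
have mp : monoid_morphism (\pi_({ideal_quot S'})%qT : A -> Q).
  split; first exact: rmorph1.
  by move=> x y; exact: rmorphM.
have ap : zmod_morphism (\pi_({ideal_quot S'})%qT : A -> Q).
  by move=> x y; exact: rmorphB.
pose p0 : A -> Q := \pi_({ideal_quot S'})%qT.
pose m1 := GRing.isZmodMorphism.Build A Q p0 ap.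
pose m2 := GRing.isMonoidMorphism.Build A Q p0 mp.
pose p : {rmorphism A -> Q} := HB.pack p0 m1 m2.
exists Q, p; split.
  by elim/quotW => a; exists a.
move=> a; have -> : (p a = 0) = (p0 a = p0 0) by rewrite -[0 in LHS](rmorph0 p).
split=> [/eqP|h].
  by rewrite -Quotient.idealrBE subr0 => /asboolP.
by apply/eqP; rewrite -Quotient.idealrBE subr0; apply/asboolP.
Qed.

End QuotientRing.

Section MaximalIdeal.
Variable R : comUnitRingType.

Definition ideal_of (G : set R) : set R := fun x =>
  exists (l : seq (R * R)), all (fun p => `[< G p.2 >]) l /\
    x = \sum_(p <- l) p.1 * p.2.

Definition proper_ideal_set (I : set R) : Prop :=
  [/\ I 0, ~ I 1, (forall a b, I a -> I b -> I (a - b))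
    & forall a b, I b -> I (a * b)].

Lemma ideal_of_proper (G : set R) : ~ ideal_of G 1 -> proper_ideal_set (ideal_of G).
Proof.
move=> h; split=> //.
- by exists [::]; rewrite big_nil.
- move=> a b [la [ha ->]] [lb [hb ->]].
  exists (la ++ [seq (- p.1, p.2) | p <- lb]); split.
    by rewrite all_cat ha all_map.
  rewrite big_cat big_map /= -sumrN; congr (_ + _).
  by apply: eq_bigr => p _; rewrite mulNr.
- move=> a b [lb [hb ->]]; exists [seq (a * p.1, p.2) | p <- lb]; split.
    by rewrite all_map.
  by rewrite big_map /= mulr_sumr; apply: eq_bigr => p _; rewrite mulrA.
Qed.

(** By Zorn's lemma there is a maximal proper ideal containing [G]; an element outside it generates
    the unit ideal together with it, so it is invertible in the quotient. *)
Lemma residue_field (G : set R) : ~ ideal_of G 1 ->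
  exists (k : comUnitRingType) (p : {rmorphism R -> k}),
    [/\ forall x : k, x != 0 -> x \is a GRing.unit, forall a, G a -> p a = 0
      & forall x : k, exists a, x = p a].
Proof.
move=> nG1.
(* The property concerns [I] joined with the given ideal, so that the empty chain, whose union is
   empty, satisfies it. *)
pose Pr (I : set R) := (proper_ideal_set (I `|` ideal_of G))%classic.
have [] := @Zorn_bigcup R Pr.
  move=> F FP FT.
  have [[I0 FI0]|F0] := pselect (exists I, F I); last first.
    have -> : (\bigcup_(X in F) X)%classic = set0.
      by apply/seteqP; split=> // x [I FI _]; case: F0; exists I.
    by rewrite /Pr set0U; apply: ideal_of_proper.
  split.
  - by right; case: (ideal_of_proper nG1).
  - move=> [[I FI I1]|//]; case: (FP I FI) => _ h _ _; apply: h; by left.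
  - have key a b : (\bigcup_(X in F) X `|` ideal_of G)%classic a ->
      (\bigcup_(X in F) X `|` ideal_of G)%classic b ->
      exists2 I, F I & (I `|` ideal_of G)%classic a /\ (I `|` ideal_of G)%classic b.
      move=> [[I FI Ia]|Ga] [[J FJ Jb]|Gb].
      + by have [/(_ a Ia) h|/(_ b Jb) h] := FT I J FI FJ;
          [exists J|exists I] => //; split; left.
      + by exists I => //; split; [left|right].
      + by exists J => //; split; [right|left].
      + by exists I0 => //; split; right.
    move=> a b ha hb; have [I FI [ha' hb']] := key a b ha hb.
    have [_ _ h _] := FP I FI; have [Ic|Gc] := h a b ha' hb'; last by right.
    by left; exists I.
  - move=> a b [[I FI Ib]|Gb]; last by right; case: (ideal_of_proper nG1) => _ _ _; apply.
    have [_ _ _ h] := FP I FI; have [Ic|Gc] := h a b (or_introl Ib); last by right.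
    by left; exists I.
move=> I [PI Imax].
pose M : set R := (I `|` ideal_of G)%classic.
have [M0 M1 MB MM] : proper_ideal_set M by [].
have [k [p [ps pk]]] := quotient_ring M0 M1 MB MM.
exists k, p; split; [|move=> a Ga|exact: ps]; last first.
  apply/pk; right; exists [:: (1, a)]; split; first by rewrite /= andbT; apply/asboolP.
  by rewrite big_seq1 mul1r.
move=> x xn0; have [a xa] := ps x.
have nMa : ~ M a by move=> /pk h; rewrite xa h eqxx in xn0.
pose J : set R := fun y => exists b m, M m /\ y = b * a + m.
have MJ : (M `<=` J)%classic by move=> m Mm; exists 0, m; rewrite mul0r add0r.
have JB c d : J c -> J d -> J (c - d).
  move=> [b1 [m1 [h1 ->]]] [b2 [m2 [h2 ->]]]; exists (b1 - b2), (m1 - m2).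
  by split; [exact: MB|rewrite mulrBl opprD addrACA].
have JM c d : J d -> J (c * d).
  move=> [b2 [m2 [h2 ->]]]; exists (c * b2), (c * m2).
  by split; [exact: MM|rewrite mulrDr mulrA].
have [[b [m [Mm e]]]|nJ1] := pselect (J 1).
  apply/unitrPr; exists (p b); rewrite xa -rmorphM -(rmorph1 p) e mulrC rmorphD.
  by move/pk: Mm => ->; rewrite addr0.
case: (Imax J).
  split; first by move=> y Iy; apply: MJ; left.
  move=> h; apply: nMa; left; apply: h; exists 1, 0.
  by rewrite mul1r addr0.
have JG : (J `|` ideal_of G)%classic = J.
  by apply/seteqP; split=> [y [//|Gy]|y Jy]; [apply: MJ; right|left].
by rewrite /Pr JG; split=> //; apply: MJ.
Qed.

End MaximalIdeal.

Section Localization.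

(** The ring is [R[X]/(gX - 1)]. A nilpotent [g] is split off because the localization would then be
    the zero ring, which is not a [comUnitRingType]. *)
Lemma localization (R : comUnitRingType) (g : R) :
  (exists k, g ^+ k = 0) \/
  exists (L : comUnitRingType) (i : {rmorphism R -> L}),
  [/\ i g \is a GRing.unit,
      forall x, exists a k, x * i g ^+ k = i a,
      forall a, i a = 0 -> exists k, g ^+ k * a = 0
    & forall (T : comUnitRingType) (c : {rmorphism R -> T}),
        c g \is a GRing.unit -> exists d : {rmorphism L -> T}, c =1 d \o i].
Proof.
pose h : {poly R} := g%:P * 'X - 1.
pose I (p : {poly R}) := exists q, p = q * h.
have coefh (q : {poly R}) i : (q * h)`_i = g * (if i is j.+1 then q`_j else 0) - q`_i.
  by rewrite /h mulrBr mulr1 coefB mulrCA coefCM coefMX; case: i.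
(* Comparing coefficients in [a = q (gX - 1)] forces [q_i = - g^i a], and a coefficient beyond the
   degree of [q] vanishes. *)
have kerI a : I a%:P -> exists k, g ^+ k * a = 0.
  move=> [q e]; exists (size q).
  have qi i : q`_i = - (g ^+ i * a).
    elim: i => [|i IH].
      have := congr1 (fun p : {poly R} => p`_0) e.
      by rewrite coefh coefC eqxx mulr0 sub0r expr0 mul1r => ->; rewrite opprK.
    have := congr1 (fun p : {poly R} => p`_i.+1) e.
    rewrite coefh coefC /= => /esym/eqP; rewrite subr_eq0 => /eqP <-.
    by rewrite IH mulrN exprS mulrA.
  by have := qi (size q); rewrite nth_default // => /esym/eqP; rewrite oppr_eq0 => /eqP.
have [I1|nI1] := pselect (I 1).
  by left; have [k] := kerI 1 I1; rewrite mulr1 => e; exists k.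
right.
have I0 : I 0 by exists 0; rewrite mul0r.
have IB a b : I a -> I b -> I (a - b).
  by move=> [q ->] [r ->]; exists (q - r); rewrite mulrBl.
have IM a b : I b -> I (a * b) by move=> [q ->]; exists (a * q); rewrite mulrA.
have [L [p [ps pk]]] := quotient_ring I0 nI1 IB IM.
pose i : {rmorphism R -> L} := (p \o polyC : {rmorphism R -> L}).
have iX : i g * p 'X = 1.
  have : p h = 0 by apply/pk; exists 1; rewrite mul1r.
  by rewrite rmorphB rmorphM rmorph1 => /eqP; rewrite subr_eq0 => /eqP.
have iu : i g \is a GRing.unit by apply/unitrPr; exists (p 'X).
have mapX : forall q : {poly R}, exists a k, p q * i g ^+ k = i a.
  move=> q; exists (\sum_(j < size q) q`_j * g ^+ (size q - j)), (size q).
  rewrite -{1}[q]coefK poly_def rmorph_sum mulr_suml [RHS](rmorph_sum i); apply: eq_bigr => j _ /=.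
  rewrite -mul_polyC (rmorphM p) (rmorphXn p) -[p _%:P]/(i _) -[RHS]/(i _) (rmorphM i) (rmorphXn i).
  rewrite -mulrA; congr (_ * _).
  have -> : i g ^+ size q = i g ^+ j * i g ^+ (size q - j).
    by rewrite -exprD subnKC // ltnW.
  rewrite mulrA.
  by rewrite -exprMn [p _ * _]mulrC iX expr1n mul1r.
exists L, i; split=> //.
- by move=> x; have [q ->] := ps x; exact: mapX.
- by move=> a /pk /kerI.
move=> T c cu.
pose ev : {rmorphism {poly R} -> T} := (horner_eval (c g)^-1 \o map_poly c : {rmorphism {poly R} -> T}).
have evI q : I q -> ev q = 0.
  move=> [r ->]; rewrite rmorphM /= [X in _ * X](_ : _ = 0) ?mulr0 //.
  rewrite /h rmorphB rmorphM rmorph1 /= map_polyC map_polyX /horner_eval.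
  by rewrite !hornerE mulrV ?subrr.
(* Evaluation at the inverse of [c g] kills the ideal, so an arbitrary preimage may be chosen. *)
pose d0 (x : L) : T := ev (projT1 (cid (ps x))).
have d0p q : d0 (p q) = ev q.
  rewrite /d0; move: (projT1 _) (projT2 (cid (ps (p q)))) => r e.
  apply/eqP; rewrite -subr_eq0 -(rmorphB ev).
  by apply/eqP; apply: evI; apply/pk; rewrite rmorphB e subrr.
have d0B : zmod_morphism d0.
  move=> x y; have [q ->] := ps x; have [r ->] := ps y.
  by rewrite -rmorphB !d0p rmorphB.
have d0M : monoid_morphism d0.
  split; first by rewrite -(rmorph1 p) d0p rmorph1.
  move=> x y; have [q ->] := ps x; have [r ->] := ps y.
  by rewrite -rmorphM !d0p rmorphM.
pose m1 := GRing.isZmodMorphism.Build L T d0 d0B.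
pose m2 := GRing.isMonoidMorphism.Build L T d0 d0M.
pose d : {rmorphism L -> T} := HB.pack d0 m1 m2.
exists d => a /=; rewrite -[RHS]/(d0 (p a%:P)) d0p /= map_polyC /horner_eval.
by rewrite hornerC.
Qed.

End Localization.
End LocalRings.

(** * Properties that hold locally for the Zariski topology *)

Module ZariskiCovers.
Import LocalRings.
Section Covers.

(** [Q] is required over every algebra in the sieve of the cover, not only over the localizations,
    which makes passage to a finer cover immediate. *)
Definition locp (R : comUnitRingType)
    (Q : forall T : comUnitRingType, {rmorphism R -> T} -> Prop) : Prop :=
  exists2 f : seq R, unit_ideal f & forall T c, in_cover f c -> Q T c.

Lemma unit_idealP (R : comUnitRingType) (f : seq R) :
  unit_ideal f <-> ideal_of (fun x => x \in f) 1.
Proof.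
split=> [[a h]|[l [hl e]]].
  exists [seq (a`_i, f`_i) | i <- iota 0 (size f)]; split.
    rewrite all_map; apply/allP => i; rewrite mem_iota add0n /= => lt.
    by apply/asboolP; exact: mem_nth.
  by rewrite big_map -h -(big_mkord xpredT (fun i => a`_i * f`_i)) /index_iota subn0.
(* The given combination may repeat generators and [f] may contain duplicates; each term is charged
   to the first occurrence of its generator in [f]. *)
pose F i := \sum_(p <- l | p.2 == f`_i) p.1 * (index f`_i f == i)%:R.
exists (mkseq F (size f)).
have hn i : (i < size f)%N -> (mkseq F (size f))`_i = F i by move=> lt; rewrite nth_mkseq.
rewrite [RHS]e; under eq_bigr => i _ do rewrite hn // mulr_suml.
rewrite (exchange_big_dep xpredT) //=; apply: eq_big_seq => p pl.
have pf : p.2 \in f by apply/asboolP; exact: (allP hl).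
have lt : (index p.2 f < size f)%N by rewrite index_mem.
rewrite (bigD1 (Ordinal lt)) /= ?nth_index // eqxx mulr1 big1 ?addr0 //.
move=> i /andP [/eqP h ni]; rewrite -h.
by rewrite (_ : (index p.2 f == i) = false) ?mulr0 ?mul0r //; apply: contraNF ni => /eqP e1; apply/eqP/val_inj.
Qed.

(** The elements [h] such that [Q] holds wherever [h] is invertible generate the unit ideal, since
    otherwise they would all vanish in one residue field. Local statements can thus be proved near
    one point at a time. *)
Lemma locp_max (R : comUnitRingType)
    (Q : forall T : comUnitRingType, {rmorphism R -> T} -> Prop) :
  (forall (k : comUnitRingType) (p : {rmorphism R -> k}),
     (forall x : k, x != 0 -> x \is a GRing.unit) -> (forall x, exists a, x = p a) ->
     exists2 h, p h != 0 & forall (T : comUnitRingType) (c : {rmorphism R -> T}), c h \is a GRing.unit -> Q T c) ->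
  locp Q.
Proof.
move=> H.
pose G : set R := fun h => forall (T : comUnitRingType) (c : {rmorphism R -> T}), c h \is a GRing.unit -> Q T c.
have [[l [hl e]]|/residue_field [k [p [kf kG ks]]]] := pselect (ideal_of G 1); last first.
  by have [h hn0 hQ] := H k p kf ks; rewrite kG ?eqxx in hn0.
exists [seq p.2 | p <- l].
  apply/unit_idealP; exists l; split=> //.
  by apply/allP => p pl; apply/asboolP; apply: map_f.
move=> T c /hasP [_ /mapP [p pl ->] cu].
by have /asboolP := allP hl _ pl; apply.
Qed.

Lemma unit_ideal_field (R k : comUnitRingType) (p : {rmorphism R -> k}) f :
  unit_ideal f -> exists2 g, g \in f & p g != 0.
Proof.
move=> [a h]; apply: contrapT => H; have := oner_neq0 k.
rewrite -(rmorph1 p) -h rmorph_sum big1 ?eqxx // => i _.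
rewrite rmorphM; case: (eqVneq (p f`_i) 0) => [->|n0]; first by rewrite mulr0.
by case: H; exists f`_i => //; apply: mem_nth.
Qed.

(** Near a maximal point, take a member [g] of the outer cover that does not vanish there, pass to
    the localization at [g], and clear the denominator of a member of the inner cover. The
    factorisation of a morphism through the localization is only a pointwise equality, hence the
    extensionality hypothesis. *)
Lemma locp_trans (R : comUnitRingType)
    (Q : forall T : comUnitRingType, {rmorphism R -> T} -> Prop) :
  (forall (T : comUnitRingType) (c d : {rmorphism R -> T}), c =1 d -> Q T c -> Q T d) ->
  locp (fun T c => locp (fun U d => Q U (d \o c : {rmorphism R -> U}))) -> locp Q.
Proof.
move=> Qext [f uf H]; apply: locp_max => k p kf ks.
have [g gf pg] := unit_ideal_field p uf.
have [[n gn]|[L [i [iu inum iker iuniv]]]] := localization g.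
  by have := expf_neq0; have := congr1 p gn; rewrite rmorphXn rmorph0 => e;
     have := unitrX n (kf _ pg); rewrite e unitr0.
have [|f' uf' H'] := H L i; first by apply/hasP; exists g.
have [q e] : exists q : {rmorphism L -> k}, p =1 q \o i by apply: iuniv; apply: kf.
have [h' h'f qh'] := unit_ideal_field q uf'.
have [h [n hn]] := inum h'.
have unitd (T : comUnitRingType) (d : {rmorphism L -> T}) :
    d (i h) \is a GRing.unit = (d h' \is a GRing.unit).
  by rewrite -hn rmorphM rmorphXn unitrM unitrX ?andbT //; apply: rmorph_unit.
exists (g * h).
  have qu : q (i h) \is a GRing.unit by rewrite unitd; apply: kf.
  apply: contraTneq (oner_neq0 k) => hh; rewrite negbK.
  have : p (g * h) \is a GRing.unit.
    by rewrite rmorphM unitrM (kf _ pg) e.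
  by rewrite hh unitr0.
move=> T c; rewrite rmorphM unitrM => /andP [cg ch].
have [d cd] := iuniv T c cg.
have dd : in_cover f' d.
  by apply/hasP; exists h' => //; rewrite -unitd -[d _]/((d \o i) h) -cd.
by apply: Qext (H' _ _ dd) => a; rewrite cd.
Qed.

(** If the annihilator of [r] generated a proper ideal, it would vanish in some residue field; yet a
    power of a cover element that is nonzero there kills [r]. *)
Lemma local0 (R : comUnitRingType) (r : R) f : unit_ideal f ->
  (forall (T : comUnitRingType) (c : {rmorphism R -> T}), in_cover f c -> c r = 0) -> r = 0.
Proof.
move=> uf H.
pose G : set R := fun x => x * r = 0.
have [[l [hl e]]|/residue_field [k [p [kf kG _]]]] := pselect (ideal_of G 1).
  rewrite -[r]mul1r e mulr_suml big_seq big1 // => p pl.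
  by have /asboolP := allP hl _ pl; rewrite -mulrA => ->; rewrite mulr0.
have [g gf pg] := unit_ideal_field p uf.
suff [n hn] : exists n, g ^+ n * r = 0.
  by have := unitrX n (kf _ pg); rewrite -rmorphXn (kG _ hn) unitr0.
have [[n gn]|[L [i [iu inum iker iuniv]]]] := localization g.
  by exists n; rewrite gn mul0r.
by apply: iker; apply: H; apply/hasP; exists g.
Qed.

Lemma in_coverM (R T : comUnitRingType) (c : {rmorphism R -> T}) (f g : seq R) :
  in_cover [seq x * y | x <- f, y <- g] c = in_cover f c && in_cover g c.
Proof.
apply/hasP/andP => [[_ /allpairsP [[x y] [/= xf yg ->]]]|[/hasP [x xf cx] /hasP [y yg cy]]].
  by rewrite rmorphM unitrM => /andP [cx cy]; split; apply/hasP; [exists x|exists y].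
exists (x * y); first by apply/allpairsP; exists (x, y).
by rewrite rmorphM unitrM cx.
Qed.

Lemma unit_idealM (R : comUnitRingType) (f g : seq R) :
  unit_ideal f -> unit_ideal g -> unit_ideal [seq x * y | x <- f, y <- g].
Proof.
move=> /unit_idealP [l [hl e]] /unit_idealP [l' [hl' e']]; apply/unit_idealP.
exists [seq (p.1 * q.1, p.2 * q.2) | p <- l, q <- l']; split.
  apply/allP => _ /allpairsP [[p q] [/= pl ql ->]]; apply/asboolP.
  apply/allpairsP; exists (p.2, q.2); split=> //=.
    by apply/asboolP; apply: (allP hl).
  by apply/asboolP; apply: (allP hl').
rewrite big_allpairs_dep /= -(mulr1 1) {1}e e' mulr_suml; apply: eq_bigr => p _.
by rewrite mulr_sumr; apply: eq_bigr => q _; rewrite mulrACA.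
Qed.

Lemma locp_and (R : comUnitRingType)
    (Q1 Q2 : forall T : comUnitRingType, {rmorphism R -> T} -> Prop) :
  locp Q1 -> locp Q2 -> locp (fun T c => Q1 T c /\ Q2 T c).
Proof.
move=> [f uf hf] [g ug hg]; exists [seq x * y | x <- f, y <- g].
  exact: unit_idealM.
by move=> T c; rewrite in_coverM => /andP [h k]; split; [apply: hf|apply: hg].
Qed.

Lemma locp_imp (R : comUnitRingType)
    (Q1 Q2 : forall T : comUnitRingType, {rmorphism R -> T} -> Prop) :
  (forall T c, Q1 T c -> Q2 T c) -> locp Q1 -> locp Q2.
Proof. by move=> h [f uf hf]; exists f => // T c cf; apply/h/hf. Qed.

Lemma locp_all (R : comUnitRingType)
    (Q : forall T : comUnitRingType, {rmorphism R -> T} -> Prop) :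
  (forall T c, Q T c) -> locp Q.
Proof. by move=> h; exists [:: 1]; [exact: unit_ideal1|move=> T c _; exact: h]. Qed.

Lemma locp_res (R T : comUnitRingType) (c : {rmorphism R -> T})
    (Q : forall T : comUnitRingType, {rmorphism R -> T} -> Prop) :
  locp Q -> locp (fun U (d : {rmorphism T -> U}) => Q U (d \o c : {rmorphism R -> U})).
Proof.
move=> [f uf H]; exists (map c f); first exact: unit_ideal_map.
by move=> U d df; apply: H; apply: in_cover_map1.
Qed.

Lemma locp_fin (R : comUnitRingType) (I : finType)
    (Q : I -> forall T : comUnitRingType, {rmorphism R -> T} -> Prop) :
  (forall i, locp (Q i)) -> locp (fun T c => forall i, Q i T c).
Proof.
move=> H; suff : locp (fun T c => forall i, i \in enum I -> Q i T c).
  by apply: locp_imp => T c h i; apply: h; rewrite mem_enum.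
elim: (enum I) => [|i s IH]; first exact: locp_all.
apply: locp_imp (locp_and (H i) IH) => T c [h1 h2] j.
by rewrite inE => /orP [/eqP ->|/h2].
Qed.

End Covers.
End ZariskiCovers.

(** * Sheaves and morphisms defined by local relations *)

Module SheafGluing.
Import LocalRings ZariskiCovers.
Section Sheaves.

Definition zsep (X : zfun) : Prop := forall (R : comUnitRingType) (x y : X R),
  locp (fun T (c : {rmorphism R -> T}) => zeq (zres c x) (zres c y)) -> zeq x y.

Definition zglue (X : zfun) : Prop := forall (R : comUnitRingType) (f : seq R)
  (F : forall (T : comUnitRingType) (c : {rmorphism R -> T}), in_cover f c -> X T),
  unit_ideal f ->
  (forall (T U : comUnitRingType) (c : {rmorphism R -> T}) (d : {rmorphism T -> U})
     (e : {rmorphism R -> U}) (p : in_cover f c) (q : in_cover f e),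
     e =1 d \o c -> zeq (zres d (F T c p)) (F U e q)) ->
  exists x, forall (T : comUnitRingType) (c : {rmorphism R -> T}) p, zeq (zres c x) (F T c p).

Lemma zres_ext (X : zfun) (R T : comUnitRingType) (c d : {rmorphism R -> T}) (x : X R) :
  c =1 d -> zeq (zres c x) (zres d x).
Proof.
move=> h; apply: zeq_trans (zres_comp (d := (idfun : {rmorphism T -> T})) x _) _; last exact: zres_id.
by move=> a /=; exact: h.
Qed.

Lemma zres_comp1 (X : zfun) (R T U : comUnitRingType) (c : {rmorphism R -> T})
    (d : {rmorphism T -> U}) (x : X R) :
  zeq (zres (d \o c : {rmorphism R -> U}) x) (zres d (zres c x)).
Proof. exact: zres_comp. Qed.

Section Sheafified.
Variable F : zfun.

Lemma zunit_loc_eq (R : comUnitRingType) (a b : F R) :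
  loc_eq a b -> zeq (zunit a) (zunit b).
Proof. by move=> h T c p q; apply: loc_res. Qed.

Lemma loc_eq_zunit (R : comUnitRingType) (a b : F R) :
  zeq (zunit a) (zunit b) -> loc_eq a b.
Proof.
move=> h; have p : in_cover [:: 1] (idfun : {rmorphism R -> R}).
  by rewrite /in_cover /= unitr1.
by apply: loc_eq_zeq (h R idfun p p) _ _ _ _ => /=; [apply: zeq_sym|]; exact: zres_id.
Qed.

Lemma zunit_res (R T : comUnitRingType) (c : {rmorphism R -> T}) (a : F R) :
  zeq (zres c (zunit a)) (zunit (zres c a)).
Proof. by move=> U d p q; apply/loc_base/zres_comp. Qed.

Lemma sh_val_zunit (R T : comUnitRingType) (c : {rmorphism R -> T}) (x : sheafify F R)
    (p : in_cover (sh_cov x) c) : zeq (zres c x) (zunit (sh_val p)).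
Proof.
move=> U d p' q /=; apply: loc_sym.
exact: (@sh_match _ _ x T U c d (d \o c) p (in_cover_map1 p')).
Qed.

Local Arguments sh_val_zunit [R T c x] p.
Local Arguments zunit_res [R T] c a.

Lemma zunit_surj (R : comUnitRingType) (x : sheafify F R) :
  locp (fun T (c : {rmorphism R -> T}) => exists a, zeq (zres c x) (zunit a)).
Proof.
exists (sh_cov x); first exact: sh_covP.
by move=> T c p; exists (sh_val p); exact: sh_val_zunit.
Qed.

Lemma sheafify_sep : zsep (sheafify F).
Proof.
move=> R x y [f uf H] T c p q.
apply: (loc_cover (unit_ideal_map c uf)) => U d df.
apply: loc_eq_zunit.
have e1 : (d \o c : {rmorphism R -> U}) =1 d \o c by [].
have hx := sh_val_zunit p; have {}hx := @zres_eq (sheafify F) _ _ d _ _ hx.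
have hy := sh_val_zunit q; have {}hy := @zres_eq (sheafify F) _ _ d _ _ hy.
apply: (@zeq_trans (sheafify F) _ _ _ _ (zeq_sym (zunit_res d _))).
apply: (@zeq_trans (sheafify F) _ _ _ _ _ (zunit_res d _)).
apply: (@zeq_trans (sheafify F) _ _ _ _ (zeq_sym hx)).
apply: (@zeq_trans (sheafify F) _ _ _ _ _ hy).
apply: (@zeq_trans (sheafify F) _ _ _ _ (zeq_sym (zres_comp x e1))).
apply: (@zeq_trans (sheafify F) _ _ _ _ _ (zres_comp y e1)).
by apply: H; apply: in_cover_map1.
Qed.

(** The cover is refined until each given section comes from a point of the presheaf; the chosen
    representatives then form a matching family. *)
Lemma sheafify_glue : zglue (sheafify F).
Proof.
move=> R f G uf Gm.
pose Q (T : comUnitRingType) (c : {rmorphism R -> T}) :=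
  exists (p : in_cover f c) (a : F T), zeq (G T c p) (zunit a).
have [f' uf' H] : locp Q.
  apply: locp_trans.
    move=> T c d cd [p [a h]].
    have q : in_cover f d by move: (p) => /hasP [g gf gu]; apply/hasP; exists g; rewrite // -cd.
    exists q, a; apply: zeq_trans h.
    apply: (@zeq_trans (sheafify F) _ _ (zres (idfun : {rmorphism T -> T}) (G T c p))).
      by apply: zeq_sym; apply: Gm => g /=; rewrite cd.
    exact: zres_id.
  exists f => // T c p.
  apply: locp_imp (zunit_surj (G T c p)) => U d [a h].
  have q : in_cover f (d \o c) by apply: (in_cover_comp (c := c)) (p).
  by exists q, a; apply: zeq_trans h; apply: zeq_sym; apply: Gm.
pose pc (T : comUnitRingType) (c : {rmorphism R -> T}) (p : in_cover f' c) := projT1 (cid (H T c p)).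
pose av (T : comUnitRingType) (c : {rmorphism R -> T}) (p : in_cover f' c) := projT1 (cid (projT2 (cid (H T c p)))).
have avP (T : comUnitRingType) (c : {rmorphism R -> T}) (p : in_cover f' c) : zeq (G T c (pc T c p)) (zunit (av T c p)).
  exact: (projT2 (cid (projT2 (cid (H T c p))))).
have mt : forall (T U : comUnitRingType) (c : {rmorphism R -> T}) (d : {rmorphism T -> U})
      (e : {rmorphism R -> U}) (p : in_cover f' c) (q : in_cover f' e),
      e =1 d \o c -> loc_eq (zres d (av T c p)) (av U e q).
  move=> T U c d e p q h; apply: loc_eq_zunit.
  apply: (@zeq_trans (sheafify F) _ _ _ _ (zeq_sym (zunit_res d _))).
  apply: (@zeq_trans (sheafify F) _ _ _ _ (@zres_eq (sheafify F) _ _ d _ _ (zeq_sym (avP T c p)))).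
  apply: (@zeq_trans (sheafify F) _ _ _ _ _ (avP U e q)).
  exact: Gm.
exists (Shpt uf' mt : sheafify F R) => T c p.
apply: sheafify_sep; exists (map c f'); first exact: unit_ideal_map.
move=> U d df; have q := in_cover_map1 df.
have e1 : (d \o c : {rmorphism R -> U}) =1 d \o c by [].
apply: (@zeq_trans (sheafify F) _ _ _ _ (zeq_sym (zres_comp _ e1))).
apply: (@zeq_trans (sheafify F) _ _ _ _ (@sh_val_zunit _ _ _ (Shpt uf' mt) q)).
apply: (@zeq_trans (sheafify F) _ _ _ _ (zeq_sym (avP U _ q))).
by apply: zeq_sym; apply: Gm.
Qed.

End Sheafified.

Lemma zprod_sep (I : Type) (F : I -> zfun) : (forall i, zsep (F i)) -> zsep (zprod F).
Proof.
move=> h R x y [f uf H] i; apply: h; exists f => // T c p; exact: (H T c p i).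
Qed.

(** One cover serves all the factors, so infinite products cause no difficulty. *)
Lemma zprod_glue (I : Type) (F : I -> zfun) : (forall i, zglue (F i)) -> zglue (zprod F).
Proof.
move=> h R f G uf Gm.
have H i : exists x : F i R, forall (T : comUnitRingType) (c : {rmorphism R -> T}) p, zeq (zres c x) (G T c p i).
  by apply: (h i R f (fun T c p => G T c p i)) => // T U c d e p q ed; exact: (Gm T U c d e p q ed i).
exists (fun i => projT1 (cid (H i))) => T c p i /=.
exact: (projT2 (cid (H i))).
Qed.

Section Sub.
Variables (F : zfun) (P : forall R, F R -> Prop)
  (PR : forall (R T : comUnitRingType) (c : {rmorphism R -> T}) (x : F R), P x -> P (zres c x)).

Lemma zsub_sep : zsep F -> zsep (zsub PR).
Proof. by move=> h R x y [f uf H]; apply: h; exists f. Qed.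

Lemma zsub_glue : zglue F -> (forall R (x y : F R), zeq x y -> P x -> P y) ->
  (forall R (x : F R), locp (fun T (c : {rmorphism R -> T}) => P (zres c x)) -> P x) ->
  zglue (zsub PR).
Proof.
move=> h Peq Ploc R f G uf Gm.
have [x hx] : exists x : F R, forall (T : comUnitRingType) (c : {rmorphism R -> T}) p,
    zeq (zres c x) (proj1_sig (G T c p)).
  exact: (h R f (fun T c p => proj1_sig (G T c p))).
have Px : P x.
  apply: Ploc; exists f => // T c p; apply: Peq (zeq_sym (hx T c p)) _.
  exact: (proj2_sig (G T c p)).
by exists (exist _ x Px) => T c p; exact: hx.
Qed.
End Sub.

End Sheaves.

Section IsoOfRelation.
Variables (X Y : zfun) (sX : zsep X) (gX : zglue X) (sY : zsep Y) (gY : zglue Y).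
Variable Th : forall R : comUnitRingType, X R -> Y R -> Prop.
Hypothesis Thres : forall (R T : comUnitRingType) (c : {rmorphism R -> T}) x y,
  Th x y -> Th (zres c x) (zres c y).
Hypothesis Thx : forall R (x x' : X R) (y : Y R), zeq x x' -> Th x y -> Th x' y.
Hypothesis Thy : forall R (x : X R) (y y' : Y R), zeq y y' -> Th x y -> Th x y'.
Hypothesis Thfun : forall R (x : X R) (y y' : Y R), Th x y -> Th x y' -> zeq y y'.

Let LTh (R : comUnitRingType) (x : X R) (y : Y R) :=
  locp (fun T (c : {rmorphism R -> T}) => Th (zres c x) (zres c y)).

(** Local images exist and are unique, so the chosen ones agree on overlaps and glue. *)
Lemma locp_rel_ex : (forall R (x : X R),
    locp (fun T (c : {rmorphism R -> T}) => exists y, Th (zres c x) y)) ->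
  forall R (x : X R), exists y, LTh x y.
Proof.
move=> ex R x; have [f uf H] := ex R x.
have [] := gY (F := fun T c p => projT1 (cid (H T c p))) uf.
  move=> T U c d e p q ed.
  have h1 := Thres d (projT2 (cid (H T c p))).
  have h2 := projT2 (cid (H U e q)).
  apply: Thfun h2; apply: Thx h1; exact/zeq_sym/zres_comp.
move=> y hy; exists y; exists f => // T c p.
by apply: Thy (projT2 (cid (H T c p))); apply/zeq_sym/hy.
Qed.

Lemma locp_rel_fun R (x x' : X R) (y y' : Y R) : zeq x x' -> LTh x y -> LTh x' y' -> zeq y y'.
Proof.
move=> xx' h h'; apply: sY; apply: locp_imp (locp_and h h') => T c [k k'].
by apply: Thfun k _; apply: Thx k'; apply/zres_eq/zeq_sym.
Qed.

Lemma locp_rel_res (R T : comUnitRingType) (c : {rmorphism R -> T}) x y :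
  LTh x y -> LTh (zres c x) (zres c y).
Proof.
move=> /(locp_res c); apply: locp_imp => U d h.
by apply: Thx (zres_comp1 c d x) _; apply: Thy (zres_comp1 c d y) _.
Qed.

Lemma zmor_of_rel : (forall R (x : X R),
    locp (fun T (c : {rmorphism R -> T}) => exists y, Th (zres c x) y)) ->
  exists a : zmor X Y, forall (R : comUnitRingType) (x : X R), LTh x (a R x).
Proof.
move=> ex; have H := locp_rel_ex ex.
unshelve eexists (@Zmor X Y (fun R x => projT1 (cid (H R x))) _ _).
- by move=> R x y xy; apply: (locp_rel_fun xy); exact: (projT2 (cid (H R _))).
- move=> R T c x; apply: (locp_rel_fun (zeq_refl _) (projT2 (cid (H T _)))).
  exact: locp_rel_res (projT2 (cid (H R x))).
- by move=> R x; exact: (projT2 (cid (H R x))).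
Qed.

End IsoOfRelation.

(** In neither direction is there a formula for a map, only a relation between points. Being
    functional and locally total both ways, it induces two morphisms, inverse to each other by
    uniqueness. *)
Lemma ziso_of_rel (X Y : zfun) (sX : zsep X) (gX : zglue X) (sY : zsep Y) (gY : zglue Y)
    (Th : forall R : comUnitRingType, X R -> Y R -> Prop) :
  (forall (R T : comUnitRingType) (c : {rmorphism R -> T}) x y,
     Th R x y -> Th T (zres c x) (zres c y)) ->
  (forall R (x x' : X R) (y y' : Y R), zeq x x' -> zeq y y' -> Th R x y -> Th R x' y') ->
  (forall R (x : X R) (y y' : Y R), Th R x y -> Th R x y' -> zeq y y') ->
  (forall R (x x' : X R) (y : Y R), Th R x y -> Th R x' y -> zeq x x') ->
  (forall R (x : X R), locp (fun T (c : {rmorphism R -> T}) => exists y, Th T (zres c x) y)) ->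
  (forall R (y : Y R), locp (fun T (c : {rmorphism R -> T}) => exists x, Th T x (zres c y))) ->
  ziso X Y.
Proof.
move=> Tres Teq Tfun Tinj Tx Ty.
have Thx R (x x' : X R) (y : Y R) : zeq x x' -> Th R x y -> Th R x' y.
  by move=> h; apply: Teq h (zeq_refl _).
have Thy R (x : X R) (y y' : Y R) : zeq y y' -> Th R x y -> Th R x y'.
  by move=> h; apply: Teq (zeq_refl _) h.
have [a ha] := zmor_of_rel sY gY Tres Thx Thy Tfun Tx.
have [b hb] := @zmor_of_rel Y X sX gX (fun R y x => Th R x y)
  (fun R T c y x => @Tres R T c x y) (fun R x x' y => @Thy R y x x')
  (fun R x y y' => @Thx R y y' x) (fun R x y y' => @Tinj R y y' x) Ty.
exists a, b; split=> [R x|R y].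
  apply: sX; apply: locp_imp (locp_and (ha R x) (hb R (a R x))) => T c [h k].
  exact: Tinj k h.
apply: sY; apply: locp_imp (locp_and (hb R y) (ha R (b R y))) => T c [h k].
exact: Tfun k h.
Qed.
End SheafGluing.

Module Blocks.
(** * Blocks and lattice points *)

Section Items.
Variables (N : nat) (s : 'I_N -> nat).
Hypotheses (s_gt0 : forall t, (0 < s t)%N) (n_ge2 : (2 <= \sum_(t < N) s t)%N).

Let pre (k : nat) := (\sum_(r < N | r < k) s r)%N.

Let preS (t : 'I_N) : pre t.+1 = (pre t + s t)%N.
Proof.
rewrite /pre (bigD1 t) /= ?ltnSn // addnC; congr (_ + _)%N; apply: eq_bigl => r.
by rewrite -(inj_eq val_inj) /= ltnS; case: ltngtP.
Qed.

Let pre_mono k l : (k <= l)%N -> (pre k <= pre l)%N.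
Proof.
move=> kl; rewrite /pre [leqRHS](bigID (fun r : 'I_N => (r < k)%N)) /=.
rewrite (eq_bigl (fun r : 'I_N => (r < l)%N && (r < k)%N)) ?leq_addr // => r.
by case: (ltnP r k) => h; rewrite ?andbF // (leq_trans h kl).
Qed.

Let in_block (t : 'I_N) (a : 'I_(tot s)) : (a \in block s t) = (pre t <= a < pre t.+1)%N.
Proof. by rewrite inE /pre; congr (_ && (_ < _))%N; apply: eq_bigl => r; rewrite ltnS. Qed.

Lemma block_ex (a : 'I_(tot s)) : exists t, a \in block s t.
Proof.
have exk : exists k, (a < pre k)%N.
  by exists N; rewrite /pre (eq_bigl xpredT) // => r; rewrite ltn_ord.
case: (ex_minnP exk) => -[|k]; first by rewrite /pre big_pred0 // ltn0.
move=> ak kmin; have kN : (k < N)%N.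
  rewrite ltnNge; apply/negP => Nk; suff e : pre k.+1 = pre k by have := kmin k; rewrite ltnn -e ak => /(_ isT).
  apply: eq_bigl => r; rewrite (leq_trans (ltn_ord r) (leq_trans Nk (leqnSn k))).
  by rewrite (leq_trans (ltn_ord r) Nk).
exists (Ordinal kN); rewrite in_block /= ak andbT leqNgt; apply/negP => h.
by have := kmin _ h; rewrite ltnn.
Qed.

Definition bl (a : 'I_(tot s)) : 'I_N := xchoose (block_ex a).

Lemma blP (a : 'I_(tot s)) t : (a \in block s t) = (bl a == t).
Proof.
apply/idP/eqP => [h|<-]; last exact: (xchooseP (block_ex a)).
have := xchooseP (block_ex a); rewrite -/(bl a); move: h; rewrite !in_block.
move=> /andP [h1 h2] /andP [h3 h4]; apply: val_inj; apply/eqP; rewrite eqn_leq.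
apply/andP; split; rewrite leqNgt; apply/negP => lt.
  by have := pre_mono lt; rewrite leqNgt (leq_ltn_trans h3 h2).
by have := pre_mono lt; rewrite leqNgt (leq_ltn_trans h1 h4).
Qed.

(** The pairs for which [e_i + e_j] belongs to [Vset s]: a block may be used twice only if it has at
    least two elements. *)
Definition adm (i j : 'I_N) : bool := (i != j) || (1 < s i)%N.

Lemma adm_sym i j : adm i j = adm j i.
Proof. by rewrite /adm eq_sym; case: eqVneq => // ->. Qed.

Lemma adm_neq i j : i != j -> adm i j.
Proof. by rewrite /adm => ->. Qed.

Lemma adm_bl (a b : 'I_(tot s)) : a != b -> adm (bl a) (bl b).
Proof.
move=> ab; rewrite /adm; case: eqVneq => //= e.
have h1 : a \in block s (bl a) by rewrite blP.
have h2 : b \in block s (bl a) by rewrite blP e.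
move: h1 h2; rewrite !in_block preS => /andP [h1 h2] /andP [h3 h4].
rewrite ltnNge; apply/negP => s1; move/negP: ab; apply; apply/eqP/val_inj/eqP.
rewrite eqn_leq; apply/andP; split; rewrite -ltnS.
  by apply: (leq_trans h2); rewrite -addn1 leq_add.
by apply: (leq_trans h4); rewrite -addn1 leq_add.
Qed.

Fact itemP (i j : 'I_N) :
  (\sum_t ([ffun t : 'I_N => inord ((t == i) + (t == j))] : {ffun 'I_N -> 'I_3}) t == 2)%N.
Proof.
under eq_bigr => t _ do rewrite ffunE inordK ?(leq_ltn_trans (leq_add (leq_b1 _) (leq_b1 _))) //.
rewrite big_split /=.
have e (k : 'I_N) : (\sum_(t : 'I_N) (t == k) = 1)%N.
  by rewrite (bigD1 k) //= eqxx big1 // => t /negPf ->.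
by rewrite !e.
Qed.

Definition item (i j : 'I_N) : lpt N :=
  exist (fun x : {ffun 'I_N -> 'I_3} => is_true (\sum_t x t == 2)%N) _ (itemP i j).

Lemma itemE i j t : sval (item i j) t = ((t == i) + (t == j))%N :> nat.
Proof. by rewrite ffunE inordK // ltnS; case: (_ == _); case: (_ == _). Qed.

Lemma item_sym i j : item i j = item j i.
Proof. by apply/val_inj/ffunP => t /=; rewrite !ffunE addnC. Qed.

Lemma item_Vset i j : (item i j \in Vset s) = adm i j.
Proof.
rewrite inE; apply/forallP/idP => [h|h t].
  rewrite /adm; case: eqVneq => //= e; have := h i.
  by rewrite itemE e eqxx.
rewrite itemE; case: eqVneq => [->|ti]; case: eqVneq => // e.
by move: h; rewrite /adm e eqxx.
Qed.

Lemma adm_ex : exists p : 'I_N * 'I_N, adm p.1 p.2.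
Proof.
have [/existsP [i hi]|h] := boolP [exists i, (1 < s i)%N].
  by exists (i, i); rewrite /adm /= eqxx.
have s1 t : s t = 1%N.
  move: h; rewrite negb_exists => /forallP /(_ t); rewrite -leqNgt => h.
  by apply/eqP; rewrite eqn_leq h s_gt0.
have N2 : (1 < N)%N.
  by move: n_ge2; under eq_bigr => t _ do rewrite s1; rewrite sum1_card card_ord.
by exists (Ordinal (ltnW N2), Ordinal N2).
Qed.

Definition vs0 : VS s := exist _ (item (xchoose adm_ex).1 (xchoose adm_ex).2)
  (etrans (item_Vset _ _) (xchooseP adm_ex)).

(** Total in [i] and [j], with an arbitrary default; the value is the point [e_i + e_j] only for
    admissible pairs. *)
Definition vs (i j : 'I_N) : VS s := insubd vs0 (item i j).

Lemma vs_val i j : adm i j -> val (vs i j) = item i j.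
Proof. by move=> h; rewrite /vs val_insubd item_Vset h. Qed.

Lemma vs_sym i j : vs i j = vs j i.
Proof. by rewrite /vs item_sym. Qed.

Lemma vsE i j t : adm i j -> vco (vs i j) t = ((t == i) + (t == j))%N.
Proof. by move=> h; rewrite /vco -(itemE i j t) -(vs_val h). Qed.

Lemma vcoP (v w : VS s) : (forall t, vco v t = vco w t) -> v = w.
Proof.
by move=> h; apply/val_inj/val_inj/ffunP => t; apply/val_inj/h.
Qed.

Lemma lptP (x : lpt N) : exists i j, x = item i j.
Proof.
have sx : (\sum_t sval x t = 2)%N by apply/eqP/(svalP x).
have [i xi] : exists i, (0 < sval x i)%N.
  apply/existsP; apply: contraT; rewrite negb_exists => /forallP h.
  by move: sx; rewrite big1 // => t _; apply/eqP; rewrite -leqn0 leqNgt; exact: h.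
move: (sx); rewrite (bigD1 i) //=.
have : (sval x i <= 2)%N by rewrite -ltnS.
rewrite leq_eqVlt => /orP [/eqP e|lt].
  rewrite e => /eqP; rewrite -[X in _ == X]addn0 eqn_add2l sum_nat_eq0 => /forall_inP h.
  exists i, i; apply/val_inj/ffunP => t; apply: val_inj; apply: etrans (esym (itemE i i t)).
  by case: eqVneq => [->|/h /eqP]; rewrite ?e.
have -> : sval x i = 1%N :> nat by apply/eqP; rewrite eqn_leq -ltnS lt.
move=> /eqP; rewrite -[X in _ == X]/(1 + 1)%N eqn_add2l => /eqP sx'.
have [j ji xj] : exists2 j, j != i & (0 < sval x j)%N.
  apply/exists_inP; apply: contraT; rewrite negb_exists_in => /forall_inP h.
  by move: sx'; rewrite big1 // => t /h; rewrite lt0n negbK => /eqP.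
move: sx'; rewrite (bigD1 j) //= => sx'.
have e : sval x j = 1%N :> nat.
  by apply/eqP; rewrite eqn_leq xj andbT; apply: leq_trans (leq_addr _ _) (eq_leq sx').
move: sx'; rewrite e => /eqP; rewrite -[X in _ == X]addn0 eqn_add2l sum_nat_eq0 => /forall_inP h.
exists i, j; apply/val_inj/ffunP => t; apply: val_inj; apply: etrans (esym (itemE i j t)).
case: (eqVneq t i) => [->|ti].
  by rewrite eq_sym (negPf ji) addn0; apply/eqP; rewrite eqn_leq -ltnS lt.
case: (eqVneq t j) => [->|tj]; first exact: e.
by apply/eqP; apply: h; rewrite ti.
Qed.

Lemma vsP (v : VS s) : exists i j, adm i j /\ v = vs i j.
Proof.
have [i [j e]] := lptP (val v); exists i, j.
have h : adm i j by rewrite -item_Vset -e; exact: valP v.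
by split=> //; apply: val_inj; rewrite vs_val.
Qed.

Lemma vco_sum (v : VS s) : (\sum_t vco v t = 2)%N.
Proof. exact/eqP/(svalP (sval v)). Qed.

Lemma vs_inj i j k l : adm i j -> adm k l -> vs i j = vs k l ->
  (i = k /\ j = l) \/ (i = l /\ j = k).
Proof.
move=> h1 h2 e; have H t : ((t == i) + (t == j) = (t == k) + (t == l))%N.
  by rewrite -(vsE t h1) e vsE.
have := H i; rewrite eqxx; case: (eqVneq i k) => [ik _|ik].
  left; split=> //; have := H j; rewrite eqxx ik; case: (eqVneq j k) => [->|jk] /=.
    by case: eqVneq.
  by case: eqVneq.
case: (eqVneq i l) => // il _; right; split=> //.
have := H j; rewrite eqxx il; case: (eqVneq j k) => // jk; case: eqVneq => //= jl _.
Qed.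

Definition vI (I : idx2 s) : VS s := vs (bl (sval I).1) (bl (sval I).2).

Lemma idx2_neq (I : idx2 s) : (sval I).1 != (sval I).2.
Proof. by rewrite -(inj_eq val_inj) neq_ltn (svalP I). Qed.

Lemma inI_vI v (I : idx2 s) : inI v I = (v == vI I).
Proof.
have ne := idx2_neq I; have ad := adm_bl ne.
have E t : #|[set (sval I).1; (sval I).2] :&: block s t| =
    ((t == bl (sval I).1) + (t == bl (sval I).2))%N.
  rewrite -!(eq_sym (bl _) t) -!blP finset.setIUl cardsU.
  have e (a : 'I_(tot s)) : #|[set a] :&: block s t| = (a \in block s t).
    case: (boolP (_ \in _)) => h; first by rewrite (finset.setIidPl _) ?cards1 ?finset.sub1set.
    by apply/eqP; rewrite cards_eq0 finset.setI_eq0 disjoints1.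
  rewrite !e (_ : _ :&: _ = finset.set0) ?cards0 ?subn0 //.
  apply/setP => a; rewrite !inE; case: eqVneq => //= ->; rewrite [X in _ && X](_ : _ = false) ?andbF //.
  by rewrite (negPf ne).
apply/forallP/eqP => [h|-> t].
  by apply: vcoP => t; rewrite /vI vsE // -E; apply/esym/eqP.
by rewrite E /vI vsE.
Qed.

Section Ext.
Variable R : pzRingType.
Variable x : idx2 s -> R.

(** The alternating extension of the coordinates to ordered pairs; with it, a three-term Pluecker
    expression changes only by a sign when its four indices are permuted. *)
Definition ext (a b : 'I_(tot s)) : R :=
  if insub (a, b) : option (idx2 s) is Some J then x J else
  if insub (b, a) : option (idx2 s) is Some J then - x J else 0.

Lemma ext_lt (a b : 'I_(tot s)) (h : (a < b)%N) : ext a b = x (pr2 h).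
Proof. by rewrite /ext insubT. Qed.

Lemma ext_anti a b : ext a b = - ext b a.
Proof.
rewrite /ext; case: insubP => [I hI eI|ab]; case: insubP => [J hJ eJ|ba].
- by move: (ltn_trans hI hJ); rewrite ltnn.
- by rewrite opprK.
- by [].
- by rewrite oppr0.
Qed.

Lemma ext_aa a : ext a a = 0.
Proof. by rewrite /ext insubF ?ltnn. Qed.

Lemma ext_idx (I : idx2 s) : ext (sval I).1 (sval I).2 = x I.
Proof. by rewrite (ext_lt (svalP I)); congr x; apply: val_inj; case: I => -[]. Qed.

End Ext.

(** The sign is the same for all rings and all coordinate functions, so it can be pulled out when
    coordinates are rescaled. *)
Lemma idx2_ext (a b : 'I_(tot s)) : a != b ->
  exists I : idx2 s, vI I = vs (bl a) (bl b) /\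
    exists e : bool, forall (R : pzRingType) (x : idx2 s -> R), ext x a b = (-1) ^+ e * x I.
Proof.
rewrite -(inj_eq val_inj) neq_ltn => /orP [h|h].
  by exists (pr2 h); split=> //; exists false => R x; rewrite (ext_lt _ h) mul1r.
exists (pr2 h); split; first by rewrite /vI vs_sym.
by exists true => R x; rewrite ext_anti (ext_lt _ h) mulN1r.
Qed.

End Items.
End Blocks.

Module AffineCharts.
Import Blocks.
(** * Cells and their affine bases *)

Section Cells.
Variables (N : nat) (s : 'I_N -> nat).
Hypotheses (s_gt0 : forall t, (0 < s t)%N) (n_ge2 : (2 <= \sum_(t < N) s t)%N).
Variable K : realType.
Notation vs := (vs s_gt0 n_ge2).
Notation adm := (adm s).

Definition affrow (v : VS s) : 'rV[K]_(1 + N) :=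
  row_mx (1%:M : 'M[K]_1) (\row_t (vco v t)%:R).

Definition affmx (A : {set VS s}) : 'M[K]_(#|A|, 1 + N) :=
  \matrix_(k < #|A|) affrow (enum_val k).

Lemma adim1E A : adim1 K A = \rank (affmx A).
Proof. by []. Qed.

Lemma affrow_sub (A : {set VS s}) v : v \in A -> (affrow v <= affmx A)%MS.
Proof.
move=> vA; rewrite (_ : affrow v = row (enum_rank_in vA v) (affmx A)) ?row_sub //.
by apply/rowP => i; rewrite [RHS]mxE [in RHS]mxE enum_rankK_in.
Qed.

Lemma affmx_sub m (A : {set VS s}) (M : 'M[K]_(m, 1 + N)) :
  (forall v, v \in A -> (affrow v <= M)%MS) -> (affmx A <= M)%MS.
Proof.
move=> h; apply/row_subP => k.
rewrite (_ : row k _ = affrow (enum_val k)); first exact/h/enum_valP.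
by apply/rowP => i; rewrite mxE mxE.
Qed.

Lemma affrowM (v : VS s) (c : K) (a : 'I_N -> K) :
  affrow v *m col_mx (const_mx c : 'M_(1, 1)) (\col_t a t) = const_mx (c + \sum_t a t * (vco v t)%:R).
Proof.
rewrite mul_row_col mul1mx; apply/matrixP => i j; rewrite !mxE; congr (_ + _).
by apply: eq_bigr => t _; rewrite !mxE mulrC.
Qed.

(** Equal dimension means that the homogenised points of [A] span those of all of [S], so an affine
    equation valid on [A] propagates. *)
Lemma adim1_functional (A : {set VS s}) (c : K) (a : 'I_N -> K) :
  adim1 K A = adim1 K [set: VS s] ->
  (forall v, v \in A -> c + \sum_t a t * (vco v t)%:R = 0) ->
  forall v : VS s, c + \sum_t a t * (vco v t)%:R = 0.
Proof.
move=> hA h v.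
have sub : (affmx A <= affmx [set: VS s])%MS.
  by apply: affmx_sub => w _; apply: affrow_sub.
have sub' : (affmx [set: VS s] <= affmx A)%MS.
  by rewrite -(geq_leqif (mxrank_leqif_sup sub)) -!adim1E hA.
have h1 := submx_trans (affrow_sub (finset.in_setT v)) sub'.
pose Q := col_mx (const_mx c : 'M[K]_(1, 1)) (\col_t a t).
have h2 : affmx A *m Q = 0.
  apply/row_matrixP => k; rewrite row_mul row0.
  rewrite (_ : row k _ = affrow (enum_val k)); last by apply/rowP => i; rewrite !mxE.
  by rewrite affrowM h ?enum_valP //; apply/rowP => i; rewrite !mxE.
have : affrow v *m Q = 0.
  by have [L ->] := submxP h1; rewrite -mulmxA h2 mulmx0.
by rewrite affrowM => /matrixP /(_ ord0 ord0); rewrite !mxE.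
Qed.

Section Chart.
Variables (A e : {set VS s}) (C : {ffun VS s -> int}) (D : 'I_N -> {ffun VS s -> int}).

Definition afch (x : 'I_N -> int) (w : VS s) : int := C w + \sum_t x t * D t w.

Definition in_affspan (x : 'I_N -> int) : Prop :=
  exists a : VS s -> K, \sum_v a v = 1 /\ forall t, (x t)%:~R = \sum_v a v * (vco v t)%:R.

(* Barycentric coordinates with respect to e, as an integral affine map. *)
Definition affine_chart : Prop :=
  [/\ e \subset A,
      forall w w', w \in e -> afch (fun t => (vco w t)%:Z) w' = (w' == w)%:Z,
      forall w x, w \notin e -> afch x w = 0
    & forall x, in_affspan x -> \sum_w afch x w = 1 /\
        forall t, x t = \sum_w afch x w * (vco w t)%:Z].

Hypothesis chart : affine_chart.

Lemma in_affspan_vco (v : VS s) : in_affspan (fun t => (vco v t)%:Z).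
Proof.
exists (fun w => (w == v)%:R); split.
  by rewrite (bigD1 v) //= eqxx big1 ?addr0 // => w /negPf ->.
move=> t; rewrite (bigD1 v) //= eqxx mul1r big1 ?addr0 // => w /negPf ->.
by rewrite mul0r.
Qed.

Lemma chart_sum_e (f : VS s -> int) x :
  \sum_(w in e) afch x w * f w = \sum_w afch x w * f w.
Proof.
have [_ _ h _] := chart; rewrite [RHS](bigID (mem e)) /= [X in _ + X]big1 ?addr0 //.
by move=> w we; rewrite h // mul0r.
Qed.

(** Barycentric coordinates express every point through [e], and as a matrix they are a right
    inverse of the homogenised points of [e]; hence these points are independent and span. *)
Lemma chart_rank : adim1 K A = adim1 K [set: VS s] /\ #|e| = adim1 K [set: VS s].
Proof.
have [eA h1 h2 h3] := chart.
have sub1 : (affmx [set: VS s] <= affmx e)%MS.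
  apply: affmx_sub => v _; have [hs hc] := h3 _ (in_affspan_vco v).
  pose r w : K := (afch (fun t => (vco v t)%:Z) w)%:~R.
  rewrite (_ : affrow v = \sum_(w in e) r w *: affrow w).
    by apply: summx_sub => w we; apply: scalemx_sub; apply: affrow_sub.
  rewrite (_ : \sum_(w in e) _ = \sum_w r w *: affrow w); last first.
    rewrite [RHS](bigID (mem e)) /= [X in _ + X]big1 ?addr0 // => w we.
    by rewrite /r h2 // scale0r.
  apply/rowP => i; rewrite summxE; case: (split_ordP i) => j ->.
    rewrite row_mxEl mxE ord1 eqxx -[LHS]/((1%:~R) : K) -hs rmorph_sum; apply: eq_bigr => w _.
    by rewrite mxE row_mxEl mxE eqxx mulr1.
  rewrite row_mxEr mxE -[LHS]/(((vco v j)%:Z)%:~R : K) hc rmorph_sum; apply: eq_bigr => w _.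
  by rewrite mxE row_mxEr mxE rmorphM.
have sub2 : (affmx e <= affmx A)%MS.
  by apply: affmx_sub => w we; apply: affrow_sub; apply: (fintype.subsetP eA).
have sub3 : (affmx A <= affmx [set: VS s])%MS.
  by apply: affmx_sub => w we; apply: affrow_sub.
have rk : \rank (affmx e) = #|e|.
  apply/eqP; rewrite -/(row_free _); apply/row_freeP.
  exists (col_mx (\row_k (C (enum_val k))%:~R : 'M_(1, #|e|)) (\matrix_(t, k) (D t (enum_val k))%:~R)).
  apply/row_matrixP => k; rewrite row_mul (_ : row k _ = affrow (enum_val k)); last first.
    by apply/rowP => i; rewrite mxE mxE.
  rewrite mul_row_col mul1mx; apply/rowP => l; rewrite !mxE.
  have := h1 _ (enum_val l) (enum_valP k); rewrite (inj_eq enum_val_inj) /afch eq_sym => hh.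
  have := congr1 (fun z : int => z%:~R : K) hh; rewrite rmorphD rmorph_sum /= => hh'.
  transitivity (((k == l)%:Z)%:~R : K); last by case: eqP.
  rewrite -hh'; congr (_ + _); apply: eq_bigr => t _.
  by rewrite !mxE rmorphM.
rewrite -!adim1E in rk *; rewrite -rk; split; apply/eqP; rewrite eqn_leq !adim1E.
  by rewrite (mxrankS sub3) (mxrankS (submx_trans sub1 sub2)).
by rewrite (mxrankS (submx_trans sub2 sub3)) (mxrankS sub1).
Qed.

Lemma chart_affine_basis : affine_basis K A e.
Proof.
have [eA h1 h2 h3] := chart; split=> //; first by case: chart_rank.
move=> x /h3 [hs hc]; exists (afch x); split.
  rewrite -hs -[RHS](eq_bigr _ (fun w _ => mulr1 _)) -chart_sum_e.
  by apply: eq_bigr => w _; rewrite mulr1.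
by move=> t; rewrite chart_sum_e.
Qed.

(** The class of [v] minus its barycentric interpolation on [e], that is, the [v]-th coordinate of
    the representative normalised to 1 on [e]. *)
Definition chart_split (v : VS s) : {ffun VS s -> int} :=
  delta v - [ffun w => afch (fun t => (vco v t)%:Z) w].

Lemma chart_splitting : splitting e chart_split.
Proof.
have [eA h1 h2 h3] := chart; split.
- move=> v; have [hs hc] := h3 _ (in_affspan_vco v).
  have dv (f : VS s -> int) : \sum_w delta v w * f w = f v.
    rewrite (bigD1 v) //= /delta ffunE eqxx mul1r big1 ?addr0 // => w /negPf nw.
    by rewrite ffunE nw mul0r.
  split=> [|t].
    rewrite (eq_bigr (fun w => delta v w * 1 - afch (fun t => (vco v t)%:Z) w)).
      by rewrite sumrB dv hs subrr.
    by move=> w _; rewrite !ffunE mulr1.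
  rewrite (eq_bigr (fun w => delta v w * (vco w t)%:Z - afch (fun t => (vco v t)%:Z) w * (vco w t)%:Z)).
    by rewrite sumrB dv -hc subrr.
  by move=> w _; rewrite !ffunE mulrBl.
- exists C, D => v; apply/ffunP => w; rewrite !ffunE sum_ffunE /afch -addrA.
  rewrite [X in _ = _ + X](_ : _ = 0) ?addr0 //.
  apply/eqP; rewrite addrC subr_eq0; apply/eqP; congr (_ + _).
  by apply: eq_bigr => t _; rewrite ffunMnE pmulrn mulrzz mulrC.
- move=> v ve; apply/ffunP => w; rewrite !ffunE h1 //.
  by rewrite subrr.
Qed.

End Chart.
End Cells.
End AffineCharts.

(** * Cells of rank two and their integral affine bases *)

Module Cells.
Import Blocks AffineCharts.
Section FfunEval.
Variables (N : nat) (s : 'I_N -> nat).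
Implicit Types f g : {ffun VS s -> int}.
Lemma ffaddE f g w : (f + g) w = f w + g w. Proof. by rewrite ffunE. Qed.
Lemma ffoppE f w : (- f) w = - f w. Proof. by rewrite ffunE. Qed.
Lemma ffzeroE w : (0 : {ffun VS s -> int}) w = 0. Proof. by rewrite ffunE. Qed.
Lemma deltaE (v w : VS s) : delta v w = (w == v)%:Z. Proof. by rewrite ffunE. Qed.
End FfunEval.

Section CellSets.
Variables (N : nat) (s : 'I_N -> nat).
Hypotheses (s_gt0 : forall t, (0 < s t)%N) (n_ge2 : (2 <= \sum_(t < N) s t)%N).
Variable K : realType.
Notation vs := (vs s_gt0 n_ge2).
Notation adm := (adm s).

Variables (E : rel 'I_N) (Lp : {set 'I_N}).
Hypotheses (Erefl : reflexive E) (Esym : forall i j, E i j = E j i) (Etrans : transitive E)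
  (Ladm : forall a, a \in Lp -> adm a a)
  (Lsing : forall a t, a \in Lp -> E a t -> t = a).

(** A cell is encoded by an equivalence relation [E] and a set [Lp] of blocks that may be doubled:
    its points are the sums of two blocks from different classes and the doubles from [Lp]. By
    [Lsing] a block that may be doubled is alone in its class. *)
Definition cpair (i j : 'I_N) : bool := if i == j then i \in Lp else ~~ E i j.

Definition cellset : {set VS s} :=
  [set v | [exists p : 'I_N * 'I_N, [&& adm p.1 p.2, v == vs p.1 p.2 & cpair p.1 p.2]]].

Lemma cpair_sym i j : cpair i j = cpair j i.
Proof. by rewrite /cpair eq_sym; case: eqVneq => [->|_] //; rewrite Esym. Qed.

Lemma cpair_loop a t : cpair a a -> cpair a t.
Proof.
rewrite /cpair eqxx => La; case: eqVneq => // ne; apply/negP => Eat.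
by move: ne; rewrite (Lsing La Eat) eqxx.
Qed.

Lemma cpair_adm i j : cpair i j -> adm i j.
Proof. by rewrite /cpair; case: eqVneq => [->|ne _]; [apply: Ladm|apply: adm_neq]. Qed.

Lemma in_cellset i j : adm i j -> (vs i j \in cellset) = cpair i j.
Proof.
move=> ad; rewrite inE; apply/existsP/idP => [[[k l] /= /and3P [ad' /eqP e h]]|h].
  by case: (vs_inj ad ad' e) => [[-> ->]|[-> ->]] //; rewrite cpair_sym.
by exists (i, j); rewrite /= ad eqxx.
Qed.

Lemma cellsetP v : reflect (exists i j, [/\ adm i j, v = vs i j & cpair i j]) (v \in cellset).
Proof.
rewrite inE; apply: (iffP existsP) => [[[i j] /= /and3P [h1 /eqP h2 h3]]|[i [j [h1 h2 h3]]]].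
  by exists i, j.
by exists (i, j); rewrite /= h1 h3 h2 eqxx.
Qed.

(** The ways of being full-dimensional. With two classes and no doubled block, every point has mass
    one on each class, which lowers the dimension unless [S] is a single point. *)
Definition cfull : Prop :=
  [\/ exists a, a \in Lp, exists a b c, [/\ ~~ E a b, ~~ E a c & ~~ E b c]
    | (forall v w : VS s, v = w) /\ exists v, v \in cellset].

(* The rank function of the cell: J meets a point of the cell in at most [crk J] units. *)
Let crk (J : {set 'I_N}) : nat :=
  if J == finset.set0 then 0%N else
  if [exists p : 'I_N * 'I_N, [&& p.1 \in J, p.2 \in J & cpair p.1 p.2]] then 2%N else 1%N.

Let crk_mono (J J' : {set 'I_N}) : J \subset J' -> (crk J <= crk J')%N.
Proof.
move=> sub; rewrite /crk; case: eqVneq => // J0.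
case: eqVneq => [J'0|_]; first by move: sub; rewrite J'0 finset.subset0 (negPf J0).
case: existsP => [[p /and3P [h1 h2 h3]]|_]; last by case: ifP.
by rewrite ifT //; apply/existsP; exists p; rewrite !(fintype.subsetP sub) ?h1 ?h2.
Qed.

Let crk_le2 J : (crk J <= 2)%N.
Proof. by rewrite /crk; case: (_ == _) => //; case: [exists _, _]. Qed.

Let crk1 (J : {set 'I_N}) a b : crk J = 1%N -> a \in J -> b \in J -> ~~ cpair a b.
Proof.
rewrite /crk; case: (J == _) => //; case: existsP => // h _ aJ bJ; apply/negP => h'.
by apply: h; exists (a, b); rewrite /= aJ bJ.
Qed.

(** The essential case is that of two intersecting sets of rank one: all their elements are
    equivalent to a common one and none may be doubled, so the union has rank one as well. *)
Let crk_sub (J J' : {set 'I_N}) : (crk (J :|: J') + crk (J :&: J') <= crk J + crk J')%N.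
Proof.
have [J0|J0] := eqVneq J finset.set0.
  by rewrite J0 finset.set0U finset.set0I addnC.
have [J0'|J0'] := eqVneq J' finset.set0.
  by rewrite J0' finset.setU0 finset.setI0 leq_add2l.
have [r2|r2] := leqP 2 (crk J).
  by apply: leq_add; [apply: leq_trans r2|apply: crk_mono; apply: finset.subsetIr].
have [r2'|r2'] := leqP 2 (crk J').
  rewrite addnC; apply: leq_add; last by apply: leq_trans r2'.
  by apply: crk_mono; apply: finset.subsetIl.
have r1 : crk J = 1%N by move: r2; rewrite /crk (negPf J0); case: ifP.
have r1' : crk J' = 1%N by move: r2'; rewrite /crk (negPf J0'); case: ifP.
rewrite r1 r1'; have [->|] := eqVneq (J :&: J') finset.set0.
  by rewrite [X in (_ + X)%N]/crk eqxx addn0.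
move=> /finset.set0Pn [z]; rewrite finset.in_setI => /andP [zJ zJ'].
apply: leq_trans (leq_add (n1 := 1%N) _ (crk_mono (finset.subsetIl J J'))) _; last by rewrite r1.
rewrite /crk; case: ifP => // _; case: ifP => // /existsP [[a b] /= /and3P [ha hb hab]].
have Ez (J1 : {set 'I_N}) c : crk J1 = 1%N -> z \in J1 -> c \in J1 -> E z c && (cpair c c == false).
  move=> rj zj cj; have := crk1 rj zj cj; have := crk1 rj cj cj; rewrite /cpair eqxx.
  by case: eqVneq => [->|_] /negPf ->; rewrite ?Erefl //= ?negbK => ->.
have Eab c : c \in J :|: J' -> E z c && (cpair c c == false).
  by rewrite finset.in_setU => /orP [h|h]; [apply: (Ez J)|apply: (Ez J')].
have /andP [za /eqP aa] := Eab a ha; have /andP [zb _] := Eab b hb.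
move: hab aa; rewrite /cpair eqxx; case: eqVneq => [_ -> //|_] /negP []; apply: Etrans zb.
by rewrite Esym.
Qed.

(** The lower bounds are complementary to the rank function [crk], whose submodularity becomes the
    required supermodularity. *)
Lemma cellset_convex : (exists v, v \in cellset) -> entire_convex (sval @: cellset).
Proof.
move=> [v0 v0c].
have [i0 [j0 [ad0 e0 c0]]] := cellsetP _ v0c.
exists (fun I => 2 - crk (~: I))%N; split.
- rewrite finset.setC0 /crk ifF ?ifT //.
    by apply/existsP; exists (i0, j0); rewrite !finset.in_setT c0.
  by apply/negbTE/finset.set0Pn; exists i0; rewrite finset.in_setT.
- by rewrite finset.setCT /crk eqxx.
- move=> I J; rewrite finset.setCU finset.setCI addnC.
  have := crk_sub (~: I) (~: J); have := crk_le2 (~: I); have := crk_le2 (~: J).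
  have := crk_le2 (~: I :|: ~: J); have := crk_le2 (~: I :&: ~: J).
  move: (crk _) (crk _) (crk _) (crk _).
  by move=> [|[|[]]] // [|[|[]]] // [|[|[]]] // [|[|[]]].
have isum i j (I : {set 'I_N}) : (\sum_(t in I) sval (item i j) t = (i \in I) + (j \in I))%N.
  under eq_bigr => t _ do rewrite itemE.
  rewrite big_split /=; congr (_ + _)%N.
    case: (boolP (i \in I)) => h; last by rewrite big1 // => t; case: eqVneq => // -> /(negP h).
    by rewrite (bigD1 i) //= eqxx big1 // => t /andP [_ /negPf ->].
  case: (boolP (j \in I)) => h; last by rewrite big1 // => t; case: eqVneq => // -> /(negP h).
  by rewrite (bigD1 j) //= eqxx big1 // => t /andP [_ /negPf ->].
have key i j : (forall I, (2 - crk (~: I) <= \sum_(t in I) sval (item i j) t)%N) <-> cpair i j.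
  split=> [h|h I].
    (* Testing on the complement of the two blocks forces the set [{i, j}] to have rank two. *)
    have := h (~: [set i; j]); rewrite finset.setCK isum !inE !eqxx orbT /= leqn0 subn_eq0.
    rewrite /crk; case: ifP => // _; case: ifP => // /existsP [[a b] /= /and3P [ha hb hab]] _.
    move: ha hb hab; rewrite !inE => /orP [] /eqP -> /orP [] /eqP -> //.
    - exact: cpair_loop.
    - by rewrite cpair_sym.
    - by move=> h2; rewrite cpair_sym; exact: cpair_loop.
  rewrite isum leq_subLR /crk; case: ifP => [/eqP/finset.setP h0|/negbT h0].
    have hi := h0 i; have hj := h0 j; rewrite !inE in hi hj.
    by rewrite (negbFE hi) (negbFE hj).
  case: ifP => [_|/negbT h1]; first by rewrite leq_addr.
  rewrite add1n ltnS lt0n addn_eq0; apply/negP => /andP [/eqP hi /eqP hj].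
  move/negP: h1; apply; apply/existsP; exists (i, j); rewrite /= !inE h andbT.
  by move: hi hj; case: (i \in I); case: (j \in I).
apply/setP => x; rewrite inE; have [i [j e]] := lptP x.
apply/imsetP/forallP => [[v /cellsetP [k [l [ad' ev c]]] xv]|h].
  have ek : x = item k l by rewrite xv ev -(vs_val s_gt0 n_ge2 ad').
  by rewrite ek; apply/key.
have cp : cpair i j by apply/key; rewrite -e.
have ad := cpair_adm cp.
by exists (vs i j); [rewrite in_cellset|rewrite e -(vs_val s_gt0 n_ge2 ad)].
Qed.

Lemma affspan_sum x : @in_affspan N s K x -> \sum_t x t = 2.
Proof.
move=> [a [a1 ax]]; apply/eqP; rewrite -(eqr_int K) rmorph_sum /=; under eq_bigr => t _ do rewrite ax.
rewrite exchange_big /= (eq_bigr (fun v => a v * 2)).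
  by rewrite -mulr_suml a1 mul1r.
by move=> v _; rewrite -mulr_sumr -natr_sum vco_sum.
Qed.

Lemma cellset_chart : cfull -> exists e C D, affine_chart K cellset e C D.
Proof.
have [dl dlE] : exists dl : VS s -> {ffun VS s -> int}, forall v w, dl v w = (w == v)%:Z.
  by exists (@delta N s) => v w; rewrite deltaE.
have dlt (v : VS s) (f : VS s -> int) : \sum_w dl v w * f w = f v.
  rewrite (bigD1 v) //= dlE eqxx mul1r big1 ?addr0 // => w /negPf nw.
  by rewrite dlE nw mul0r.
have D0 : forall (C : {ffun VS s -> int}) (D : 'I_N -> {ffun VS s -> int}) w x, C w = 0 -> (forall t : 'I_N, D t w = 0) -> afch C D x w = 0 :> int.
  by move=> C D w x h1 h2; rewrite /afch h1 big1 ?addr0 // => t _; rewrite h2 mulr0.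
have lin (C : {ffun VS s -> int}) (D : 'I_N -> {ffun VS s -> int}) (x : 'I_N -> int) (f : VS s -> int) :
    \sum_w afch C D x w * f w = \sum_w C w * f w + \sum_t x t * \sum_w D t w * f w.
  rewrite /afch; under eq_bigr => w _ do rewrite mulrDl mulr_suml.
  rewrite big_split /= exchange_big; congr (_ + _); apply: eq_bigr => t _.
  by rewrite mulr_sumr; apply: eq_bigr => w _; rewrite mulrA.
have vsz i j t : adm i j -> (vco (vs i j) t)%:Z = (t == i)%:Z + (t == j)%:Z.
  by move=> ad; rewrite vsE // PoszD.
have sz (i : 'I_N) (g : 'I_N -> int) : \sum_t (t == i)%:Z * g t = g i.
  by rewrite (bigD1 i) //= eqxx mul1r big1 ?addr0 // => t /negPf ->; rewrite mul0r.
have afz (C : {ffun VS s -> int}) (D : 'I_N -> {ffun VS s -> int}) i j w : adm i j -> afch C D (fun t => (vco (vs i j) t)%:Z) w = C w + D i w + D j w.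
  move=> ad; rewrite /afch -addrA; congr (_ + _).
  by under eq_bigr => t _ do rewrite vsz // mulrDl; rewrite big_split /= !sz.
case=> [[a aL]|[a [b [c [ab ac bc]]]]|[VS1 [v0 v0c]]].
- have ad t : adm a t by case: (eqVneq a t) => [<-|/adm_neq//]; apply: Ladm.
  have cp t : cpair a t by apply: cpair_loop; rewrite /cpair eqxx.
  (* With [2 e_a] available, a point [x] is [2 e_a] plus the sum of the [x_t (e_t - e_a)], because
     the [x_t] sum to 2. *)
  exists [set vs a t | t : 'I_N], (dl (vs a a)), (fun t => dl (vs a t) - dl (vs a a)); split.
  + by apply/fintype.subsetP => _ /imsetP [t _ ->]; rewrite in_cellset.
  + move=> w w' /imsetP [t _ ->].
    rewrite (afz _ _ _ _ _ (ad t)).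
    rewrite ?(ffaddE, ffoppE, ffzeroE, dlE).
    by case: (w' == vs a a); case: (w' == vs a t).
  + move=> w x we; have nw t : (w == vs a t) = false.
      by apply: contraNF we => /eqP ->; apply: imset_f.
    by apply: D0 => [|t]; rewrite ?(ffaddE, ffoppE, ffzeroE, dlE) !nw.
  + move=> x /affspan_sum sx.
    have key f : \sum_w afch (dl (vs a a)) (fun t => dl (vs a t) - dl (vs a a)) x w * f w
       = f (vs a a) + \sum_t x t * (f (vs a t) - f (vs a a)).
      rewrite lin dlt; congr (_ + _); apply: eq_bigr => t _; congr (_ * _).
      under eq_bigr => w _ do rewrite ffaddE ffoppE mulrBl.
      by rewrite sumrB !dlt.
    split=> [|r].
      have := key (fun=> 1); under eq_bigr => w _ do rewrite mulr1.
      by move=> ->; rewrite big1 ?addr0 // => t _; rewrite subrr mulr0.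
    rewrite key vsz //; under eq_bigr => t _ do rewrite !vsz // opprD addrACA subrr add0r mulrBr.
    rewrite sumrB -mulr_suml sx.
    under eq_bigr => t _ do rewrite eq_sym mulrC.
    by rewrite sz mulrDl !mul1r addrC subrK.
- have [ba ca] : a != b /\ a != c.
    by split; [move: ab|move: ac]; apply: contraNneq => <-.
  have cb : b != c by move: bc; apply: contraNneq => <-.
  (* The combination [(a+b) + (a+c) - (b+c)] replaces the missing point [2 e_a]. *)
  pose C : {ffun VS s -> int} := dl (vs a b) + dl (vs a c) - dl (vs b c).
  (* Each direction [e_t - e_a] is realised by points of the cell: through [b] when [t] is
     equivalent to [a], through [a] otherwise. *)
  pose D t : {ffun VS s -> int} := if E a t then dl (vs b t) - dl (vs b a) else dl (vs a t) - C.
  have Ebt t : E a t -> ~~ E b t.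
    by move=> at'; apply: contraNN ab => bt; apply: Etrans at' _; rewrite Esym.
  have neq i j : ~~ E i j -> i != j by apply: contraNneq => ->; rewrite Erefl.
  pose e := [set vs (if E a t then b else a) t | t : 'I_N] :|: [set vs b c].
  have ep (t : 'I_N) : ~~ E (if E a t then b else a) t.
    by case: (boolP (E a t)) => // /Ebt.
  have inc i j : ~~ E i j -> vs i j \in cellset.
    move=> h; rewrite in_cellset; first by rewrite /cpair (negPf (neq _ _ h)).
    exact/adm_neq/neq.
  have Da : D a = 0 by rewrite /D Erefl subrr.
  have Db : D b = dl (vs a b) - C by rewrite /D (negPf ab).
  have Dc : D c = dl (vs a c) - C by rewrite /D (negPf ac).
  have inab := inc _ _ ab; have inbc := inc _ _ bc; have inac := inc _ _ ac.
  have et t : vs (if E a t then b else a) t \in e.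
    by rewrite finset.in_setU; apply/orP; left; apply: imset_f.
  have eab : vs a b \in e by have := et b; rewrite (negPf ab).
  have eac : vs a c \in e by have := et c; rewrite (negPf ac).
  have eba : vs b a \in e by rewrite vs_sym.
  have ebc : vs b c \in e by rewrite finset.in_setU finset.in_set1 eqxx orbT.
  exists e, C, D; split.
  + apply/fintype.subsetP => w; rewrite finset.in_setU => /orP [/imsetP [t _ ->]|/finset.set1P -> //].
    exact: inc.
  + move=> w w'; rewrite finset.in_setU => /orP [/imsetP [t _ ->]|/finset.set1P ->].
      rewrite afz; last exact/adm_neq/neq.
      case: (boolP (E a t)) => at'.
        rewrite Db /D at' ?(ffaddE, ffoppE, ffzeroE, dlE) (vs_sym s_gt0 n_ge2 b a).
        by case: (w' == vs a b); case: (w' == vs a c); case: (w' == vs b c); case: (w' == vs b t).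
      rewrite Da {1}/D (negPf at') ?(ffaddE, ffoppE, ffzeroE, dlE).
      by case: (w' == vs a b); case: (w' == vs a c); case: (w' == vs b c); case: (w' == vs a t).
    rewrite afz; last exact: adm_neq.
    rewrite Db Dc ?(ffaddE, ffoppE, ffzeroE, dlE).
    by case: (w' == vs a b); case: (w' == vs a c); case: (w' == vs b c).
  + move=> w x we; have nw v : v \in e -> (w == v) = false.
      by move=> ve; apply: contraNF we => /eqP ->.
    have Cw : C w = 0 by rewrite ?(ffaddE, ffoppE, ffzeroE, dlE) !nw.
    apply: D0 => // t; rewrite /D; case: (boolP (E a t)) => at'.
      by have := et t; rewrite at' => h; rewrite ?(ffaddE, ffoppE, ffzeroE, dlE) !nw.
    have := et t; rewrite (negPf at') => h.
    by rewrite ffaddE ffoppE Cw subr0 dlE nw.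
  + move=> x /affspan_sum sx.
    have dC (f : VS s -> int) : \sum_w C w * f w = f (vs a b) + f (vs a c) - f (vs b c).
      under eq_bigr => w _ do rewrite !ffaddE ffoppE mulrBl mulrDl.
      by rewrite sumrB big_split /= !dlt.
    have dD t (f : VS s -> int) : \sum_w D t w * f w =
       if E a t then f (vs b t) - f (vs b a) else f (vs a t) - (f (vs a b) + f (vs a c) - f (vs b c)).
      rewrite /D; case: ifP => _.
        by under eq_bigr => w _ do rewrite ffaddE ffoppE mulrBl; rewrite sumrB !dlt.
      by under eq_bigr => w _ do rewrite ffaddE ffoppE mulrBl; rewrite sumrB !dlt dC.
    split=> [|r].
      have := lin C D x (fun=> 1); under eq_bigr => w _ do rewrite mulr1.
      move=> ->; rewrite dC addrK big1 ?addr0 // => t _; rewrite dD.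
      by case: ifP => _; rewrite ?addrK subrr mulr0.
    have nat' t : ~~ E a t -> adm a t by move=> h; apply/adm_neq/neq.
    rewrite lin dC !vsz ?adm_neq //.
    rewrite (eq_bigr (fun t => x t * (r == t)%:Z - x t * (r == a)%:Z)); last first.
      move=> t _; rewrite dD -mulrBr; congr (_ * _).
      case: (boolP (E a t)) => at'.
        rewrite !vsz; [|by rewrite adm_neq // eq_sym|exact/adm_neq/neq/Ebt].
        by rewrite opprD addrACA subrr add0r.
      rewrite !vsz ?nat' ?adm_neq //.
      by case: (r == a); case: (r == b); case: (r == c); case: (r == t).
    rewrite sumrB -mulr_suml sx.
    under eq_bigr => t _ do rewrite eq_sym mulrC.
    rewrite sz [X in _ = X + _](_ : _ = 2 * (r == a)%:Z); first by rewrite addrC subrK.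
    by case: (r == a); case: (r == b); case: (r == c).
exists cellset, (dl v0), (fun=> 0); split=> //.
- move=> w w' _; rewrite /afch big1 ?addr0; last by move=> t _; rewrite ffzeroE mulr0.
  by rewrite dlE (VS1 v0 w).
- by move=> w x; rewrite (VS1 w v0) v0c.
- move=> x [a [a1 ax]].
  have af w : afch (dl v0) (fun=> 0) x w = 1.
    rewrite /afch big1 ?addr0; last by move=> t _; rewrite ffzeroE mulr0.
    by rewrite dlE (VS1 w v0) eqxx.
  have sv (R : zmodType) (f : VS s -> R) : \sum_w f w = f v0.
    by rewrite (bigD1 v0) //= big1 ?addr0 // => w; rewrite (VS1 w v0) eqxx.
  rewrite sv af; split=> // t; rewrite sv af mul1r.
  by apply/eqP; rewrite -(eqr_int K) ax !sv; move: a1; rewrite sv => ->; rewrite mul1r.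
Qed.

End CellSets.
End Cells.

(** * Convex hulls of cells *)

Module CellHulls.
Import Blocks AffineCharts Cells.
Section CellHull.
Variables (N : nat) (s : 'I_N -> nat).
Hypotheses (s_gt0 : forall t, (0 < s t)%N) (n_ge2 : (2 <= \sum_(t < N) s t)%N).
Variable K : realType.
Notation vs := (vs s_gt0 n_ge2).
Notation adm := (adm s).

(** The weights sum to one because [x] and every point of [S] have coordinate sum 2. *)
Lemma hull_family (I : finType) (A : {set VS s}) (p : I -> K) (v : I -> VS s)
    (x : 'I_N -> K) :
  (forall i, 0 <= p i) -> (forall i, p i != 0 -> v i \in A) -> \sum_t x t = 2 ->
  (forall t, x t = \sum_i p i * (vco (v i) t)%:R) -> hull A x.
Proof.
move=> p0 pA sx hx; pose a w := \sum_(i | v i == w) p i.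
have key (f : VS s -> K) : \sum_w a w * f w = \sum_i p i * f (v i).
  rewrite [RHS](partition_big v xpredT) //=; apply: eq_bigr => w _.
  by rewrite mulr_suml; apply: eq_bigr => i /eqP ->.
exists a; split.
- by move=> w; apply: sumr_ge0.
- move=> w wA; rewrite /a big1 // => i /eqP vi; apply/eqP; apply: contraNT wA => /pA.
  by rewrite vi.
- have : \sum_i p i * 2 = 2.
    rewrite -[RHS]sx; under [RHS]eq_bigr => t _ do rewrite hx.
    rewrite exchange_big /=; apply: eq_bigr => i _.
    by rewrite -mulr_sumr -natr_sum vco_sum.
  have := key (fun=> 1); under eq_bigr => w _ do rewrite mulr1.
  move=> ->; rewrite -mulr_suml; under [in X in X -> _]eq_bigr => w _ do rewrite -[p w]mulr1.
  by move=> h; apply: (mulIf (x := 2)); rewrite ?pnatr_eq0 // mul1r.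
- by move=> t; rewrite hx -(key (fun w => (vco w t)%:R)).
Qed.

Variables (E : rel 'I_N) (Lp : {set 'I_N}).
Hypotheses (Erefl : reflexive E) (Esym : forall i j, E i j = E j i) (Etrans : transitive E)
  (Ladm : forall a, a \in Lp -> adm a a)
  (Lsing : forall a t, a \in Lp -> E a t -> t = a).

Notation cellset := (cellset s_gt0 n_ge2 E Lp).

Let inc i j : cpair E Lp i j -> vs i j \in cellset.
Proof. by move=> h; rewrite in_cellset //; apply: cpair_adm h. Qed.

Let sz (i : 'I_N) (g : 'I_N -> K) : \sum_t (t == i)%:R * g t = g i.
Proof. by rewrite (bigD1 i) //= eqxx mul1r big1 ?addr0 // => t /negPf ->; rewrite mul0r. Qed.

(* The classes are packed into three bins of mass at most 1; a point of the
   hypersimplex on three letters is then spread along the bins. *)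
Lemma cellset_hull (x : 'I_N -> K) : (forall t, 0 <= x t) -> \sum_t x t = 2 ->
  (forall i, i \notin Lp -> \sum_(j | E i j) x j <= 1) -> hull cellset x.
Proof.
move=> x0 sx cl.
(* A doubled block of mass above one can be combined with every block: the weight of [e_a + e_t] is
   [x_t], diminished by one when [t = a]. *)
have [/existsP [a /andP [aL xa]]|nbig] := boolP [exists a, (a \in Lp) && (1 < x a)].
  have cp t : cpair E Lp a t by apply: cpair_loop => //; rewrite /cpair eqxx.
  apply: (@hull_family _ _ (fun t => x t - (t == a)%:R) (fun t => vs a t)) => //.
  - by move=> t; case: eqVneq => [->|_]; rewrite ?subr0 // subr_ge0 ltW.
  - by move=> t _; apply: inc.
  - move=> t; rewrite (eq_bigr (fun r => (x r - (r == a)%:R) * (t == a)%:R + (r == t)%:R * (x r - (r == a)%:R))).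
      rewrite big_split /= -mulr_suml (sz t (fun r => x r - (r == a)%:R)) sumrB sx.
      have -> : \sum_(i : 'I_N) ((i == a)%:R : K) = 1.
        by rewrite -[RHS](sz a (fun=> 1)); apply: eq_bigr => i _; rewrite mulr1.
      by ring.
    move=> r _; rewrite vsE; last exact: (cpair_adm Ladm (cp r)).
    by rewrite natrD [r == t]eq_sym; ring.
have cl1 i : \sum_(j | E i j) x j <= 1.
  case: (boolP (i \in Lp)) => [iL|/cl //].
  rewrite (bigD1 i) ?Erefl //= big1 ?addr0 => [|j /andP [/(Lsing iL) -> /eqP //]].
  by move: nbig; rewrite negb_exists => /forallP /(_ i); rewrite iL -leNgt.
pose ok (B : {set 'I_N}) := [forall i, forall j, E i j ==> (i \in B) ==> (j \in B)] && (\sum_(j in B) x j <= 1).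
have ok0 : ok finset.set0.
  rewrite /ok big_set0 ler01 andbT; apply/forallP => i; apply/forallP => j.
  by rewrite finset.in_set0 implybT.
(* The first bin is a union of classes of mass at most one with the most elements, the second is one
   further class [T]. By maximality the two together exceed mass one, so the rest fits into a third
   bin. *)
have [B /andP [Bcl Bx] Bmax] := arg_maxnP (fun B : {set 'I_N} => #|B|) ok0.
have Bc i j : E i j -> i \in B -> j \in B.
  by move/forallP: Bcl => /(_ i) /forallP /(_ j) /implyP h /h /implyP.
have [t tB] : exists t, t \notin B.
  apply/existsP; apply: contraT; rewrite negb_exists => /forallP h.
  move: Bx; rewrite (eq_bigl xpredT) ?sx; first by rewrite leNgt ltr1n.
  by move=> j; have := h j; rewrite negbK => ->.
pose T : pred 'I_N := fun j => E t j.
have TB j : T j -> j \notin B.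
  by move=> tj; apply: contra tB; apply: Bc; rewrite Esym.
have nT j : j \in B -> T j = false by move=> jB; apply/negP => /TB; rewrite jB.
have B2 : 1 < \sum_(j | (j \in B) || T j) x j.
  rewrite ltNge; apply/negP => h.
  have okU : ok [set j | (j \in B) || T j].
    rewrite /ok; apply/andP; split.
      apply/forallP => i; apply/forallP => j; apply/implyP => ij; apply/implyP; rewrite !inE.
      by move=> /orP [/(Bc _ _ ij) ->//|ti]; rewrite /T (Etrans ti ij) orbT.
    by rewrite (eq_bigl (fun j => (j \in B) || T j)) // => j; rewrite inE.
  suff : (#|B| < #|[set j | (j \in B) || T j]|)%N by rewrite ltnNge => /negP; apply; exact: Bmax okU.
  apply: proper_card.
  apply/fintype.properP; split; first by apply/fintype.subsetP => j; rewrite inE => ->.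
  by exists t => //; rewrite inE /T Erefl orbT.
pose b1 j : K := if j \in B then x j else 0.
pose b2 j : K := if T j then x j else 0.
pose b3 j : K := if (j \in B) || T j then 0 else x j.
pose X1 := \sum_j b1 j; pose X2 := \sum_j b2 j; pose X3 := \sum_j b3 j.
have b1_0 j : 0 <= b1 j by rewrite /b1; case: ifP.
have b2_0 j : 0 <= b2 j by rewrite /b2; case: ifP.
have b3_0 j : 0 <= b3 j by rewrite /b3; case: ifP.
have bx j : b1 j + b2 j + b3 j = x j.
  rewrite /b1 /b2 /b3; case: (boolP (j \in B)) => jB /=.
    case: (boolP (T j)) => [/TB|_]; first by rewrite jB.
    by rewrite !addr0.
  by case: (T j); rewrite ?addr0 ?add0r.
have sX : X1 + X2 + X3 = 2 by rewrite -sx -!big_split /=; apply: eq_bigr => j _; exact: bx.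
have X1_0 : 0 <= X1 by apply: sumr_ge0.
have X2_0 : 0 <= X2 by apply: sumr_ge0.
have X3_0 : 0 <= X3 by apply: sumr_ge0.
have X1_1 : X1 <= 1 by rewrite /X1 /b1 -big_mkcond.
have X2_1 : X2 <= 1 by rewrite /X2 /b2 -big_mkcond; exact: cl1.
have X3_1 : X3 <= 1.
  have : 1 < X1 + X2.
    rewrite -big_split /=; apply: (lt_le_trans B2); rewrite [leLHS]big_mkcond /=.
    apply: ler_sum => j _; rewrite /b1 /b2; case: (boolP (j \in B)) => jB /=.
      by rewrite lerDl; case: ifP.
    by rewrite add0r.
  by move: sX; lra.
have z1 : X1 = 0 -> forall j, b1 j = 0 by move/psumr_eq0P => h j; apply: h.
have z2 : X2 = 0 -> forall j, b2 j = 0 by move/psumr_eq0P => h j; apply: h.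
have z3 : X3 = 0 -> forall j, b3 j = 0 by move/psumr_eq0P => h j; apply: h.
(* The masses of the three bins sum to 2; the pair of bins omitting bin [i] receives the weight
   [1 - Xi], spread as a product measure. If a bin is empty the other two have mass 1, and the
   identities [k1], [k2], [k3] still hold. *)
pose c3 := (1 - X3) / (X1 * X2); pose c2 := (1 - X2) / (X1 * X3); pose c1 := (1 - X1) / (X2 * X3).
pose p (q : 'I_N * 'I_N) := c3 * (b1 q.1 * b2 q.2) + c2 * (b1 q.1 * b3 q.2) + c1 * (b2 q.1 * b3 q.2).
have c_0 : [/\ 0 <= c1, 0 <= c2 & 0 <= c3].
  by split; apply: divr_ge0; rewrite ?subr_ge0 // mulr_ge0.
have [c1_0 c2_0 c3_0] := c_0.
have sup q : p q != 0 -> ~~ E q.1 q.2.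
  apply: contraNN => e; rewrite /p /b1 /b2 /b3.
  case: (boolP (q.1 \in B)) => h1.
    by rewrite (Bc _ _ e h1) !nT ?(Bc _ _ e h1) //= !mulr0 !addr0.
  case: (boolP (T q.1)) => h2; last by rewrite !mul0r !mulr0 !addr0.
  by rewrite (_ : T q.2) ?orbT ?mulr0 ?mul0r ?mulr0 ?addr0 //; apply: Etrans e.
have bil (u v : 'I_N -> K) r : \sum_(q : 'I_N * 'I_N) (u q.1 * v q.2) * ((r == q.1)%:R + (r == q.2)%:R)
   = u r * (\sum_j v j) + (\sum_j u j) * v r.
  rewrite -(pair_big xpredT xpredT (fun i j => u i * v j * ((r == i)%:R + (r == j)%:R))) /=.
  under eq_bigr => i _ do under eq_bigr => j _ do rewrite mulrDr.
  under eq_bigr => i _ do rewrite big_split /=.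
  rewrite big_split /=; congr (_ + _).
    rewrite -[RHS](sz r (fun i => u i * \sum_j v j)); apply: eq_bigr => i _.
    rewrite [in RHS]mulr_sumr mulr_sumr; apply: eq_bigr => j _; rewrite eq_sym mulrC.
    by [].
  rewrite mulr_suml; apply: eq_bigr => i _; rewrite -(sz r (fun j => u i * v j)).
  by apply: eq_bigr => j _; rewrite eq_sym mulrC.
apply: (@hull_family _ _ p (fun q => vs q.1 q.2)) => //.
- by move=> q; rewrite /p; apply: addr_ge0; [apply: addr_ge0|]; apply: mulr_ge0 => //; apply: mulr_ge0.
- move=> q /sup h; apply: inc; rewrite /cpair ifF //.
  by apply: contraNF h => /eqP ->; rewrite Erefl.
move=> r.
transitivity (c3 * (b1 r * X2 + X1 * b2 r) + c2 * (b1 r * X3 + X1 * b3 r) + c1 * (b2 r * X3 + X2 * b3 r)); last first.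
  rewrite /X1 /X2 /X3 -!bil !mulr_sumr -!big_split /=; apply: eq_bigr => q _.
  have [p0|pn0] := eqVneq (p q) 0; last first.
    rewrite vsE; last by apply/adm_neq; apply: contraNneq (sup _ pn0) => ->; rewrite Erefl.
    by rewrite natrD /p; ring.
  rewrite p0 mul0r -[RHS](mul0r ((r == q.1)%:R + (r == q.2)%:R)) -p0 /p.
  by ring.
rewrite -[LHS]bx.
have k3 : c3 * X1 * X2 = 1 - X3.
  have [h1|h1] := eqVneq X1 0; first by rewrite h1 mulr0 mul0r; move: sX X2_1 X3_1; lra.
  have [h2|h2] := eqVneq X2 0; first by rewrite h2 mulr0; move: sX X1_1 X3_1; lra.
  by rewrite /c3 -mulrA mulfVK // mulf_neq0.
have k2 : c2 * X1 * X3 = 1 - X2.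
  have [h1|h1] := eqVneq X1 0; first by rewrite h1 mulr0 mul0r; move: sX X2_1 X3_1; lra.
  have [h2|h2] := eqVneq X3 0; first by rewrite h2 mulr0; move: sX X1_1 X2_1; lra.
  by rewrite /c2 -mulrA mulfVK // mulf_neq0.
have k1 : c1 * X2 * X3 = 1 - X1.
  have [h1|h1] := eqVneq X2 0; first by rewrite h1 mulr0 mul0r; move: sX X1_1 X3_1; lra.
  have [h2|h2] := eqVneq X3 0; first by rewrite h2 mulr0; move: sX X1_1 X2_1; lra.
  by rewrite /c1 -mulrA mulfVK // mulf_neq0.
have e1 : b1 r * (c3 * X2 + c2 * X3) = b1 r.
  have [h1|h1] := eqVneq X1 0; first by rewrite z1 // mul0r.
  rewrite -[RHS]mulr1; congr (_ * _); apply: (mulfI h1); rewrite mulrDr mulrCA mulrA k3.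
  by rewrite mulrCA mulrA k2; move: sX; lra.
have e2 : b2 r * (c3 * X1 + c1 * X3) = b2 r.
  have [h1|h1] := eqVneq X2 0; first by rewrite z2 // mul0r.
  rewrite -[RHS]mulr1; congr (_ * _); apply: (mulfI h1); rewrite mulrDr mulrC k3.
  by rewrite mulrCA mulrA k1; move: sX; lra.
have e3 : b3 r * (c2 * X1 + c1 * X2) = b3 r.
  have [h1|h1] := eqVneq X3 0; first by rewrite z3 // mul0r.
  rewrite -[RHS]mulr1; congr (_ * _); apply: (mulfI h1); rewrite mulrDr mulrC k2.
  by rewrite mulrC k1; move: sX; lra.
by rewrite -[in LHS]e1 -[in LHS]e2 -[in LHS]e3; ring.
Qed.

End CellHull.
End CellHulls.

(** * Closures for pointwise convergence *)

Module PointwiseClosure.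
Import Blocks AffineCharts Cells.
Import numFieldTopology.Exports.

Section PointwiseClosure.
Variables (I : finType) (K : realType).

Lemma near_pointwise (v : {ptws I -> K}) (e : K) : 0 < e ->
  nbhs v (fun w : {ptws I -> K} => forall i, `|v i - w i| < e).
Proof.
move=> e0; apply: (@filter_forall {ptws I -> K} I (fun i (w : {ptws I -> K}) => `|v i - w i| < e) (nbhs v) _) => i.
have /(_ (fun z => `|v i - z| < e)) := @proj_continuous I (fun=> K) i v.
by apply; exists e.
Qed.

(** As the index set is finite, a pointwise neighbourhood is controlled by one uniform bound. *)
Lemma closure_pointwise (A : set {ptws I -> K}) (v : {ptws I -> K}) :
  closure A v <-> forall e : K, 0 < e -> exists2 w, A w & forall i, `|v i - w i| < e.
Proof.
split=> [cl e e0|H].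
  by have [w [Aw h]] := cl _ (near_pointwise v e0); exists w.
pose F : set_system {ptws I -> K} := fun B =>
  exists2 e : K, 0 < e & forall w, (forall i, `|v i - w i| < e) -> B w.
have FF : Filter F.
  split.
  - by exists 1.
  - move=> P Q [e e0 eP] [f f0 fQ]; exists (Num.min e f); first by rewrite lt_min e0.
    by move=> w h; split; [apply: eP|apply: fQ] => i; have := h i; rewrite lt_min => /andP [].
  - by move=> P Q PQ [e e0 eP]; exists e => // w /eP /PQ.
have Fv : (F --> (v : {ptws I -> K}))%classic.
  have upd (i : I) (y : K) : (if i == i then y else v i) = y by rewrite eqxx.
  apply/cvg_sup => i; apply/cvg_image.
    rewrite eqEsubset; split=> y // _; exists (fun j => if j == i then y else v j) => //.
  move=> Q [e /= e0 eQ]; exists (fun w : {ptws I -> K} => Q (w i)).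
    exists e => // w h; apply: eQ; exact: h.
  rewrite eqEsubset; split=> [y [w Qw <-] //|y Qy].
  exists (fun j => if j == i then y else v j); last exact: upd.
  by rewrite /= eqxx.
move=> B /Fv [e e0 eB]; have [w Aw h] := H e e0.
by exists w; split=> //; exact: eB.
Qed.

Lemma closure_linear_ge0 (A : set {ptws I -> K}) (m : I -> K) :
  (forall u, A u -> 0 <= \sum_i m i * u i) ->
  forall u, closure A u -> 0 <= \sum_i m i * u i.
Proof.
move=> H u cu; rewrite leNgt; apply/negP => lt0.
pose M := 1 + \sum_i `|m i|.
have M0 : 0 < M by rewrite ltr_wpDr ?sumr_ge0.
pose e := - (\sum_i m i * u i) / M.
have e0 : 0 < e by rewrite divr_gt0 ?oppr_gt0.
have /closure_pointwise /(_ e e0) [w Aw h] := cu.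
have := H w Aw; apply/negP; rewrite -ltNge.
have -> : \sum_i m i * w i = \sum_i m i * u i + \sum_i m i * (w i - u i).
  by rewrite -big_split /=; apply: eq_bigr => i _; rewrite -mulrDr addrC subrK.
have : \sum_i m i * (w i - u i) <= \sum_i `|m i| * e.
  apply: ler_sum => i _; apply: le_trans (ler_norm _) _; rewrite normrM ler_wpM2l //.
  by rewrite distrC ltW.
rewrite -mulr_suml => h2.
have h3 : (\sum_i `|m i|) * e < - \sum_i m i * u i.
  have : M * e = - \sum_i m i * u i by rewrite /e mulrC divfK // gt_eqF.
  by move=> <-; rewrite /M mulrDl mul1r ltrDr.
by rewrite -ltrBrDl sub0r; apply: le_lt_trans h2 h3.
Qed.

End PointwiseClosure.
End PointwiseClosure.

Module PavingQuads.
Import Blocks AffineCharts Cells CellHulls PointwiseClosure.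
Import numFieldTopology.Exports.

(** * Pavings *)

Lemma item_sum N (i j : 'I_N) (I : {set 'I_N}) :
  (\sum_(t in I) sval (item i j) t = (i \in I) + (j \in I))%N.
Proof.
under eq_bigr => t _ do rewrite itemE.
have e (k : 'I_N) : (\sum_(t in I) (t == k) = (k \in I))%N.
  case: (boolP (k \in I)) => h; last by rewrite big1 // => t; case: eqVneq => // -> /(negP h).
  by rewrite (bigD1 k) //= eqxx big1 // => t /andP [_ /negPf ->].
by rewrite big_split /= !e.
Qed.

(** The booleans record which of four blocks lie in a set, and [n] is the lower bound for that set.
    A bound respected by the midpoint of two points but violated by one of them must separate the
    two pairs of blocks completely. *)
Lemma bad_pair (x1 x2 x3 x4 : bool) n : ((x1 + x2 < n) \/ (x3 + x4 < n))%N ->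
  (2 * n <= x1 + x2 + (x3 + x4))%N -> [/\ x2 = x1, x3 = ~~ x1, x4 = ~~ x1 & (0 < n)%N].
Proof. by case: x1; case: x2; case: x3; case: x4 => /= h k; split=> //; lia. Qed.

(** Two crossing separations of four blocks contradict supermodularity: the union of the two sets
    contains three of the blocks and the intersection one, which bounds the right-hand side by 1. *)
Lemma bad_pairs (x y : bool) n1 n2 n3 n4 : (0 < n1)%N -> (0 < n2)%N ->
  (2 * n4 <= (x && y) + (x && ~~ y) + ((~~ x && y) + (~~ x && ~~ y)))%N ->
  (2 * n3 <= (x || y) + (x || ~~ y) + ((~~ x || y) + (~~ x || ~~ y)))%N ->
  (n1 + n2 <= n3 + n4)%N -> False.
Proof. by case: x; case: y => /=; lia. Qed.

Section Pavings.
Variables (N : nat) (s : 'I_N -> nat).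
Hypotheses (s_gt0 : forall t, (0 < s t)%N) (n_ge2 : (2 <= \sum_(t < N) s t)%N).
Variable K : realType.
Notation vs := (vs s_gt0 n_ge2).
Notation adm := (adm s).

Lemma vs_sum i j (f : 'I_N -> K) : adm i j ->
  \sum_t f t * (vco (vs i j) t)%:R = f i + f j.
Proof.
move=> ad; have sz (k : 'I_N) : \sum_t f t * (t == k)%:R = f k.
  by rewrite (bigD1 k) //= eqxx mulr1 big1 ?addr0 // => t /negPf ->; rewrite mulr0.
by under eq_bigr => t _ do rewrite vsE // natrD mulrDr; rewrite big_split /= !sz.
Qed.

Lemma affine_vs (l : VS s -> K) : is_affine l ->
  exists (c : K) (a : 'I_N -> K), forall i j, adm i j -> l (vs i j) = c + (a i + a j).
Proof. by move=> [c [a h]]; exists c, a => i j ad; rewrite h vs_sum. Qed.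

Lemma affine_quad (l : VS s -> K) a b c d : is_affine l ->
  adm a b -> adm c d -> adm a c -> adm b d ->
  l (vs a b) + l (vs c d) = l (vs a c) + l (vs b d).
Proof.
move=> /affine_vs [k [f h]] h1 h2 h3 h4; rewrite !h //.
by ring.
Qed.

Lemma affineB (l l' : VS s -> K) : is_affine l -> is_affine l' ->
  is_affine (fun v => l v - l' v).
Proof.
move=> [c [a h]] [c' [a' h']]; exists (c - c'), (fun t => a t - a' t) => v.
rewrite h h'; under [in RHS]eq_bigr => t _ do rewrite mulrBl.
by rewrite sumrB; ring.
Qed.

Section Quads.
Variables (P : {set {set VS s}}) (hP : paving K P).

(** The midpoint of [ab] and [cd] is also that of [ac] and [bd]. A cell containing it contains one
    of the two pairs of points: otherwise its defining bounds would separate the four blocks in two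
    crossing ways, which [bad_pairs] excludes. *)
Lemma paving_quad a b c d : adm a b -> adm c d -> adm a c -> adm b d ->
  exists2 A, A \in P & (vs a b \in A /\ vs c d \in A) \/ (vs a c \in A /\ vs b d \in A).
Proof.
move=> hab hcd hac hbd.
pose x (t : 'I_N) : K := ((vco (vs a b) t)%:R + (vco (vs c d) t)%:R) / 2.
have hx : hull [set: VS s] x.
  apply: (@hull_family _ _ _ bool _ (fun=> 2^-1) (fun b0 : bool => if b0 then vs a b else vs c d)).
  - by move=> _; rewrite invr_ge0 ler0n.
  - by move=> i _; rewrite finset.in_setT.
  - rewrite -mulr_suml big_split /= -!natr_sum !vco_sum; by field.
  - by move=> t; rewrite /x big_bool /=; ring.
have [P1 [P2 P3] _] := hP.
have [A AP hA] : exists2 A, A \in P & hull A x by apply/P2.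
have [[d' [d0 dT dS Ae]] _] := P1 A AP.
exists A => //.
have inA i j : adm i j -> vs i j \in A = [forall I : {set 'I_N}, (d' I <= (i \in I) + (j \in I))%N].
  move=> ad; rewrite -(mem_imset _ _ val_inj) -[val]/sval Ae inE -[sval (vs i j)]/(val (vs i j)) vs_val //.
  by apply: eq_forallb => I; rewrite item_sum.
have dle I : (2 * d' I <= (a \in I) + (b \in I) + ((c \in I) + (d \in I)))%N.
  have [w [w0 wA w1 wx]] := hA.
  have : (d' I)%:R <= \sum_(t in I) x t.
    under eq_bigr => t _ do rewrite wx.
    rewrite exchange_big /= (_ : (d' I)%:R = \sum_v w v * (d' I)%:R); last by rewrite -mulr_suml w1 mul1r.
    apply: ler_sum => v _.
    rewrite -mulr_sumr; have [vA|/wA ->] := boolP (v \in A); last by rewrite !mul0r.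
    apply: ler_wpM2l => //; rewrite -natr_sum ler_nat.
    have : sval v \in (sval @: A) by apply: imset_f.
    by rewrite Ae inE => /forallP /(_ I).
  have -> : \sum_(t in I) x t = ((a \in I) + (b \in I) + ((c \in I) + (d \in I)))%:R / 2.
    rewrite -mulr_suml big_split /= natrD; congr ((_ + _) / _); rewrite -natr_sum; congr (_%:R).
      rewrite -item_sum; apply: eq_bigr => t _.
      by rewrite -(vs_val s_gt0 n_ge2 hab).
    rewrite -item_sum; apply: eq_bigr => t _.
    by rewrite -(vs_val s_gt0 n_ge2 hcd).
  by rewrite ler_pdivlMr ?ltr0n // -natrM ler_nat mulnC.
case: (boolP ((vs a b \in A) && (vs c d \in A))) => [/andP|]; first by left.
case: (boolP ((vs a c \in A) && (vs b d \in A))) => [/andP|]; first by right.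
rewrite !negb_and !inA // !negb_forall => bad2 bad1.
have [I1 h1] : exists I : {set 'I_N}, ((a \in I) + (b \in I) < d' I)%N \/ ((c \in I) + (d \in I) < d' I)%N.
  by move/orP: bad1 => [] /existsP [I]; rewrite -ltnNge => h; exists I; [left|right].
have [I2 h2] : exists I : {set 'I_N}, ((a \in I) + (c \in I) < d' I)%N \/ ((b \in I) + (d \in I) < d' I)%N.
  by move/orP: bad2 => [] /existsP [I]; rewrite -ltnNge => h; exists I; [left|right].
have [b1 c1 d1 n1] := bad_pair h1 (dle I1).
have dle2 : (2 * d' I2 <= (a \in I2) + (c \in I2) + ((b \in I2) + (d \in I2)))%N.
  by have := dle I2; rewrite addnACA.
have [c2 b2 d2 n2] := bad_pair h2 dle2.
exfalso; have := dS I1 I2; have := dle (I1 :|: I2); have := dle (I1 :&: I2).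
rewrite !finset.in_setU !finset.in_setI b1 c1 d1 c2 b2 d2.
move=> k1 k2 k3; exact: bad_pairs n1 n2 k1 k2 k3.
Qed.

Section Cone.
Variables (u : VS s -> K) (hu : cone P u).

(** The tropical Pluecker relation: the affine minorant of the cell found by [paving_quad] is exact
    on one of the first two pairings and has the same sum on all three. *)
Lemma cone_quad_min a b c d : adm a b -> adm c d -> adm a c -> adm b d -> adm a d -> adm b c ->
  u (vs a b) + u (vs c d) <= u (vs a d) + u (vs b c) \/
  u (vs a c) + u (vs b d) <= u (vs a d) + u (vs b c).
Proof.
move=> h1 h2 h3 h4 h5 h6; have [A AP h] := paving_quad h1 h2 h3 h4.
have [l [laff lu lA]] := hu AP.
have e1 : l (vs a b) + l (vs c d) = l (vs a d) + l (vs b c).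
  by have [k [g hl]] := affine_vs laff; rewrite !hl //; ring.
have e2 := affine_quad laff h1 h2 h3 h4.
case: h => -[]; rewrite !lA => /eqP ha /eqP hb; [left|right].
  by rewrite -ha -hb e1 lerD.
by rewrite -ha -hb -e2 e1 lerD.
Qed.

(** The comparison depends on the paving only: the smaller pairing has both its points in a common
    cell, on which every height of the cone coincides with an affine minorant. *)
Lemma cone_quad_sign (u' : VS s -> K) a b c d : cone P u' ->
  adm a b -> adm c d -> adm a c -> adm b d ->
  u (vs a c) + u (vs b d) <= u (vs a b) + u (vs c d) ->
  u' (vs a c) + u' (vs b d) <= u' (vs a b) + u' (vs c d).
Proof.
move=> hu' h1 h2 h3 h4 le; have [A AP h] := paving_quad h1 h2 h3 h4.
have [l [laff lu lA]] := hu AP.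
have [l' [laff' lu' lA']] := hu' _ AP.
have e := affine_quad laff h1 h2 h3 h4; have e' := affine_quad laff' h1 h2 h3 h4.
have [ha hb] : vs a c \in A /\ vs b d \in A.
  case: h => // -[]; rewrite !lA => /eqP ha /eqP hb.
  have := lu (vs a c); have := lu (vs b d); move: le; rewrite -ha -hb => k1 k2 k3.
  by split; apply/eqP/le_anti; rewrite ?lu /=; lra.
move: ha hb; rewrite !lA' => /eqP <- /eqP <-; rewrite -e'.
by apply: lerD.
Qed.

Lemma adm_ex1 t : exists j, adm t j.
Proof.
have [/existsP [j jt]|h] := boolP [exists j, j != t].
  by exists j; apply: adm_neq; rewrite eq_sym.
have al j : j = t by move: h; rewrite negb_exists => /forallP /(_ j); rewrite negbK => /eqP.
by have [[i j] /=] := adm_ex s_gt0 n_ge2; rewrite (al i) (al j); exists t.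
Qed.

(** Subtracting the affine minorant of [A] leaves a nonnegative function with zero set [A] that
    still obeys the tropical relation. The pairs of positive value, together with the diagonal, form
    the equivalence relation. *)
Lemma paving_cellset A : A \in P ->
  exists (E : rel 'I_N) (Lp : {set 'I_N}),
  [/\ [/\ reflexive E, forall i j, E i j = E j i & transitive E],
      forall a, a \in Lp -> adm a a, forall a t, a \in Lp -> E a t -> t = a,
      A = cellset s_gt0 n_ge2 E Lp & cfull s_gt0 n_ge2 E Lp].
Proof.
move=> AP; have [l [laff lu lA]] := hu AP.
have [P1 _ _] := hP; have [_ Adim] := P1 A AP.
pose f v := u v - l v.
have f0 v : 0 <= f v by rewrite subr_ge0.
have fA v : (v \in A) = (f v == 0) by rewrite lA subr_eq0 eq_sym.
have fq a b c d : adm a b -> adm c d -> adm a c -> adm b d -> adm a d -> adm b c ->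
  f (vs a b) + f (vs c d) <= f (vs a d) + f (vs b c) \/
  f (vs a c) + f (vs b d) <= f (vs a d) + f (vs b c).
  move=> h1 h2 h3 h4 h5 h6; have := cone_quad_min h1 h2 h3 h4 h5 h6.
  have [k [g hl]] := affine_vs laff; rewrite /f !hl //.
  by case=> h; [left|right]; first [clear -h; lra|lra].
(* A block that never occurs in [A] would make its coordinate vanish on [A], hence on [S] by
   equality of dimensions. The partner found here is what proves transitivity. *)
have cov t : exists2 j, adm t j & f (vs t j) = 0.
  apply: contrapT => H.
  have [j0 ad0] := adm_ex1 t.
  have := @adim1_functional _ _ K A 0 (fun r => (r == t)%:R) Adim.
  have h0 : forall v, v \in A -> 0 + \sum_t0 (t0 == t)%:R * (vco v t0)%:R = 0 :> K.
    move=> v vA; rewrite add0r big1 // => r _; case: eqVneq => [->|]; last by rewrite mul0r.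
    rewrite mul1r; have [i [j [ad e]]] := vsP s_gt0 n_ge2 v.
    rewrite e vsE //; case: (eqVneq t i) => [ti|_].
      by case: H; exists j; rewrite ti //; apply/eqP; rewrite -fA -e.
    case: (eqVneq t j) => [tj|_] //.
    by case: H; exists i; rewrite tj 1?adm_sym // vs_sym; apply/eqP; rewrite -fA -e.
  move=> /(_ h0 (vs t j0)); rewrite add0r vs_sum // eqxx => /eqP.
  by rewrite -natrD pnatr_eq0.
pose E : rel 'I_N := fun i j => (i == j) || (0 < f (vs i j)).
pose Lp : {set 'I_N} := [set a | adm a a && (f (vs a a) == 0)].
have Esym i j : E i j = E j i by rewrite /E eq_sym vs_sym.
have Epos i j : E i j -> i != j -> 0 < f (vs i j) by rewrite /E => /orP [/eqP ->|//]; rewrite eqxx.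
have Etr : transitive E.
  move=> j i k; rewrite {1 2}/E; case: (eqVneq i j) => [->|ij /=]; first by [].
  case: (eqVneq j k) => [<- h _|jk /= hij hjk]; first by rewrite /E h orbT.
  rewrite /E; case: eqVneq => //= ik; rewrite lt_def f0 andbT; apply/eqP => fik.
  have [l' ad fl] := cov j.
  have il : i != l' by apply: contraTneq hij => ->; rewrite vs_sym fl ltxx.
  have lk : l' != k by apply: contraTneq hjk => <-; rewrite fl ltxx.
  have [h|h] := fq i j l' k (adm_neq _ ij) (adm_neq _ lk) (adm_neq _ il) (adm_neq _ jk) (adm_neq _ ik) ad.
    by have := f0 (vs l' k); move: h hij; rewrite fik fl; first [clear; lra|lra].
  by have := f0 (vs i l'); move: h hjk; rewrite fik fl; first [clear; lra|lra].
have Lsing a t : a \in Lp -> E a t -> t = a.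
  rewrite inE => /andP [aa /eqP faa] hE; apply/eqP; apply: contraT => ta.
  have := Epos _ _ hE; rewrite eq_sym ta => /(_ isT) hf.
  have [l' ad fl] := cov t.
  have al : a != l' by apply: contraTneq hf => ->; rewrite vs_sym fl ltxx.
  have at' : a != t by rewrite eq_sym.
  have la : l' != a by rewrite eq_sym.
  have [h|h] := fq a t l' a (adm_neq _ at') (adm_neq _ la) (adm_neq _ al) (adm_neq _ ta) aa ad.
    by have := f0 (vs l' a); move: h hf; rewrite faa fl; first [clear; lra|lra].
  by have := f0 (vs a l'); move: h hf; rewrite faa fl vs_sym; have := f0 (vs t a); rewrite [vs t a]vs_sym; first [clear; lra|lra].
have Ladm a : a \in Lp -> adm a a by rewrite inE => /andP [].
have Ac : A = cellset s_gt0 n_ge2 E Lp.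
  apply/setP => v; have [i [j [ad ->]]] := vsP s_gt0 n_ge2 v.
  rewrite in_cellset // fA /cpair; case: (eqVneq i j) => [ij|ij].
    by rewrite -ij in ad *; rewrite inE ad.
  by rewrite /E (negPf ij) /= -leNgt eq_le f0 andbT.
exists E, Lp; split=> //; first by split=> // i; rewrite /E eqxx.
have [/existsP [a aL]|nL] := boolP [exists a, a \in Lp]; first by apply: Or31; exists a.
have nL' a : a \notin Lp by move: nL; rewrite negb_exists => /forallP.
have [[a [b [c h3]]]|n3] := pselect (exists a b c, [/\ ~~ E a b, ~~ E a c & ~~ E b c]).
  by apply: Or32; exists a, b, c.
(* With no doubled block and no three classes, the class of [t0] has mass one on [A], hence on all
   of [S], and this leaves room for a single point only. *)
apply: Or33; have [t0 _] : exists t0 : 'I_N, true by have [[i j] _] := adm_ex s_gt0 n_ge2; exists i.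
have [j0 adj fj] := cov t0.
have v0A : vs t0 j0 \in A by rewrite fA fj.
have ntj : ~~ E t0 j0.
  by move: v0A; rewrite Ac in_cellset // /cpair; case: eqVneq => // _; rewrite (negPf (nL' _)).
have := @adim1_functional _ _ K A (-1) (fun r => (E t0 r)%:R) Adim.
have h0 : forall v, v \in A -> -1 + \sum_t (E t0 t)%:R * (vco v t)%:R = 0 :> K.
  move=> v vA; have [i [j [ad e]]] := vsP s_gt0 n_ge2 v.
  rewrite e vs_sum //; move: vA; rewrite e Ac in_cellset // /cpair.
  case: eqVneq => [_ h|_ nij]; first by rewrite (negPf (nL' _)) in h.
  case: (boolP (E t0 i)) => hi; case: (boolP (E t0 j)) => hj; rewrite ?addr0 ?add0r ?addNr //.
    by case/negP: nij; apply: Etr hj; rewrite Esym.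
  by case: n3; exists t0, i, j.
move=> /(_ h0) Hf.
have Hv i j : adm i j -> E t0 i = ~~ E t0 j.
  move=> ad; have := Hf (vs i j); rewrite vs_sum // => /eqP; rewrite addrC subr_eq0 -natrD -[1]/(1%:R) eqr_nat.
  by case: (E t0 i); case: (E t0 j).
have tj0 : t0 != j0 by apply: contraNneq ntj => <-; rewrite /E eqxx.
have only k : k = t0 \/ k = j0.
  case: (eqVneq k t0) => [->|kt]; first by left.
  case: (eqVneq k j0) => [->|kj]; first by right.
  have := Hv _ _ (adm_neq s kt); have := Hv _ _ (adm_neq s kj); rewrite (negPf ntj) /E eqxx /=.
  by move=> ->.
have only2 v : v = vs t0 j0.
  have [i [j [ad ->]]] := vsP s_gt0 n_ge2 v; have := Hv _ _ ad.
  case: (only i) => ->; case: (only j) => -> //; rewrite 1?vs_sym //.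
    by case: (E _ _).
  by case: (E _ _).
by split; [move=> v w; rewrite (only2 v) (only2 w)|exists (vs t0 j0); rewrite -Ac].
Qed.

Lemma paving_basis A : A \in P -> exists e b, affine_basis K A e /\ splitting e b.
Proof.
move=> /paving_cellset [E [Lp [[h1 h2 h3] h4 h5 -> h6]]].
have [e [C [D ch]]] := @cellset_chart _ _ s_gt0 n_ge2 K E Lp h1 h2 h3 h4 h5 h6.
exists e, (chart_split C D); split; first exact: chart_affine_basis ch.
exact: chart_splitting ch.
Qed.

End Cone.
End Quads.
End Pavings.
End PavingQuads.

(** * The ultrametric of a height function *)

Module HeightUltrametric.
Import Blocks AffineCharts Cells CellHulls PointwiseClosure PavingQuads.
Import numFieldTopology.Exports.

Section NormalForm.
Variables (N : nat) (s : 'I_N -> nat).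
Hypotheses (s_gt0 : forall t, (0 < s t)%N) (n_ge2 : (2 <= \sum_(t < N) s t)%N).
Variable K : realType.
Notation vs := (vs s_gt0 n_ge2).
Notation adm := (adm s).

(* An ultrametric measuring depths from a root on the branch of oo; U a a is the
   depth of the leaf a, when 2 e_a is a point of S. *)
Definition ultra (oo : 'I_N) (U : 'I_N -> 'I_N -> K) : Prop :=
  [/\ forall a b, U a b = U b a, forall a b, 0 <= U a b,
      forall a b c, U a b <= U a c \/ U b c <= U a c,
      forall a, a != oo -> U a oo = 0
    & (exists i j, [/\ i != oo, j != oo, adm i j & U i j = 0]) \/
      (forall i j, i != oo -> j != oo -> ~~ adm i j)].

Lemma cone_affine (P : {set {set VS s}}) (u l : VS s -> K) :
  cone P u -> is_affine l -> cone P (fun v => u v - l v).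
Proof.
move=> hu hl A /hu [l' [h1 h2 h3]]; exists (fun v => l' v - l v); split.
- exact: affineB.
- by move=> i; rewrite lerB.
- by move=> i; rewrite h3 -subr_eq0 -[RHS]subr_eq0 opprB addrA subrK.
Qed.

(** Subtracting an affine function keeps a height in the cone. Once the height vanishes on all
    [e_a + e_oo], the tropical relation on [a, b, c, oo] is the ultrametric inequality. *)
Lemma paving_ultra (P : {set {set VS s}}) : paving K P ->
  exists oo U, ultra oo U /\ exists2 u, cone P u & forall a b, adm a b -> u (vs a b) = U a b.
Proof.
move=> hP; have [_ _ [u hu]] := hP.
have [oo _] : exists oo : 'I_N, true by have [[i j] _] := adm_ex s_gt0 n_ge2; exists i.
have ado a : a != oo -> adm a oo by exact: adm_neq.
pose g t := if t == oo then 0 else u (vs t oo).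
pose l1 (v : VS s) : K := 0 + \sum_t g t * (vco v t)%:R.
have l1a : is_affine l1 by exists 0, g.
pose u1 v := u v - l1 v.
have hu1 : cone P u1 by apply: cone_affine.
have u1o a : a != oo -> u1 (vs a oo) = 0.
  by move=> h; rewrite /u1 /l1 add0r vs_sum ?ado // /g eqxx (negPf h) addr0 subrr.
pose off (p : 'I_N * 'I_N) := [&& p.1 != oo, p.2 != oo & adm p.1 p.2].
(* [k] is the least height of a pair avoiding [oo]; if no pair avoids [oo], it is chosen to bring
   the height of [2 e_oo] to zero. *)
have [k [hk1 hk2]] : exists k : K, (forall p, off p -> k <= u1 (vs p.1 p.2)) /\
    ((exists2 p, off p & u1 (vs p.1 p.2) = k) \/ ((forall p, ~~ off p) /\ k = - u1 (vs oo oo))).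
  have [/existsP [p0 hp0]|no] := boolP [exists p, off p].
    case: (arg_minP (fun p => u1 (vs p.1 p.2)) hp0) => p hp hmin.
    by exists (u1 (vs p.1 p.2)); split=> //; left; exists p.
  exists (- u1 (vs oo oo)); have h p : ~~ off p by move: no; rewrite negb_exists => /forallP.
  by split=> [p hp|]; [have := h p; rewrite hp|right].
(* This affine function is [k] on pairs avoiding [oo], zero on the [e_a + e_oo], and [- k] on
   [2 e_oo]. *)
pose l2 (v : VS s) : K := k + \sum_t (if t == oo then - k else 0) * (vco v t)%:R.
have l2a : is_affine l2 by exists k, (fun t => if t == oo then - k else 0).
pose u0 v := u1 v - l2 v.
have hu0 : cone P u0 by apply: cone_affine.
have u0o a : a != oo -> u0 (vs a oo) = 0.
  by move=> h; rewrite /u0 u1o // /l2 vs_sum ?ado // eqxx (negPf h); ring.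
have u0ab a b : a != oo -> b != oo -> adm a b -> u0 (vs a b) = u1 (vs a b) - k.
  by move=> h h' ad; rewrite /u0 /l2 vs_sum // (negPf h) (negPf h'); ring.
have u0oo : adm oo oo -> u0 (vs oo oo) = u1 (vs oo oo) + k.
  by move=> ad; rewrite /u0 /l2 vs_sum // eqxx; ring.
have u0_ge0 a b : adm a b -> 0 <= u0 (vs a b).
  move=> ad; case: (eqVneq a oo) => [ao|ao]; case: (eqVneq b oo) => [bo|bo].
  - rewrite ao bo in ad *; case: hk2 => [[[i j] /= /and3P [/= hi hj hij] e]|[_ e]].
      have hi' : adm oo i by rewrite adm_sym ado.
      have hj' : adm oo j by rewrite adm_sym ado.
      have := @cone_quad_min _ _ s_gt0 n_ge2 K P hP u0 hu0 oo i j oo hi' (ado _ hj) hj' (ado _ hi) ad hij.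
      rewrite (u0ab _ _ hi hj hij) e subrr (vs_sym _ _ oo i) (vs_sym _ _ oo j) (u0o _ hi) (u0o _ hj) !addr0.
      by case.
    by rewrite u0oo // e subrr.
  - by rewrite ao vs_sym u0o.
  - by rewrite bo u0o.
  - by rewrite u0ab // subr_ge0; apply: (hk1 (a, b)); rewrite /off ao bo.
(* Doubles of one-element blocks are not points of [S]; a common upper bound of the heights serves
   as their depth and keeps the ultrametric inequality. *)
pose big := \sum_(p : 'I_N * 'I_N | adm p.1 p.2) u0 (vs p.1 p.2).
have bigP a b : adm a b -> u0 (vs a b) <= big.
  move=> ad; rewrite /big (bigD1 (a, b)) //= lerDl; apply: sumr_ge0 => p /andP [h _].
  exact: u0_ge0.
have big0 : 0 <= big by apply: sumr_ge0 => p; apply: u0_ge0.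
pose U a b := if adm a b then u0 (vs a b) else big.
have UE a b : adm a b -> u0 (vs a b) = U a b by rewrite /U => ->.
have Uo a : a != oo -> U a oo = 0 by move=> h; rewrite -UE ?u0o // ado.
have Usym a b : U a b = U b a by rewrite /U adm_sym vs_sym.
have U0 a b : 0 <= U a b by rewrite /U; case: ifP => // /u0_ge0.
have Ubig a b : U a b <= big by rewrite /U; case: ifP => // /bigP.
exists oo, U; split; last by exists u0.
split=> //.
- move=> a b c; case: (boolP (adm a c)) => [ac|nac]; last by left; rewrite [U a c]/U (negPf nac).
  case: (boolP (adm a b)) => [ab|]; last by rewrite /adm negb_or negbK => /andP [/eqP <- _]; right.
  case: (boolP (adm b c)) => [bc|]; last by rewrite /adm negb_or negbK => /andP [/eqP <- _]; left.
  case: (eqVneq b oo) => [->|bo].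
    case: (eqVneq a oo) => [->|ao]; first by right.
    by left; rewrite Uo.
  case: (eqVneq a oo) => [->|ao]; first by left; rewrite Usym Uo.
  case: (eqVneq c oo) => [->|co]; first by right; rewrite Uo.
  have oc : adm oo c by rewrite adm_sym ado.
  have := @cone_quad_min _ _ s_gt0 n_ge2 K P hP u0 hu0 a b oo c ab oc (ado _ ao) bc ac (ado _ bo).
  rewrite (vs_sym _ _ oo c) !u0o // !UE // addr0 add0r.
  by rewrite addr0.
- case: hk2 => [[[i j] /= /and3P [/= hi hj hij] e]|[h _]].
    by left; exists i, j; split=> //; rewrite -UE // u0ab // e subrr.
  by right=> i j hi hj; apply: contra (h (i, j)) => hij; rewrite /off /= hi hj.
Qed.

End NormalForm.
End HeightUltrametric.

Module UltrametricTree.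
Import Blocks AffineCharts Cells CellHulls PointwiseClosure PavingQuads HeightUltrametric.
(** * The tree of an ultrametric *)

Local Opaque delta.

Ltac ffring := apply/ffunP => ?; rewrite ?(ffaddE, ffoppE, ffzeroE); ring.

Lemma sum_pick (I : finType) (Z : nmodType) (f : I -> Z) k : \sum_t f t *+ (t == k) = f k.
Proof. by rewrite (bigD1 k) //= eqxx mulr1n big1 ?addr0 // => t /negPf ->; rewrite mulr0n. Qed.

Section Tree.
Variables (N : nat) (s : 'I_N -> nat).
Hypotheses (s_gt0 : forall t, (0 < s t)%N) (n_ge2 : (2 <= \sum_(t < N) s t)%N).
Variable K : realType.
Notation vs := (vs s_gt0 n_ge2).
Notation adm := (adm s).
Variables (oo : 'I_N) (U : 'I_N -> 'I_N -> K).
Hypothesis hU : ultra s oo U.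

Let Usym a b : U a b = U b a. Proof. by case: hU. Qed.
Let U0 a b : 0 <= U a b. Proof. by case: hU. Qed.
Let U3 a b c : U a b <= U a c \/ U b c <= U a c. Proof. by case: hU. Qed.
Let Uo a : a != oo -> U a oo = 0. Proof. by case: hU => _ _ _ h _; apply: h. Qed.

Lemma ultra_ge r a b c : r <= U a b -> r <= U b c -> r <= U a c.
Proof. by move=> h1 h2; case: (U3 a b c); apply: le_trans. Qed.

Lemma ultra_diag a b : U a b <= U a a.
Proof. by apply: (@ultra_ge _ a b a) => //; rewrite Usym. Qed.

Definition ends (v : VS s) : 'I_N * 'I_N :=
  odflt (oo, oo) [pick p : 'I_N * 'I_N | adm p.1 p.2 && (v == vs p.1 p.2)].

Lemma endsP v : adm (ends v).1 (ends v).2 /\ v = vs (ends v).1 (ends v).2.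
Proof.
rewrite /ends; case: pickP => [p /andP [h /eqP e]|h] //=.
by have [i [j [ad e]]] := vsP s_gt0 n_ge2 v; have := h (i, j); rewrite /= ad e eqxx.
Qed.

Definition hgt (v : VS s) : K := U (ends v).1 (ends v).2.

(** For [v = e_a + e_b], the blocks lying below the vertex of the tree at which the branches of [a]
    and [b] part. *)
Definition ball (v : VS s) : {set 'I_N} := [set t | hgt v <= U (ends v).1 t].

Lemma ends_vs a b : adm a b ->
  (ends (vs a b)).1 = a /\ (ends (vs a b)).2 = b \/ (ends (vs a b)).1 = b /\ (ends (vs a b)).2 = a.
Proof.
move=> ad; have [ad' e] := endsP (vs a b).
by case: (vs_inj ad ad' e) => [[<- <-]|[<- <-]]; [left|right].
Qed.

Lemma hgt_vs a b : adm a b -> hgt (vs a b) = U a b.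
Proof. by move=> ad; rewrite /hgt; case: (ends_vs ad) => [[-> ->]|[-> ->]]. Qed.

Lemma in_ball_vs a b t : adm a b -> (t \in ball (vs a b)) = (U a b <= U a t).
Proof.
move=> ad; rewrite inE hgt_vs //; case: (ends_vs ad) => [[-> _]//|[-> _]].
by apply/idP/idP => h; [apply: ultra_ge h|apply: (@ultra_ge _ b a)]; rewrite // Usym.
Qed.

Lemma ball_ends v : (ends v).1 \in ball v /\ (ends v).2 \in ball v.
Proof. by rewrite !inE lexx ultra_diag. Qed.

Lemma mem_ball v x y : x \in ball v -> (y \in ball v) = (hgt v <= U x y).
Proof.
rewrite !inE => hx; apply/idP/idP => h; first by apply: ultra_ge h; rewrite Usym.
exact: ultra_ge h.
Qed.

Lemma hgt_ball v x y : x \in ball v -> y \in ball v -> hgt v <= U x y.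
Proof. by move=> hx; rewrite (mem_ball _ hx). Qed.

Definition verts : {set {set 'I_N}} := [set ball v | v : VS s].

Lemma vertsP C : reflect (exists v, C = ball v) (C \in verts).
Proof. by apply: (iffP imsetP) => [[v _ ->]|[v ->]]; exists v. Qed.

Lemma ball_sub v w x : x \in ball v -> x \in ball w -> hgt w <= hgt v -> ball v \subset ball w.
Proof.
move=> xv xw h; apply/fintype.subsetP => y; rewrite (mem_ball _ xv) (mem_ball _ xw).
exact: le_trans.
Qed.

(** Any point of an ultrametric ball may serve as its centre, so a common point reduces the question
    to comparing two heights. *)
Lemma laminar C D x : C \in verts -> D \in verts -> x \in C -> x \in D ->
  (C \subset D) || (D \subset C).
Proof.
move=> /vertsP [v ->] /vertsP [w ->] xv xw.
case: (leP (hgt w) (hgt v)) => h; first by rewrite (ball_sub xv xw).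
by rewrite (ball_sub xw xv) ?orbT // ltW.
Qed.

Lemma ball_subE C a b : C \in verts -> adm a b ->
  (ball (vs a b) \subset C) = (a \in C) && (b \in C).
Proof.
move=> /vertsP [w ->] ad.
have ha : a \in ball (vs a b) by rewrite in_ball_vs // ultra_diag.
have hb : b \in ball (vs a b) by rewrite in_ball_vs.
apply/idP/andP => [/fintype.subsetP h|[aw bw]]; first by split; apply: h.
by apply: (ball_sub ha aw); rewrite hgt_vs // hgt_ball.
Qed.

Lemma verts_nonempty C : C \in verts -> exists x, x \in C.
Proof. by move=> /vertsP [v ->]; exists (ends v).1; case: (ball_ends v). Qed.

Lemma vertsT : [set: 'I_N] \in verts.
Proof.
have [/existsP [a ao]|h] := boolP [exists a, a != oo].
  apply/vertsP; exists (vs a oo); apply/setP => t.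
  by rewrite in_ball_vs ?adm_neq // Uo // U0 finset.in_setT.
have al a : a = oo by move: h; rewrite negb_exists => /forallP /(_ a); rewrite negbK => /eqP.
apply/vertsP; exists (vs oo oo); apply/setP => t; rewrite finset.in_setT (al t).
rewrite in_ball_vs ?lexx //.
by have [[i j] /=] := adm_ex s_gt0 n_ge2; rewrite (al i) (al j).
Qed.

Definition par (C : {set 'I_N}) : {set 'I_N} :=
  [arg min_(D < [set: 'I_N] | (D \in verts) && (C \proper D)) #|D|].

Lemma parP C : C \in verts -> C != [set: 'I_N] ->
  [/\ par C \in verts, C \proper par C &
      forall D, D \in verts -> C \proper D -> par C \subset D].
Proof.
move=> CV CT; rewrite /par; case: arg_minnP => [|D /andP [DV CD] Dmin].
  by rewrite vertsT finset.properT.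
split=> // D' D'V CD'.
have [x xC] := verts_nonempty CV.
have := laminar DV D'V (fintype.subsetP (proper_sub CD) x xC) (fintype.subsetP (proper_sub CD') x xC).
case/orP => // sub; have := Dmin D'; rewrite D'V CD' => /(_ isT) le.
by have /eqP -> : D' == D; rewrite // finset.eqEcard sub le.
Qed.

Lemma telescope_par (Z : zmodType) (f : {set 'I_N} -> Z) C : C \in verts ->
  f C = f [set: 'I_N] + \sum_(D in verts | (C \subset D) && (D != [set: 'I_N])) (f D - f (par D)).
Proof.
have [n] := ubnP #|~: C|; elim: n C => // n IH C lt CV.
have [->|CT] := eqVneq C [set: 'I_N].
  by rewrite big_pred0 ?addr0 // => D; rewrite finset.subTset; case: eqVneq; rewrite ?andbF.
have [pV pC pmin] := parP CV CT.
rewrite (bigD1 C) /=; last by rewrite CV subxx.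
rewrite addrCA -[LHS](subrK (f (par C))); congr (_ + _).
rewrite (IH (par C)) //; last first.
  apply: leq_trans (_ : #|~: C| <= n)%N; last by rewrite -ltnS.
  by apply: proper_card; rewrite finset.properC.
congr (_ + _); apply: eq_bigl => D; case: (boolP (D \in verts)) => //= DV.
case: (D != [set: 'I_N]); rewrite ?andbF ?andbT //.
apply/idP/andP => [h|[h1 h2]]; last by apply: pmin; rewrite // finset.properEneq eq_sym h2.
have h' := fintype.proper_sub_trans pC h.
by move: h'; rewrite finset.properEneq eq_sym => /andP [-> ->].
Qed.

(** The value of the character [m] on the function that is 1 at the points whose ball lies in [C]
    and 0 elsewhere; by [cone_ray] such functions can be added to the height without leaving the
    cone. *)
Definition nbelow (C : {set 'I_N}) (m : {ffun VS s -> int}) : int :=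
  \sum_(v | ball v \subset C) m v.

Definition rep (C : {set 'I_N}) : VS s := odflt (vs oo oo) [pick v | ball v == C].

Lemma ball_rep C : C \in verts -> ball (rep C) = C.
Proof.
move=> /vertsP [v ->]; rewrite /rep; case: pickP => [w /eqP //|/(_ v)].
by rewrite eqxx.
Qed.

Lemma ball_verts v : ball v \in verts. Proof. by apply/vertsP; exists v. Qed.

(** Abel summation along the tree; the value at the root drops out because the coefficients of [m]
    sum to zero. *)
Lemma sum_char_tree (b : VS s -> {ffun VS s -> int}) (m : {ffun VS s -> int}) :
  \sum_v m v = 0 ->
  \sum_v b v *~ m v = \sum_v (b v - b (rep (ball v))) *~ m v
    + \sum_(C in verts | C != [set: 'I_N]) (b (rep C) - b (rep (par C))) *~ nbelow C m.
Proof.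
move=> m0; under [in RHS]eq_bigr => v _ do rewrite mulrzBl.
rewrite sumrB; set Z := (X in _ - _ + X); suff -> : \sum_v b (rep (ball v)) *~ m v = Z by rewrite subrK.
rewrite (eq_bigr (fun v => b (rep [set: 'I_N]) *~ m v + \sum_(D in verts | (ball v \subset D) && (D != [set: 'I_N]))
   (b (rep D) - b (rep (par D))) *~ m v)); last first.
  by move=> v _; rewrite (telescope_par (fun C => b (rep C)) (ball_verts v)) mulrzDl mulrz_suml.
rewrite big_split /= -mulrz_sumr m0 mulr0z add0r.
rewrite /Z (exchange_big_dep (fun D => (D \in verts) && (D != [set: 'I_N]))) /=.
  apply: eq_bigr => D /andP [DV DT]; rewrite /nbelow mulrz_sumr; apply: eq_bigl => v.
  by rewrite DV DT andbT.
by move=> v D _ /and3P [-> _ ->].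
Qed.

(** The cross ratio of four blocks, written additively as a character of the torus. *)
Definition cr (q : 'I_N * 'I_N * ('I_N * 'I_N)) : {ffun VS s -> int} :=
  delta (vs q.1.1 q.1.2) + delta (vs q.2.1 q.2.2) - delta (vs q.1.1 q.2.1) - delta (vs q.1.2 q.2.2).

Definition cr_adm (q : 'I_N * 'I_N * ('I_N * 'I_N)) : bool :=
  [&& adm q.1.1 q.1.2, adm q.2.1 q.2.2, adm q.1.1 q.2.1 & adm q.1.2 q.2.2].

Definition cr_pos (q : 'I_N * 'I_N * ('I_N * 'I_N)) : bool :=
  cr_adm q && (U q.1.1 q.2.1 + U q.1.2 q.2.2 <= U q.1.1 q.1.2 + U q.2.1 q.2.2).

Definition crspan (m : {ffun VS s -> int}) : Prop :=
  exists2 L, all cr_pos L & m = \sum_(q <- L) cr q.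

Lemma crspan0 : crspan 0.
Proof. by exists [::]; rewrite ?big_nil. Qed.

Lemma crspanD m m' : crspan m -> crspan m' -> crspan (m + m').
Proof.
by move=> [L hL ->] [L' hL' ->]; exists (L ++ L'); rewrite ?all_cat ?hL ?big_cat.
Qed.

Lemma crspan_cr q : cr_pos q -> crspan (cr q).
Proof. by move=> h; exists [:: q]; rewrite /= ?h // big_seq1. Qed.

Lemma crspanMn m n : crspan m -> crspan (m *+ n).
Proof. by move=> h; elim: n => [|n IH]; [exact: crspan0|rewrite mulrS; apply: crspanD]. Qed.

Lemma crspan_sum (I : eqType) (r : seq I) (Q : pred I) (F : I -> {ffun VS s -> int}) :
  (forall i, Q i -> crspan (F i)) -> crspan (\sum_(i <- r | Q i) F i).
Proof. by move=> h; apply: big_ind => //; [exact: crspan0|exact: crspanD]. Qed.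

(* The class of [i, j] relative to oo: delta v is [v] plus an affine function of v. *)
Let br (i j : 'I_N) : {ffun VS s -> int} :=
  delta (vs i j) - delta (vs i oo) - delta (vs j oo).

Let br_sym i j : br i j = br j i.
Proof.
rewrite /br (vs_sym s_gt0 n_ge2 i j); move: (delta (vs i oo)) (delta (vs j oo)) (delta _) => x y z.
by ffring.
Qed.

Let brB a b c : a != oo -> b != oo -> c != oo -> adm a b -> adm a c -> U a c <= U a b ->
  crspan (br a b - br a c).
Proof.
move=> ao bo co ab ac le.
have -> : br a b - br a c = cr ((a, b), (c, oo)).
  rewrite /cr /br /=.
  move: (delta (vs a b)) (delta (vs a oo)) (delta (vs b oo)) (delta (vs a c)) (delta (vs c oo)) => x y z t w.
  by ffring.
apply: crspan_cr; rewrite /cr_pos /cr_adm /= ab ac !adm_neq //= [U b oo]Uo // [U c oo]Uo //.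
by rewrite !addr0.
Qed.

(** The ends are replaced one at a time. One of [c], [d] has exactly the depth [U c d] with [a], and
    using it for the intermediate pair makes both comparisons go the right way. *)
Lemma crspan_br a b c d : a != oo -> b != oo -> c != oo -> d != oo -> adm a b -> adm c d ->
  U c d <= U a c -> U c d <= U a d -> U c d <= U b c -> U c d <= U b d -> U c d <= U a b ->
  crspan (br a b - br c d).
Proof.
have trans x y z : crspan (x - y) -> crspan (y - z) -> crspan (x - z).
  by move=> h h'; have := crspanD h h'; rewrite addrA subrK.
have half a1 b1 c1 d1 : a1 != oo -> b1 != oo -> c1 != oo -> d1 != oo -> adm a1 b1 -> adm c1 d1 ->
    U c1 d1 <= U a1 b1 -> U a1 c1 = U c1 d1 -> a1 != c1 -> crspan (br a1 b1 - br c1 d1).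
  move=> ao bo co do_ ab cd hab hac ne; apply: (trans _ (br a1 c1)).
    by apply: brB => //; [exact: adm_neq|rewrite hac].
  rewrite br_sym; apply: brB; rewrite // 1?adm_sym ?adm_neq // 1?eq_sym //.
  by rewrite (Usym c1 a1) hac.
move=> ao bo co do_ ab cd hac had hbc hbd hab.
have [ac|ac] := eqVneq a c; first by subst c; apply: brB.
have [ad|ad] := eqVneq a d.
  by subst d; rewrite (br_sym c a); apply: brB; rewrite // 1?adm_sym // Usym.
case: (U3 c a d) => h.
  by apply: half => //; apply/le_anti; rewrite hac Usym h.
rewrite (br_sym c d); apply: half; rewrite // 1?adm_sym // (Usym d c) //.
by apply/le_anti; rewrite had h.
Qed.

(* The affine functions subtracted are normalised at a pair (i0, j0) of height 0, if any. *)
Definition aff_const : {ffun VS s -> int} :=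
  if [pick p : 'I_N * 'I_N | [&& p.1 != oo, p.2 != oo, adm p.1 p.2 & U p.1 p.2 == 0]] is Some p
  then br p.1 p.2 else - delta (vs oo oo).

Definition aff_lin (t : 'I_N) : {ffun VS s -> int} :=
  if t == oo then - aff_const else delta (vs t oo).

(** A correction of [delta v] by a term affine in [v], which a character trivial on affine functions
    does not see; it is arranged to vanish at the points [e_i + e_oo] with [i] different from
    [oo]. *)
Definition beta (v : VS s) : {ffun VS s -> int} :=
  delta v - (aff_const + \sum_t aff_lin t *+ vco v t).

Lemma beta_vs i j : adm i j -> beta (vs i j) = delta (vs i j) - (aff_const + (aff_lin i + aff_lin j)).
Proof.
move=> ad; rewrite /beta; congr (_ - (_ + _)).
under eq_bigr => t _ do rewrite vsE // mulrnDr.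
by rewrite big_split /= (sum_pick aff_lin i) (sum_pick aff_lin j).
Qed.

Lemma beta_oo i : i != oo -> beta (vs i oo) = 0.
Proof.
move=> io; rewrite beta_vs ?adm_neq // /aff_lin eqxx (negPf io).
by move: (delta _) aff_const => x y; ffring.
Qed.

Lemma sum_beta (m : {ffun VS s -> int}) : charA m -> \sum_v beta v *~ m v = m.
Proof.
move=> [m0 m1]; have e : \sum_v delta v *~ m v = m.
  apply/ffunP => w; rewrite sum_ffunE (bigD1 w) //= big1 ?addr0 => [|v vw].
    by rewrite ffunMzE deltaE eqxx mulrzz mul1r.
  by rewrite ffunMzE deltaE eq_sym (negPf vw) mul0rz.
rewrite /beta; under eq_bigr => v _ do rewrite mulrzBl mulrzDl mulrz_suml.
rewrite sumrB e big_split /= -mulrz_sumr m0 mulr0z add0r exchange_big /= big1 ?subr0 // => t _.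
by under eq_bigr => v _ do rewrite pmulrn -mulrzA mulrC; rewrite -mulrz_sumr m1 mulr0z.
Qed.

Let beta_off i j a b : i != oo -> j != oo -> a != oo -> b != oo -> adm a b -> aff_const = br i j ->
  beta (vs a b) = br a b - br i j.
Proof.
move=> io jo ao bo ab e; rewrite beta_vs // /aff_lin (negPf ao) (negPf bo) e.
rewrite [br a b]/br; move: (br i j) (delta (vs a b)) (delta (vs a oo)) (delta (vs b oo)) => x y z t.
by ffring.
Qed.

Let beta_oooo : adm oo oo -> beta (vs oo oo) = delta (vs oo oo) + aff_const.
Proof.
move=> ad; rewrite beta_vs // /aff_lin eqxx; move: aff_const (delta _) => x y.
by ffring.
Qed.

Let norm_pair :
  (exists i j, [/\ i != oo, j != oo, adm i j, U i j = 0 & aff_const = br i j]) \/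
  ((forall i j, i != oo -> j != oo -> ~~ adm i j) /\ aff_const = - delta (vs oo oo)).
Proof.
rewrite /aff_const; case: pickP => [[i j] /= /and4P [io jo ij /eqP u]|h].
  by left; exists i, j.
right; split=> //; case: hU => _ _ _ _ [[i [j [io jo ij u]]]|//].
by have := h (i, j); rewrite /= io jo ij u eqxx.
Qed.

Let crspan_beta_pos a b : adm a b -> crspan (beta (vs a b)).
Proof.
move=> ab; have [ao|ao] := eqVneq a oo; last first.
  have [->|bo] := eqVneq b oo; first by rewrite beta_oo //; exact: crspan0.
  case: norm_pair => [[i [j [io jo ij u e]]]|[h _]]; last by have := h a b ao bo; rewrite ab.
  by rewrite (beta_off io jo) //; apply: crspan_br; rewrite // u.
subst a; have [bo|bo] := eqVneq b oo; last by rewrite vs_sym beta_oo //; exact: crspan0.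
subst b; rewrite beta_oooo //; case: norm_pair => [[i [j [io jo ij u e]]]|[_ ->]]; last first.
  by rewrite subrr; exact: crspan0.
rewrite e (_ : _ + _ = cr ((oo, oo), (i, j))).
  apply: crspan_cr; rewrite /cr_pos /cr_adm /= ab ij ![adm oo _]adm_sym !adm_neq //=.
  by rewrite (Usym oo i) (Usym oo j) (Uo io) (Uo jo) u !addr0 ?U0.
rewrite /cr /br /= (vs_sym _ _ oo i) (vs_sym _ _ oo j).
move: (delta (vs oo oo)) (delta (vs i j)) (delta (vs i oo)) (delta (vs j oo)) => x y z t.
by ffring.
Qed.

Let crspan_beta_neg a b : adm a b -> U a b = 0 -> crspan (- beta (vs a b)).
Proof.
move=> ab u0; have [ao|ao] := eqVneq a oo; last first.
  have [->|bo] := eqVneq b oo; first by rewrite beta_oo // oppr0; exact: crspan0.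
  case: norm_pair => [[i [j [io jo ij u e]]]|[h _]]; last by have := h a b ao bo; rewrite ab.
  by rewrite (beta_off io jo) // opprB; apply: crspan_br; rewrite // u0.
subst a; have [bo|bo] := eqVneq b oo; last by rewrite vs_sym beta_oo // oppr0; exact: crspan0.
subst b; rewrite beta_oooo //; case: norm_pair => [[i [j [io jo ij u e]]]|[_ ->]]; last first.
  by rewrite subrr oppr0; exact: crspan0.
rewrite e (_ : - _ = cr ((oo, i), (oo, j))).
  apply: crspan_cr; rewrite /cr_pos /cr_adm /= ab ij ![adm oo _]adm_sym !adm_neq //=.
  by rewrite (Usym oo i) (Usym oo j) (Uo io) (Uo jo) u u0 !addr0.
rewrite /cr /br /= (vs_sym _ _ oo i) (vs_sym _ _ oo j).
move: (delta (vs oo oo)) (delta (vs i j)) (delta (vs i oo)) (delta (vs j oo)) => x y z t.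
by ffring.
Qed.

(** Moving inward in the tree costs only nonnegative cross ratios. An outer ball of positive height
    that contains [oo] is reduced to [oo], and then the two characters coincide. *)
Lemma crspan_betaB v w : ball v \subset ball w -> crspan (beta v - beta w).
Proof.
have [abv ev] := endsP v; have [abw ew] := endsP w.
move: (ends v).1 (ends v).2 (ends w).1 (ends w).2 abv ev abw ew => a b c d ab -> cd -> {v w}.
rewrite ball_subE ?ball_verts // => /andP [ha hb].
have [u0|un0] := eqVneq (U c d) 0.
  by apply: crspanD; [exact: crspan_beta_pos|exact: crspan_beta_neg].
have cin : c \in ball (vs c d) by rewrite in_ball_vs // ultra_diag.
have din : d \in ball (vs c d) by rewrite in_ball_vs.
have hh x y : x \in ball (vs c d) -> y \in ball (vs c d) -> U c d <= U x y.
  by move=> hx hy; rewrite -hgt_vs // hgt_ball.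
have Upos : 0 < U c d by rewrite lt_def un0 U0.
have all_oo x : oo \in ball (vs c d) -> x \in ball (vs c d) -> x = oo.
  move=> h hx; apply/eqP; apply: contraT => xo; have := hh _ _ hx h.
  by rewrite Uo // leNgt Upos.
have [oin|nin] := boolP (oo \in ball (vs c d)).
  have -> : a = oo by apply: all_oo. have -> : b = oo by apply: all_oo.
  have -> : c = oo by apply: all_oo. have -> : d = oo by apply: all_oo.
  by move: (beta _) => x; rewrite subrr; exact: crspan0.
have noo x : x \in ball (vs c d) -> x != oo by apply: contraTneq => ->.
case: norm_pair => [[i [j [io jo ij u e]]]|[h _]]; last first.
  by have := h c d (noo _ cin) (noo _ din); rewrite cd.
rewrite !(beta_off io jo) ?noo // (_ : _ - _ = br a b - br c d); last first.
  by move: (br a b) (br i j) (br c d) => x y z; ffring.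
by apply: crspan_br; rewrite ?noo // hh.
Qed.

(** In the decomposition of [sum_char_tree], the first terms compare two points with the same ball
    and may be taken with either sign; the others pass from a ball to its parent, and there the
    coefficient [nbelow] must be nonnegative. The generation is over the integers, not merely over
    the rationals. *)
Lemma crspan_char m : charA m ->
  (forall C, C \in verts -> C != [set: 'I_N] -> 0 <= nbelow C m) -> crspan m.
Proof.
move=> hm hn; rewrite -[m](sum_beta hm) sum_char_tree; last by case: hm.
have mulz (x : {ffun VS s -> int}) (n : int) : 0 <= n -> crspan x -> crspan (x *~ n).
  by case: n => // n _ hx; rewrite -pmulrn; exact: crspanMn.
apply: crspanD.
  apply: (@crspan_sum _ _ _ (fun v => (beta v - beta (rep (ball v))) *~ m v)) => v _.
  have br_ := ball_rep (ball_verts v).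
  have [n0|n0] := leP 0 (m v).
    by apply: mulz => //; apply: crspan_betaB; rewrite br_.
  rewrite -[m v]opprK mulrNz -mulNrz opprB; apply: mulz; first by rewrite oppr_ge0 ltW.
  by apply: crspan_betaB; rewrite br_.
apply: (@crspan_sum _ _ _ (fun C => (beta (rep C) - beta (rep (par C))) *~ nbelow C m)) => C /andP [CV CT].
have [pV pC _] := parP CV CT.
by apply: mulz; [exact: hn|apply: crspan_betaB; rewrite !ball_rep // proper_sub].
Qed.

End Tree.
End UltrametricTree.

(** * Dual cones generated by cross ratios *)

Module DualCones.
Import Blocks AffineCharts Cells CellHulls PointwiseClosure PavingQuads HeightUltrametric UltrametricTree.
Import numFieldTopology.Exports.
Local Opaque delta.

Section DualCone.
Variables (N : nat) (s : 'I_N -> nat).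
Hypotheses (s_gt0 : forall t, (0 < s t)%N) (n_ge2 : (2 <= \sum_(t < N) s t)%N).
Variable K : realType.
Notation vs := (vs s_gt0 n_ge2).
Notation adm := (adm s).
Notation cr := (cr s_gt0 n_ge2).

Definition pairing (m : {ffun VS s -> int}) (u : VS s -> K) : K := \sum_v (m v)%:~R * u v.

Lemma pairingD m m' u : pairing (m + m') u = pairing m u + pairing m' u.
Proof.
by rewrite /pairing -big_split; apply: eq_bigr => v _; rewrite ffaddE intrD mulrDl.
Qed.

Lemma pairingN m u : pairing (- m) u = - pairing m u.
Proof.
by rewrite /pairing -sumrN; apply: eq_bigr => v _; rewrite ffoppE rmorphN mulNr.
Qed.

Lemma pairing0 u : pairing 0 u = 0.
Proof. by rewrite /pairing big1 // => v _; rewrite ffzeroE mul0r. Qed.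

Lemma pairing_delta v u : pairing (delta v) u = u v.
Proof.
rewrite /pairing (bigD1 v) //= deltaE eqxx mul1r big1 ?addr0 // => w /negPf h.
by rewrite deltaE h mul0r.
Qed.

Lemma pairing_comb m u u' (r : K) : pairing m (fun v => u v + r * u' v) = pairing m u + r * pairing m u'.
Proof.
rewrite /pairing mulr_sumr -big_split; apply: eq_bigr => v _ /=.
by rewrite mulrDr mulrCA.
Qed.

Lemma charA0 : charA (0 : {ffun VS s -> int}).
Proof. by split=> [|t]; rewrite big1 // => v _; rewrite ffzeroE ?mul0r. Qed.

Lemma charAD (m m' : {ffun VS s -> int}) : charA m -> charA m' -> charA (m + m').
Proof.
move=> [h1 h2] [h3 h4]; split=> [|t].
  by under eq_bigr => v _ do rewrite ffaddE; rewrite big_split /= h1 h3.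
by under eq_bigr => v _ do rewrite ffaddE mulrDl; rewrite big_split /= h2 h4.
Qed.

Lemma charAN (m : {ffun VS s -> int}) : charA m -> charA (- m).
Proof.
move=> [h1 h2]; split=> [|t].
  by under eq_bigr => v _ do rewrite ffoppE; rewrite sumrN h1 oppr0.
by under eq_bigr => v _ do rewrite ffoppE mulNr; rewrite sumrN h2 oppr0.
Qed.

Lemma crE a b c d : cr ((a, b), (c, d)) =
  delta (vs a b) + delta (vs c d) - delta (vs a c) - delta (vs b d).
Proof. by []. Qed.

Lemma pairing_cr a b c d u :
  pairing (cr ((a, b), (c, d))) u = u (vs a b) + u (vs c d) - u (vs a c) - u (vs b d).
Proof.
rewrite crE -(pairing_delta (vs a b)) -(pairing_delta (vs c d)) -(pairing_delta (vs a c)).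
rewrite -(pairing_delta (vs b d)).
move: (delta (vs a b)) (delta (vs c d)) (delta (vs a c)) (delta (vs b d)) => x y z w.
by rewrite !pairingD !pairingN.
Qed.

Lemma charA_cr q : cr_adm s q -> charA (cr q).
Proof.
case: q => [[a b] [c d]] /and4P [/= ab cd ac bd].
have D v (f : VS s -> int) : \sum_w delta v w * f w = f v.
  rewrite (bigD1 v) //= deltaE eqxx mul1r big1 ?addr0 // => w /negPf nw.
  by rewrite deltaE nw mul0r.
have key (f : VS s -> int) : \sum_v cr ((a, b), (c, d)) v * f v =
    f (vs a b) + f (vs c d) - f (vs a c) - f (vs b d).
  rewrite crE -(D (vs a b)) -(D (vs c d)) -(D (vs a c)) -(D (vs b d)).
  move: (delta (vs a b)) (delta (vs c d)) (delta (vs a c)) (delta (vs b d)) => x y z w.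
  under eq_bigr => v _ do rewrite !ffaddE !ffoppE !mulrDl !mulNr.
  by rewrite !big_split /= !sumrN.
split=> [|t].
  under eq_bigr => v _ do rewrite -[cr _ v]mulr1.
  by rewrite (key (fun=> 1)).
rewrite (key (fun v => (vco v t)%:Z)) !vsE // !PoszD.
by move: (nat_of_bool _) (nat_of_bool _) (nat_of_bool _) (nat_of_bool _) => x y z w; ring.
Qed.

Section WithPaving.
Variables (P : {set {set VS s}}) (hP : paving K P).

Lemma dualconeI m : charA m -> (forall u, cone P u -> 0 <= pairing m u) -> dualcone K P m.
Proof.
move=> hm h; split=> // u; exact: (@closure_linear_ge0 _ K (cone P) (fun v => (m v)%:~R) h u).
Qed.

Lemma dualconeE m u : dualcone K P m -> cone P u -> 0 <= pairing m u.
Proof. by move=> [_ h] hu; apply: h; exact: subset_closure. Qed.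

Lemma dualcone0 : dualcone K P 0.
Proof. by apply: dualconeI => [|u _]; [exact: charA0|rewrite pairing0]. Qed.

Lemma dualconeD m m' : dualcone K P m -> dualcone K P m' -> dualcone K P (m + m').
Proof.
move=> h h'; apply: dualconeI => [|u hu]; first by apply: charAD; [case: h|case: h'].
by rewrite pairingD addr_ge0 ?dualconeE.
Qed.

(** The affine part of the splitting, paired with [u], agrees with [l] on [e], hence at every point,
    since [e] generates the lattice of the affine span. *)
Lemma splitting_pairing A e b : affine_basis K A e -> splitting e b ->
  forall (u l : VS s -> K), is_affine l -> (forall w, w \in e -> u w = l w) ->
  forall v, pairing (b v) u = u v - l v.
Proof.
move=> [_ _ eb] [bA [c [d hd]] be] u l hl ul v.
pose l' (w : VS s) := pairing c u + \sum_t pairing (d t) u * (vco w t)%:R.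
have lin w : u w = pairing (b w) u + l' w.
  rewrite -[LHS]pairing_delta hd !pairingD; congr (_ + (_ + _)).
  rewrite /pairing; under eq_bigr => z _ do rewrite sum_ffunE rmorph_sum mulr_suml.
  rewrite exchange_big; apply: eq_bigr => t _ /=; rewrite mulr_suml; apply: eq_bigr => z _.
  by rewrite ffunMnE rmorphMn /= -mulr_natr mulrAC.
have l'e w : w \in e -> l' w = l w.
  by move=> we; rewrite -(ul w we) (lin w) be // pairing0 add0r.
have [c0 [a0 hl0]] := hl.
suff -> : l v = l' v by rewrite (lin v) addrK.
have [|x [x1 xt]] := eb (fun t => (vco v t)%:Z).
  exists (fun w => (w == v)%:R); split.
    by rewrite (bigD1 v) //= eqxx big1 ?addr0 // => w /negPf ->.
  move=> t; rewrite (bigD1 v) //= eqxx mul1r big1 ?addr0 // => w /negPf ->.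
  by rewrite mul0r.
have comb k (g : 'I_N -> K) : k + \sum_t g t * (vco v t)%:R =
    \sum_(w in e) (x w)%:~R * (k + \sum_t g t * (vco w t)%:R).
  under [RHS]eq_bigr => w _ do rewrite mulrDr mulr_sumr.
  rewrite big_split /= -mulr_suml -rmorph_sum x1 mul1r exchange_big /=; congr (_ + _).
  apply: eq_bigr => t _; rewrite -[(vco v t)%:R]/(((vco v t)%:Z)%:~R) xt rmorph_sum mulr_sumr.
  by apply: eq_bigr => w _; rewrite rmorphM /= mulrCA.
rewrite hl0 comb /l' [RHS]comb; apply: eq_bigr => w we.
by rewrite -hl0 -l'e.
Qed.

(** For [l] the affine minorant exact on [A], the character [b v] pairs with a height [u] to
    [u v - l v], which is nonnegative and vanishes for [v] in [A]. *)
Lemma dualcone_splitting A e b v : A \in P -> affine_basis K A e -> splitting e b ->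
  dualcone K P (b v) /\ (v \in A -> dualcone K P (- b v)).
Proof.
move=> AP hb hs; have bA : charA (b v) by case: hs.
have key u : cone P u -> exists l, [/\ is_affine l, forall i, l i <= u i,
    forall i, (i \in A) = (l i == u i) & pairing (b v) u = u v - l v].
  move=> hu; have [l [h1 h2 h3]] := hu A AP; exists l; split=> //.
  apply: (splitting_pairing hb hs h1) => w we.
  by have [/fintype.subsetP h _ _] := hb; have := h w we; rewrite h3 => /eqP ->.
split=> [|vA].
  by apply: dualconeI => // u /key [l [_ h _ ->]]; rewrite subr_ge0.
apply: dualconeI => [|u /key [l [_ _ h e']]]; first exact: charAN.
by rewrite pairingN e'; move: vA; rewrite h => /eqP ->; rewrite subrr oppr0.
Qed.

(** A bipolar theorem proved by hand: nonnegativity on the characters of the splittings yields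
    affine minorants of [u'] that are exact on each cell, though possibly elsewhere too. Adding a
    small multiple of a height of the paving restores strictness off the cell. *)
Lemma dual_closure (u' : VS s -> K) :
  (forall m, dualcone K P m -> 0 <= pairing m u') -> closure (cone P) u'.
Proof.
move=> H; have [_ _ [u0 hu0]] := hP.
have cc (r : K) : 0 < r -> cone P (fun v => u' v + r * u0 v).
  move=> r0 A AP; have [l [la lu lA]] := hu0 A AP.
  have [e [b [hb hs]]] := paving_basis s_gt0 n_ge2 hP hu0 AP.
  have bA v : charA (b v) by case: hs.
  have [_ [c [d hd]] be] := hs.
  pose l' (w : VS s) := pairing c u' + \sum_t pairing (d t) u' * (vco w t)%:R.
  have la' : is_affine l' by exists (pairing c u'), (fun t => pairing (d t) u').
  have lin w : u' w = pairing (b w) u' + l' w.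
    rewrite -[LHS]pairing_delta hd !pairingD; congr (_ + (_ + _)).
    rewrite /pairing; under eq_bigr => z _ do rewrite sum_ffunE rmorph_sum mulr_suml.
    rewrite exchange_big; apply: eq_bigr => t _ /=; rewrite mulr_suml; apply: eq_bigr => z _.
    by rewrite ffunMnE rmorphMn /= -mulr_natr mulrAC.
  have le' v : l' v <= u' v by rewrite (lin v) lerDr; apply: H; case: (dualcone_splitting v AP hb hs).
  have eq' v : v \in A -> l' v = u' v.
    move=> vA; have [h1 /(_ vA) h2] := dualcone_splitting v AP hb hs.
    rewrite (lin v); have := H _ h2; rewrite pairingN oppr_ge0 => h3.
    by have /eqP -> : pairing (b v) u' == 0; rewrite ?add0r // eq_le h3 H.
  exists (fun v => l' v + r * l v); split.
  - have [c1 [a1 h1]] := la'; have [c2 [a2 h2]] := la.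
    exists (c1 + r * c2), (fun t => a1 t + r * a2 t) => v; rewrite h1 h2 mulrDr mulr_sumr addrACA.
    by congr (_ + _); rewrite -big_split; apply: eq_bigr => t _ /=; rewrite mulrDl mulrA.
  - by move=> v; apply: lerD => //; rewrite ler_pM2l.
  - move=> v; apply/idP/eqP => [vA|h]; first by rewrite eq' //; move: vA; rewrite lA => /eqP ->.
    rewrite lA eq_le lu /= -(ler_pM2l r0); have := le' v; move: h; set x := r * l v; set y := r * u0 v.
    by lra.
apply/closure_pointwise => e e0.
pose M := 1 + \sum_v `|u0 v|.
have M0 : 0 < M by rewrite ltr_wpDr ?sumr_ge0.
exists (fun v => u' v + (e / M) * u0 v); first by apply: cc; rewrite divr_gt0.
move=> v; rewrite opprD addrA subrr add0r normrN normrM gtr0_norm ?divr_gt0 //.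
rewrite mulrAC ltr_pdivrMr // ltr_pM2l //; apply: le_lt_trans (_ : \sum_v `|u0 v| < _).
  by rewrite (bigD1 v) //= lerDl sumr_ge0.
by rewrite ltrDr.
Qed.

Section WithUltra.
Variables (oo : 'I_N) (U : 'I_N -> 'I_N -> K) (hU : ultra s oo U).
Variables (u0 : VS s -> K) (hu0 : cone P u0) (hUu : forall a b, adm a b -> u0 (vs a b) = U a b).

Lemma dualcone_cr q : cr_pos s U q -> dualcone K P (cr q).
Proof.
case: q => [[a b] [c d]] /andP [ad le].
have /and4P [/= ab cd ac bd] := ad.
apply: dualconeI => [|u hu]; first exact: charA_cr.
have := @cone_quad_sign _ _ s_gt0 n_ge2 K P hP u0 hu0 u a b c d hu ab cd ac bd.
by rewrite !hUu // => /(_ le); rewrite pairing_cr; lra.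
Qed.

Lemma dualcone_crspan m : crspan s_gt0 n_ge2 U m -> dualcone K P m.
Proof.
move=> [L hL ->]; elim: L hL => [|q L IH] /=; first by rewrite big_nil => *; exact: dualcone0.
by move=> /andP [h /IH h']; rewrite big_cons; apply: dualconeD => //; exact: dualcone_cr.
Qed.

Notation ball := (ball s_gt0 n_ge2 oo U).
Notation verts := (verts s_gt0 n_ge2 oo U).

(** The added function is the positive part of the affine function giving the mass on [C] minus one.
    No cell crosses the hyperplane where the latter vanishes, so the added function is affine on
    every cell. *)
Lemma cone_ray C (r : K) : C \in verts -> 0 <= r ->
  cone P (fun v => u0 v + r * (ball v \subset C)%:R).
Proof.
move=> CV r0 A AP; have [l [la lu lA]] := hu0 AP.
have Usym a b : U a b = U b a by case: hU.
have [w Cw] := vertsP s_gt0 n_ge2 oo U _ CV.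
have inC a b : a \in C -> b \in C -> hgt s_gt0 n_ge2 oo U w <= U a b.
  by rewrite Cw; exact: hgt_ball.
have outC a b : a \in C -> b \notin C -> U a b < hgt s_gt0 n_ge2 oo U w.
  by rewrite Cw => ha; rewrite (mem_ball hU _ ha) -ltNge.
have vC a b : adm a b -> \sum_t ((t \in C)%:R : K) * (vco (vs a b) t)%:R = (a \in C)%:R + (b \in C)%:R.
  by move=> ab; rewrite vs_sum.
(* If one cell contained [ab] inside [C] and [cd] outside, its minorant would make [ab + cd] at most
   as high as both crossing pairings. Crossing depths are below the height of [C], and the
   ultrametric inequality then makes one crossing pairing strictly lower. *)
have side : (forall v, v \in A -> (\sum_t ((t \in C)%:R : K) * (vco v t)%:R <= 1)) \/
    (forall v, v \in A -> (1 <= \sum_t ((t \in C)%:R : K) * (vco v t)%:R)).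
  apply: contrapT => /not_orP [/existsNP [v /not_implyP [vA hv]] /existsNP [z /not_implyP [zA hz]]].
  have [a [b [ab e1]]] := vsP s_gt0 n_ge2 v; have [c [d [cd e2]]] := vsP s_gt0 n_ge2 z.
  move: vA hv zA hz; rewrite e1 e2 !vC // => vA /negP; rewrite -ltNge => hv zA /negP; rewrite -ltNge => hz.
  have [aC bC] : a \in C /\ b \in C.
    by move: hv; case: (a \in C); case: (b \in C) => //=; rewrite ?addr0 ?add0r ?ltxx // ltr10.
  have [cC dC] : c \notin C /\ d \notin C.
    move: hz; case: (c \in C); case: (d \in C) => //=; rewrite ?addr0 ?add0r ?ltxx //.
    by rewrite -natrD ltrn1.
  have ne x y : x \in C -> y \notin C -> x != y by move=> hx hy; apply: contraNneq hy => <-.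
  have ac := adm_neq s (ne _ _ aC cC); have bd := adm_neq s (ne _ _ bC dC).
  have ad := adm_neq s (ne _ _ aC dC); have bc := adm_neq s (ne _ _ bC cC).
  have cb : adm c b by rewrite adm_sym.
  have l1 := affine_quad s_gt0 n_ge2 la ab cd ac bd.
  have dc : adm d c by rewrite adm_sym.
  have l2 := affine_quad s_gt0 n_ge2 la ab dc ad bc.
  move: vA zA; rewrite !lA => /eqP h1 /eqP h2.
  move: l1 l2; rewrite (vs_sym _ _ d c) h1 h2 => l1 l2.
  have k1 := inC _ _ aC bC; have k2 := outC _ _ aC cC; have k3 := outC _ _ bC dC.
  have k4 := outC _ _ aC dC; have k5 := outC _ _ bC cC.
  have j1 := lu (vs a c); have j2 := lu (vs b d); have j3 := lu (vs a d); have j4 := lu (vs b c).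
  move: l1 l2 j1 j2 j3 j4; rewrite !hUu // => l1 l2 j1 j2 j3 j4.
  have [_ _ U3 _ _] := hU.
  by have [h|h] := U3 c a d; move: h; rewrite ?(Usym c a) => h; first [clear -h l1 l2 j1 j2 j3 j4; lra|lra].
have rho v : 0 <= (ball v \subset C)%:R :> K /\
    \sum_t ((t \in C)%:R : K) * (vco v t)%:R - 1 <= (ball v \subset C)%:R.
  have [a [b [ab ->]]] := vsP s_gt0 n_ge2 v; rewrite ler0n vC // (ball_subE hU) //.
  by split=> //; case: (a \in C); case: (b \in C); rewrite /= ?addr0 ?add0r ?subrr ?sub0r ?lerN10 //; lra.
have rho1 v : (\sum_t ((t \in C)%:R : K) * (vco v t)%:R <= 1) -> (ball v \subset C)%:R = 0 :> K.
  have [a [b [ab ->]]] := vsP s_gt0 n_ge2 v; rewrite vC // (ball_subE hU) //.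
  by case: (a \in C); case: (b \in C) => //=; rewrite -natrD lern1.
have rho2 v : (1 <= \sum_t ((t \in C)%:R : K) * (vco v t)%:R) ->
    (ball v \subset C)%:R = \sum_t ((t \in C)%:R : K) * (vco v t)%:R - 1.
  have [a [b [ab ->]]] := vsP s_gt0 n_ge2 v; rewrite vC // (ball_subE hU) //.
  by case: (a \in C); case: (b \in C) => //=; rewrite ?addr0 ?add0r ?subrr ?addrK // ler10.
case: side => hs.
  exists l; split=> // v; first by apply: ler_wpDr => //; apply: mulr_ge0 => //; case: (rho v).
  apply/idP/eqP => [vA|e].
    by rewrite rho1 ?hs // mulr0 addr0; move: vA; rewrite lA => /eqP.
  rewrite lA eq_le lu /= e lerDl mulr_ge0 //; by case: (rho v).
exists (fun v => l v + r * (\sum_t ((t \in C)%:R : K) * (vco v t)%:R - 1)); split.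
- have [c1 [a1 h1]] := la; exists (c1 - r), (fun t => a1 t + r * (t \in C)%:R) => v.
  rewrite h1 mulrBr mulr1 mulr_sumr; under [in RHS]eq_bigr => t _ do rewrite mulrDl -mulrA.
  by rewrite big_split /=; ring.
- by move=> v; apply: lerD => //; apply: ler_wpM2l => //; case: (rho v).
- move=> v; apply/idP/eqP => [vA|e].
    by rewrite rho2 ?hs //; move: vA; rewrite lA => /eqP ->.
  rewrite lA eq_le lu /=; have [_ h] := rho v; have := ler_wpM2l r0 h; move: e.
  by set x := r * _; set y := r * _; lra.
Qed.

Lemma dualcone_nbelow m C : dualcone K P m -> C \in verts -> 0 <= nbelow s_gt0 n_ge2 oo U C m.
Proof.
move=> hm CV; rewrite leNgt; apply/negP => lt.
have en : pairing m (fun v => (ball v \subset C)%:R) = (nbelow s_gt0 n_ge2 oo U C m)%:~R.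
  rewrite /nbelow /pairing rmorph_sum [RHS]big_mkcond; apply: eq_bigr => v _.
  by case: ifP; rewrite ?mulr1 ?mulr0.
have p0 := dualconeE hm hu0.
(* A multiple exceeding the pairing with [u0] forces a negative value, the integer [nbelow] being at
   most -1. *)
have := dualconeE hm (cone_ray CV (r := 1 + pairing m u0) _); rewrite pairing_comb en.
have : (nbelow s_gt0 n_ge2 oo U C m)%:~R <= -1 :> K.
  rewrite -[-1]/((-1)%:~R) ler_int; lia.
move=> h1 h2; have := h2 (addr_ge0 ler01 p0); move: p0 h1; move: (pairing m u0) (_%:~R) => x y.
by nra.
Qed.

Lemma dualconeP m : dualcone K P m <-> crspan s_gt0 n_ge2 U m.
Proof.
split=> [h|]; last exact: dualcone_crspan.
apply: (crspan_char hU); first by case: h.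
by move=> C CV _; exact: dualcone_nbelow.
Qed.

End WithUltra.
End WithPaving.
End DualCone.
End DualCones.

(** * The paving of an ultrametric *)

Module UltrametricPavings.
Import Blocks AffineCharts Cells CellHulls PointwiseClosure PavingQuads HeightUltrametric UltrametricTree DualCones.
Import numFieldTopology.Exports.
Local Opaque delta.

Section Faces.
Variables (N : nat) (s : 'I_N -> nat) (K : realType) (P : {set {set VS s}}).

Lemma affine_comb (l : VS s -> K) : is_affine l ->
  exists (c : K) (a : 'I_N -> K), forall p : VS s -> K, \sum_v p v = 1 ->
    \sum_v p v * l v = c + \sum_t a t * (\sum_v p v * (vco v t)%:R).
Proof.
move=> [c [a h]]; exists c, a => p p1.
under eq_bigr => v _ do rewrite h mulrDr mulr_sumr.
rewrite big_split /= -mulr_suml p1 mul1r exchange_big /=; congr (_ + _).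
by apply: eq_bigr => t _; rewrite mulr_sumr; apply: eq_bigr => v _; rewrite mulrCA.
Qed.

(** On a convex combination of points, the affine minorant of a cell is at most the same combination
    of the heights, with equality exactly when it is supported on that cell. A nonempty intersection
    is thus the locus in the hull of [A] where the minorant of [B] minus that of [A] is maximal. *)
Lemma cone_faces (u : VS s -> K) : cone P u -> forall A B, A \in P -> B \in P ->
  is_face (fun x => hull A x /\ hull B x) (hull A : set ('I_N -> K)).
Proof.
move=> hu A B AP BP.
have [lA [/affine_comb [cA [aA hA]] uA eA]] := hu A AP.
have [lB [/affine_comb [cB [aB hB]] uB eB]] := hu B BP.
pose f a c (x : 'I_N -> K) := c + \sum_t a t * x t.
have key (C : {set VS s}) l a c (lu : forall i, l i <= u i) (le : forall i, (i \in C) = (l i == u i))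
    (hl : forall p : VS s -> K, \sum_v p v = 1 ->
       \sum_v p v * l v = c + \sum_t a t * (\sum_v p v * (vco v t)%:R)) :
    forall p x, (forall v, 0 <= p v) -> \sum_v p v = 1 ->
      (forall t, x t = \sum_v p v * (vco v t)%:R) ->
      [/\ f a c x <= \sum_v p v * u v, (forall v, v \notin C -> p v = 0) -> f a c x = \sum_v p v * u v
        & f a c x = \sum_v p v * u v -> forall v, v \notin C -> p v = 0].
  move=> p x p0 p1 px; have -> : f a c x = \sum_v p v * l v.
    by rewrite hl // /f; congr (_ + _); apply: eq_bigr => t _; rewrite px.
  split; first by apply: ler_sum => v _; apply: ler_wpM2l.
    move=> h; apply: eq_bigr => v _; have [|/h ->] := boolP (v \in C); last by rewrite !mul0r.
    by rewrite le => /eqP ->.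
  move=> /esym/eqP; rewrite -subr_eq0 -sumrB psumr_eq0 => [/allP h v vC|v _]; last first.
    by rewrite subr_ge0 ler_wpM2l.
  have := h v (mem_index_enum _); rewrite -mulrBr mulf_eq0 => /orP [/eqP //|].
  by rewrite subr_eq0 eq_sym -le (negPf vC).
have kA := key A lA aA cA uA eA hA; have kB := key B lB aB cB uB eB hB.
have leA x : hull A x -> f aB cB x <= f aA cA x /\ (f aB cB x = f aA cA x -> hull B x).
  move=> [p [p0 pA p1 px]]; have [_ /(_ pA) e _] := kA p x p0 p1 px.
  have [le _ e'] := kB p x p0 p1 px; rewrite e; split=> // /e' h; by exists p.
have eqAB x : hull A x -> hull B x -> f aB cB x = f aA cA x.
  move=> hxA [p [p0 pB p1 px]]; apply/eqP; rewrite eq_le (leA x hxA).1.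
  have [le _ _] := kA p x p0 p1 px; have [_ /(_ pB) -> _] := kB p x p0 p1 px; exact: le.
have [[y [yA yB]]|h] := pselect (exists y : 'I_N -> K, hull A y /\ hull B y); last first.
  by left=> x hx; apply: h; exists x.
right; exists (fun t => aB t - aA t) => x.
have dif z : \sum_t (aB t - aA t) * z t = f aB cB z - f aA cA z - (cB - cA).
  by under eq_bigr => t _ do rewrite mulrBl; rewrite sumrB /f; ring.
split=> [[xA xB]|[xA mx]]; split=> //.
  by move=> z zA; rewrite !dif lerD2r (eqAB x) // subrr subr_le0; case: (leA z zA).
have [le e] := leA x xA; apply: e; apply/eqP; rewrite eq_le le -subr_ge0 /=.
by have := mx y yA; rewrite !dif lerD2r (eqAB y) // subrr.
Qed.

End Faces.

Section UltraPaving.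
Variables (N : nat) (s : 'I_N -> nat).
Hypotheses (s_gt0 : forall t, (0 < s t)%N) (n_ge2 : (2 <= \sum_(t < N) s t)%N).
Variable K : realType.
Notation vs := (vs s_gt0 n_ge2).
Notation adm := (adm s).
Variables (oo : 'I_N) (U : 'I_N -> 'I_N -> K) (hU : ultra s oo U).
Hypothesis Uoo : (forall i j, i != oo -> j != oo -> ~~ adm i j) -> U oo oo = 0.

Let Usym a b : U a b = U b a. Proof. by case: hU. Qed.
Let U0 a b : 0 <= U a b. Proof. by case: hU. Qed.
Let Uo a : a != oo -> U a oo = 0. Proof. by case: hU => _ _ _ h _; apply: h. Qed.
Let Uge r a b c : r <= U a b -> r <= U b c -> r <= U a c.
Proof. exact: (@ultra_ge _ s K oo U hU). Qed.
Let Ugt r a b c : r < U a b -> r < U b c -> r < U a c.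
Proof. by have [_ _ U3 _ _] := hU; case: (U3 a b c) => h h1 h2; [apply: lt_le_trans h|apply: lt_le_trans h]. Qed.

Let Uiso c i j : U c j < U c i -> U i j = U c j.
Proof.
move=> lt; apply/eqP; rewrite eq_le; apply/andP; split.
  by rewrite leNgt; apply/negP => h; have := Ugt lt h; rewrite ltxx.
by apply: (@Uge _ i c j) => //; rewrite (Usym i c) ltW.
Qed.

(** The classes seen from the vertex at depth [r] above [c]: the branches below the vertex, and
    everything outside its ball as one class. The leaves ending at the vertex itself are collected
    in [cellL]. *)
Definition cellE c r : rel 'I_N := fun i j =>
  [|| i == j, [&& r <= U c i, r <= U c j & r < U i j] | (U c i < r) && (U c j < r)].

Definition cellL c r : {set 'I_N} := [set i | [&& adm i i, r <= U c i & U i i == r]].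

Definition ucell c r : {set VS s} := cellset s_gt0 n_ge2 (cellE c r) (cellL c r).

Definition upaving : {set {set VS s}} :=
  [set ucell p.1 (U p.1 p.2) | p in [set p : 'I_N * 'I_N | adm p.1 p.2]].

Lemma upavingP A : reflect (exists c d, adm c d /\ A = ucell c (U c d)) (A \in upaving).
Proof.
apply: (iffP imsetP) => [[[c d]]|[c [d [h ->]]]]; last by exists (c, d); rewrite ?inE.
by rewrite inE => h ->; exists c, d.
Qed.

Lemma cellE_refl c r : reflexive (cellE c r).
Proof. by move=> i; rewrite /cellE eqxx. Qed.

Lemma cellE_sym c r i j : cellE c r i j = cellE c r j i.
Proof.
by rewrite /cellE eq_sym (Usym i j) andbCA; congr (_ || (_ || _)); rewrite andbC.
Qed.

Lemma cellE_trans c r : transitive (cellE c r).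
Proof.
move=> j i k; rewrite /cellE; case: eqVneq => [-> //|_] /=; case: eqVneq => [<- ->|_] /=; first by rewrite orbT.
move=> /orP [/and3P [h1 h2 h3]|/andP [h1 h2]] /orP [/and3P [h4 h5 h6]|/andP [h4 h5]].
- by rewrite h1 h5 (Ugt h3 h6) orbT.
- by move: h4; rewrite ltNge h2.
- by move: h2; rewrite ltNge h4.
- by rewrite h1 h5 !orbT.
Qed.

Lemma cellL_adm c r a : a \in cellL c r -> adm a a.
Proof. by rewrite inE => /and3P []. Qed.

Lemma cellL_sing c r a t : a \in cellL c r -> cellE c r a t -> t = a.
Proof.
rewrite inE => /and3P [_ h /eqP e]; rewrite /cellE; case: eqVneq => //= _ /orP [/and3P [_ _]|/andP []].
  by rewrite ltNge -e (ultra_diag hU).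
by rewrite ltNge h.
Qed.

(** The affine minorant attached to a vertex: each block contributes its depth along the path to
    [c], truncated at [r]. *)
Definition ell c r (x : 'I_N -> K) : K := \sum_t Num.min r (U c t) * x t - r.

Lemma ell_vs c r i j : adm i j ->
  ell c r (fun t => (vco (vs i j) t)%:R) = Num.min r (U c i) + Num.min r (U c j) - r.
Proof. by move=> ad; rewrite /ell (vs_sum s_gt0 n_ge2 (fun t => Num.min r (U c t))). Qed.

(** By cases on which of the two blocks lie in the ball: if exactly one does, the isosceles property
    gives equality; if neither does, the inequality is strict. *)
Lemma ell_le c r i j : adm i j -> 
  ell c r (fun t => (vco (vs i j) t)%:R) <= U i j /\
  (vs i j \in ucell c r) = (ell c r (fun t => (vco (vs i j) t)%:R) == U i j).
Proof.
move=> ad; rewrite ell_vs // /ucell in_cellset //; try exact: cellE_sym.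
have [ci|ci] := leP r (U c i); have [cj|cj] := leP r (U c j).
- have rij : r <= U i j by apply: (@Uge _ i c j) => //; rewrite Usym.
  rewrite addrK; split=> //; rewrite /cpair; case: eqVneq => [ij|ij].
    by subst j; rewrite inE ad ci eq_sym.
  by rewrite /cellE (negPf ij) ci cj /= (ltNge _ r) ci orbF -leNgt eq_le rij.
- have e : U c j = U i j by rewrite (Uiso (lt_le_trans cj ci)).
  rewrite addrAC subrr add0r e lexx eqxx; split=> //.
  have ij : i != j by apply: contraTneq cj => <-; rewrite -leNgt.
  by rewrite /cpair (negPf ij) /cellE (negPf ij) ci (leNgt _ (U c j)) cj (ltNge _ r) ci.
- have e : U c i = U i j by rewrite (Usym i) (Uiso (lt_le_trans ci cj)).
  rewrite addrK e lexx eqxx; split=> //.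
  have ij : i != j by apply: contraTneq ci => ->; rewrite -leNgt.
  by rewrite /cpair (negPf ij) /cellE (negPf ij) cj (leNgt _ (U c i)) ci (ltNge _ r) cj.
- have lt : U c i + U c j - r < U i j.
    have [h|h] := leP (U c i) (U c j).
      by have := @Uge (U c i) i c j; rewrite (Usym i c) lexx h => /(_ isT isT); lra.
    have := @Uge (U c j) i c j; rewrite (Usym i c) lexx (ltW h) => /(_ isT isT); lra.
  split; first exact: ltW.
  rewrite (lt_eqF lt) /cpair; case: eqVneq => [ij|ij]; last by rewrite /cellE ci cj !orbT.
  by rewrite inE (leNgt r) ci !andbF.
Qed.

Lemma upaving_cone (u : VS s -> K) : (forall i j, adm i j -> u (vs i j) = U i j) -> cone upaving u.
Proof.
move=> hu A /upavingP [c [d [cd ->]]]; set r := U c d.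
exists (fun v => ell c r (fun t => (vco v t)%:R)); split.
- by exists (- r), (fun t => Num.min r (U c t)) => v; rewrite /ell addrC.
- by move=> v; have [i [j [ij ->]]] := vsP s_gt0 n_ge2 v; rewrite hu //; case: (ell_le c r ij).
- by move=> v; have [i [j [ij ->]]] := vsP s_gt0 n_ge2 v; rewrite hu //; case: (ell_le c r ij).
Qed.

Lemma ucell_nonempty c d : adm c d -> vs c d \in ucell c (U c d).
Proof.
move=> cd; case: (ell_le c (U c d) cd) => _ ->; rewrite ell_vs //.
by rewrite (min_idPl (ultra_diag hU _ _)) minxx addrK.
Qed.

(** If the ball misses a block, that block, [c] and [d] are in three classes. Otherwise the vertex
    is the root, of depth 0, and [oo] with the normalising pair of the ultrametric does the same,
    apart from the degenerate cases of a doubled block or of a single point. *)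
Lemma ucell_full c d : adm c d -> cfull s_gt0 n_ge2 (cellE c (U c d)) (cellL c (U c d)).
Proof.
move=> cd; set r := U c d.
have [e|ne] := eqVneq c d.
  by apply: Or31; exists c; rewrite inE /r -e lexx eqxx; move: cd; rewrite -e => ->.
have ccr : r <= U c c by exact: (ultra_diag hU).
have [/existsP [t lt]|al] := boolP [exists t, U c t < r].
  apply: Or32; exists c, d, t; split; rewrite /cellE.
  - by rewrite (negPf ne) -/r ltxx !andbF.
  - by rewrite (leNgt r (U c t)) lt (ltNge (U c c)) ccr /= ?andbF ?orbF; apply: contraTneq lt => <-; rewrite -leNgt.
  - by rewrite (leNgt r (U c t)) lt -/r ltxx /= ?andbF ?orbF; apply: contraTneq lt => <-; rewrite ltxx.
have inC t : r <= U c t by rewrite leNgt; apply: contra al => h; apply/existsP; exists t.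
have r0 : r = 0.
  have le0 : r <= 0.
    have [e|co] := eqVneq c oo.
      by rewrite /r e Usym Uo // -e eq_sym.
    by have := inC oo; rewrite Uo.
  by apply/eqP; rewrite eq_le le0 U0.
have [_ _ _ _ [[i [j [io jo ij uij]]]|h]] := hU.
  have [eij|nij] := eqVneq i j.
    by move: ij uij; rewrite -eij => ii uii; apply: Or31; exists i; rewrite inE ii inC uii r0 eqxx.
  apply: Or32; exists oo, i, j; split; rewrite /cellE.
  - by rewrite eq_sym (negPf io) (Usym oo i) (Uo io) -r0 ltxx !andbF /= (ltNge _ r) inC.
  - by rewrite eq_sym (negPf jo) (Usym oo j) (Uo jo) -r0 ltxx !andbF /= (ltNge _ r) inC.
  - by rewrite (negPf nij) uij -r0 ltxx !andbF /= (ltNge _ r) inC.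
have [ao|nao] := boolP (adm oo oo).
  by apply: Or31; exists oo; rewrite inE ao inC Uoo // r0 eqxx.
apply: Or33; split; last by exists (vs c d); exact: ucell_nonempty.
have uniq x y : x != oo -> y != oo -> x = y.
  by move=> hx hy; apply/eqP; apply: contraNT (h x y hx hy); exact: adm_neq.
have nrm v : exists x, x != oo /\ v = vs x oo.
  have [i [j [ij ->]]] := vsP s_gt0 n_ge2 v.
  have [ei|io] := eqVneq i oo; have [ej|jo] := eqVneq j oo.
  - by move: ij; rewrite ei ej (negPf nao).
  - by exists j; rewrite ei vs_sym.
  - by exists i; rewrite ej.
  - by move: ij; rewrite (negPf (h i j io jo)).
by move=> v w; have [x [hx ->]] := nrm v; have [y [hy ->]] := nrm w; rewrite (uniq x y).
Qed.

Lemma ell_eq c i r : r <= U c i -> ell i r =1 ell c r.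
Proof.
move=> h x; rewrite /ell; congr (_ - _); apply: eq_bigr => t _; congr (_ * _).
have [h1|h1] := leP r (U c t); first by rewrite (min_idPl _) //; apply: Uge h1; rewrite Usym.
have -> : U i t = U c t by rewrite (Uiso (lt_le_trans h1 h)).
by rewrite min_r // ltW.
Qed.

Lemma ell_split c r' r (D : {set 'I_N}) x : r' <= r ->
  (forall t, t \in D -> r <= U c t) -> (forall t, t \notin D -> U c t <= r') ->
  ell c r x - ell c r' x = (r - r') * (\sum_(t in D) x t - 1).
Proof.
move=> le hD hD'.
have e t : Num.min r (U c t) * x t - Num.min r' (U c t) * x t = (r - r') * (if t \in D then x t else 0).
  rewrite -mulrBl; case: ifP => [tD|/negbT tD].
    by rewrite !min_l ?hD // (le_trans le) ?hD.
  by rewrite !min_r ?hD' ?(le_trans _ le) ?hD' // subrr mul0r mulr0.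
have : \sum_t (Num.min r (U c t) * x t - Num.min r' (U c t) * x t) = (r - r') * \sum_(t in D) x t.
  by rewrite (eq_bigr _ (fun t _ => e t)) -mulr_sumr -big_mkcond.
by rewrite sumrB /ell => h; rewrite mulrBr -h; ring.
Qed.

(** The cell is that of the vertex whose minorant is largest at [x]. [cellset_hull] asks for mass at
    most one on each class, and this is obtained by comparison with the next vertex in the direction
    of the class. *)
Lemma upaving_cover (x : 'I_N -> K) : hull [set: VS s] x -> exists2 A, A \in upaving & hull A x.
Proof.
move=> [p [p0 _ p1 px]].
have x0 t : 0 <= x t by rewrite px sumr_ge0 // => v _; rewrite mulr_ge0.
have sx : \sum_t x t = 2.
  under eq_bigr => t _ do rewrite px.
  rewrite exchange_big (eq_bigr (fun v => p v * 2)) => [|v _ /=].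
    by rewrite -mulr_suml p1 mul1r.
  by rewrite -mulr_sumr -natr_sum vco_sum.
have x1 t : ~~ adm t t -> x t <= 1.
  rewrite /adm eqxx /= -leqNgt => st; rewrite px -[leRHS]p1; apply: ler_sum => v _.
  rewrite ler_piMr // -[1]/(1%:R) ler_nat.
  by have := svalP v; rewrite inE => /forallP /(_ t) h; exact: leq_trans h st.
have [[c0 d0] /= ad0] := adm_ex s_gt0 n_ge2.
pose F (q : 'I_N * 'I_N) := ell q.1 (U q.1 q.2) x.
have [[c d] /= ad mx] : exists2 q : 'I_N * 'I_N, adm q.1 q.2 & forall q' : 'I_N * 'I_N, adm q'.1 q'.2 -> F q' <= F q.
  case: (@Order.TotalTheory.arg_maxP _ _ _ (c0, d0) (fun q : 'I_N * 'I_N => adm q.1 q.2) F ad0) => q h1 h2.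
  by exists q.
set r := U c d in mx; exists (ucell c r); first by apply/upavingP; exists c, d.
apply: cellset_hull => //.
- exact: cellE_refl.
- exact: cellE_sym.
- exact: cellE_trans.
- exact: cellL_adm.
- exact: cellL_sing.
move=> i iL.
have ccr : r <= U c c by exact: (ultra_diag hU).
(* Outer class: the comparison is with the next vertex up, at the greatest depth below [r]. *)
have [ci|ci] := ltP (U c i) r.
  have [t0 t0c tm] : exists2 t0, U c t0 < r & forall t, U c t < r -> U c t <= U c t0.
    by case: (@Order.TotalTheory.arg_maxP _ _ _ i (fun t => U c t < r) (U c) ci) => t h1 h2; exists t.
  have ct0 : adm c t0 by apply: adm_neq; apply: contraTneq t0c => <-; rewrite -leNgt.
  have := mx (c, t0) ct0; rewrite /F /= -/r -subr_ge0.
  rewrite (@ell_split c (U c t0) r [set t | r <= U c t]) ?(ltW t0c) //; first last.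
  - by move=> t; rewrite inE -ltNge; exact: tm.
  - by move=> t; rewrite inE.
  rewrite pmulr_rge0 ?subr_gt0 // subr_ge0 => h.
  have : \sum_(t in [set t | r <= U c t]) x t + \sum_(t | t \notin [set t | r <= U c t]) x t = 2.
    by rewrite -sx [RHS](bigID (mem [set t | r <= U c t])).
  have -> : \sum_(t | t \notin [set t | r <= U c t]) x t = \sum_(j | cellE c r i j) x j.
    apply: eq_bigl => j; rewrite inE -ltNge /cellE ci (leNgt r (U c i)) ci /=.
    by case: eqVneq => //= <-; rewrite ci.
  by move: h; set y := \sum_(t in _) x t; set z := \sum_(t | _) x t; lra.
(* Inner branch: the comparison is with the next vertex down, at the least depth above [r]. If there
   is none, the class is the single block [i], whose double is not in [S]. *)
have [/existsP [j0 /andP [ij0 lt0]]|none] := boolP [exists j, adm i j && (r < U i j)].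
  have [j1 /andP [j1a j1r] jm] : exists2 j1, adm i j1 && (r < U i j1) &
      forall j, adm i j && (r < U i j) -> U i j1 <= U i j.
    case: (@Order.TotalTheory.arg_minP _ _ _ j0 (fun j => adm i j && (r < U i j)) (U i)); first by rewrite ij0.
    by move=> j h1 h2; exists j.
  have := mx (i, j1) j1a; rewrite /F /= -(ell_eq ci) -subr_le0.
  rewrite (@ell_split i r (U i j1) [set j | cellE c r i j]) ?(ltW j1r) //; first last.
  - move=> t; rewrite inE /cellE ci (ltNge _ r) ci /= orbF negb_or => /andP [it].
    by rewrite negb_and -leNgt -ltNge => /orP [h|//]; rewrite (Uiso (lt_le_trans h ci)) ltW.
  - move=> t; rewrite inE /cellE ci (ltNge _ r) ci /= orbF => /orP [/eqP <-|/andP [h1 h2]].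
      exact: (ultra_diag hU).
    have [e|ne] := eqVneq i t; first by rewrite -e; exact: (ultra_diag hU).
    by apply: jm; rewrite adm_neq //; case/andP: h2.
  rewrite pmulr_rle0 ?subr_gt0 // subr_le0.
  by apply: le_trans; rewrite le_eqVlt; apply/orP; left; apply/eqP/eq_bigl => t; rewrite inE.
have nii : ~~ adm i i.
  apply/negP => ii; move/negP: iL; apply; rewrite inE ii ci /= eq_le; apply/andP; split.
    rewrite leNgt; apply: contra none => h; apply/existsP; exists i; by rewrite ii.
  by apply: (@Uge _ i c i) => //; rewrite Usym.
rewrite (bigD1 i) ?cellE_refl //= big1 ?addr0 ?x1 // => j /andP [h ne].
move: h; rewrite /cellE eq_sym (negPf ne) /= (ltNge _ r) ci /= orbF => /andP [_ h].
by case/negP: none; apply/existsP; exists j; rewrite adm_neq // eq_sym.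
Qed.

Lemma upaving_paving : paving K upaving.
Proof.
have hc : exists u : VS s -> K, forall i j, adm i j -> u (vs i j) = U i j.
  by exists (hgt s_gt0 n_ge2 oo U) => i j; exact: hgt_vs.
have [u /upaving_cone hu] := hc.
split; last by exists u.
- move=> A /upavingP [c [d [cd ->]]]; split.
    apply: cellset_convex.
    - exact: cellE_refl.
    - exact: cellE_sym.
    - exact: cellE_trans.
    - exact: cellL_adm.
    - exact: cellL_sing.
    - by exists (vs c d); exact: ucell_nonempty.
  have [e [C [D ch]]] := cellset_chart K (@cellE_refl c (U c d)) (@cellE_sym c (U c d))
    (@cellE_trans c (U c d)) (@cellL_adm c (U c d)) (@cellL_sing c (U c d)) (ucell_full cd).
  by case: (chart_rank ch).
- split; last exact: (cone_faces hu).
  move=> x; split=> [|[A _ [p [h1 h2 h3 h4]]]]; first exact: upaving_cover.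
  by exists p; split=> // v; rewrite finset.in_setT.
Qed.

End UltraPaving.
End UltrametricPavings.

(** * Pluecker relations divided by their smallest coefficient *)

Module ReducedRelations.
Import Blocks AffineCharts Cells CellHulls PointwiseClosure PavingQuads HeightUltrametric UltrametricTree DualCones.
Import numFieldTopology.Exports.
Local Opaque delta.

Lemma tuple_sorted n (Q : 'I_n -> 'I_n -> 'I_n -> 'I_n -> Prop) :
  (forall a b c d, Q a b c d -> Q b a c d) -> (forall a b c d, Q a b c d -> Q a c b d) ->
  (forall a b c d, Q a b c d -> Q a b d c) -> (forall a c d, Q a a c d) ->
  (forall a b c d : 'I_n, (a < b)%N -> (b < c)%N -> (c < d)%N -> Q a b c d) ->
  forall a b c d, Q a b c d.
Proof.
move=> s12 s23 s34 e12 so.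
have e23 a b d : Q a b b d by apply/s12/s23.
have e34 a b c : Q a b c c by apply/s23/s34.
have P3 (a b c d : 'I_n) : (a < b)%N -> (b < c)%N -> Q a b c d.
  move=> ab bc; have [cd|dc|/val_inj ->//] := ltngtP c d; first exact: so.
  apply: s34; have [bd|db|/val_inj ->//] := ltngtP b d; first exact: so.
  apply: s23; have [ad|da|/val_inj ->//] := ltngtP a d; first exact: so.
  by apply: s12; exact: so.
have P2 (a b c d : 'I_n) : (a < b)%N -> Q a b c d.
  move=> ab; have [bc|cb|/val_inj ->//] := ltngtP b c; first exact: P3.
  apply: s23; have [ac|ca|/val_inj ->//] := ltngtP a c; first exact: P3.
  by apply: s12; exact: P3.
move=> a b c d; have [ab|ba|/val_inj ->//] := ltngtP a b; first exact: P2.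
by apply: s12; exact: P2.
Qed.

HB.lock Definition pd N (s : 'I_N -> nat) (v w : VS s) : {ffun VS s -> int} := delta v + delta w.

Lemma mem3_2 (T : eqType) (x y z : T) : y \in [:: x; y; z].
Proof. by rewrite !inE eqxx orbT. Qed.

Lemma mem3_3 (T : eqType) (x y z : T) : z \in [:: x; y; z].
Proof. by rewrite !inE eqxx !orbT. Qed.

Section ReducedPluecker.
Variables (N : nat) (s : 'I_N -> nat).
Hypotheses (s_gt0 : forall t, (0 < s t)%N) (n_ge2 : (2 <= \sum_(t < N) s t)%N).
Variable K : realType.
Notation vs := (vs s_gt0 n_ge2).
Notation adm := (adm s).
Notation chr := {ffun VS s -> int}.

Lemma pdC (v w : VS s) : pd v w = pd w v. Proof. rewrite pd.unlock; exact: addrC. Qed.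

Definition vv (a b : 'I_(tot s)) : VS s := vs (bl a) (bl b).

Lemma vvC a b : vv a b = vv b a. Proof. exact: vs_sym. Qed.

Lemma crE' a b c d : cr s_gt0 n_ge2 ((a, b), (c, d)) = pd (vs a b) (vs c d) - pd (vs a c) (vs b d).
Proof.
rewrite crE pd.unlock; move: (delta (vs a b)) (delta (vs c d)) (delta (vs a c)) (delta (vs b d)) => x y z w.
by ffring.
Qed.

Lemma pairing_pd (v w : VS s) u : pairing (pd v w) u = u v + u w :> K.
Proof. by rewrite -(pairing_delta v) -(pairing_delta w) -pairingD pd.unlock. Qed.

(** A least element of [S] for the order in which a difference is nonnegative when it is regular on
    the chart. Subtracting it from the degrees leaves coefficients that make sense on the boundary
    of the torus. *)
Definition base P (S : chr -> Prop) (g0 : chr) : Prop :=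
  S g0 /\ forall g, S g -> dualcone K P (g - g0).

Lemma dualcone_sub P P' m : (closure (cone P' : set {ptws VS s -> K}) `<=` closure (cone P))%classic ->
  dualcone K P m -> dualcone K P' m.
Proof. by move=> h [h1 h2]; split=> // u /h /h2. Qed.

Lemma base_sub P P' S g : (closure (cone P' : set {ptws VS s -> K}) `<=` closure (cone P))%classic ->
  base P S g -> base P' S g.
Proof. by move=> h [h1 h2]; split=> // g' /h2; exact: dualcone_sub. Qed.

(** Two least degrees differ by a character that is invertible on the chart. *)
Lemma base_change R (z : tpt s K R) S g0 g1 : base (tp_pav z) S g0 -> base (tp_pav z) S g1 ->
  exists2 c, c \is a GRing.unit & forall g, S g -> tp_val z (g - g0) = c * tp_val z (g - g1).
Proof.
move=> [S0 h0] [S1 h1]; exists (tp_val z (g1 - g0)).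
  apply/unitrP; exists (tp_val z (g0 - g1)).
  have e : tp_val z (g0 - g1) * tp_val z (g1 - g0) = 1.
    rewrite -tp_D; [|exact: h1|exact: h0]; rewrite -(tp_0 z); congr (tp_val z _).
    by move: g0 g1 {S0 h0 S1 h1} => x y; ffring.
  by split; rewrite // mulrC.
move=> g Sg; rewrite -tp_D; [|exact: h0|exact: h1]; congr (tp_val z _); by move: g g0 g1 {Sg S0 S1 h0 h1} => x y w; ffring.
Qed.

Lemma min3 (DC : chr -> Prop) (p1 p2 p3 : chr) (f1 f2 f3 : K) : (forall x, DC (x - x)) ->
  (f2 <= f1 -> DC (p1 - p2)) -> (f1 <= f2 -> DC (p2 - p1)) -> (f3 <= f1 -> DC (p1 - p3)) ->
  (f1 <= f3 -> DC (p3 - p1)) -> (f3 <= f2 -> DC (p2 - p3)) -> (f2 <= f3 -> DC (p3 - p2)) ->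
  exists g0, g0 \in [:: p1; p2; p3] /\ forall g, g \in [:: p1; p2; p3] -> DC (g - g0).
Proof.
move=> D D12 D21 D13 D31 D23 D32.
have [h12|/ltW h12] := leP f1 f2; [have [h|/ltW h] := leP f1 f3|have [h|/ltW h] := leP f2 f3].
- exists p1; rewrite inE eqxx; split=> // g; rewrite !inE => /or3P [] /eqP -> //; [exact: D21|exact: D31].
- exists p3; rewrite !inE eqxx !orbT; split=> // g; rewrite !inE => /or3P [] /eqP -> //; [exact: D13|].
  by apply: D23; apply: le_trans h12.
- exists p2; rewrite !inE eqxx orbT; split=> // g; rewrite !inE => /or3P [] /eqP -> //; [exact: D12|exact: D32].
- exists p3; rewrite !inE eqxx !orbT; split=> // g; rewrite !inE => /or3P [] /eqP -> //; [|exact: D23].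
  by apply: D13; apply: le_trans h12.
Qed.

Section Bases.
Variables (P : {set {set VS s}}) (hP : paving K P).

Lemma dualcone_quad (u0 : VS s -> K) a b c d : cone P u0 -> adm a b -> adm c d -> adm a c -> adm b d ->
  u0 (vs a c) + u0 (vs b d) <= u0 (vs a b) + u0 (vs c d) ->
  dualcone K P (pd (vs a b) (vs c d) - pd (vs a c) (vs b d)).
Proof.
move=> hu0 ab cd ac bd le; rewrite -crE'; apply: dualconeI => [|u hu].
  by apply: charA_cr; rewrite /cr_adm /= ab cd ac bd.
have := @cone_quad_sign _ _ s_gt0 n_ge2 K P hP u0 hu0 u a b c d hu ab cd ac bd le.
by rewrite pairing_cr; lra.
Qed.

(** If [paving_quad] returns the other pair, the minorant exact on [ac, bd] has the same sum on
    [ab, cd], and the assumed comparison makes it exact there too. *)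
Lemma quad_cell a b c d : adm a b -> adm c d -> adm a c -> adm b d ->
  dualcone K P (pd (vs a c) (vs b d) - pd (vs a b) (vs c d)) ->
  exists2 A, A \in P & vs a b \in A /\ vs c d \in A.
Proof.
move=> ab cd ac bd h; have [_ _ [u0 hu0]] := hP.
have := dualconeE h hu0; rewrite pairingD pairingN !pairing_pd => le.
have [A AP [//|[h1 h2]]] := paving_quad s_gt0 n_ge2 hP ab cd ac bd; first by exists A.
exists A => //; have [l [la lu lA]] := hu0 A AP.
have := affine_quad s_gt0 n_ge2 la ab cd ac bd.
move: h1 h2; rewrite !lA => /eqP -> /eqP -> e; have := lu (vs a b); have := lu (vs c d).
by move=> k1 k2; split; apply/eqP; lra.
Qed.

Definition pairs3 (a b c d : 'I_(tot s)) : chr -> Prop := fun g =>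
  g \in [:: pd (vv a b) (vv c d); pd (vv a c) (vv b d); pd (vv a d) (vv b c)].

Lemma pairs3_12 a b c d g : pairs3 b a c d g = pairs3 a b c d g.
Proof.
rewrite /pairs3 !inE (vvC b a) (pdC (vv b c)) (pdC (vv b d)); congr (is_true (_ || _)); exact: orbC.
Qed.

Lemma pairs3_23 a b c d g : pairs3 a c b d g = pairs3 a b c d g.
Proof. by rewrite /pairs3 !inE (vvC c b) orbCA. Qed.

Lemma pairs3_34 a b c d g : pairs3 a b d c g = pairs3 a b c d g.
Proof. by rewrite /pairs3 !inE (vvC d c); congr (is_true (_ || _)); exact: orbC. Qed.

(** The order of two pairings is the same for all heights of the cone, so the values at a single
    height [u0] decide which degree is least. *)
Lemma base3 a b c d : uniq [:: a; b; c; d] -> exists g0, base P (pairs3 a b c d) g0.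
Proof.
rewrite /= !inE !negb_or => /and4P [/and3P [ab ac ad] /andP [bc bd] cd _].
have [_ _ [u0 hu0]] := hP; have A x y (h : x != y) := adm_bl h.
have S (x y : 'I_(tot s)) (h : x != y) : y != x by rewrite eq_sym.
have dc0 x : dualcone K P (x - x) by rewrite subrr; exact: dualcone0.
have D (x y z w : 'I_(tot s)) : x != y -> z != w -> x != z -> y != w ->
  u0 (vv x z) + u0 (vv y w) <= u0 (vv x y) + u0 (vv z w) ->
  dualcone K P (pd (vv x y) (vv z w) - pd (vv x z) (vv y w)).
  by move=> h1 h2 h3 h4; apply: dualcone_quad => //; exact: A.
have D12 := D _ _ _ _ ab cd ac bd; have D21 := D _ _ _ _ ac bd ab cd.
have D13 := D _ _ _ _ (S _ _ ab) cd bc ad; have D31 := D _ _ _ _ bc ad (S _ _ ab) cd.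
have D23 := D _ _ _ _ (S _ _ ac) bd (S _ _ bc) ad; have D32 := D _ _ _ _ (S _ _ bc) ad (S _ _ ac) bd.
move: D13 D31 D23 D32; rewrite !(vvC b a) !(vvC c a) !(vvC c b) !(pdC (vv b c)).
set f1 := u0 (vv a b) + _ in D12 D21 *; set f2 := u0 (vv a c) + _ in D12 D21 *.
rewrite (addrC (u0 (vv b c))); set f3 := u0 (vv a d) + _ => D13 D31 D23 D32.
exact: (@min3 _ _ _ _ f1 f2 f3).
Qed.

End Bases.

Section PlE.
Variables (R : comUnitRingType).
Implicit Types (h : VS s -> VS s -> R) (x : idx2 s -> R).

Definition plE h x a b c d : R :=
  h (vv a b) (vv c d) * (ext x a b * ext x c d)
  - h (vv a c) (vv b d) * (ext x a c * ext x b d)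
  + h (vv a d) (vv b c) * (ext x a d * ext x b c).

Lemma plE_12 h x a b c d : (forall v w, h v w = h w v) -> plE h x b a c d = - plE h x a b c d.
Proof.
move=> hC; rewrite /plE (vvC b a) (hC (vv b c)) (hC (vv b d)) (ext_anti x b a); ring.
Qed.

Lemma plE_23 h x a b c d : plE h x a c b d = - plE h x a b c d.
Proof. rewrite /plE (vvC c b) (ext_anti x c b); ring. Qed.

Lemma plE_34 h x a b c d : plE h x a b d c = - plE h x a b c d.
Proof. rewrite /plE (vvC d c) (ext_anti x d c); ring. Qed.

Lemma plE_diag h x a c d : (forall v w, h v w = h w v) -> plE h x a a c d = 0.
Proof. by move=> hC; rewrite /plE ext_aa (hC (vv a d)); ring. Qed.

Lemma plE_scale h h' (k : R) x a b c d :
  (forall v w, pairs3 a b c d (pd v w) -> h v w = k * h' v w) ->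
  plE h x a b c d = k * plE h' x a b c d.
Proof. by move=> e; rewrite /plE !e; [ring|rewrite /pairs3 !inE eqxx ?orbT..]. Qed.

End PlE.

(** Stated for all ordered quadruples and all least degrees, hence without reference to a cell or to
    the splitting used in [chart_eqs]. *)
Definition RP R (z : tpt s K R) (x : idx2 s -> R) : Prop :=
  forall a b c d g0, base (tp_pav z) (pairs3 a b c d) g0 ->
    plE (fun v w => tp_val z (pd v w - g0)) x a b c d = 0.

Lemma RP_sorted R (z : tpt s K R) (x : idx2 s -> R) :
  (forall a b c d : 'I_(tot s), (a < b)%N -> (b < c)%N -> (c < d)%N ->
     exists g0 c0, [/\ base (tp_pav z) (pairs3 a b c d) g0, c0 \is a GRing.unit &
       c0 * plE (fun v w => tp_val z (pd v w - g0)) x a b c d = 0]) -> RP z x.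
Proof.
move=> H; apply: tuple_sorted => [a b c d h g0 b0|a b c d h g0 b0|a b c d h g0 b0|a c d g0 _|a b c d ab bc cd g0 b0].
- by rewrite plE_12 ?h ?oppr0 // => [|v w]; [case: b0 => h1 h2; split=> [|g]; rewrite -pairs3_12; [|apply: h2]|rewrite pdC].
- by rewrite plE_23 ?h ?oppr0 //; case: b0 => h1 h2; split=> [|g]; rewrite -pairs3_23; [|apply: h2].
- by rewrite plE_34 ?h ?oppr0 //; case: b0 => h1 h2; split=> [|g]; rewrite -pairs3_34; [|apply: h2].
- by rewrite plE_diag // => v w; rewrite pdC.
- have [g1 [c0 [b1 uc e]]] := H a b c d ab bc cd.
  have [k uk hk] := base_change b0 b1.
  rewrite (@plE_scale _ _ (fun v w => tp_val z (pd v w - g1)) k) => [|v w hv]; last exact: hk.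
  rewrite (_ : plE _ x a b c d = 0) ?mulr0 //.
  by apply: (mulrI uc); rewrite e mulr0.
Qed.

Lemma chi_idxE (b : VS s -> chr) (I : idx2 s) : chi_idx b I = b (vI s_gt0 n_ge2 I).
Proof. by rewrite /chi_idx (big_pred1 (vI s_gt0 n_ge2 I)) // => v; rewrite inI_vI. Qed.

(** The affine correction in the splitting depends only on the four blocks, so it is common to the
    three pairings and cancels in differences. *)
Lemma splitting_pd e (b : VS s -> chr) a1 a2 a3 a4 (v w : VS s) : splitting e b ->
  a1 != a2 -> a3 != a4 -> a1 != a3 -> a2 != a4 -> a1 != a4 -> a2 != a3 ->
  pairs3 a1 a2 a3 a4 (pd v w) -> forall v0 w0, 
  (v0, w0) \in [:: (vv a1 a2, vv a3 a4); (vv a1 a3, vv a2 a4); (vv a1 a4, vv a2 a3)] ->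
  (v, w) \in [:: (vv a1 a2, vv a3 a4); (vv a1 a3, vv a2 a4); (vv a1 a4, vv a2 a3)] ->
  b v + b w = (pd v w - pd v0 w0) + (b v0 + b w0).
Proof.
move=> [_ [c [d hd]] _] h12 h34 h13 h24 h14 h23 _ v0 w0 h0 h.
have L x y : x != y -> delta (vv x y) = b (vv x y) + (c + (d (bl x) + d (bl y))).
  move=> /adm_bl ad; rewrite hd; congr (_ + (_ + _)); under eq_bigr => t _ do rewrite vsE // mulrnDr.
  by rewrite big_split /= !sum_pick.
have S v1 w1 : (v1, w1) \in [:: (vv a1 a2, vv a3 a4); (vv a1 a3, vv a2 a4); (vv a1 a4, vv a2 a3)] ->
   pd v1 w1 = b v1 + b w1 + (c + c + (d (bl a1) + d (bl a2) + d (bl a3) + d (bl a4))).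
  rewrite !inE pd.unlock => /or3P [] /eqP [-> ->]; rewrite !L //.
  - clear hd L; by move: (b _) (b _) c (d _) (d _) (d _) (d _) => x1 x2 x3 x4 x5 x6 x7; ffring.
  - clear hd L; by move: (b _) (b _) c (d _) (d _) (d _) (d _) => x1 x2 x3 x4 x5 x6 x7; ffring.
  - clear hd L; by move: (b _) (b _) c (d _) (d _) (d _) (d _) => x1 x2 x3 x4 x5 x6 x7; ffring.
rewrite (S _ _ h) (S _ _ h0).
by move: (b v) (b w) (b v0) (b w0) (c + c + _) => x1 x2 x3 x4 x5; ffring.
Qed.

Lemma pluecker_plE (R : comUnitRingType) (h : VS s -> VS s -> R) (chi : idx2 s -> idx2 s -> R) (x : idx2 s -> R) :
  (forall I J, chi I J = h (vI s_gt0 n_ge2 I) (vI s_gt0 n_ge2 J)) ->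
  pluecker chi x <-> (forall a b c d : 'I_(tot s), (a < b)%N -> (b < c)%N -> (c < d)%N -> plE h x a b c d = 0).
Proof.
move=> e; split=> H.
  move=> a b c d ab bc cd; have := H a b c d ab bc cd.
  by rewrite /= !e -!ext_lt.
move=> a b c d ab bc cd /=; have := H a b c d ab bc cd.
by rewrite !e /plE (ext_lt x ab) (ext_lt x cd) (ext_lt x (ltn_trans ab bc)) (ext_lt x (ltn_trans bc cd))
  (ext_lt x (ltn_trans (ltn_trans ab bc) cd)) (ext_lt x bc).
Qed.

End ReducedPluecker.
End ReducedRelations.

(** * Chart equations of Omega as reduced relations *)

Module ChartEquations.
Import Blocks AffineCharts Cells CellHulls PointwiseClosure PavingQuads HeightUltrametric UltrametricTree DualCones ReducedRelations.
Import numFieldTopology.Exports.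
Local Opaque delta.

Section ReducedPluecker.
Variables (N : nat) (s : 'I_N -> nat).
Hypotheses (s_gt0 : forall t, (0 < s t)%N) (n_ge2 : (2 <= \sum_(t < N) s t)%N).
Variable K : realType.
Notation vs := (vs s_gt0 n_ge2).
Notation adm := (adm s).
Notation vv := (vv s_gt0 n_ge2).
Notation pairs3 := (pairs3 s_gt0 n_ge2).
Notation plE := (plE s_gt0 n_ge2).
Notation RP := (RP s_gt0 n_ge2).
Notation base := (base K).
Notation chr := {ffun VS s -> int}.

(** A chart equation is the reduced relation multiplied by the value of the splitting at the least
    pairing. That factor is a unit when the cell contains the least pairing, and [quad_cell]
    provides such a cell. *)
Lemma RP_chart R (z : tpt s K R) x : RP z x <-> chart_eqs z x.
Proof.
have hP := tp_ok z.
have m3 (T : eqType) (x1 x2 x3 : T) : x3 \in [:: x1; x2; x3] by rewrite !inE eqxx !orbT.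
have he (bb : VS s -> chr) (I J : idx2 s) : tp_val z (chi_idx bb I + chi_idx bb J) =
    (fun v w => tp_val z (bb v + bb w)) (vI s_gt0 n_ge2 I) (vI s_gt0 n_ge2 J).
  by rewrite !(chi_idxE s_gt0 n_ge2).
have ne (a b : 'I_(tot s)) : (a < b)%N -> a != b by move=> h; rewrite -(inj_eq val_inj) ltn_eqF.
have split3 (a b c d : 'I_(tot s)) (ab : (a < b)%N) (bc : (b < c)%N) (cd : (c < d)%N) A e bb v0 w0 :
    A \in tp_pav z -> affine_basis K A e -> splitting e bb ->
    (v0, w0) \in [:: (vv a b, vv c d); (vv a c, vv b d); (vv a d, vv b c)] ->
    base (tp_pav z) (pairs3 a b c d) (pd v0 w0) ->
    plE (fun v w => tp_val z (bb v + bb w)) x a b c d =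
    tp_val z (bb v0 + bb w0) * plE (fun v w => tp_val z (pd v w - pd v0 w0)) x a b c d.
  move=> AP hb hs h0 [b0 b1].
  have [n1 n2 n3] := And3 (ne _ _ ab) (ne _ _ cd) (ne _ _ (ltn_trans ab bc)).
  have [n4 n5 n6] := And3 (ne _ _ (ltn_trans bc cd)) (ne _ _ (ltn_trans (ltn_trans ab bc) cd)) (ne _ _ bc).
  have D v : dualcone K (tp_pav z) (bb v) by case: (dualcone_splitting v AP hb hs).
  have E v w : (v, w) \in [:: (vv a b, vv c d); (vv a c, vv b d); (vv a d, vv b c)] ->
      pairs3 a b c d (pd v w) -> 
      tp_val z (bb v + bb w) = tp_val z (bb v0 + bb w0) * tp_val z (pd v w - pd v0 w0).
    move=> h hp; rewrite (splitting_pd hs n1 n2 n3 n4 n5 n6 hp h0 h) tp_D; [|exact: b1|exact: dualconeD].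
    exact: mulrC.
  rewrite /plE (E (vv a b) (vv c d)); [|by rewrite !inE eqxx|by rewrite /ReducedRelations.pairs3 !inE eqxx].
  rewrite (E (vv a c) (vv b d)); [|by rewrite !inE eqxx orbT|by rewrite /ReducedRelations.pairs3 !inE eqxx orbT].
  rewrite (E (vv a d) (vv b c)); [|exact: mem3_3|by rewrite /ReducedRelations.pairs3; exact: mem3_3].
  by ring.
split=> H.
  move=> A e bb AP hb hs; apply/(pluecker_plE (h := fun v w => tp_val z (bb v + bb w)) x (he bb)).
  move=> a b c d ab bc cd.
  have un : uniq [:: a; b; c; d].
    by rewrite /= !inE !negb_or !ne //; lia.
  have [g0 hg0] := base3 s_gt0 n_ge2 hP un; have [h0 _] := hg0.
  have [v0 [w0 [e0 m0]]] : exists v0 w0, g0 = pd v0 w0 /\ (v0, w0) \in [:: (vv a b, vv c d); (vv a c, vv b d); (vv a d, vv b c)].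
    by move: h0; rewrite /ReducedRelations.pairs3 !inE => /or3P [] /eqP ->; [exists (vv a b), (vv c d)|exists (vv a c), (vv b d)|exists (vv a d), (vv b c)];
      (split; [by []|]); [exact: mem_head|exact: mem3_2|exact: mem3_3].
  rewrite e0 in hg0; rewrite (split3 _ _ _ _ ab bc cd A e bb v0 w0 AP hb hs m0 hg0).
  by rewrite (H _ _ _ _ _ hg0) mulr0.
apply: RP_sorted => a b c d ab bc cd.
have un : uniq [:: a; b; c; d].
  by rewrite /= !inE !negb_or !ne //; lia.
have [n1 n2 n3] := And3 (adm_bl (ne _ _ ab)) (adm_bl (ne _ _ cd)) (adm_bl (ne _ _ (ltn_trans ab bc))).
have [n4 n5 n6] := And3 (adm_bl (ne _ _ (ltn_trans bc cd))) (adm_bl (ne _ _ (ltn_trans (ltn_trans ab bc) cd))) (adm_bl (ne _ _ bc)).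
have [g0 hg0] := base3 s_gt0 n_ge2 hP un; have [h0 h1] := hg0.
have [v0 [w0 [A [e0 m0 AP [vA wA]]]]] : exists v0 w0 A, [/\ g0 = pd v0 w0,
    (v0, w0) \in [:: (vv a b, vv c d); (vv a c, vv b d); (vv a d, vv b c)], A \in tp_pav z & v0 \in A /\ w0 \in A].
  have k1 : pairs3 a b c d (pd (vv a b) (vv c d)) by rewrite /ReducedRelations.pairs3 !inE eqxx.
  have k2 : pairs3 a b c d (pd (vv a c) (vv b d)) by rewrite /ReducedRelations.pairs3 !inE eqxx orbT.
  move: h0; rewrite /ReducedRelations.pairs3 !inE => /or3P [] /eqP e0; rewrite e0 in h1 *.
  - have [A AP hA] := quad_cell hP n1 n2 n3 n4 (h1 _ k2).
    by exists (vv a b), (vv c d), A; split=> //; rewrite !inE eqxx.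
  - have [A AP hA] := quad_cell hP n3 n4 n1 n2 (h1 _ k1).
    by exists (vv a c), (vv b d), A; split=> //; rewrite !inE eqxx ?orbT.
  - have := h1 _ k1; rewrite (vvC s_gt0 n_ge2 c d) => h1'.
    have n7 : adm (bl d) (bl c) by rewrite adm_sym.
    have [A AP hA] := quad_cell hP n5 n6 n1 n7 h1'.
    exists (vv a d), (vv b c), A; split; [by []|exact: m3|exact: AP|exact: hA].
have [_ _ [u0 hu0]] := hP.
have [e [bb [hb hs]]] := paving_basis s_gt0 n_ge2 hP hu0 AP.
exists (pd v0 w0), (tp_val z (bb v0 + bb w0)); rewrite -e0; split=> //.
  have [d1 /(_ vA) d2] := dualcone_splitting v0 AP hb hs.
  have [d3 /(_ wA) d4] := dualcone_splitting w0 AP hb hs.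
  apply/unitrP; exists (tp_val z (- bb v0 + - bb w0)).
  have e' : tp_val z (- bb v0 + - bb w0) * tp_val z (bb v0 + bb w0) = 1.
    rewrite -tp_D; try exact: dualconeD.
    rewrite -(tp_0 z); congr (tp_val z _); by move: (bb v0) (bb w0) => x1 x2; ffring.
  by split; rewrite // mulrC.
rewrite e0 in hg0 *; rewrite -(split3 _ _ _ _ ab bc cd A e bb v0 w0 AP hb hs m0 hg0).
have /(pluecker_plE (h := fun v w => tp_val z (bb v + bb w)) x (he bb)) := H A e bb AP hb hs.
exact.
Qed.

End ReducedPluecker.
End ChartEquations.

(** * The monomials attached to the vectors of C *)

Module MonomialSets.
Import Blocks AffineCharts Cells CellHulls PointwiseClosure PavingQuads HeightUltrametric UltrametricTree DualCones ReducedRelations ChartEquations.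
Import numFieldTopology.Exports.
Local Opaque delta.

Lemma pairing_cases (T : eqType) (Q : T -> T -> T -> T -> Prop) a b c d i j k l :
  (forall i j k l, Q i j k l -> Q j i k l) -> (forall i j k l, Q i j k l -> Q k l i j) ->
  uniq [:: i; j; k; l] -> {subset [:: i; j; k; l] <= [:: a; b; c; d]} ->
  Q a b c d -> Q a c b d -> Q a d b c -> Q i j k l.
Proof.
move=> s1 s2 u sb q1 q2 q3.
have s3 i' j' k' l' : Q i' j' k' l' -> Q i' j' l' k' by move=> /s2 /s1 /s2.
have hi : i \in [:: a; b; c; d] by apply: sb; rewrite !inE eqxx.
have hj : j \in [:: a; b; c; d] by apply: sb; rewrite !inE eqxx orbT.
have hk : k \in [:: a; b; c; d] by apply: sb; rewrite !inE eqxx !orbT.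
have hl : l \in [:: a; b; c; d] by apply: sb; rewrite !inE eqxx !orbT.
move: hi hj hk hl u {sb}; rewrite !inE.
move=> /or4P [] /eqP -> /or4P [] /eqP -> /or4P [] /eqP -> /or4P [] /eqP ->;
  rewrite /= !inE ?eqxx /= ?orbT ?andbF //= => _; auto 6.
Qed.

Definition six (T : eqType) (p q r s t u : T) : seq (T * T) :=
  [:: (p, q); (r, s); (t, u); (q, p); (s, r); (u, t)].

Lemma six_3 (T : eqType) (p q r s t u : T) : (t, u) \in six p q r s t u.
Proof. by rewrite !inE eqxx !orbT. Qed.

Lemma six_cases (T : eqType) (p q r s t u x y : T) : (x, y) \in six p q r s t u ->
  [\/ (x = p /\ y = q) \/ (x = q /\ y = p), (x = r /\ y = s) \/ (x = s /\ y = r)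
    | (x = t /\ y = u) \/ (x = u /\ y = t)].
Proof.
rewrite !inE !xpair_eqE => /or4P [/andP [/eqP -> /eqP ->]|/andP [/eqP -> /eqP ->]|/andP [/eqP -> /eqP ->]|/or3P [] /andP [/eqP -> /eqP ->]].
- by apply: Or31; left.
- by apply: Or32; left.
- by apply: Or33; left.
- by apply: Or31; right.
- by apply: Or32; right.
- by apply: Or33; right.
Qed.

Lemma mem6_swap (T : eqType) (p q r s t u x y : T) : (x, y) \in six p q r s t u ->
  (y, x) \in six p q r s t u.
Proof.
by move=> /six_cases [] [] [-> ->]; rewrite !inE !xpair_eqE !eqxx ?orbT.
Qed.

Section GSets.
Variables (N : nat) (s : 'I_N -> nat).
Hypotheses (s_gt0 : forall t, (0 < s t)%N) (n_ge2 : (2 <= \sum_(t < N) s t)%N).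
Notation vs := (vs s_gt0 n_ge2).
Notation adm := (adm s).
Notation vI := (vI s_gt0 n_ge2).
Notation vv := (vv s_gt0 n_ge2).
Notation pairs3 := (pairs3 s_gt0 n_ge2).
Notation chr := {ffun VS s -> int}.

Lemma mkidx (t : 'I_N) k : (k < s t)%N ->
  exists a : 'I_(tot s), bl a = t /\ val a = (\sum_(r < N | (r < t)%N) s r + k)%N.
Proof.
move=> kt; have e : (\sum_(r < N | (r <= t)%N) s r = \sum_(r < N | (r < t)%N) s r + s t)%N.
  rewrite (bigD1 t) //= addnC; congr (_ + _)%N; apply: eq_bigl => r.
  by rewrite -(inj_eq val_inj) /=; case: ltngtP.
have lt : (\sum_(r < N | (r < t)%N) s r + k < tot s)%N.
  apply: (@leq_trans (\sum_(r < N | (r <= t)%N) s r)); first by rewrite e ltn_add2l.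
  by rewrite /tot [leqRHS](bigID (fun r : 'I_N => (r <= t)%N)) /= leq_addr.
exists (Ordinal lt); split=> //; apply/eqP; rewrite -blP inE /= leq_addr e ltn_add2l.
exact: kt.
Qed.

Lemma bl_surj t : exists a : 'I_(tot s), bl a = t.
Proof. by have [a [h _]] := mkidx (s_gt0 t); exists a. Qed.

Lemma pair_ex i j : adm i j -> exists a b : 'I_(tot s), [/\ a != b, bl a = i & bl b = j].
Proof.
have [<-|ne] := eqVneq i j; last first.
  move=> _; have [a ha] := bl_surj i; have [b hb] := bl_surj j; exists a, b; split=> //.
  by apply: contraNneq ne => ab; rewrite -ha -hb ab.
rewrite /Blocks.adm eqxx /= => si; have [a [ha ea]] := mkidx (s_gt0 i); have [b [hb eb]] := mkidx si.
by exists a, b; split=> //; rewrite -(inj_eq val_inj) ea eb eqn_add2l.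
Qed.

Lemma idx_ex v : exists I, vI I = v.
Proof.
have [i [j [ad ->]]] := vsP s_gt0 n_ge2 v; have [a [b [ab <- <-]]] := pair_ex ad.
by have [I [h _]] := @idx2_ext _ _ s_gt0 n_ge2 a b ab; exists I.
Qed.

Definition d1 (I : idx2 s) : {ffun idx2 s -> nat} := [ffun J => (J == I) : nat].
Definition d2 (I J : idx2 s) : {ffun idx2 s -> nat} := [ffun L => ((L == I) + (L == J))%N].

Lemma prod_pick (R : comUnitRingType) (I : finType) (f : I -> R) i : \prod_j f j ^+ (j == i) = f i.
Proof. by rewrite (bigD1 i) //= eqxx expr1 big1 ?mulr1 // => j /negPf ->; rewrite expr0. Qed.

Lemma mono_d1 (R : comUnitRingType) (z : idx2 s -> R) I : mono z (d1 I) = z I.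
Proof. by rewrite /mono -[RHS](prod_pick z); apply: eq_bigr => J _; rewrite ffunE. Qed.

Lemma mono_d2 (R : comUnitRingType) (z : idx2 s -> R) I J : mono z (d2 I J) = z I * z J.
Proof.
rewrite /mono -(prod_pick z I) -(prod_pick z J) -big_split.
by apply: eq_bigr => L _; rewrite ffunE exprD.
Qed.

(** The multidegree of a monomial in the character lattice of the torus indexed by [S]. *)
Definition degm (m : {ffun idx2 s -> nat}) : chr := \sum_I delta (vI I) *+ m I.

Lemma degm_d1 I : degm (d1 I) = delta (vI I).
Proof. by rewrite /degm -[RHS](sum_pick (fun I => delta (vI I))); apply: eq_bigr => J _; rewrite ffunE. Qed.

Lemma degm_d2 I J : degm (d2 I J) = pd (vI I) (vI J).
Proof.
rewrite pd.unlock /degm -(sum_pick (fun I => delta (vI I)) I) -(sum_pick (fun I => delta (vI I)) J) -big_split.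
by apply: eq_bigr => L _; rewrite ffunE mulrnDr.
Qed.

Lemma size2_sum (l : seq (VS s * idx2 s)) :
  (\sum_t \sum_(p <- l) vco p.1 t = 2 * size l)%N.
Proof.
rewrite exchange_big /= (eq_bigr (fun=> 2%N)) => [|p _]; last exact: vco_sum.
by rewrite big_const_seq count_predT iter_addn_0.
Qed.

Lemma inG1 (w : {ffun 'I_N -> nat}) m : (\sum_t w t = 2)%N -> inG w m ->
  exists I, m = d1 I /\ forall t, w t = vco (vI I) t.
Proof.
move=> h2 [l [hl hw hm]]; have := size2_sum l.
rewrite -(eq_bigr _ (fun t _ => hw t)) h2.
case: l hl hw hm => [|[v I] [|p l]] //= hl hw -> e; last by move: e; rewrite mulnC; lia.
exists I; split.
  by apply/ffunP => J; rewrite !ffunE /= addn0 eq_sym.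
by move=> t; rewrite hw big_seq1 /=; move: hl; rewrite andbT inI_vI => /eqP ->.
Qed.

Lemma inG2 (w : {ffun 'I_N -> nat}) m : (\sum_t w t = 4)%N -> inG w m ->
  exists I J, m = d2 I J /\ forall t, w t = (vco (vI I) t + vco (vI J) t)%N.
Proof.
move=> h2 [l [hl hw hm]]; have := size2_sum l.
rewrite -(eq_bigr _ (fun t _ => hw t)) h2.
case: l hl hw hm => [|[v I] [|[v' J] [|p l]]] //= hl hw -> e; last by move: e; rewrite mulnC; lia.
exists I, J; split.
  by apply/ffunP => L; rewrite !ffunE /= addn0 (eq_sym L I) (eq_sym L J).
move=> t; rewrite hw big_cons big_seq1 /=; move: hl; rewrite !(inI_vI s_gt0 n_ge2) andbT.
by move=> /andP [/eqP -> /eqP ->].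
Qed.

Lemma inG_d1 (w : {ffun 'I_N -> nat}) I : (forall t, w t = vco (vI I) t) -> inG w (d1 I).
Proof.
move=> h; exists [:: (vI I, I)]; split; first by rewrite /= (inI_vI s_gt0 n_ge2) eqxx.
  by move=> t; rewrite big_seq1.
by apply/ffunP => J; rewrite !ffunE /= addn0 eq_sym.
Qed.

Lemma inG_d2 (w : {ffun 'I_N -> nat}) I J : (forall t, w t = (vco (vI I) t + vco (vI J) t)%N) ->
  inG w (d2 I J).
Proof.
move=> h; exists [:: (vI I, I); (vI J, J)]; split; first by rewrite /= !(inI_vI s_gt0 n_ge2) !eqxx.
  by move=> t; rewrite big_cons big_seq1.
by apply/ffunP => L; rewrite !ffunE /= addn0 (eq_sym L I) (eq_sym L J).
Qed.

Lemma inC1 (v : VS s) : @inC N s [ffun t => vco v t].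
Proof.
have [i [j [ad ->]]] := vsP s_gt0 n_ge2 v.
have key (i' j' : 'I_N) : (i' < j')%N -> @inC N s [ffun t => vco (vs i' j') t].
  move=> lt; apply: Or31; exists i', j'; split=> //; apply/ffunP => t; rewrite !ffunE.
  have ne : i' != j' by rewrite -(inj_eq val_inj) ltn_eqF.
  rewrite vsE ?adm_neq // !inE; case: (eqVneq t i') => [->|_] //=.
  by rewrite (negPf ne).
have [lt|gt|/val_inj e] := ltngtP i j; first exact: key.
  by rewrite vs_sym; apply: key.
apply: Or32; exists i; split; first by move: ad; rewrite /Blocks.adm e eqxx.
by apply/ffunP => t; rewrite !ffunE vsE // -e; case: eqVneq.
Qed.

Lemma inC4 (a b c d : 'I_N) : uniq [:: a; b; c; d] ->
  @inC N s [ffun t => nat_of_bool (t \in [:: a; b; c; d])].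
Proof.
pose Q (a b c d : 'I_N) := uniq [:: a; b; c; d] ->
  @inC N s [ffun t => nat_of_bool (t \in [:: a; b; c; d])].
apply: (@tuple_sorted N Q) => {a b c d} [a b c d|a b c d|a b c d|a c d|a b c d ab bc cd]; rewrite /Q => {Q}.
- move=> h u; rewrite (_ : [ffun t => _] = [ffun t => nat_of_bool (t \in [:: a; b; c; d])]).
    by apply: h; move: u; rewrite /= !inE !negb_or (eq_sym b a) => /and4P [/and3P [-> -> ->] /andP [-> ->] -> _].
  by apply/ffunP => t; rewrite !ffunE !inE orbCA.
- move=> h u; rewrite (_ : [ffun t => _] = [ffun t => nat_of_bool (t \in [:: a; b; c; d])]).
    by apply: h; move: u; rewrite /= !inE !negb_or (eq_sym c b) => /and4P [/and3P [-> -> ->] /andP [-> ->] -> _].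
  by apply/ffunP => t; rewrite !ffunE !inE; congr (nat_of_bool (_ || _)); rewrite orbCA.
- move=> h u; rewrite (_ : [ffun t => _] = [ffun t => nat_of_bool (t \in [:: a; b; c; d])]).
    by apply: h; move: u; rewrite /= !inE !negb_or (eq_sym d c) => /and4P [/and3P [-> -> ->] /andP [-> ->] -> _].
  by apply/ffunP => t; rewrite !ffunE !inE; congr (nat_of_bool (_ || (_ || _))); rewrite orbC.
- by rewrite /= inE eqxx.
- by move=> _; apply: Or33; exists a, b, c, d.
Qed.

Definition mkC (w : {ffun 'I_N -> nat}) (h : @inC N s w) : Cset s :=
  exist (fun w => is_true `[< @inC N s w >]) w (asboolT h).

Definition mkG (w : Cset s) m (h : inG (sval w) m) : Gset w :=
  exist (fun m => is_true `[< inG (sval w) m >]) m (asboolT h).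

Definition W1 (v : VS s) : Cset s := mkC (inC1 v).
Definition W4 (a b c d : 'I_N) (u : uniq [:: a; b; c; d]) : Cset s := mkC (inC4 u).

Lemma M1P (I : idx2 s) : inG (sval (W1 (vI I))) (d1 I).
Proof. by apply: inG_d1 => t; rewrite ffunE. Qed.

Definition M1 (I : idx2 s) : Gset (W1 (vI I)) := mkG (M1P I).

Lemma sum_mem4 (a b c d : 'I_N) : uniq [:: a; b; c; d] ->
  (\sum_t (t \in [:: a; b; c; d]) = 4)%N.
Proof.
move=> u; have <- : #|[:: a; b; c; d]| = 4%N by rewrite (card_uniqP u).
rewrite -sum1_card [RHS]big_mkcond /=; apply: eq_bigr => t _.
by case: (t \in _).
Qed.

Lemma W4_deg (a b c d : 'I_(tot s)) (u : uniq [:: bl a; bl b; bl c; bl d]) v v' :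
  (forall t, nat_of_bool (t \in [:: bl a; bl b; bl c; bl d]) = (vco v t + vco v' t)%N) <->
  (v, v') \in six (vv a b) (vv c d) (vv a c) (vv b d) (vv a d) (vv b c).
Proof.
pose L := six (vv a b) (vv c d) (vv a c) (vv b d) (vv a d) (vv b c).
split.
  have [i [j [ij ->]]] := vsP s_gt0 n_ge2 v; have [k [l [kl ->]]] := vsP s_gt0 n_ge2 v'.
  move=> h; have h' t : (nat_of_bool (t \in [:: bl a; bl b; bl c; bl d]) = (t == i) + (t == j) + ((t == k) + (t == l)))%N.
    by rewrite h !vsE.
  have sb : {subset [:: i; j; k; l] <= [:: bl a; bl b; bl c; bl d]}.
    by move=> t; rewrite !inE => /or4P [] e; have := h' t; rewrite e !inE; case: (_ || _) => //; rewrite ?addnS.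
  have ne (x y : bool) n : nat_of_bool (x && y) = n -> (1 < n)%N -> False by case: (x && y) => <-.
  have lt1 t : ((t == i) + (t == j) + ((t == k) + (t == l)) <= 1)%N by rewrite -h' leq_b1.
  have ui : uniq [:: i; j; k; l].
    rewrite /= !inE !negb_or !andbT; have := lt1 i; have := lt1 j; have := lt1 k; rewrite !eqxx.
    rewrite (eq_sym j i) (eq_sym k i) (eq_sym k j).
    by case: (i == j); case: (i == k); case: (i == l); case: (j == k); case: (j == l); case: (k == l).
  apply: (@pairing_cases _ (fun i j k l => (vs i j, vs k l) \in L) _ _ _ _ i j k l _ _ ui sb).
  - by move=> i' j' k' l'; rewrite (vs_sym _ _ j' i').
  - by move=> i' j' k' l'; exact: mem6_swap.
  - by rewrite /L mem_head.
  - by rewrite /L in_cons mem_head orbT.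
  - by rewrite /L; exact: six_3.
move=> h t; move: (u); rewrite /= !inE !negb_or => /and4P [/and3P [ab ac ad] /andP [bc bd] cd _].
have N0 (x y z w : bool) : ~~ (x && y) -> ~~ (x && z) -> ~~ (x && w) -> ~~ (y && z) -> ~~ (y && w) -> ~~ (z && w) ->
  (nat_of_bool [|| x, y, z | w] = x + y + (z + w))%N by case: x; case: y; case: z; case: w.
have E (x y : 'I_N) : x != y -> ~~ ((t == x) && (t == y)).
  by move=> xy; apply: contra xy => /andP [/eqP <-].
rewrite (N0 (t == bl a)) ?E //.
have L4 (x y z w : nat) : [/\ (x + z + (y + w) = x + y + (z + w))%N, (x + w + (y + z) = x + y + (z + w))%N,
    (z + w + (x + y) = x + y + (z + w))%N, (y + w + (x + z) = x + y + (z + w))%N & (y + z + (x + w) = x + y + (z + w))%N].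
  by clear; split; lia.
have [e1 e2 e3 e4 e5] := L4 (t == bl a) (t == bl b) (t == bl c) (t == bl d).
have V x y : bl x != bl y -> vco (vv x y) t = ((t == bl x) + (t == bl y))%N.
  by move=> xy; apply: vsE; exact: adm_neq.
have [v1 v2 v3] := And3 (V _ _ ab) (V _ _ cd) (V _ _ ac).
have [v4 v5 v6] := And3 (V _ _ bd) (V _ _ ad) (V _ _ bc).
move: v1 v2 v3 v4 v5 v6 (six_cases h) => v1 v2 v3 v4 v5 v6; clear h V.
move: (vv a b) (vv c d) (vv a c) (vv b d) (vv a d) (vv b c) v1 v2 v3 v4 v5 v6 => x1 x2 x3 x4 x5 x6 v1 v2 v3 v4 v5 v6.
by move=> [] [] [-> ->]; rewrite ?v1 ?v2 ?v3 ?v4 ?v5 ?v6 ?e1 ?e2 ?e3 ?e4 ?e5.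
Qed.

(** The coordinates of [w] sum to 2 or 4 and each variable accounts for 2, so the monomials are
    single variables of one degree, or products of two variables realising a pairing of four
    distinct blocks. *)
Lemma G_struct (w : Cset s) :
  (exists v : VS s, sval w = [ffun t => vco v t] /\ forall m : Gset w, exists I, sval m = d1 I /\ vI I = v) \/
  (exists a b c d : 'I_(tot s), exists u : uniq [:: bl a; bl b; bl c; bl d],
     w = W4 u /\ forall m : Gset w, exists I J, sval m = d2 I J /\
       (vI I, vI J) \in six (vv a b) (vv c d) (vv a c) (vv b d) (vv a d) (vv b c)).
Proof.
have one (v : VS s) : sval w = [ffun t => vco v t] ->
  exists v, sval w = [ffun t => vco v t] /\ forall m : Gset w, exists I, sval m = d1 I /\ vI I = v.
  move=> e; exists v; split=> // -[m /= /asboolP hm].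
  have [|I [em ei]] := inG1 _ hm; first by rewrite e; under eq_bigr => t _ do rewrite ffunE; exact: vco_sum.
  by exists I; split=> //; apply: vcoP => t; rewrite -ei e ffunE.
have : inC s (sval w) by have := svalP w; move=> /asboolP.
case=> [[i [j [ij e]]]|[i [si e]]|[a [b [c [d [[ab bc cd] e]]]]]].
- left; apply: (one (vs i j)); rewrite e; apply/ffunP => t; rewrite !ffunE.
  have ne : i != j by rewrite -(inj_eq val_inj) ltn_eqF.
  rewrite vsE ?adm_neq // !inE; case: (eqVneq t i) => [->|_] //=.
  by rewrite (negPf ne).
- left; apply: (one (vs i i)); rewrite e; apply/ffunP => t; rewrite !ffunE vsE ?/Blocks.adm ?si ?orbT //.
  by case: eqVneq.
- right; have [a' ha] := bl_surj a; have [b' hb] := bl_surj b.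
  have [c' hc] := bl_surj c; have [d' hd] := bl_surj d; exists a', b', c', d'.
  have u : uniq [:: bl a'; bl b'; bl c'; bl d'].
    rewrite ha hb hc hd /= !inE !negb_or -!(inj_eq val_inj) /= !andbT; lia.
  exists u; have ew : w = W4 u by apply: val_inj; rewrite /= e ha hb hc hd.
  split=> // -[m /= /asboolP hm].
  have [|I [J [em ei]]] := inG2 _ hm.
    by rewrite ew /=; under eq_bigr => t _ do rewrite ffunE; exact: sum_mem4.
  exists I, J; split=> //; apply/(W4_deg u) => t; by rewrite -ei ew /= ffunE.
Qed.

Definition Gdeg (w : Cset s) : chr -> Prop := fun g => exists m : Gset w, g = degm (sval m).

Lemma Gdeg4 a b c d (u : uniq [:: bl a; bl b; bl c; bl d]) g :
  Gdeg (W4 u) g <-> pairs3 a b c d g.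
Proof.
split=> [[[m /= /asboolP hm] ->]|].
  have [|I [J [-> ei]]] := inG2 _ hm.
    by under eq_bigr => t _ do rewrite ffunE; exact: sum_mem4.
  have : (vI I, vI J) \in six (vv a b) (vv c d) (vv a c) (vv b d) (vv a d) (vv b c).
    by apply/(W4_deg u) => t; rewrite -ei ffunE.
  rewrite degm_d2 => /six_cases h; suff : pd (vI I) (vI J) \in [:: pd (vv a b) (vv c d); pd (vv a c) (vv b d); pd (vv a d) (vv b c)] by [].
  have m3 (T : eqType) (x1 x2 x3 : T) : [/\ x1 \in [:: x1; x2; x3], x2 \in [:: x1; x2; x3] & x3 \in [:: x1; x2; x3]].
    by rewrite !inE !eqxx !orbT.
  have [k1 k2 k3] := m3 _ (pd (vv a b) (vv c d)) (pd (vv a c) (vv b d)) (pd (vv a d) (vv b c)).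
  by case: h => [] [] [-> ->] //; rewrite pdC.
have key v v' : (v, v') \in six (vv a b) (vv c d) (vv a c) (vv b d) (vv a d) (vv b c) -> Gdeg (W4 u) (pd v v').
  move=> /(W4_deg u) h; have [I eI] := idx_ex v; have [J eJ] := idx_ex v'.
  have hG : inG (sval (W4 u)) (d2 I J) by apply: inG_d2 => t; rewrite ffunE h eI eJ.
  by exists (mkG hG); rewrite /= degm_d2 eI eJ.
rewrite /ReducedRelations.pairs3 !inE => /or3P [] /eqP ->; apply: key.
- exact: mem_head.
- by rewrite /six in_cons mem_head orbT.
- exact: six_3.
Qed.

Lemma Gdeg_base (K : realType) (P : {set {set VS s}}) w : paving K P -> exists g0, base K P (Gdeg w) g0.
Proof.
move=> hP; case: (G_struct w) => [[v [e h]]|[a [b [c [d [u [-> _]]]]]]].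
  have [I eI] := idx_ex v; have hG : inG (sval w) (d1 I) by apply: inG_d1 => t; rewrite e ffunE eI.
  exists (delta v); split; first by exists (mkG hG); rewrite /= degm_d1 eI.
  by move=> g [m ->]; have [J [-> eJ]] := h m; rewrite degm_d1 eJ subrr; exact: dualcone0.
have ub : uniq [:: a; b; c; d] by apply: (@map_uniq _ _ (@bl _ s)).
have [g0 [h1 h2]] := base3 s_gt0 n_ge2 hP ub.
by exists g0; split=> [|g hg]; [apply/Gdeg4|apply/h2/Gdeg4; exact: hg].
Qed.

Lemma G_size (w : Cset s) : exists k, forall m : Gset w, (\sum_I sval m I = k)%N.
Proof.
have sz (I : idx2 s) : (\sum_J (J == I) = 1)%N.
  by rewrite (bigD1 I) //= eqxx big1 // => J /negPf ->.
case: (G_struct w) => [[v [e h]]|[a [b [c [d [u [e h]]]]]]].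
  by exists 1%N => m; have [I [-> _]] := h m; under eq_bigr => J _ do rewrite ffunE; exact: sz.
exists 2%N => m; have [I [J [-> _]]] := h m; under eq_bigr => L _ do rewrite ffunE.
by rewrite big_split /= !sz.
Qed.

End GSets.
End MonomialSets.

(** * The relation theta and its invariance *)

Module Correspondence.
Import ZariskiCovers SheafGluing Blocks AffineCharts Cells CellHulls PointwiseClosure PavingQuads HeightUltrametric UltrametricTree DualCones ReducedRelations ChartEquations MonomialSets.
Import numFieldTopology.Exports.
Local Opaque delta.

(** The nested covers of the inductive definition collapse to a single one by [locp_trans]. *)
Lemma loc_eq_locp (F : zfun) (R : comUnitRingType) (a b : F R) : loc_eq a b ->
  locp (fun T (c : {rmorphism R -> T}) => zeq (zres c a) (zres c b)).
Proof.
elim=> {R a b} [R a b h|R a b f uf _ IH]; first by apply: locp_all => T c; exact: zres_eq.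
apply: locp_trans.
  move=> T c d cd h; have e : (d : R -> T) =1 idfun \o c by move=> r; rewrite /= cd.
  apply: zeq_trans (zres_comp (c := c) (d := idfun) a e) _; apply: zeq_sym.
  apply: zeq_trans (zres_comp (c := c) (d := idfun) b e) _; apply: zeq_sym.
  exact: zres_eq.
exists f => // T c cf; apply: locp_imp (IH T c cf) => U d h.
apply: zeq_trans (zres_comp (c := c) (d := d) a _) _ => //; apply: zeq_sym.
by apply: zeq_trans (zres_comp (c := c) (d := d) b _) _ => //; apply: zeq_sym.
Qed.

Section Theta.
Variables (N : nat) (s : 'I_N -> nat).
Hypotheses (s_gt0 : forall t, (0 < s t)%N) (n_ge2 : (2 <= \sum_(t < N) s t)%N).
Variable K : realType.
Notation vs := (vs s_gt0 n_ge2).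
Notation vI := (vI s_gt0 n_ge2).
Notation vv := (vv s_gt0 n_ge2).
Notation pairs3 := (pairs3 s_gt0 n_ge2).
Notation plE := (plE s_gt0 n_ge2).
Notation RP := (RP s_gt0 n_ge2).
Notation degm := (degm s_gt0 n_ge2).
Notation Gdeg := (Gdeg s_gt0 n_ge2).
Notation base := (base K).
Notation chr := {ffun VS s -> int}.

Definition theta (R : comUnitRingType) (z : tpt s K R) (x : idx2 s -> R)
    (y : forall w : Cset s, Gset w -> R) : Prop :=
  forall w, exists a g0, [/\ a \is a GRing.unit, base (tp_pav z) (Gdeg w) g0 &
    forall m : Gset w, y w m = a * tp_val z (degm (sval m) - g0) * mono x (sval m)].

Lemma theta_rebase R (z : tpt s K R) x y w g1 : theta z x y -> base (tp_pav z) (Gdeg w) g1 ->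
  exists2 a, a \is a GRing.unit &
    forall m : Gset w, y w m = a * tp_val z (degm (sval m) - g1) * mono x (sval m).
Proof.
move=> /(_ w) [a [g0 [ua b0 h]]] b1; have [c uc hc] := base_change b0 b1.
exists (a * c); first by rewrite unitrM ua.
by move=> m; rewrite h (hc (degm (sval m))) ?mulrA //; exists m.
Qed.

Lemma theta_uniq R (z : tpt s K R) x y y' : theta z x y -> theta z x y' ->
  forall w, exists2 u, u \is a GRing.unit & forall m, y' w m = u * y w m.
Proof.
move=> h h' w; have [g0 b0] := Gdeg_base s_gt0 n_ge2 w (tp_ok z).
have [a ua ha] := theta_rebase h b0; have [a' ua' ha'] := theta_rebase h' b0.
exists (a' / a); first by rewrite unitrM ua' unitrV.
by move=> m; rewrite ha ha' !mulrA divrK.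
Qed.

(** [z'] is the same point of the toric variety seen in a smaller chart; elementary gluing of two
    points passes through a common such [z']. *)
Definition tsub R (z z' : tpt s K R) : Prop :=
  (closure (cone (tp_pav z') : set {ptws VS s -> K}) `<=` closure (cone (tp_pav z)))%classic /\
  forall m, dualcone K (tp_pav z) m -> tp_val z' m = tp_val z m.

Lemma tglue_tsub R (z z' : tpt s K R) : tglue z z' -> exists z'', tsub z z'' /\ tsub z' z''.
Proof.
move=> [z'' [e h1 h2]]; exists z''; split; split=> //; rewrite e; [exact: subIsetl|exact: subIsetr].
Qed.

(** A least degree for a cone stays least for a smaller cone, and the two points agree on the
    differences of degrees involved. *)
Lemma theta_sub R (z z' : tpt s K R) x y : tsub z z' -> theta z x y <-> theta z' x y.
Proof.
move=> [cl hv]; split=> h w; have [g0 b0] := Gdeg_base s_gt0 n_ge2 w (tp_ok z).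
  have [a ua ha] := theta_rebase h b0; exists a, g0; split=> //; first exact: base_sub b0.
  by move=> m; rewrite ha hv //; case: b0 => _; apply; exists m.
have [a ua ha] := theta_rebase h (base_sub cl b0); exists a, g0; split=> // m.
by rewrite ha hv //; case: b0 => _; apply; exists m.
Qed.

Lemma plE_eq (R : comUnitRingType) h h' (x : idx2 s -> R) a b c d :
  (forall v w, pairs3 a b c d (pd v w) -> h v w = h' v w) -> plE h x a b c d = plE h' x a b c d.
Proof. by move=> e; rewrite -[RHS]mul1r; apply: plE_scale => v w hp; rewrite mul1r e. Qed.

Lemma sorted_uniq (a b c d : 'I_(tot s)) : (a < b)%N -> (b < c)%N -> (c < d)%N -> uniq [:: a; b; c; d].
Proof. by move=> ab bc cd; rewrite /= !inE !negb_or -!(inj_eq val_inj) /=; lia. Qed.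

Lemma RP_sub R (z z' : tpt s K R) x : tsub z z' -> RP z x <-> RP z' x.
Proof.
move=> [cl hv]; split=> h; apply: RP_sorted => a b c d ab bc cd.
  have [g0 b0] := base3 s_gt0 n_ge2 (tp_ok z) (sorted_uniq ab bc cd).
  exists g0, 1; split; [exact: base_sub b0|exact: unitr1|].
  rewrite mul1r -(h _ _ _ _ _ b0); apply: plE_eq => v w hp; apply: hv.
  by case: b0 => _; apply.
have [g0 b0] := base3 s_gt0 n_ge2 (tp_ok z) (sorted_uniq ab bc cd).
exists g0, 1; split; [exact: b0|exact: unitr1|].
rewrite mul1r -(h _ _ _ _ _ (base_sub cl b0)); apply: plE_eq => v w hp; apply/esym/hv.
by case: b0 => _; apply.
Qed.

(** Equality of toric points is generated by gluing, so invariance need only be checked along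
    [tsub]. *)
Lemma teq_inv R (z z' : tpt s K R) x (Q : tpt s K R -> Prop) :
  (forall z z', tsub z z' -> Q z <-> Q z') -> teq z z' -> (Q z <-> Q z') /\ (RP z x <-> RP z' x).
Proof.
move=> HQ; elim=> {z z'} [z z'|z|z z' _ [h1 h2]|z z' z'' _ [h1 h2] _ [k1 k2]].
- by move=> /tglue_tsub [t [h1 h2]]; rewrite (HQ _ _ h1) (HQ _ _ h2) (RP_sub x h1) (RP_sub x h2).
- by [].
- by rewrite h1 h2.
- by rewrite h1 k1 h2 k2.
Qed.

Lemma theta_teq R (z z' : tpt s K R) x y : teq z z' -> theta z x y <-> theta z' x y.
Proof. by move=> h; case: (@teq_inv R z z' x (fun z => theta z x y) _ h) => // t t'; exact: theta_sub. Qed.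

Lemma RP_teq R (z z' : tpt s K R) x : teq z z' -> RP z x <-> RP z' x.
Proof. by move=> h; case: (@teq_inv R z z' x (fun=> True) _ h). Qed.

Lemma ext_scale (R : comUnitRingType) (f : VS s -> R) (x : idx2 s -> R) a b :
  ext (fun I => f (vI I) * x I) a b = f (vv a b) * ext x a b.
Proof.
have [->|ab] := eqVneq a b; first by rewrite !ext_aa mulr0.
have [I [eI [e he]]] := @idx2_ext _ _ s_gt0 n_ge2 a b ab.
by rewrite !he eI mulrCA.
Qed.

Lemma theta_scale R (z : tpt s K R) x x' y u : u \is a GRing.unit -> (forall I, x' I = u * x I) ->
  theta z x y -> theta z x' y.
Proof.
move=> uu e h w; have [k hk] := G_size s_gt0 n_ge2 w; have [a [g0 [ua b0 ha]]] := h w.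
exists (a * u ^- k), g0; split=> //; first by rewrite unitrM ua unitrV unitrX.
move=> m; rewrite ha; have -> : mono x' (sval m) = u ^+ k * mono x (sval m).
  rewrite -(hk m) /mono -prodrXr -big_split; apply: eq_bigr => I _; rewrite e exprMn; congr (_ * _).
by rewrite mulrA; congr (_ * _); rewrite mulrAC divrK ?unitrX.
Qed.

Lemma RP_scale R (z : tpt s K R) x x' u : (forall I, x' I = u * x I) -> RP z x -> RP z x'.
Proof.
move=> e h a b c d g0 b0; have -> : x' = (fun I => (fun=> u) (vI I) * x I) by apply/funext.
rewrite /ReducedRelations.plE !ext_scale; have := h _ _ _ _ _ b0; rewrite /ReducedRelations.plE => e0.
by rewrite -(mulr0 (u * u)) -e0; ring.
Qed.

Lemma wscaleE (R : comUnitRingType) (mu : torus s R) I : wscale mu I = proj1_sig mu (vI I).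
Proof. by rewrite /wscale (big_pred1 (vI I)) // => v; rewrite (inI_vI s_gt0 n_ge2). Qed.

Lemma chareval_delta (R : comUnitRingType) (mu : torus s R) v : chareval mu (delta v) = proj1_sig mu v.
Proof.
rewrite /chareval (bigD1 v) //= deltaE eqxx expr1z big1 ?mulr1 // => w /negPf nw.
by rewrite deltaE nw expr0z.
Qed.

Lemma charevalN (R : comUnitRingType) (mu : torus s R) m : chareval mu (- m) * chareval mu m = 1.
Proof. by rewrite -charevalD addNr chareval0. Qed.

Lemma chareval_unit (R : comUnitRingType) (mu : torus s R) m : chareval mu m \is a GRing.unit.
Proof. by apply/unitrP; exists (chareval mu (- m)); rewrite charevalN mulrC charevalN. Qed.

Lemma chareval_pd (R : comUnitRingType) (mu : torus s R) v w :
  chareval mu (pd v w) = proj1_sig mu v * proj1_sig mu w.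
Proof. by rewrite -(chareval_delta mu v) -(chareval_delta mu w) -charevalD pd.unlock. Qed.

Lemma mono_wact (R : comUnitRingType) (mu : torus s R) (x : idx2 s -> R) m :
  mono (fun I => wscale mu I * x I) m = chareval mu (degm m) * mono x m.
Proof.
have -> : chareval mu (degm m) = \prod_I proj1_sig mu (vI I) ^+ m I.
  rewrite /MonomialSets.degm (big_morph (chareval mu) (charevalD mu) (chareval0 mu)).
  apply: eq_bigr => I _; rewrite -chareval_delta; move: (delta _) => dl; elim: (m I) => [|n IH].
    by rewrite mulr0n chareval0.
  by rewrite mulrS exprS charevalD IH.
rewrite /mono -big_split; apply: eq_bigr => I _ /=.
by rewrite wscaleE exprMn.
Qed.

Lemma charevalB3 (R : comUnitRingType) (mu : torus s R) (g g0 : chr) :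
  chareval mu (- (g - g0)) * chareval mu g = chareval mu g0.
Proof. by rewrite -charevalD; congr (chareval mu _); ffring. Qed.

(** The action multiplies a monomial by the character of its degree and the coefficient by the
    inverse character of the degree difference; what remains depends only on the least degree and is
    absorbed in the unit. *)
Lemma theta_torus R (z : tpt s K R) x y (mu : torus s R) : theta z x y ->
  theta (tact mu z) (fun I => wscale mu I * x I) y.
Proof.
move=> h w; have [a [g0 [ua b0 ha]]] := h w.
exists (a * chareval mu (- g0)), g0; split=> //; first by rewrite unitrM ua chareval_unit.
move=> m; rewrite ha mono_wact /=; move: (degm (sval m)) => g.
transitivity (a * (chareval mu (- g0) * (chareval mu (- (g - g0)) * chareval mu g)) *
  tp_val z (g - g0) * mono x (sval m)); last by ring.
by rewrite charevalB3 charevalN mulr1.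
Qed.

Lemma RP_torus R (z : tpt s K R) x (mu : torus s R) : RP z x ->
  RP (tact mu z) (fun I => wscale mu I * x I).
Proof.
move=> h a b c d g0 b0; have := h a b c d g0 b0.
have -> : (fun I => wscale mu I * x I) = (fun I => proj1_sig mu (vI I) * x I).
  by apply/funext => I; rewrite wscaleE.
rewrite /ReducedRelations.plE !ext_scale /=.
have E v w : chareval mu (- (pd v w - g0)) * tp_val z (pd v w - g0) * (proj1_sig mu v * proj1_sig mu w)
    = chareval mu g0 * tp_val z (pd v w - g0).
  by rewrite -chareval_pd mulrAC charevalB3.
move=> e0.
have T v w p q : chareval mu (- (pd v w - g0)) * tp_val z (pd v w - g0) *
   (proj1_sig mu v * p * (proj1_sig mu w * q)) = chareval mu g0 * (tp_val z (pd v w - g0) * (p * q)).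
  by rewrite (mulrA (chareval mu g0)) -E; ring.
by rewrite !T -mulrBr -mulrDr e0 mulr0.
Qed.

Lemma ext_map (R T : comUnitRingType) (c : {rmorphism R -> T}) (x : idx2 s -> R) a b :
  ext (c \o x) a b = c (ext x a b).
Proof. by rewrite /ext; case: insub => //; case: insub => [J|]; rewrite ?rmorph0 ?rmorphN. Qed.

Lemma plE_map (R T : comUnitRingType) (c : {rmorphism R -> T}) h (x : idx2 s -> R) a b a' b' :
  plE (fun v w => c (h v w)) (c \o x) a b a' b' = c (plE h x a b a' b').
Proof. by rewrite /ReducedRelations.plE !ext_map rmorphD rmorphB !rmorphM. Qed.

Lemma RP_res (R T : comUnitRingType) (c : {rmorphism R -> T}) (z : tpt s K R) x :
  RP z x -> RP (tres c z) (c \o x).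
Proof. by move=> h a b a' b' g0 b0; rewrite plE_map h ?rmorph0. Qed.

Lemma RP_local (R : comUnitRingType) (z : tpt s K R) x f : unit_ideal f ->
  (forall (T : comUnitRingType) (c : {rmorphism R -> T}), in_cover f c -> RP (tres c z) (c \o x)) -> RP z x.
Proof.
move=> uf h a b a' b' g0 b0; apply: (local0 uf) => T c cf.
by rewrite -plE_map; exact: (h T c cf).
Qed.

Lemma RP_loc (R : comUnitRingType) (z z' : toric_pre s K R) : loc_eq z z' -> forall x, RP z x -> RP z' x.
Proof.
elim=> {R z z'} [R z z' h|R z z' f uf _ IH] x hx; first by apply/(RP_teq x h).
by apply: (RP_local uf) => T c cf; apply: IH => //; exact: RP_res.
Qed.

Lemma RP_locx (R : comUnitRingType) (x x' : wedge_pre s R) : loc_eq x x' ->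
  forall z : tpt s K R, RP z (proj1_sig x) -> RP z (proj1_sig x').
Proof.
elim=> {R x x'} [R x x' [u uu h]|R x x' f uf _ IH] z hz; first exact: RP_scale h hz.
by apply: (RP_local uf) => T c cf; apply: (IH T c cf); exact: RP_res.
Qed.

(** The condition quantifies over all representatives of all restrictions; these are locally equal
    to the given ones, and the reduced relations are invariant under local equality. *)
Lemma omega_pt_zunit (R : comUnitRingType) (z : toric_pre s K R) (x : wedge_pre s R) :
  RP z (proj1_sig x) -> @omega_pt _ s K R (zunit z, zunit x).
Proof.
move=> h T c z' x' hz hx; apply/(RP_chart s_gt0 n_ge2).
have hz' : loc_eq (zres c z) z'.
  by apply: loc_eq_zunit; apply: zeq_trans hz; apply: zeq_sym; exact: zunit_res.
have hx' : loc_eq (zres c x) x'.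
  by apply: loc_eq_zunit; apply: zeq_trans hx; apply: zeq_sym; exact: zunit_res.
by apply: (RP_locx hx'); apply: (RP_loc hz'); exact: RP_res.
Qed.

Lemma omega_pt_RP (R : comUnitRingType) (p : Omega s K R) (z : toric_pre s K R) (x : wedge_pre s R) :
  zeq (proj1_sig p).1 (zunit z) -> zeq (proj1_sig p).2 (zunit x) -> RP z (proj1_sig x).
Proof.
move=> hz hx; apply/(RP_chart s_gt0 n_ge2); apply: (proj2_sig p R idfun z x).
  by apply: zeq_trans hz; apply: zres_id.
by apply: zeq_trans hx; apply: zres_id.
Qed.

Lemma theta_res (R T : comUnitRingType) (c : {rmorphism R -> T}) (z : tpt s K R) x y :
  theta z x y -> theta (tres c z) (c \o x) (fun w m => c (y w m)).
Proof.
move=> h w; have [a [g0 [ua b0 ha]]] := h w; exists (c a), g0; split=> //; first exact: rmorph_unit.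
move=> m; rewrite ha !rmorphM; congr (_ * _); rewrite /mono rmorph_prod.
by apply: eq_bigr => I _; rewrite rmorphXn.
Qed.

End Theta.
End Correspondence.

(** * Forms vanishing on the image, and lifts along chains of balls *)

Module InteriorForms.
Import ZariskiCovers SheafGluing Blocks AffineCharts Cells CellHulls PointwiseClosure PavingQuads HeightUltrametric UltrametricTree DualCones ReducedRelations ChartEquations MonomialSets Correspondence.
Import numFieldTopology.Exports.
Local Opaque delta.

Section Forms.
Variables (W : eqType) (J : W -> Type).

(** Each group of variables has a fixed degree, placed as an exponent on one chosen variable of the
    group so that the scaling factor becomes a product over the variables. *)
Lemma mf_scale (f : mform J) : exists e : 'I_(mf_n f) -> nat,
  forall (R : comUnitRingType) (u : W -> R) (y y' : mcoords J R),
    (forall w j, y' w j = u w * y w j) ->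
    mf_eval f y' = (\prod_i u (tag (mf_var i)) ^+ e i) * mf_eval f y.
Proof.
pose tg (i : 'I_(mf_n f)) := tag (mf_var i).
have [d hd] : exists d : 'I_(mf_n f) -> nat, forall j m, m \in msupp (mf_pol f) ->
    (\sum_(i | tg i == tg j) m i)%N = d j.
  exists (fun j => projT1 (cid (mf_hom f (tg j)))) => j m hm.
  exact: (projT2 (cid (mf_hom f (tg j))) m hm).
pose r (i : 'I_(mf_n f)) := odflt i [pick j | tg j == tg i].
have rt i : tg (r i) = tg i by rewrite /r; case: pickP => [j /eqP|] //=.
have rE i j : tg i = tg j -> r i = r j.
  move=> e; rewrite /r e; case: pickP => // /(_ j); by rewrite eqxx.
exists (fun j => if r j == j then d j else 0%N) => R u y y' h.
rewrite /mf_eval /mmap mulr_sumr [LHS]big_seq [RHS]big_seq; apply: eq_bigr => m hm.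
rewrite mulrCA; congr (_ * _); rewrite /mmap1.
rewrite [LHS](eq_bigr (fun i : 'I_(mf_n f) => u (tag (mf_var i)) ^+ m i * y _ (tagged (mf_var i)) ^+ m i)) => [|i _]; last by rewrite h exprMn.
rewrite big_split /=; congr (_ * _).
rewrite [LHS](partition_big r xpredT) //=; apply: eq_bigr => j _.
case: eqP => [rj|rj]; last first.
  by rewrite big_pred0 ?expr0 // => i; apply/eqP => e; apply: rj; rewrite -e; apply: rE; rewrite rt.
rewrite -(hd j m hm) -prodrXr; apply: eq_big => [i|i /eqP e].
  apply/eqP/eqP => [e|/rE e]; [rewrite -(rt i) e; by rewrite -{1}rj rt|by rewrite e].
by rewrite -/(tg i) -(rt i) e.
Qed.

Lemma mf_map (f : mform J) (R T : comUnitRingType) (c : {rmorphism R -> T}) (y : mcoords J R) :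
  mf_eval f (fun w j => c (y w j)) = c (mf_eval f y).
Proof.
rewrite /mf_eval /mmap rmorph_sum; apply: eq_bigr => m _.
rewrite rmorphM rmorph_int; congr (_ * _); rewrite /mmap1 rmorph_prod.
by apply: eq_bigr => i _; rewrite rmorphXn.
Qed.

End Forms.

Lemma poly_eval (V : finType) (T : comUnitRingType) (f : V -> T) :
  exists phi : {rmorphism {mpoly int[#|V|]} -> T}, forall v, phi 'X_(enum_rank v) = f v.
Proof.
exists (mmap (intmul (1 : T)) (fun i => f (enum_val i))) => v /=.
by rewrite mmapX mmap1U enum_rankK.
Qed.

Section Interior.
Variables (N : nat) (s : 'I_N -> nat).
Hypotheses (s_gt0 : forall t, (0 < s t)%N) (n_ge2 : (2 <= \sum_(t < N) s t)%N).

Lemma Gset_ex (w : Cset s) : exists m : Gset w, True.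
Proof.
case: (G_struct s_gt0 n_ge2 w) => [[v [e _]]|[a [b [c [d [u [-> _]]]]]]].
  have [I eI] := idx_ex s_gt0 n_ge2 v; have hG : inG (sval w) (d1 I) by apply: (@inG_d1 _ _ s_gt0 n_ge2) => t; rewrite e ffunE eI.
  by exists (mkG hG).
have [|m _] := (Gdeg4 s_gt0 n_ge2 u (pd (vv s_gt0 n_ge2 a b) (vv s_gt0 n_ge2 c d))).2.
  by rewrite /pairs3 mem_head.
by exists m.
Qed.

(** Where all Pluecker coordinates are nonzero, the monomials themselves define a point of the
    graph, hence of its closure. *)
Lemma mf_vanish_interior (f : mform (@Gset N s)) (F : fieldType) (z : idx2 s -> F) :
  mf_vanish (@imageM N s) f -> pluecker (fun _ _ => 1) z -> (forall I, z I != 0) ->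
  mf_eval f (fun w (m : Gset w) => mono z (sval m)) = 0.
Proof.
move=> H pl z0; apply: H; exists z.
pose y0 := fun o : option (Cset s) => match o return Jgraph o -> F with
  | None => z | Some w => fun m => mono z (sval m) end.
have mz m : mono z m != 0 by apply/prodf_neq0 => I _; rewrite expf_neq0.
have nz : nzcoords y0.
  move=> [w|]; first by have [m _] := Gset_ex w; exists m; exact: mz.
  have [[i j] /= ad] := adm_ex s_gt0 n_ge2; have [I _] := idx_ex s_gt0 n_ge2 (vs s_gt0 n_ge2 i j).
  by exists I; exact: z0.
split=> // g hg; apply: hg; split=> // w; exists 1; first exact: oner_neq0.
by move=> m; rewrite mul1r.
Qed.

(** The form is read as a form on the ambient space of the graph in which the Pluecker variables do
    not occur, and so vanishes on the closure. *)
Lemma mf_vanish_graph (f : mform (@Gset N s)) : 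
  (forall (F : fieldType) (z : idx2 s -> F) (y : mcoords (@Gset N s) F),
     pluecker (fun _ _ => 1) z ->
     (forall w, exists2 a, a != 0 & forall m : Gset w, y w m = a * mono z (sval m)) ->
     mf_eval f y = 0) ->
  mf_vanish (@imageM N s) f.
Proof.
move=> H F y [z [_ hz]].
pose J' := @Jgraph N s.
pose var (i : 'I_(mf_n f)) : {o & J' o} := existT J' (Some (tag (mf_var i))) (tagged (mf_var i)).
have hom : forall o, exists d : nat, forall m, m \in msupp (mf_pol f) ->
    (\sum_(i < mf_n f | tag (var i) == o) m i)%N = d.
  move=> [w|]; last by exists 0%N => m _; rewrite big_pred0.
  have [d hd] := mf_hom f w; exists d => m /hd <-; apply: eq_bigl => i /=.
  by apply/eqP/eqP => [[]|->].
apply: (hz (@Mform _ J' (mf_n f) var (mf_pol f) hom)) => F' y' [_ pl gr].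
exact: (H F' (y' None) (fun w => y' (Some w)) pl gr).
Qed.

End Interior.

Section Lift.
Variables (N : nat) (s : 'I_N -> nat) (V : {set {set 'I_N}}).

(** The balls containing a given block form a chain, so they can be enumerated by cardinality; the
    root, which has no parent, is left out. *)
Definition chain_ball (k : nat) (t : 'I_N) : option {set 'I_N} :=
  [pick C | [&& C \in V, t \in C, #|C| == k & C != [set: 'I_N]]].

Section Ring.
Variables (R : comUnitRingType) (w : 'I_(tot s) -> R * R)
  (G : {set 'I_N} -> (R * R) * (R * R)).

Definition mulG (g : (R * R) * (R * R)) (v : R * R) : R * R :=
  (g.1.1 * v.1 + g.1.2 * v.2, g.2.1 * v.1 + g.2.2 * v.2).
Definition detG (g : (R * R) * (R * R)) : R := g.1.1 * g.2.2 - g.1.2 * g.2.1.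
Definition det2 (v v' : R * R) : R := v.1 * v'.2 - v'.1 * v.2.

Lemma det_mulG g v v' : det2 (mulG g v) (mulG g v') = detG g * det2 v v'.
Proof. by rewrite /det2 /mulG /detG /=; ring. Qed.

(** Carries a vector from its innermost frame upward, applying the transition matrix of each ball of
    cardinality below [k] met on the way. *)
Fixpoint lift (k : nat) (d : 'I_(tot s)) : R * R :=
  if k is k'.+1 then
    if chain_ball k' (bl d) is Some C then mulG (G C) (lift k' d) else lift k' d
  else w d.

Hypothesis V_lam : forall C D x, C \in V -> D \in V -> x \in C -> x \in D ->
  C \subset D \/ D \subset C.

Lemma chain_same k t t' C : C \in V -> t \in C -> t' \in C -> (#|C| <= k)%N ->
  chain_ball k t = chain_ball k t'.
Proof.
move=> CV tC t'C le.
have key x y D : D \in V -> x \in C -> y \in C -> #|D| = k -> x \in D -> y \in D.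
  move=> DV xC yC eD xD; have [/fintype.subsetP|h] := V_lam CV DV xC xD; first exact.
  have e : D = C by apply/eqP; rewrite eqEcard h eD.
  by rewrite e.
rewrite /chain_ball; apply: eq_pick => D; apply/and4P/and4P => -[DV hx /eqP eD nD]; split=> //.
- exact: key eD hx.
- by rewrite eD.
- exact: key eD hx.
- by rewrite eD.
Qed.

Lemma chain_ballP k t C : chain_ball k t = Some C ->
  [/\ C \in V, t \in C, #|C| = k, C != [set: 'I_N] &
   forall D, D \in V -> t \in D -> #|D| = k -> D = C].
Proof.
rewrite /chain_ball; case: pickP => // D /and4P [DV tD /eqP eD nD] [<-]; split=> // E EV tE eE.
apply/eqP; have [h|h] := V_lam EV DV tE tD; first by rewrite eqEcard h eD eE leqnn.
by rewrite eq_sym eqEcard h eD eE leqnn.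
Qed.

(** From their smallest common ball on, both vectors meet the same balls and undergo the same
    matrices, so each ball multiplies the determinant once. *)
Lemma lift_det d e C k : C \in V -> bl d \in C -> bl e \in C ->
   (forall E, E \in V -> bl d \in E -> bl e \in E -> C \subset E) -> (#|C| <= k)%N ->
  det2 (lift k d) (lift k e) =
  (\prod_(E in V | [&& bl d \in E, bl e \in E, (#|E| < k)%N & E != [set: 'I_N]]) detG (G E)) *
  det2 (lift #|C| d) (lift #|C| e).
Proof.
move=> CV dC eC Cmin; elim: k => [|k IH].
  by rewrite leqn0 => /eqP ->; rewrite big_pred0 ?mul1r // => E; rewrite ltn0 !andbF.
rewrite leq_eqVlt => /orP [/eqP <-|lt].
  rewrite big_pred0 ?mul1r // => E; apply/negbTE/negP => /and5P [EV dE eE h _].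
  by move: h; rewrite ltnNge subset_leq_card // Cmin.
rewrite ltnS in lt; have e0 := chain_same CV dC eC lt; rewrite /= -e0.
case e1 : (chain_ball k (bl d)) => [D|].
  have [DV dD eD nD Du] := chain_ballP e1.
  have eDe : bl e \in D by rewrite e0 in e1; case: (chain_ballP e1).
  rewrite det_mulG IH // mulrA [in RHS](bigD1 D) /=; last by rewrite DV dD eDe eD ltnSn nD.
  congr (_ * _ * _); apply: eq_bigl => E; rewrite ltnS (leq_eqVlt #|E|).
  apply/idP/idP => [/and5P [EV dE eE h ne]|].
    by rewrite EV dE eE h ne orbT /=; apply: contraTneq h => ->; rewrite eD ltnn.
  move=> /andP [/and5P [EV dE eE h ne] nED]; rewrite EV dE eE ne andbT /=.
  by case/orP: h => // /eqP h; move: nED; rewrite (Du E) ?eqxx.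
rewrite IH //; congr (_ * _); apply: eq_bigl => E; rewrite ltnS (leq_eqVlt #|E|).
apply/idP/idP => [/and5P [EV dE eE h ne]|/and5P [EV dE eE h ne]]; first by rewrite EV dE eE h ne orbT.
rewrite EV dE eE ne andbT /=; case/orP: h => // /eqP h.
by move: e1; rewrite /chain_ball; case: pickP => // /(_ E); rewrite EV dE h eqxx ne.
Qed.

End Ring.

Lemma lift_map (R T : comUnitRingType) (c : {rmorphism R -> T}) w G k d :
  lift (fun d => (c (w d).1, c (w d).2))
    (fun C => ((c (G C).1.1, c (G C).1.2), (c (G C).2.1, c (G C).2.2))) k d =
  (c (lift w G k d).1, c (lift w G k d).2).
Proof.
elim: k => [|k IH] //=; case: chain_ball => [C|] //.
by rewrite IH /mulG /= !rmorphD !rmorphM.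
Qed.

End Lift.
End InteriorForms.

(** * Frames of rank two on the tree *)

Module TreeFrames.
Import ZariskiCovers SheafGluing Blocks AffineCharts Cells CellHulls PointwiseClosure PavingQuads HeightUltrametric UltrametricTree DualCones ReducedRelations ChartEquations MonomialSets Correspondence InteriorForms.
Import numFieldTopology.Exports.
Local Opaque delta.

Lemma absz_subn (n m : nat) : (m <= n)%N -> `|n%:Z - m%:Z|%N = (n - m)%N.
Proof. by move=> h; rewrite subzn. Qed.

Lemma sub_add_sub (k m n : nat) : (k <= m)%N -> (m <= n)%N -> (m - k + (n - m) = n - k)%N.
Proof. by lia. Qed.

Section Tree.
Variables (N : nat) (s : 'I_N -> nat).
Hypotheses (s_gt0 : forall t, (0 < s t)%N) (n_ge2 : (2 <= \sum_(t < N) s t)%N).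
Variable K : realType.
Notation vs := (vs s_gt0 n_ge2).
Notation adm := (adm s).
Notation vI := (vI s_gt0 n_ge2).
Notation vv := (vv s_gt0 n_ge2).
Notation pairs3 := (pairs3 s_gt0 n_ge2).
Notation RP := (RP s_gt0 n_ge2).
Notation chr := {ffun VS s -> int}.
Variables (oo : 'I_N) (U : 'I_N -> 'I_N -> K) (hU : ultra s oo U).
Notation ball := (ball s_gt0 n_ge2 oo U).
Notation verts := (verts s_gt0 n_ge2 oo U).
Notation nbelow := (nbelow s_gt0 n_ge2 oo U).
Notation par := (par s_gt0 n_ge2 oo U).
Notation rep := (rep s_gt0 n_ge2 oo U).
Notation beta := (beta s_gt0 n_ge2 oo U).
Notation top := [set: 'I_N].

Section Normal.
Variables (R : comUnitRingType) (z : tpt s K R).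
Notation DC := (dualcone K (tp_pav z)).
Variables (u0 : VS s -> K) (hu0 : cone (tp_pav z) u0) (hUu : forall a b, adm a b -> u0 (vs a b) = U a b).

Lemma dc_sum (I : Type) (r : seq I) (Q : pred I) (F : I -> chr) : (forall i, Q i -> DC (F i)) ->
  DC (\sum_(i <- r | Q i) F i).
Proof. by move=> h; apply: big_ind => //; [exact: dualcone0|move=> *; exact: dualconeD]. Qed.

Lemma tp_sum (I : Type) (r : seq I) (Q : pred I) (F : I -> chr) : (forall i, Q i -> DC (F i)) ->
  tp_val z (\sum_(i <- r | Q i) F i) = \prod_(i <- r | Q i) tp_val z (F i).
Proof.
move=> h; elim: r => [|i r IH]; first by rewrite !big_nil tp_0.
rewrite !big_cons; case: ifP => // qi; rewrite tp_D ?IH //; [exact: h|exact: dc_sum].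
Qed.

Lemma tp_Mn g n : DC g -> DC (g *+ n) /\ tp_val z (g *+ n) = tp_val z g ^+ n.
Proof.
move=> h; elim: n => [|n [IH1 IH2]]; first by rewrite mulr0n tp_0; split=> //; exact: dualcone0.
by rewrite mulrS exprS tp_D // IH2; split=> //; exact: dualconeD.
Qed.

Lemma tp_unit g : DC g -> DC (- g) -> tp_val z (- g) * tp_val z g = 1 /\ tp_val z g \is a GRing.unit.
Proof.
move=> h h'; have e : tp_val z (- g) * tp_val z g = 1 by rewrite -tp_D // addNr tp_0.
by split=> //; apply/unitrP; exists (tp_val z (- g)); rewrite e mulrC.
Qed.

Lemma tp_Mz g (k : int) : DC g -> DC (- g) -> DC (g *~ k) /\ tp_val z (g *~ k) = tp_val z g ^ k.
Proof.
move=> h h'; case: k => n; first exact: tp_Mn.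
have [e u] := tp_unit h h'; have [h1 h2] := tp_Mn n.+1 h'.
rewrite NegzE mulrNz -mulNrz; split; first exact: h1.
rewrite [LHS]h2 -exprnN; apply: (mulIr (unitrX n.+1 u)).
by rewrite -exprMn e expr1n mulVr ?unitrX.
Qed.

(** Differences between points with the same ball are invertible characters, whose values a torus
    element removes; by [sum_char_tree] one parameter per ball below the root remains. *)
Lemma tree_normal : exists (mu : torus s R) (t : {set 'I_N} -> R), forall M, DC M ->
  tp_val (tact mu z) M = \prod_(C in verts | C != top) t C ^+ `|nbelow C M|%N.
Proof.
have hP := tp_ok z.
have DCs m (h : crspan s_gt0 n_ge2 U m) : DC m := dualcone_crspan hP hu0 hUu h.
pose eps v := beta v - beta (rep (ball v)).
have reb v : ball (rep (ball v)) = ball v by apply: ball_rep; exact: ball_verts.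
have e1 v : DC (eps v) by apply/DCs/(crspan_betaB hU); rewrite reb.
have e2 v : DC (- eps v).
  by rewrite /eps opprB; apply/DCs/(crspan_betaB hU); rewrite reb.
pose tau C := beta (rep C) - beta (rep (par C)).
have tD C : C \in verts -> C != top -> DC (tau C).
  move=> CV nC; apply/DCs/(crspan_betaB hU).
  have [h1 /fintype.proper_sub h2 _] := parP hU CV nC.
  by rewrite !ball_rep.
pose mu : torus s R := exist (fun mu : VS s -> R => forall v, mu v \is a GRing.unit) (fun v => tp_val z (eps v))
  (fun v => (tp_unit (e1 v) (e2 v)).2).
exists mu, (fun C => tp_val z (tau C)) => M hM.
have [[M0 M1] _] := hM.
have dec : M = \sum_v eps v *~ M v + \sum_(C in verts | C != top) tau C *~ nbelow C M.
  rewrite -[LHS](sum_beta s_gt0 n_ge2 oo U (conj M0 M1)); exact: sum_char_tree.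
have nn C : C \in verts -> 0 <= nbelow C M by move=> CV; exact: (dualcone_nbelow hU hu0 hUu hM CV).
have tN C : C \in verts -> C != top -> DC (tau C *~ nbelow C M) /\
    tp_val z (tau C *~ nbelow C M) = tp_val z (tau C) ^+ `|nbelow C M|%N.
  move=> CV nC; have := nn C CV; case: (nbelow C M) => // k _.
  exact: (tp_Mn k (tD C CV nC)).
have vM : tp_val z M = chareval mu M * \prod_(C in verts | C != top) tp_val z (tau C) ^+ `|nbelow C M|%N.
  rewrite {1}dec tp_D; first last.
  - by apply: dc_sum => C /andP [CV nC]; case: (tN C CV nC).
  - by apply: dc_sum => v _; case: (tp_Mz (M v) (e1 v) (e2 v)).
  rewrite !tp_sum; first last.
  - by move=> v _; case: (tp_Mz (M v) (e1 v) (e2 v)).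
  - by move=> C /andP [CV nC]; case: (tN C CV nC).
  congr (_ * _); first by apply: eq_bigr => v _; case: (tp_Mz (M v) (e1 v) (e2 v)).
  by apply: eq_bigr => C /andP [CV nC]; case: (tN C CV nC).
by rewrite /= vM mulrA charevalN mul1r.
Qed.

End Normal.

Lemma nbelowD C m m' : nbelow C (m + m') = nbelow C m + nbelow C m'.
Proof. by rewrite /UltrametricTree.nbelow -big_split; apply: eq_bigr => v _; rewrite ffaddE. Qed.

Lemma nbelowN C m : nbelow C (- m) = - nbelow C m.
Proof. by rewrite /UltrametricTree.nbelow -sumrN; apply: eq_bigr => v _; rewrite ffoppE. Qed.

Lemma nbelow_delta C v : nbelow C (delta v) = (ball v \subset C)%:Z.
Proof.
rewrite /UltrametricTree.nbelow big_mkcond (bigD1 v) //= deltaE eqxx big1 => [|w /negPf nw].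
  by rewrite addr0; case: (_ \subset _).
by rewrite deltaE nw; case: ifP.
Qed.

Lemma nbelow_pd C v w : nbelow C (pd v w) = (ball v \subset C)%:Z + (ball w \subset C)%:Z.
Proof. by rewrite -!nbelow_delta -nbelowD pd.unlock. Qed.

Definition nE (E : {set 'I_N}) (a b : 'I_(tot s)) : nat := (bl a \in E) && (bl b \in E).

Lemma nEC E a b : nE E a b = nE E b a. Proof. by rewrite /nE andbC. Qed.

Lemma nbelow_vv C a b c d : C \in verts -> a != b -> c != d ->
  nbelow C (pd (vv a b) (vv c d)) = (nE C a b + nE C c d)%N.
Proof.
move=> CV /adm_bl ab /adm_bl cd.
have e1 := ball_subE hU CV ab; have e2 := ball_subE hU CV cd.
by rewrite nbelow_pd PoszD; congr (nat_of_bool _ + nat_of_bool _)%:Z.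
Qed.

Section Frames.
Variables (R : comUnitRingType) (z : tpt s K R) (x : idx2 s -> R) (t : {set 'I_N} -> R).
Notation DC := (dualcone K (tp_pav z)).
Variables (u0 : VS s -> K) (hu0 : cone (tp_pav z) u0) (hUu : forall a b, adm a b -> u0 (vs a b) = U a b).
Hypothesis hz : forall M, DC M -> tp_val z M = \prod_(C in verts | C != top) t C ^+ `|nbelow C M|%N.
Hypothesis hRP : RP z x.

Let lam C D y : C \in verts -> D \in verts -> y \in C -> y \in D -> C \subset D \/ D \subset C.
Proof. by move=> h1 h2 h3 h4; apply/orP; exact: (laminar hU h1 h2 h3 h4). Qed.

(** The coefficient of a pairing in terms of the tree parameters, restricted to the balls strictly
    inside [C], with one factor [t E] removed for every [E] containing [C']. *)
Definition hE (C C' : {set 'I_N}) a b c d : R :=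
  \prod_(E in verts | E \proper C) t E ^+ (nE E a b + nE E c d - (C' \subset E))%N.

Lemma hE_eq C C' a b c d a' b' c' d' :
  (forall E, nE E a b + nE E c d = nE E a' b' + nE E c' d')%N -> hE C C' a b c d = hE C C' a' b' c' d'.
Proof. by move=> e; apply: eq_bigr => E _; rewrite e. Qed.

(** Balls that are not strictly inside [C] occur equally in the three pairings and cancel against
    the least degree; the remaining exponents are restored by the factor [Kf]. When indices coincide
    the relation is trivial and is treated apart. *)
Lemma hE_pl C C' a c d e : C' \in verts -> C \in verts -> C' \subset C -> ball (vv a c) = C' -> a != c ->
  bl d \in C' -> bl e \in C ->
  hE C C' a c d e * (ext x a c * ext x d e) - hE C C' a d c e * (ext x a d * ext x c e)
  + hE C C' a e c d * (ext x a e * ext x c d) = 0.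
Proof.
move=> C'V CV sC bC ac dC' eC; have hac := adm_bl ac.
have [aC' cC'] : bl a \in C' /\ bl c \in C'.
  by apply/andP; rewrite -(ball_subE hU C'V hac) bC.
have [aC cC dC] : [/\ bl a \in C, bl c \in C & bl d \in C].
  by split; apply: (fintype.subsetP sC).
have [e0|nad] := eqVneq a d.
  subst d; rewrite ext_aa (@hE_eq _ _ a e c a a c a e); last by move=> E; rewrite (nEC E c a) addnC.
  by rewrite (ext_anti x c a); ring.
have [e0|nae] := eqVneq a e.
  subst e; rewrite ext_aa (@hE_eq _ _ a d c a a c d a); last by move=> E; rewrite (nEC E c a) (nEC E d a) addnC.
  by rewrite (ext_anti x c a) (ext_anti x d a); ring.
have [e0|ncd] := eqVneq c d.
  subst d; rewrite ext_aa; ring.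
have [e0|nce] := eqVneq c e.
  subst e; rewrite ext_aa (@hE_eq _ _ a c c d a c d c); last by move=> E; rewrite (nEC E d c).
  by rewrite (ext_anti x d c); ring.
have [e0|nde] := eqVneq d e.
  subst e; rewrite ext_aa; ring.
have un : uniq [:: a; c; d; e] by rewrite /= !inE !negb_or ac nad nae ncd nce nde.
have [g0 b0] := base3 s_gt0 n_ge2 (tp_ok z) un; have [g0in g0min] := b0.
have fact E g : E \in verts -> pairs3 a c d e g -> exists n : nat, [/\ nbelow E g = n,
    ((C' \subset E) <= n)%N & ~~ (E \proper C) -> n = if C \subset E then 2%N else 0%N].
  move=> EV gin.
  have sub' : C' \subset E -> [/\ bl a \in E, bl c \in E & bl d \in E].
    by move=> /fintype.subsetP h; split; apply: h.
  have out : ~~ (E \proper C) -> ~~ (C \subset E) -> [/\ bl a \notin E, bl c \notin E, bl d \notin E & bl e \notin E].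
    move=> nEC nCE; have o y : y \in C -> y \notin E.
      move=> yC; apply/negP => yE; have [h|h] := lam CV EV yC yE; first by rewrite h in nCE.
      by rewrite fintype.properE h nCE in nEC.
    by split; apply: o.
  have inn : C \subset E -> [/\ bl a \in E, bl c \in E, bl d \in E & bl e \in E].
    by move=> /fintype.subsetP h; split; apply: h.
  have bd (p q r w : bool) : (C' \subset E -> [/\ p, q & r]) ->
    ((C' \subset E) <= (p && q) + (r && w))%N /\ ((C' \subset E) <= (p && r) + (q && w))%N /\ ((C' \subset E) <= (p && w) + (q && r))%N.
    by case: (C' \subset E) => // /(_ isT) [-> -> ->]; rewrite /= addn1.
  have bd' (p q r w : bool) : ~~ (E \proper C) -> (~~ (E \proper C) -> ~~ (C \subset E) -> [/\ ~~ p, ~~ q, ~~ r & ~~ w]) ->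
     (C \subset E -> [/\ p, q, r & w]) ->
     [/\ ((p && q) + (r && w) = if C \subset E then 2 else 0)%N, ((p && r) + (q && w) = if C \subset E then 2 else 0)%N &
      ((p && w) + (q && r) = if C \subset E then 2 else 0)%N].
    case: (E \proper C) => // _; case: (C \subset E) => [_ /(_ isT) [-> -> -> ->] //|/(_ isT isT)].
    by move=> [/negPf -> /negPf -> /negPf -> /negPf ->].
  have [q1 [q2 q3]] := bd _ _ _ (bl e \in E) sub'.
  move: gin; rewrite /ReducedRelations.pairs3 !inE => /or3P [] /eqP ->; rewrite nbelow_vv //; (eexists; split; [reflexivity|by []|]).
  - by move=> nEC; case: (bd' _ _ _ _ nEC out inn).
  - by move=> nEC; case: (bd' _ _ _ _ nEC out inn).
  - by move=> nEC; case: (bd' _ _ _ _ nEC out inn).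
pose n0 E := `|nbelow E g0|%N.
pose Kf := \prod_(E in verts | E \proper C) t E ^+ (n0 E - (C' \subset E))%N.
have val p : pairs3 a c d e p ->
    Kf * tp_val z (p - g0) = \prod_(E in verts | E \proper C) t E ^+ (`|nbelow E p| - (C' \subset E))%N.
  move=> pin; rewrite hz; last exact: g0min.
  have -> : \prod_(E in verts | E != top) t E ^+ `|nbelow E (p - g0)%R|%N =
      \prod_(E in verts | E \proper C) t E ^+ (`|nbelow E p| - n0 E)%N.
    rewrite big_mkcond [RHS]big_mkcond; apply: eq_bigr => E _.
    case: ifP => [/andP [EV nE]|/negbT].
      have [n [en k1 k2]] := fact E p EV pin; have [n' [en' k1' k2']] := fact E g0 EV g0in.
      have le := dualcone_nbelow hU hu0 hUu (g0min p pin) EV.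
      move: le; rewrite nbelowD nbelowN /n0 en en' /= => le; rewrite EV /=.
      have le' : (n' <= n)%N by move: le; rewrite subr_ge0 lez_nat.
      rewrite (absz_subn le').
      by case: ifP => // /negbT h; rewrite k2 // k2' // subnn expr0.
    rewrite negb_and negbK => /orP [/negPf -> //|/eqP ->].
    by case: ifP => // /andP [_ h]; move: (fintype.properE top C) h => ->; rewrite finset.subsetT andbF.
  rewrite -big_split; apply: eq_bigr => E /andP [EV _] /=; rewrite -exprD; congr (_ ^+ _).
  have [n [en k1 k2]] := fact E p EV pin; have [n' [en' k1' k2']] := fact E g0 EV g0in.
  have le := dualcone_nbelow hU hu0 hUu (g0min p pin) EV.
  move: le; rewrite nbelowD nbelowN subr_ge0 /n0 en en' lez_nat /= => le.
  exact: sub_add_sub.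
have [p1 p2 p3] : [/\ pairs3 a c d e (pd (vv a c) (vv d e)), pairs3 a c d e (pd (vv a d) (vv c e)) &
    pairs3 a c d e (pd (vv a e) (vv c d))].
  have m3 (T : eqType) (x1 x2 x3 : T) : [/\ x1 \in [:: x1; x2; x3], x2 \in [:: x1; x2; x3] & x3 \in [:: x1; x2; x3]].
    by rewrite !inE !eqxx !orbT.
  exact: m3.
have hv y1 y2 y3 y4 : y1 != y2 -> y3 != y4 -> pairs3 a c d e (pd (vv y1 y2) (vv y3 y4)) ->
   Kf * tp_val z (pd (vv y1 y2) (vv y3 y4) - g0) = hE C C' y1 y2 y3 y4.
  move=> h1 h2 hp; rewrite val //; apply: eq_bigr => E /andP [EV _].
  by rewrite (nbelow_vv EV h1 h2) absz_nat.
rewrite -!hv //; have := hRP b0; rewrite /ReducedRelations.plE => e1.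
by rewrite -(mulr0 Kf) -e1; ring.
Qed.

Definition piE (C : {set 'I_N}) (a b : 'I_(tot s)) : R :=
  \prod_(E in verts | [&& E \proper C, bl a \in E & bl b \in E]) t E.
(** The bracket of [a] and [b] in the frame of the vertex [C]: the coordinate times the parameters
    of the balls strictly inside [C] that contain both blocks. *)
Definition zz (C : {set 'I_N}) a b : R := ext x a b * piE C a b.

Lemma piEC C a b : piE C a b = piE C b a.
Proof. by apply: eq_bigl => E; rewrite (andbC (bl a \in E)). Qed.

Lemma zz_anti C a b : zz C a b = - zz C b a.
Proof. by rewrite /zz ext_anti piEC mulNr. Qed.

Lemma piE_exp (C C' : {set 'I_N}) (a b : 'I_(tot s)) : C' \subset C ->
  piE C' a b = \prod_(E in verts | E \proper C) t E ^+ ((E \proper C') && (nE E a b == 1%N)).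
Proof.
move=> sC; rewrite /piE big_mkcond [RHS]big_mkcond; apply: eq_bigr => E _.
rewrite /nE; case: (E \in verts) => //=; case: (boolP (E \proper C')) => [h|_] /=.
  rewrite (fintype.proper_sub_trans h sC) /=; by case: (_ && _).
by case: ifP => //; rewrite expr0.
Qed.

(** A Pluecker relation at [C] whose brackets with [d] are taken in the finer frame of [C']. With
    [C' = C] it gives determinants within one frame, otherwise the passage from a ball to its
    parent. *)
Lemma frame_pl C C' a c d e : C' \in verts -> C \in verts -> C' \subset C -> ball (vv a c) = C' -> a != c ->
  bl d \in C' -> bl e \in C ->
  ext x a c * zz C d e = zz C' d c * zz C a e + zz C' a d * zz C c e.
Proof.
move=> C'V CV sC bC ac dC' eC; have := hE_pl C'V CV sC bC ac dC' eC; have hac := adm_bl ac.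
have [aC' cC'] : bl a \in C' /\ bl c \in C'.
  by apply/andP; rewrite -(ball_subE hU C'V hac) bC.
have acE E : E \in verts -> nE E a c = (C' \subset E) :> nat.
  by move=> EV; rewrite /nE -(ball_subE hU EV hac) bC.
have sp E a' d' : E \in verts -> bl a' \in C' -> bl d' \in C' ->
    nE E a' d' = ((C' \subset E) + ((E \proper C') && (nE E a' d' == 1%N)))%N.
  move=> EV ha hd; rewrite fintype.properE; case: (boolP (C' \subset E)) => [h|nh] /=.
    by rewrite andbF addn0 /nE !(fintype.subsetP h).
  rewrite andbT add0n /nE; case: (boolP (bl a' \in E)) => [aE|_] /=; last by rewrite andbF.
  have [h|->] := lam C'V EV ha aE; first by rewrite h in nh.
  by case: (bl d' \in E).
have one E a' d' : nE E a' d' = (nE E a' d' == 1%N) :> nat by rewrite /nE; case: (_ && _).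
have e1 : hE C C' a c d e = piE C d e.
  rewrite (piE_exp d e (fintype.subxx C)); apply: eq_bigr => E /andP [EV EC]; congr (_ ^+ _).
  by rewrite acE // addKn EC /= -one.
have e2 a' c' : bl a' \in C' -> hE C C' a' d c' e = piE C' a' d * piE C c' e.
  move=> ha; rewrite (piE_exp c' e (fintype.subxx C)) (piE_exp a' d sC) -big_split.
  apply: eq_bigr => E /andP [EV EC] /=; rewrite -exprD; congr (_ ^+ _).
  by rewrite EC /= -one {1}(sp E a' d EV ha dC') -addnA addKn.
rewrite e1 (e2 a c aC') (@hE_eq C C' a e c d c d a e) ?(e2 c a cC') /zz => [|E]; last exact: addnC.
rewrite (piEC C' d c) (ext_anti x d c) => h.
apply/eqP; rewrite -subr_eq0; apply/eqP; rewrite -h; ring.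
Qed.

Lemma zz_ball C a b : C \in verts -> ball (vv a b) = C -> zz C a b = ext x a b.
Proof.
move=> CV bC; have [->|ab] := eqVneq a b; first by rewrite /zz ext_aa mul0r.
rewrite /zz /piE big_pred0 ?mulr1 // => E; apply/negbTE/negP => /and4P [EV EC aE bE].
have : C \subset E by rewrite -bC (ball_subE hU EV (adm_bl ab)) aE.
by move: EC; rewrite fintype.properE => /andP [_ /negPf ->].
Qed.

Variables (I0 : VS s -> idx2 s) (hI0 : forall v, vI (I0 v) = v) (xI0 : forall v, x (I0 v) \is a GRing.unit).

Definition fa (C : {set 'I_N}) := (sval (I0 (rep C))).1.
Definition fc (C : {set 'I_N}) := (sval (I0 (rep C))).2.
Definition XC (C : {set 'I_N}) := x (I0 (rep C)).

Lemma frameP C : C \in verts -> [/\ ball (vv (fa C) (fc C)) = C, fa C != fc C,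
  ext x (fa C) (fc C) = XC C, bl (fa C) \in C & bl (fc C) \in C].
Proof.
move=> CV; have ne := idx2_neq (I0 (rep C)).
have b : ball (vv (fa C) (fc C)) = C by rewrite -[vv _ _]/(vI (I0 (rep C))) hI0 ball_rep.
have /andP [h1 h2] : (bl (fa C) \in C) && (bl (fc C) \in C).
  have e : (ball (vv (fa C) (fc C)) \subset C) = (bl (fa C) \in C) && (bl (fc C) \in C).
    exact: (ball_subE hU CV (adm_bl ne)).
  by rewrite -e b.
by split=> //; rewrite ext_idx.
Qed.

(** Cramer's rule for the vector of [d] relative to the reference vectors [fa C] and [fc C]. Only
    one coordinate is divided by [XC C], which makes determinants equal to brackets. *)
Definition LL C (d : 'I_(tot s)) : R * R := (zz C d (fc C) / XC C, zz C (fa C) d).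
(** The change of frame from [C'] to its parent, written with brackets at the parent; its
    determinant is the tree parameter of [C']. *)
Definition GG C' : (R * R) * (R * R) := let C := par C' in
  ((zz C (fa C') (fc C) / XC C, zz C (fc C') (fc C) / (XC C * XC C')),
   (zz C (fa C) (fa C'), zz C (fa C) (fc C') / XC C')).

Lemma LL_eq B C d : B = C -> LL B d = LL C d.
Proof. by move=> ->. Qed.

Lemma LL_det C d e : C \in verts -> bl d \in C -> bl e \in C -> det2 (LL C d) (LL C e) = zz C d e.
Proof.
move=> CV dC eC; have [b ne ex aC cC] := frameP CV.
have := frame_pl CV CV (fintype.subxx C) b ne dC eC; rewrite ex => h.
apply: (mulrI (xI0 (rep C))); rewrite -/(XC C) h /det2 /= (zz_anti C (fc C) e).
have u : XC C * (XC C)^-1 = 1 by rewrite mulrV // xI0.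
transitivity ((XC C * (XC C)^-1) * (zz C d (fc C) * zz C (fa C) e - zz C e (fc C) * zz C (fa C) d)); first by ring.
by rewrite u; ring.
Qed.

Lemma LL_par C' d : C' \in verts -> C' != top -> bl d \in C' ->
  LL (par C') d = mulG (GG C') (LL C' d).
Proof.
move=> C'V nt dC; have [CV /fintype.proper_sub sC _] := parP hU C'V nt.
have [b ne ex aC cC] := frameP C'V; have [b1 ne1 ex1 aC1 cC1] := frameP CV.
have u : XC C' * (XC C')^-1 = 1 by rewrite mulrV // xI0.
have h1 := frame_pl C'V CV sC b ne dC cC1; have h2 := frame_pl C'V CV sC b ne dC aC1.
rewrite /mulG /GG /LL /=; set C := par C' in CV sC b1 ne1 ex1 aC1 cC1 h1 h2 *; congr (_, _).
  have -> : zz C d (fc C) = (XC C')^-1 * (ext x (fa C') (fc C') * zz C d (fc C)).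
    by rewrite ex mulrA (mulrC _^-1) u mul1r.
  rewrite h1 invrM ?xI0 //; ring.
have -> : zz C (fa C) d = - ((XC C')^-1 * (ext x (fa C') (fc C') * zz C d (fa C))).
  by rewrite ex mulrA (mulrC _^-1) u mul1r -zz_anti.
rewrite h2 (zz_anti C (fa C) (fa C')) (zz_anti C (fa C) (fc C')); ring.
Qed.

Lemma GG_det C' : C' \in verts -> C' != top -> detG (GG C') = t C'.
Proof.
move=> C'V nt; have [CV pC pmin] := parP hU C'V nt; have sC := fintype.proper_sub pC.
have [b ne ex aC cC] := frameP C'V; have [b1 ne1 ex1 aC1 cC1] := frameP CV.
have u : XC C' * (XC C')^-1 = 1 by rewrite mulrV // xI0.
have u1 : XC (par C') * (XC (par C'))^-1 = 1 by rewrite mulrV // xI0.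
have h1 := frame_pl CV CV (fintype.subxx _) b1 ne1 (fintype.subsetP sC _ aC) (fintype.subsetP sC _ cC).
have h2 : zz (par C') (fa C') (fc C') = XC C' * t C'.
  rewrite /zz ex; congr (_ * _); rewrite /piE (big_pred1 C') // => E; apply/and4P/eqP => [[EV pE aE cE]|->]; last by [].
  have sE : C' \subset E by rewrite -b (ball_subE hU EV (adm_bl ne)) aE.
  apply/eqP; rewrite eq_sym finset.eqEsubset sE /=; apply: contraTT pE => nE.
  rewrite fintype.properE negb_and negbK; apply/orP; right; apply: pmin => //.
  by rewrite fintype.properE sE.
move: h1; rewrite ex1 h2 /detG /GG /= invrM ?xI0 // (zz_anti _ (fc (par C')) (fc C')).
set C := par C'; set iC := (XC C)^-1 in u1 *; set iC' := (XC C')^-1 in u *.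
move=> h1; transitivity (iC * iC' * (XC C * (XC C' * t C'))).
  by rewrite h1; ring.
by transitivity ((XC C * iC) * (XC C' * iC') * t C'); [ring|rewrite u u1; ring].
Qed.

(** The first ball of size at least [k] on the way up from [d], that is, the vertex whose frame
    [lift] has reached at stage [k]. *)
Definition balk k (d : 'I_(tot s)) : {set 'I_N} :=
  [arg min_(D < top | [&& D \in verts, bl d \in D & (k <= #|D|)%N]) #|D|].

Lemma balkP k d : (k <= N)%N -> [/\ balk k d \in verts, bl d \in balk k d, (k <= #|balk k d|)%N &
  forall D, D \in verts -> bl d \in D -> (k <= #|D|)%N -> balk k d \subset D].
Proof.
move=> kN; rewrite /balk; case: arg_minnP.
  by rewrite (vertsT s_gt0 n_ge2 hU) finset.in_setT finset.cardsT card_ord.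
move=> C /and3P [CV dC kC] Cm; split=> // D DV dD kD.
have [//|h] := lam CV DV dC dD.
suff -> : D = C by exact: fintype.subxx.
by apply/eqP; rewrite finset.eqEcard h Cm // DV dD.
Qed.

Lemma lift_LL k d : (k <= N)%N -> lift verts (fun d => LL (balk 0 d) d) GG k d = LL (balk k d) d.
Proof.
elim: k => [|k IH] // kN; rewrite /= IH ?(ltnW kN) //.
have [BV dB kB Bm] := balkP d (ltnW kN); have [BV1 dB1 kB1 Bm1] := balkP d kN.
case e : (chain_ball verts k (bl d)) => [C|].
  have [CV dC eC nC _] := chain_ballP lam e.
  have eB : balk k d = C.
    by apply/eqP; rewrite finset.eqEcard Bm ?eC.
  rewrite eB -LL_par //; apply: LL_eq.
  have [pV pC pm] := parP hU CV nC.
  apply/eqP; rewrite finset.eqEsubset; apply/andP; split.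
    apply: pm => //; have [h|h] := lam CV BV1 dC dB1.
      by rewrite finset.properEcard h eC.
    by have := subset_leq_card h; rewrite eC leqNgt kB1.
  apply: Bm1 => //; first exact: (fintype.subsetP (fintype.proper_sub pC)).
  by rewrite -eC fintype.proper_card.
apply: LL_eq; apply/eqP; rewrite finset.eqEsubset Bm ?(ltnW kB1) //=.
apply: Bm1 => //; rewrite ltn_neqAle kB andbT; apply/eqP => ek.
move: e; rewrite /chain_ball; case: pickP => // /(_ (balk k d)).
rewrite BV dB -ek eqxx /= => /negbT; rewrite negbK => /eqP h.
by move: kN; rewrite {1}ek h finset.cardsT card_ord ltnn.
Qed.

(** At the stage of the smallest common ball both vectors are expressed in its frame, where the
    bracket has no tree parameter left. *)
Lemma ext_lift a b : a != b -> let k := #|ball (vv a b)| in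
  det2 (lift verts (fun d => LL (balk 0 d) d) GG k a) (lift verts (fun d => LL (balk 0 d) d) GG k b) = ext x a b.
Proof.
move=> ab k; have kN : (k <= N)%N by rewrite -[leqRHS]card_ord max_card.
have DV : ball (vv a b) \in verts by exact: ball_verts.
have /andP [aD bD] : (bl a \in ball (vv a b)) && (bl b \in ball (vv a b)).
  by rewrite -(ball_subE hU DV (adm_bl ab)).
have eb y : bl y \in ball (vv a b) -> balk k y = ball (vv a b).
  move=> yD; have [BV dB kB Bm] := balkP y kN.
  by apply/eqP; rewrite finset.eqEcard Bm.
by rewrite !lift_LL // !eb // LL_det // zz_ball.
Qed.

End Frames.
End Tree.
End TreeFrames.

(** * Points of Omega satisfy the equations of M *)

Module FormsVanishing.
Import ZariskiCovers SheafGluing Blocks AffineCharts Cells CellHulls PointwiseClosure PavingQuads HeightUltrametric UltrametricTree DualCones ReducedRelations ChartEquations MonomialSets Correspondence InteriorForms TreeFrames.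
Import numFieldTopology.Exports.
Local Opaque delta.

Lemma lift_id N (s : 'I_N -> nat) V (R : comUnitRingType) (w : 'I_(tot s) -> R * R) G k d :
  (forall C, G C = ((1, 0), (0, 1))) -> lift V w G k d = w d.
Proof.
move=> h; elim: k => [|k IH] //=; case: chain_ball => [C|] //.
by rewrite h IH /mulG /= !mul1r !mul0r addr0 add0r; case: (w d).
Qed.

Section Vanish.
Variables (N : nat) (s : 'I_N -> nat).
Hypotheses (s_gt0 : forall t, (0 < s t)%N) (n_ge2 : (2 <= \sum_(t < N) s t)%N).
Variable K : realType.
Notation vs := (vs s_gt0 n_ge2).
Notation adm := (adm s).
Notation vI := (vI s_gt0 n_ge2).
Notation RP := (RP s_gt0 n_ge2).
Notation degm := (degm s_gt0 n_ge2).
Notation theta := (theta s_gt0 n_ge2).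
Notation top := [set: 'I_N].

Lemma nbelow_degm oo (U : 'I_N -> 'I_N -> K) C m :
  nbelow s_gt0 n_ge2 oo U C (degm m) = (\sum_I (ball s_gt0 n_ge2 oo U (vI I) \subset C) * m I)%N.
Proof.
have n0 : nbelow s_gt0 n_ge2 oo U C 0 = 0 by rewrite /nbelow big1 // => v _; rewrite ffzeroE.
rewrite /MonomialSets.degm (big_morph _ (nbelowD s_gt0 n_ge2 oo U C) n0) -[RHS]natz natr_sum; apply: eq_bigr => I _.
rewrite natz PoszM -nbelow_delta; move: (delta _) => dl; elim: (m I) => [|n IH].
  by rewrite mulr0n n0 mulr0.
by rewrite mulrS nbelowD IH intS mulrDr mulr1.
Qed.

(** The entries of the innermost vectors and of the transition matrices are replaced by
    indeterminates. Over this polynomial ring the top-level minors are the Pluecker coordinates of a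
    generic point, its monomials are nonzero multiples of the coordinates [yB], and [y] is a
    specialisation of [yB] up to units. *)
Lemma theta_vanish_normal (T : comUnitRingType) (z : tpt s K T) (x : idx2 s -> T)
    (y : forall w : Cset s, Gset w -> T) (I0 : VS s -> idx2 s) oo (U : 'I_N -> 'I_N -> K) (u0 : VS s -> K)
    (t : {set 'I_N} -> T) (hU : ultra s oo U) (hu0' : cone (tp_pav z) u0)
    (hUu : forall a b, adm a b -> u0 (vs a b) = U a b)
    (hz : forall M, dualcone K (tp_pav z) M -> tp_val z M =
       \prod_(C in verts s_gt0 n_ge2 oo U | C != top) t C ^+ `|nbelow s_gt0 n_ge2 oo U C M|%N) :
  RP z x -> theta z x y -> (forall v, vI (I0 v) = v) ->
  (forall v, x (I0 v) \is a GRing.unit) ->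
  forall f, mf_vanish (@imageM N s) f -> mf_eval f y = 0.
Proof.
move=> hRP hth hI0 xI0 f hf.
pose V := verts s_gt0 n_ge2 oo U; pose bll := ball s_gt0 n_ge2 oo U.
pose w0 d := LL s_gt0 n_ge2 oo U x t I0 (balk s_gt0 n_ge2 oo U 0 d) d.
pose G0 := GG s_gt0 n_ge2 oo U x t I0.
pose Vr : finType := (('I_(tot s) * bool) + ({set 'I_N} * (bool * bool)))%type.
pose ent (S : comUnitRingType) (w : 'I_(tot s) -> S * S) (G : {set 'I_N} -> (S * S) * (S * S)) (v : Vr) : S :=
  match v with
  | inl (d, b) => if b then (w d).1 else (w d).2
  | inr (C, (b1, b2)) => let r := if b1 then (G C).1 else (G C).2 in if b2 then r.1 else r.2
  end.
pose B : comUnitRingType := {mpoly int[#|Vr|]}.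
pose X (v : Vr) : B := 'X_(enum_rank v).
pose wB d : B * B := (X (inl (d, true)), X (inl (d, false))).
pose GB C : (B * B) * (B * B) := ((X (inr (C, (true, true))), X (inr (C, (true, false)))),
  (X (inr (C, (false, true))), X (inr (C, (false, false))))).
have spec (S : comUnitRingType) w (G : {set 'I_N} -> (S * S) * (S * S)) : exists phi : {rmorphism B -> S},
    (forall k d, lift V w G k d = (phi (lift V wB GB k d).1, phi (lift V wB GB k d).2)) /\
    forall C, detG (G C) = phi (detG (GB C)).
  have [phi hphi] := poly_eval (ent S w G); exists phi; split=> [k d|C].
    rewrite -lift_map; congr (lift V _ _ k d); apply/funext => i; rewrite /= !hphi /=.
      by case: (w i).
    by case: (G i) => [[? ?] [? ?]].
  by rewrite /detG rmorphB !rmorphM /= !hphi.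
have [phi [phil phiG]] := spec T w0 G0.
pose L1 (I : idx2 s) := (sval I).1; pose L2 (I : idx2 s) := (sval I).2.
pose xB I : B := det2 (lift V wB GB #|bll (vI I)| (L1 I)) (lift V wB GB #|bll (vI I)| (L2 I)).
pose zB I : B := det2 (lift V wB GB N (L1 I)) (lift V wB GB N (L2 I)).
pose D C := detG (GB C).
have phix I : phi (xB I) = x I.
  rewrite -(ext_idx x I) -(ext_lift hU hu0' hUu hz hRP hI0 xI0 (idx2_neq I)) -/(L1 I) -/(L2 I).
  by rewrite !phil /xB /det2 rmorphB !rmorphM.
have phiD C : C \in V -> C != top -> phi (D C) = t C.
  by move=> CV nC; rewrite -phiG; exact: (GG_det hU hu0' hUu hz hRP hI0 xI0).
(* A numerical specialisation, with identity matrices and vectors [(1, d)], shows that the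
   determinants and minors of the generic point are nonzero polynomials. *)
have [psi [psil psiG]] := spec int (fun d => (1, (val d)%:Z)) (fun=> ((1, 0), (0, 1))).
have D0 C : D C != 0.
  have : psi (D C) != 0 by rewrite -psiG.
  by apply: contraNneq => ->; rewrite rmorph0.
have z0 I : zB I != 0.
  have : psi (zB I) != 0.
    rewrite /zB /det2 rmorphB !rmorphM.
    have e d : (psi (lift V wB GB N d).1, psi (lift V wB GB N d).2) = (1, (val d)%:Z) by rewrite -psil lift_id.
    have [e1 e2] : psi (lift V wB GB N (L1 I)).1 = 1 /\ psi (lift V wB GB N (L1 I)).2 = (val (L1 I))%:Z.
      by case: (e (L1 I)).
    have [e3 e4] : psi (lift V wB GB N (L2 I)).1 = 1 /\ psi (lift V wB GB N (L2 I)).2 = (val (L2 I))%:Z.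
      by case: (e (L2 I)).
    rewrite e1 e2 e3 e4 !mul1r subr_eq0 eqz_nat neq_ltn orbC; apply/orP; left; exact: (svalP I).
  by apply: contraNneq => ->; rewrite rmorph0.
pose gg w := projT1 (cid (projT2 (cid (hth w)))); pose aa w := projT1 (cid (hth w)).
have ggP w : [/\ aa w \is a GRing.unit, base K (tp_pav z) (Gdeg s_gt0 n_ge2 w) (gg w) &
    forall m : Gset w, y w m = aa w * tp_val z (degm (sval m) - gg w) * mono x (sval m)].
  exact: (projT2 (cid (projT2 (cid (hth w))))).
pose eE (C : {set 'I_N}) (m : {ffun idx2 s -> nat}) := (\sum_I (bll (vI I) \subset C) * m I)%N.
pose e0 (C : {set 'I_N}) w := `|nbelow s_gt0 n_ge2 oo U C (gg w)|%N.
have e0P (C : {set 'I_N}) w (m : Gset w) : C \in V ->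
    (e0 C w <= eE C (sval m))%N /\ `|nbelow s_gt0 n_ge2 oo U C (degm (sval m) - gg w)%R|%N = (eE C (sval m) - e0 C w)%N.
  move=> CV; have [_ [[m1 gm1] gmin] _] := ggP w.
  have h : dualcone K (tp_pav z) (degm (sval m) - gg w) by apply: gmin; exists m.
  have := dualcone_nbelow hU hu0' hUu h CV; rewrite /e0 nbelowD nbelowN gm1 !nbelow_degm.
  by rewrite subr_ge0 lez_nat => le; split=> //; rewrite absz_subn.
pose yB (w : Cset s) (m : Gset w) : B := \prod_(C in V | C != top) D C ^+ (eE C (sval m) - e0 C w) * mono xB (sval m).
have monoc (S S' : comUnitRingType) (c : {rmorphism S -> S'}) (u : idx2 s -> S) m : mono (fun I => c (u I)) m = c (mono u m).
  by rewrite /mono rmorph_prod; apply: eq_bigr => I _; rewrite rmorphXn.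
have yE w m : y w m = aa w * phi (yB w m).
  have [_ [_ gmin] ->] := ggP w; rewrite -mulrA; congr (_ * _); rewrite rmorphM rmorph_prod; congr (_ * _).
    rewrite hz; last by apply: gmin; exists m.
    by apply: eq_bigr => C /andP [CV nC]; rewrite rmorphXn phiD //; case: (e0P C w m CV) => _ ->.
  by rewrite -monoc; apply: eq_bigr => I _; rewrite phix.
have [ee hee] := mf_scale f.
rewrite (hee T aa (fun w m => phi (yB w m))) //; suff -> : mf_eval f (fun w m => phi (yB w m)) = 0 by rewrite mulr0.
rewrite (mf_map f phi yB); suff -> : mf_eval f yB = 0 by rewrite rmorph0.
(* A top-level minor is the minor at the smallest common ball times the determinants met on the way
   up to the root. *)
have zE I : zB I = (\prod_(C in V | C != top) D C ^+ (bll (vI I) \subset C)) * xB I.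
  have CV : bll (vI I) \in V by exact: ball_verts.
  have ad := adm_bl (idx2_neq I).
  have sub E : E \in V -> (bll (vI I) \subset E) = (bl (L1 I) \in E) && (bl (L2 I) \in E).
    by move=> EV; exact: (ball_subE hU EV ad).
  have /andP [h1 h2] : (bl (L1 I) \in bll (vI I)) && (bl (L2 I) \in bll (vI I)) by rewrite -sub.
  have lam C1 C2 u : C1 \in V -> C2 \in V -> u \in C1 -> u \in C2 -> C1 \subset C2 \/ C2 \subset C1.
    by move=> k1 k2 k3 k4; apply/orP; exact: (laminar hU k1 k2 k3 k4).
  have hmin E : E \in V -> bl (L1 I) \in E -> bl (L2 I) \in E -> bll (vI I) \subset E.
    by move=> EV i1 i2; rewrite sub // i1 i2.
  have kN : (#|bll (vI I)| <= N)%N by rewrite -[leqRHS]card_ord max_card.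
  rewrite /zB (lift_det wB GB lam CV h1 h2 hmin kN); congr (_ * _).
  rewrite big_mkcond [RHS]big_mkcond; apply: eq_bigr => E _.
  case: (boolP (E \in V)) => //= EV; rewrite sub //.
  case: (boolP (E == top)) => [_|nE]; first by rewrite !andbF.
  have -> : (#|E| < N)%N.
    by rewrite -[X in (_ < X)%N]card_ord -finset.cardsT proper_card // finset.properEneq nE finset.subsetT.
  by case: (bl (L1 I) \in E); case: (bl (L2 I) \in E).
have mzE w (m : Gset w) : mono zB (sval m) = (\prod_(C in V | C != top) D C ^+ e0 C w) * yB w m.
  rewrite /yB mulrA -big_split /=.
  transitivity (\prod_(C in V | C != top) D C ^+ eE C (sval m) * mono xB (sval m)).
    rewrite /mono; under eq_bigr => I _ do rewrite zE exprMn -prodrXl.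
    rewrite big_split /= exchange_big; congr (_ * _); apply: eq_bigr => C _.
    by rewrite /eE -prodrXr; apply: eq_bigr => I _; rewrite exprM.
  congr (_ * _); apply: eq_bigr => C /andP [CV _]; rewrite -exprD subnKC //.
  by case: (e0P C w m CV).
(* The polynomial ring over the integers is a domain, so vanishing may be tested in its fraction
   field; there the form vanishes at the monomials of [zB], and the scaling factors are nonzero. *)
pose F : fieldType := {fraction {mpoly int[#|Vr|]}}.
pose c : {rmorphism B -> F} := @tofrac {mpoly int[#|Vr|]}.
have c0 b : c b = 0 -> b = 0 by move=> h; apply/eqP; rewrite -tofrac_eq0; apply/eqP.
apply: (c0); rewrite -(mf_map f c yB).
have := mf_vanish_interior s_gt0 n_ge2 (z := fun I => c (zB I)) hf.
have pl : pluecker (fun _ _ => 1) (fun I => c (zB I)).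
  move=> i j k l ij jk kl /=; rewrite !mul1r -!rmorphM -rmorphB -rmorphD.
  have c00 b : b = 0 -> c b = 0 by move=> ->; rewrite rmorph0.
  by apply: c00; rewrite /zB /L1 /L2 /det2 /=; ring.
have nz I : c (zB I) != 0 by apply: contraNneq (z0 I) => /c0 ->.
move=> /(_ pl nz) h.
have := hee F (fun w => c (\prod_(C in V | C != top) D C ^+ e0 C w)) (fun w m => c (yB w m))
  (fun w m => mono (fun I => c (zB I)) (sval m)).
rewrite h => /(_ _) /esym/eqP; rewrite mulf_eq0 => /(_ _)/orP [].
- by move=> w m; rewrite monoc mzE rmorphM.
- rewrite prodf_seq_eq0 => /hasP [i _ /=]; rewrite expf_eq0 => /andP [_ /eqP /c0 /eqP].
  by rewrite prodf_seq_eq0 => /hasP [C _ /andP [_]]; rewrite expf_eq0 (negPf (D0 C)) andbF.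
- by move/eqP.
Qed.

Lemma theta_vanish (T : comUnitRingType) (z : tpt s K T) (x : idx2 s -> T) (y : forall w : Cset s, Gset w -> T)
    (I0 : VS s -> idx2 s) : RP z x -> theta z x y -> (forall v, vI (I0 v) = v) ->
  (forall v, x (I0 v) \is a GRing.unit) ->
  forall f, mf_vanish (@imageM N s) f -> mf_eval f y = 0.
Proof.
move=> hRP hth hI0 xI0.
have [oo [U [hU [u0 hu0 hUu]]]] := paving_ultra s_gt0 n_ge2 (tp_ok z).
have [mu [t hz]] := tree_normal hU hu0 hUu.
apply: (theta_vanish_normal (z := tact mu z) (x := fun I => wscale mu I * x I) (I0 := I0) hU hu0 hUu hz) => //.
- exact: RP_torus.
- exact: theta_torus.
- by move=> v; rewrite unitrM wscale_unit xI0.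
Qed.

End Vanish.
End FormsVanishing.

(** * Transfer of identities from the interior *)

Module InteriorTransfer.
Import ZariskiCovers SheafGluing Blocks AffineCharts Cells CellHulls PointwiseClosure PavingQuads HeightUltrametric UltrametricTree DualCones ReducedRelations ChartEquations MonomialSets Correspondence InteriorForms.
Import numFieldTopology.Exports.
Local Opaque delta.

Lemma mpoly_homE n (S : comUnitRingType) (ev : {rmorphism {mpoly int[n]} -> S}) p :
  ev p = mmap (intmul (1 : S)) (fun i => ev 'X_i) p.
Proof.
rewrite {1}(mpolyE p) rmorph_sum; apply: eq_bigr => m _.
rewrite -mul_mpolyC rmorphM; congr (_ * _).
  by rewrite -[in LHS](intz p@_m) rmorph_int rmorph_int.
by rewrite -[in LHS]mmap1_id /mmap1 rmorph_prod; apply: eq_bigr => i _; rewrite rmorphXn.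
Qed.

Lemma scale_pow (F : fieldType) (a p1 p2 : F) k D : p2 != 0 -> (k <= D)%N ->
  (a * p1) ^+ k * (a * p2) ^+ (D - k) = (a * p2) ^+ D * (p1 / p2) ^+ k.
Proof.
move=> p0 kD; rewrite -[in RHS](subnK kD) exprD -mulrA -exprMn [LHS]mulrC; congr (_ * _ ^+ _).
by rewrite -mulrA; congr (_ * _); rewrite mulrCA divff // mulr1.
Qed.

Section Perm4.
Variables (A : eqType) (a b c d : A).
Lemma perm4_2 : perm_eq [:: a; b; c; d] [:: c; d; a; b]. Proof. by apply/permP => P /=; lia. Qed.
Lemma perm4_3 : perm_eq [:: a; b; c; d] [:: a; c; b; d]. Proof. by apply/permP => P /=; lia. Qed.
Lemma perm4_4 : perm_eq [:: a; b; c; d] [:: b; d; a; c]. Proof. by apply/permP => P /=; lia. Qed.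
Lemma perm4_5 : perm_eq [:: a; b; c; d] [:: a; d; b; c]. Proof. by apply/permP => P /=; lia. Qed.
Lemma perm4_6 : perm_eq [:: a; b; c; d] [:: b; c; a; d]. Proof. by apply/permP => P /=; lia. Qed.
End Perm4.

Section Transfer.
Variables (N : nat) (s : 'I_N -> nat).
Hypotheses (s_gt0 : forall t, (0 < s t)%N) (n_ge2 : (2 <= \sum_(t < N) s t)%N).
Variables (Co : finType) (co : Co -> {w : Cset s & Gset w}) (j0 : forall w : Cset s, Gset w).

(** Clearing denominators turns a polynomial identity between quotients of coordinates into a form:
    [var] lists every coordinate once as a numerator and once more through the denominator of its
    group. *)
Lemma transfer (p : {mpoly int[#|Co|]}) :
  (forall (F : fieldType) (z : idx2 s -> F) (ev : {rmorphism {mpoly int[#|Co|]} -> F}),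
     pluecker (fun _ _ => 1) z -> (forall c, mono z (sval (j0 (tag (co c)))) != 0) ->
     (forall c, ev 'X_(enum_rank c) = mono z (sval (tagged (co c))) / mono z (sval (j0 (tag (co c))))) ->
     ev p = 0) ->
  forall (T : comUnitRingType) (y : mcoords (@Gset N s) T) (ev : {rmorphism {mpoly int[#|Co|]} -> T}),
    (forall f, mf_vanish (@imageM N s) f -> mf_eval f y = 0) ->
    (forall c, y _ (j0 (tag (co c))) = 1) ->
    (forall c, ev 'X_(enum_rank c) = y _ (tagged (co c))) -> ev p = 0.
Proof.
(* [D] exceeds every exponent occurring in [p], so each denominator keeps a positive exponent after
   homogenisation. *)
move=> H T y ev hy y1 hev; set n := #|Co|; pose D := msize p.
pose var (i : 'I_(n + n)) : {w : Cset s & Gset w} := match split i with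
  | inl k => co (enum_val k) | inr k => existT _ (tag (co (enum_val k))) (j0 _) end.
pose hm (m : 'X_{1..n}) : 'X_{1..n + n} := [multinom match split i with
  | inl k => m k | inr k => (D - m k)%N end | i < n + n].
pose ph : {mpoly int[n + n]} := \sum_(m <- msupp p) p@_m *: 'X_[hm m].
have le m k : m \in msupp p -> (m k < D)%N.
  move=> mp; apply: leq_ltn_trans (msize_mdeg_lt mp).
  by rewrite mdegE (bigD1 k) //= leq_addr.
have sp m' : m' \in msupp ph -> exists2 m, m \in msupp p & m' = hm m.
  rewrite mcoeff_msupp /ph raddf_sum /= => h; apply: contrapT => nex; move/negP: h; apply.
  rewrite big_seq big1 // => m mp; rewrite mcoeffZ mcoeffX; case: eqP => e; last by rewrite mulr0.
  by case: nex; exists m.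
have hom : forall w, exists d : nat, forall m, m \in msupp ph ->
    (\sum_(i < n + n | tag (var i) == w) m i)%N = d.
  move=> w; exists (\sum_(k < n | tag (co (enum_val k)) == w) D)%N => m' /sp [m mp ->].
  rewrite big_split_ord /=.
  rewrite (eq_big (fun k => tag (co (enum_val k)) == w) (fun k => m k)); first last.
  - by move=> k _; rewrite mnmE (unsplitK (inl k)).
  - by move=> k; rewrite /var (unsplitK (inl k)).
  rewrite [X in (_ + X)%N](eq_big (fun k => tag (co (enum_val k)) == w) (fun k => (D - m k)%N)); first last.
  - by move=> k _; rewrite mnmE (unsplitK (inr k)).
  - by move=> k; rewrite /var (unsplitK (inr k)).
  by rewrite -big_split /=; apply: eq_bigr => k _; rewrite subnKC // ltnW // le.
pose f := @Mform _ (@Gset N s) (n + n) var ph hom.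
have fE (S : comUnitRingType) (u : mcoords (@Gset N s) S) : mf_eval f u =
    \sum_(m <- msupp p) (p@_m)%:~R * \prod_(k < n) (u _ (tagged (co (enum_val k))) ^+ m k *
       u _ (j0 (tag (co (enum_val k)))) ^+ (D - m k)).
  rewrite /mf_eval /= raddf_sum; apply: eq_bigr => m _ /=.
  rewrite mmapZ mmapX /mmap1 big_split_ord /= -big_split; congr (_ * _); apply: eq_bigr => k _ /=.
  by rewrite !mnmE /var (unsplitK (inl k)) (unsplitK (inr k)).
have := hy f _; rewrite fE => <-; last first.
  apply: mf_vanish_graph => F z u pl gr; rewrite fE.
  (* Where a denominator vanishes, every term contains it to a positive power, so the form vanishes;
     only points with nonzero denominators remain. *)
  have [/existsP [k /eqP k0]|nz] := boolP [exists k : 'I_n, mono z (sval (j0 (tag (co (enum_val k))))) == 0].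
    rewrite big_seq big1 // => m mp; rewrite (bigD1 k) //=.
    have [a _ ha] := gr (tag (co (enum_val k))).
    by rewrite (ha (j0 _)) k0 mulr0 expr0n subn_eq0 leqNgt le // mulr0 mul0r mulr0.
  have nz' c : mono z (sval (j0 (tag (co c)))) != 0.
    by move: nz; rewrite negb_exists => /forallP /(_ (enum_rank c)); rewrite enum_rankK.
  have [e he] := poly_eval (fun c => mono z (sval (tagged (co c))) / mono z (sval (j0 (tag (co c))))).
  have := H F z e pl nz' he; rewrite mpoly_homE /mmap => h0.
  transitivity ((\prod_(k < n) u _ (j0 (tag (co (enum_val k)))) ^+ D) *
    \sum_(m <- msupp p) (p@_m)%:~R * mmap1 (fun i => e 'X_i) m); last by rewrite h0 mulr0.
  rewrite mulr_sumr [LHS]big_seq [RHS]big_seq; apply: eq_bigr => m mp; rewrite mulrCA; congr (_ * _).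
  rewrite /mmap1 -big_split; apply: eq_bigr => k _ /=.
  have -> : e 'X_k = mono z (sval (tagged (co (enum_val k)))) / mono z (sval (j0 (tag (co (enum_val k))))).
    by rewrite -he enum_valK.
  have [a a0 ha] := gr (tag (co (enum_val k))); rewrite !ha.
  by apply: scale_pow; [exact: nz'|exact/ltnW/le].
rewrite mpoly_homE; apply: eq_bigr => m _; congr (_ * _); apply: eq_bigr => k _.
by rewrite y1 expr1n mulr1 -hev enum_valK.
Qed.

End Transfer.

Section Coordinates.
Variables (N : nat) (s : 'I_N -> nat).
Hypotheses (s_gt0 : forall t, (0 < s t)%N) (n_ge2 : (2 <= \sum_(t < N) s t)%N).
Notation vs := (vs s_gt0 n_ge2).
Notation adm := (adm s).
Notation vI := (vI s_gt0 n_ge2).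
Notation vv := (vv s_gt0 n_ge2).
Notation W1 := (W1 s_gt0 n_ge2).
Notation M1 := (M1 s_gt0 n_ge2).
Notation cr := (cr s_gt0 n_ge2).

Definition b4 (I J : idx2 s) : seq 'I_N :=
  [:: bl (sval I).1; bl (sval I).2; bl (sval J).1; bl (sval J).2].

Lemma M2P (I J : idx2 s) (u : uniq (b4 I J)) : inG (sval (W4 s u)) (d2 I J).
Proof.
have h := (W4_deg s_gt0 n_ge2 u (vI I) (vI J)).2 (mem_head _ _).
by apply: (@inG_d2 _ _ s_gt0 n_ge2) => t; rewrite ffunE -h.
Qed.

(** Finite names for the coordinates: a linear one is named by an index, a quadratic one by two
    indices involving four distinct blocks. The remaining pairs name an irrelevant linear
    coordinate. *)
Definition co (c : idx2 s + idx2 s * idx2 s) : {w : Cset s & Gset w} :=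
  match c with
  | inl K => existT _ (W1 (vI K)) (M1 K)
  | inr (K, L) => match sumbool_of_bool (uniq (b4 K L)) with
     | left u => existT _ (W4 s u) (mkG (M2P u))
     | right _ => existT _ (W1 (vI K)) (M1 K) end
  end.

Lemma coords_ext (R : Type) (y : mcoords (@Gset N s) R) (w w' : Cset s) (m : Gset w) (m' : Gset w') :
  w = w' -> sval m = sval m' -> y w m = y w' m'.
Proof. by move=> e; subst w' => /val_inj ->. Qed.

Lemma W4_perm a b c d a' b' c' d' (u : uniq [:: a; b; c; d]) (u' : uniq [:: a'; b'; c'; d']) :
  [:: a; b; c; d] =i [:: a'; b'; c'; d'] -> W4 s u = W4 s u'.
Proof. by move=> e; apply/val_inj/ffunP => t; rewrite !ffunE e. Qed.

Variables (I0 : VS s -> idx2 s) (hI0 : forall v, vI (I0 v) = v).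
Notation Co := (idx2 s + idx2 s * idx2 s)%type.
Notation B := {mpoly int[#|{: Co}|]}.
Definition X1 (I : idx2 s) : B := 'X_(enum_rank (inl I : Co)).
Definition X2 (I J : idx2 s) : B := 'X_(enum_rank (inr (I, J) : Co)).
Definition e1 i j := (sval (I0 (vs i j))).1.
Definition e2 i j := (sval (I0 (vs i j))).2.
(** Represents the product of the pairs [ij] and [kl] up to a factor shared with the pairing
    [ik | jl]. For distinct blocks this is a quadratic coordinate. For [i = j] or [k = l] it is the
    minor that a Pluecker relation equates with that product, the competing pairing being normalised
    to 1. *)
Definition YB i j k l : B :=
  if uniq [:: i; j; k; l] then X2 (I0 (vs i j)) (I0 (vs k l))
  else if (i == j) || (k == l) then
    ext X1 (e1 i j) (e1 k l) * ext X1 (e2 i j) (e2 k l) - ext X1 (e1 i j) (e2 k l) * ext X1 (e2 i j) (e1 k l)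
  else 1.

Lemma YB_sym1 i j k l : YB j i k l = YB i j k l.
Proof.
rewrite /YB /e1 /e2 (vs_sym _ _ j i) (eq_sym j i) (_ : uniq [:: j; i; k; l] = uniq [:: i; j; k; l]) //.
by apply: perm_uniq; apply/permP => P /=; lia.
Qed.

Lemma YB_sym2 i j k l : YB i j l k = YB i j k l.
Proof.
rewrite /YB /e1 /e2 (vs_sym _ _ l k) (eq_sym l k) (_ : uniq [:: i; j; l; k] = uniq [:: i; j; k; l]) //.
by apply: perm_uniq; apply/permP => P /=; lia.
Qed.

Lemma e12P i j : adm i j -> (bl (e1 i j) = i /\ bl (e2 i j) = j) \/ (bl (e1 i j) = j /\ bl (e2 i j) = i).
Proof.
move=> ad; have ne := idx2_neq (I0 (vs i j)).
have := hI0 (vs i j); rewrite /Blocks.vI => /(vs_inj (adm_bl ne) ad).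
by case=> [[-> ->]|[-> ->]]; [left|right].
Qed.

Section Interior.
Variables (F : fieldType) (z : idx2 s -> F) (ev : {rmorphism B -> F}) (j0 : forall w : Cset s, Gset w).
Hypotheses (hj : forall v, sval (j0 (W1 v)) = d1 (I0 v)) (pl : pluecker (fun _ _ => 1) z)
  (nz : forall c, mono z (sval (j0 (tag (co c)))) != 0)
  (hev : forall c, ev 'X_(enum_rank c) = mono z (sval (tagged (co c))) / mono z (sval (j0 (tag (co c))))).

Lemma pl_all a b c d : ext z a b * ext z c d = ext z a c * ext z b d - ext z a d * ext z b c.
Proof.
have : plE s_gt0 n_ge2 (fun _ _ => 1) z a b c d = 0.
  apply: (@tuple_sorted _ (fun a b c d => plE s_gt0 n_ge2 (fun _ _ => 1) z a b c d = 0)) => {a b c d} [a b c d h|a b c d h|a b c d h|a c d|].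
  - by rewrite plE_12 // h oppr0.
  - by rewrite plE_23 // h oppr0.
  - by rewrite plE_34 // h oppr0.
  - by rewrite plE_diag.
  - exact: ((pluecker_plE (s_gt0 := s_gt0) (n_ge2 := n_ge2) (h := fun _ _ => 1) z (fun _ _ => erefl)).1 pl).
rewrite /plE !mul1r => e; apply/eqP; rewrite -subr_eq0; apply/eqP; rewrite -e; ring.
Qed.

Definition zc v := z (I0 v).

Lemma zc0 v : zc v != 0.
Proof. by have := nz (inl (I0 v)); rewrite /= hI0 hj mono_d1. Qed.

Lemma ev_X1 I : ev (X1 I) = (zc (vI I))^-1 * z I.
Proof. by rewrite /X1 hev /= hj !mono_d1 mulrC. Qed.

Lemma ev_X2 I J (u : uniq (b4 I J)) : ev (X2 I J) = z I * z J / mono z (sval (j0 (W4 s u))).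
Proof.
rewrite /X2 hev /co; case: (sumbool_of_bool (uniq (b4 I J))) => [u'|e]; last by case/negP: (negbT e).
by rewrite /= mono_d2 (bool_irrelevance u' u).
Qed.

Lemma ev_ext a b : ev (ext X1 a b) = (zc (vv a b))^-1 * ext z a b.
Proof.
rewrite -ext_map -(ext_scale s_gt0 n_ge2 (fun v => (zc v)^-1)).
by congr (ext _ a b); apply/funext => I; rewrite /= ev_X1.
Qed.

Lemma ext_e i j : ext z (e1 i j) (e2 i j) = zc (vs i j).
Proof. exact: ext_idx. Qed.

Lemma b4_mem i j k l : adm i j -> adm k l -> b4 (I0 (vs i j)) (I0 (vs k l)) =i [:: i; j; k; l].
Proof.
move=> ij kl t; rewrite /b4 !inE -!/(e1 _ _) -!/(e2 _ _).
by case: (e12P ij) => -[-> ->]; case: (e12P kl) => -[-> ->]; do 4!case: (t == _).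
Qed.

Lemma b4_uniq i j k l : adm i j -> adm k l -> uniq [:: i; j; k; l] -> uniq (b4 (I0 (vs i j)) (I0 (vs k l))).
Proof.
move=> ij kl u; have e := b4_mem ij kl.
by rewrite (eq_uniq (_ : size _ = size [:: i; j; k; l]) e).
Qed.

Lemma Y_uniq i j k l (u : uniq [:: i; j; k; l]) : adm i j -> adm k l ->
  ev (YB i j k l) = zc (vs i j) * zc (vs k l) / mono z (sval (j0 (W4 s u))).
Proof.
move=> ij kl; rewrite /YB u (ev_X2 (b4_uniq ij kl u)).
by rewrite (W4_perm (b4_uniq ij kl u) u (b4_mem ij kl)).
Qed.

Lemma Y_loop i j k l : adm i j -> adm k l -> (i == j) || (k == l) ->
  ev (YB i j k l) = zc (vs i j) * zc (vs k l) / (zc (vs i k) * zc (vs j l)).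
Proof.
move=> ij kl h; rewrite /YB (_ : uniq _ = false) ?h; last first.
  by case/orP: h => /eqP ->; rewrite /= !inE eqxx ?orbT ?andbF.
rewrite rmorphB !rmorphM !ev_ext -(ext_e i j) -(ext_e k l) pl_all.
have h1 : zc (vv (e1 i j) (e1 k l)) * zc (vv (e2 i j) (e2 k l)) = zc (vs i k) * zc (vs j l).
  rewrite /ReducedRelations.vv; case: (e12P ij) => -[-> ->]; case: (e12P kl) => -[-> ->] //.
  - by case/orP: h => /eqP e; rewrite ?e // mulrC.
  - by case/orP: h => /eqP e; rewrite ?e // mulrC.
  - by rewrite mulrC.
have h2 : zc (vv (e1 i j) (e2 k l)) * zc (vv (e2 i j) (e1 k l)) = zc (vs i k) * zc (vs j l).
  rewrite /ReducedRelations.vv; case: (e12P ij) => -[-> ->]; case: (e12P kl) => -[-> ->] //.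
  - by case/orP: h => /eqP e; rewrite ?e // mulrC.
  - by rewrite mulrC.
  - by case/orP: h => /eqP e; rewrite ?e // mulrC.
rewrite mulrBl -{1}h1 -h2 !invfM; congr (_ - _); ring.
Qed.

Lemma Y_one i j k l : ~~ uniq [:: i; j; k; l] -> ~~ ((i == j) || (k == l)) -> ev (YB i j k l) = 1.
Proof. by move=> /negPf u /negPf h; rewrite /YB u h rmorph1. Qed.

Lemma vs_sym' i j : vs i j = vs j i. Proof. exact: vs_sym. Qed.

Lemma Y_meet i j k l : adm i j -> adm k l -> (i == k) || (i == l) || (j == k) || (j == l) -> ev (YB i j k l) = 1.
Proof.
move=> ij kl h; have [hl|hl] := boolP ((i == j) || (k == l)).
  have z1 := zc0 (vs i j); have z2 := zc0 (vs k l).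
  rewrite Y_loop //; suff -> : zc (vs i k) * zc (vs j l) = zc (vs i j) * zc (vs k l).
    by rewrite divff // mulf_neq0.
  case/orP: hl => /eqP e; subst; case/orP: h => [/orP [/orP [] |]|] /eqP e; subst; first [by [] | by rewrite mulrC; congr (_ * zc _); exact: vs_sym' |
      by rewrite mulrC; congr (zc _ * _); exact: vs_sym'].
rewrite Y_one //; apply/negP; rewrite /= !inE !negb_or => /and4P [/and3P [_ h1 h2] /andP [h3 h4] _ _].
by move: h; rewrite (negPf h1) (negPf h2) (negPf h3) (negPf h4).
Qed.

(** The quotient of two values of [YB] is the cross ratio of the reference coordinates [zc],
    whichever case of the definition applies to each of them. *)
Lemma Y_rat a b c d : adm a b -> adm c d -> adm a c -> adm b d ->
  ev (YB a b c d) * (zc (vs a c) * zc (vs b d)) = ev (YB a c b d) * (zc (vs a b) * zc (vs c d)).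
Proof.
move=> ab cd ac bd; have Z v := zc0 v.
have [u|nu] := boolP (uniq [:: a; b; c; d]).
  have u' : uniq [:: a; c; b; d] by rewrite -(perm_uniq (perm4_3 a b c d)).
  have e : W4 s u' = W4 s u by apply: W4_perm => t; rewrite !inE; congr (_ || _); rewrite orbCA.
  by rewrite (Y_uniq u) // (Y_uniq u') // e; ring.
have nu' : ~~ uniq [:: a; c; b; d].
  by apply: contra nu; rewrite -(perm_uniq (perm4_3 a b c d)).
have Zm v w : zc v * zc w != 0 by rewrite mulf_neq0.
have [h1|h1] := boolP ((a == b) || (c == d)).
  have -> : ev (YB a b c d) * (zc (vs a c) * zc (vs b d)) = zc (vs a b) * zc (vs c d) by rewrite Y_loop // divfK.
  by rewrite Y_meet ?mul1r //; case/orP: h1 => ->; rewrite ?orbT.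
have [h2|h2] := boolP ((a == c) || (b == d)).
  have -> : ev (YB a c b d) * (zc (vs a b) * zc (vs c d)) = zc (vs a c) * zc (vs b d) by rewrite Y_loop // divfK.
  by rewrite Y_meet ?mul1r //; case/orP: h2 => ->; rewrite ?orbT.
rewrite !Y_one // !mul1r; move: nu; rewrite /= !inE !negb_or !negb_and !negbK.
move: h1 h2; rewrite !negb_or => /andP [/negPf -> /negPf ->] /andP [/negPf -> /negPf ->]; rewrite /= !orbF.
by case/orP => /eqP e; subst; rewrite ?(vs_sym' d c) ?(vs_sym' d b) // 1?mulrC // (vs_sym' c d) mulrC.
Qed.

End Interior.
End Coordinates.
End InteriorTransfer.

(** * Identities between the coordinates of a point of M *)

Module CoordinateRelations.
Import ZariskiCovers SheafGluing Blocks AffineCharts Cells CellHulls PointwiseClosure PavingQuads HeightUltrametric UltrametricTree DualCones ReducedRelations ChartEquations MonomialSets Correspondence InteriorForms InteriorTransfer.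
Import numFieldTopology.Exports.
Local Opaque delta.

Lemma three_term_alg (F : fieldType) (z1 z2 z3 z4 z5 z6 x1 x2 x3 x4 x5 x6 Y1 Y2 Y3 : F) :
  z1 != 0 -> z2 != 0 -> z3 != 0 -> z4 != 0 -> z5 != 0 -> z6 != 0 ->
  Y1 * (z3 * z4) = Y2 * (z1 * z2) -> Y1 * (z5 * z6) = Y3 * (z1 * z2) ->
  x1 * x2 = x3 * x4 - x5 * x6 ->
  Y1 * (z1^-1 * x1 * (z2^-1 * x2)) - Y2 * (z3^-1 * x3 * (z4^-1 * x4)) +
  Y3 * (z5^-1 * x5 * (z6^-1 * x6)) = 0.
Proof.
move=> n1 n2 n3 n4 n5 n6 r1 r2 pl'.
  have E2 : Y2 = Y1 * (z3 * z4) / (z1 * z2) by rewrite r1 mulfK // mulf_neq0.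
  have E3 : Y3 = Y1 * (z5 * z6) / (z1 * z2) by rewrite r2 mulfK // mulf_neq0.
  have -> : Y1 * (z1^-1 * x1 * (z2^-1 * x2)) = Y1 / (z1 * z2) * (x1 * x2) by rewrite invfM; ring.
  have -> : Y2 * (z3^-1 * x3 * (z4^-1 * x4)) = Y1 / (z1 * z2) * (x3 * x4).
    by rewrite E2; field; rewrite ?n1 ?n2 ?n3 ?n4.
  have -> : Y3 * (z5^-1 * x5 * (z6^-1 * x6)) = Y1 / (z1 * z2) * (x5 * x6).
    by rewrite E3; field; rewrite ?n1 ?n2 ?n5 ?n6.
  by rewrite pl'; ring.
Qed.

Section Facts.
Variables (N : nat) (s : 'I_N -> nat).
Hypotheses (s_gt0 : forall t, (0 < s t)%N) (n_ge2 : (2 <= \sum_(t < N) s t)%N).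
Notation vs := (vs s_gt0 n_ge2).
Notation adm := (adm s).
Notation vI := (vI s_gt0 n_ge2).
Notation vv := (vv s_gt0 n_ge2).
Notation W1 := (W1 s_gt0 n_ge2).
Notation M1 := (M1 s_gt0 n_ge2).
Notation cr := (cr s_gt0 n_ge2).
Notation co := (co s_gt0 n_ge2).
Notation Quad := ('I_N * 'I_N * ('I_N * 'I_N))%type.

Definition Yp (T : comUnitRingType) (Y : 'I_N -> 'I_N -> 'I_N -> 'I_N -> T) (q : Quad) : T :=
  Y q.1.1 q.1.2 q.2.1 q.2.2.
Definition Ym (T : comUnitRingType) (Y : 'I_N -> 'I_N -> 'I_N -> 'I_N -> T) (q : Quad) : T :=
  Y q.1.1 q.2.1 q.1.2 q.2.2.

Variable I0 : VS s -> idx2 s.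
Notation e1 := (e1 s_gt0 n_ge2 I0).
Notation e2 := (e2 s_gt0 n_ge2 I0).

(** [Y] supplies numerators and denominators of cross ratios. [Yval] says, without dividing, that
    their quotients depend only on the character, and [Yrp] is the Pluecker relation with these
    coefficients. *)
Record facts (T : comUnitRingType) (y : mcoords (@Gset N s) T) (x : idx2 s -> T)
    (Y : 'I_N -> 'I_N -> 'I_N -> 'I_N -> T) : Prop := Facts {
  Ysym1 : forall i j k l, Y j i k l = Y i j k l;
  Ysym2 : forall i j k l, Y i j l k = Y i j k l;
  Ysym3 : forall i j k l, adm i j -> adm k l -> Y k l i j = Y i j k l;
  Ymeet : forall i j k l, adm i j -> adm k l -> (i == k) || (i == l) || (j == k) || (j == l) -> Y i j k l = 1;
  Yval : forall L L' : seq Quad, all (cr_adm s) L -> all (cr_adm s) L' ->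
    \sum_(q <- L) cr q = \sum_(q <- L') cr q ->
    (\prod_(q <- L) Yp Y q) * (\prod_(q <- L') Ym Y q) = (\prod_(q <- L') Yp Y q) * (\prod_(q <- L) Ym Y q);
  Yrp : forall a b c d : 'I_(tot s), uniq [:: a; b; c; d] ->
    Y (bl a) (bl b) (bl c) (bl d) * (ext x a b * ext x c d) -
    Y (bl a) (bl c) (bl b) (bl d) * (ext x a c * ext x b d) +
    Y (bl a) (bl d) (bl b) (bl c) * (ext x a d * ext x b c) = 0;
  Yxm : forall i j k l (u : uniq [:: i; j; k; l]) (m : Gset (W4 s u)) I J, sval m = d2 I J ->
    vI I = vs i j -> vI J = vs k l -> y (W4 s u) m = Y i j k l * (x I * x J);
  Yloop : forall i j k l, adm i j -> adm k l -> (i == j) || (k == l) -> Y i j k l =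
    ext x (e1 i j) (e1 k l) * ext x (e2 i j) (e2 k l) - ext x (e1 i j) (e2 k l) * ext x (e2 i j) (e1 k l);
  Yx0 : forall v, x (I0 v) = 1;
  Yxy : forall w (m : Gset w) I, sval m = d1 I -> sval w = sval (W1 (vI I)) -> y w m = x I
}.

Hypothesis hI0 : forall v, vI (I0 v) = v.

Lemma end_cases i j I : adm i j -> vI I = vs i j ->
  (bl (sval I).1 = i /\ bl (sval I).2 = j) \/ (bl (sval I).1 = j /\ bl (sval I).2 = i).
Proof.
move=> ad e; have := e; rewrite /Blocks.vI => /(vs_inj (adm_bl (idx2_neq I)) ad).
by case=> [[-> ->]|[-> ->]]; [left|right].
Qed.

(** The relations involving [Y] are polynomial in the coordinates of [y]; where they are not formal
    they follow by [transfer] from fields, where [Y] is known in terms of Pluecker coordinates. *)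
Lemma coord_facts (T : comUnitRingType) (y : mcoords (@Gset N s) T) (j0 : forall w : Cset s, Gset w) :
  (forall f, mf_vanish (@imageM N s) f -> mf_eval f y = 0) ->
  (forall v, sval (j0 (W1 v)) = d1 (I0 v)) -> (forall w, y w (j0 w) = 1) ->
  exists Y, facts y (fun I => y (W1 (vI I)) (M1 I)) Y.
Proof.
move=> hy hj y1; pose x I := y (W1 (vI I)) (M1 I); rewrite -/x.
have [ev hev] := poly_eval (fun c => y _ (tagged (co c))).
pose YY := YB s_gt0 n_ge2 I0.
have tr p1 p2 : (forall (F : fieldType) (z : idx2 s -> F) (e : {rmorphism _ -> F}),
     pluecker (fun _ _ => 1) z -> (forall c, mono z (sval (j0 (tag (co c)))) != 0) ->
     (forall c, e 'X_(enum_rank c) = mono z (sval (tagged (co c))) / mono z (sval (j0 (tag (co c))))) ->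
     e p1 = e p2) -> ev p1 = ev p2.
  move=> h.
  have H (F : fieldType) (z : idx2 s -> F) (e : {rmorphism {mpoly int[#|{: (idx2 s + idx2 s * idx2 s)%type}|]} -> F}) :
     pluecker (fun _ _ => 1) z -> (forall c, mono z (sval (j0 (tag (co c)))) != 0) ->
     (forall c, e 'X_(enum_rank c) = mono z (sval (tagged (co c))) / mono z (sval (j0 (tag (co c))))) -> e (p1 - p2) = 0.
    by move=> h1 h2 h3; rewrite rmorphB (h F z e h1 h2 h3) subrr.
  have h' : ev (p1 - p2) = 0 := transfer H hy (fun c => y1 _) hev.
  by move: h'; rewrite rmorphB => /eqP; rewrite subr_eq0 => /eqP.
have evx I : ev (X1 I) = x I by rewrite /X1 hev.
have evext a b : ev (ext (@X1 _ s) a b) = ext x a b.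
  by rewrite -ext_map; congr (ext _ a b); apply/funext => I; exact: evx.
have Mp (F : fieldType) (e : {rmorphism _ -> F}) (L : seq Quad) (h : Quad -> _) :
   e (\prod_(q <- L) h q) = \prod_(q <- L) e (h q) by rewrite rmorph_prod.
exists (fun i j k l => ev (YY i j k l)); split.
- by move=> i j k l; rewrite /YY YB_sym1.
- by move=> i j k l; rewrite /YY YB_sym2.
- move=> i j k l ij kl; apply: tr => F z e pl nz he.
  have [u|nu] := boolP (uniq [:: i; j; k; l]).
    have u' : uniq [:: k; l; i; j] by rewrite -(perm_uniq (perm4_2 i j k l)).
    rewrite (Y_uniq hI0 he u ij kl) (Y_uniq hI0 he u' kl ij).
    have -> : W4 s u' = W4 s u by apply: W4_perm => t; rewrite !inE; do 4!case: (t == _).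
    by rewrite (mulrC (zc _ _ _)).
  have nu' : ~~ uniq [:: k; l; i; j].
    by apply: contra nu; rewrite -(perm_uniq (perm4_2 i j k l)).
  have [h|h] := boolP ((i == j) || (k == l)).
    rewrite (Y_loop hI0 hj pl he ij kl h) (Y_loop hI0 hj pl he kl ij) 1?orbC //.
    by rewrite (vs_sym _ _ k i) (vs_sym _ _ l j) (mulrC (zc _ _ (vs k l))).
  have h' : ~~ ((k == l) || (i == j)) by rewrite orbC.
  by rewrite !Y_one.
- move=> i j k l ij kl h; rewrite -(rmorph1 ev); apply: tr => F z e pl nz he.
  by rewrite rmorph1; exact: (Y_meet hI0 hj pl nz he ij kl h).
- move=> L L' hL hL' es; rewrite /Yp /Ym -!rmorph_prod -!rmorphM; apply: tr => F z e pl nz he.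
  rewrite !rmorphM !Mp.
  (* The reference coordinates form a point of the torus, at which the character [cr q] takes the
     value [Yp] divided by [Ym]. *)
  pose mu : torus s F := exist (fun nu : VS s -> F => forall v, nu v \is a GRing.unit) (zc (F := F) I0 z)
    (fun v => etrans (unitfE _) (zc0 hI0 hj nz v)).
  have one q : cr_adm s q -> e (Yp YY q) = e (Ym YY q) * chareval mu (cr q).
    case: q => [[a b] [c d]] /and4P [/= ab cd ac bd]; rewrite /Yp /Ym /=.
    have := Y_rat hI0 hj pl nz he ab cd ac bd.
    have z1 : zc (F := F) I0 z (vs a c) * zc I0 z (vs b d) != 0 by rewrite mulf_neq0 ?(zc0 hI0 hj nz).
    move=> h; apply: (mulIf z1); rewrite h -mulrA; congr (_ * _).
    by rewrite crE' -(chareval_pd mu (vs a b)) -(chareval_pd mu (vs a c)) -charevalD subrK.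
  have all1 M : all (cr_adm s) M -> \prod_(q <- M) e (Yp YY q) = (\prod_(q <- M) e (Ym YY q)) * chareval mu (\sum_(q <- M) cr q).
    elim: M => [|q M IH] /=; first by rewrite !big_nil chareval0 mulr1.
    by move=> /andP [hq /IH hM]; rewrite !big_cons charevalD one // hM mulrACA.
  rewrite -/(Yp YY) -/(Ym YY).
  by rewrite [X in X * _](all1 L hL) [X in _ = X * _](all1 L' hL') es; ring.
- move=> a b c d; rewrite /= !inE !negb_or => /and4P [/and3P [ab ac ad] /andP [bc bd] cd _].
  rewrite -(evext a b) -(evext c d) -(evext a c) -(evext b d) -(evext a d) -(evext b c).
  rewrite -!rmorphM -rmorphB -rmorphD -(rmorph0 ev); apply: tr => F z e pl nz he.
  rewrite rmorph0 rmorphD rmorphB !rmorphM !(ev_ext hj he).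
  have ba : b != a by rewrite eq_sym.
  have Z v := zc0 hI0 hj nz v.
  have r1 := Y_rat hI0 hj pl nz he (adm_bl ab) (adm_bl cd) (adm_bl ac) (adm_bl bd).
  have dc : d != c by rewrite eq_sym.
  have r2 := Y_rat hI0 hj pl nz he (adm_bl ab) (adm_bl dc) (adm_bl ad) (adm_bl bc).
  rewrite (YB_sym2 _ _ I0 (bl a) (bl b) (bl c) (bl d)) in r2.
  have := pl_all s_gt0 n_ge2 pl a b c d; move: r1 r2 (Z (vv a b)) (Z (vv c d)) (Z (vv a c)) (Z (vv b d)) (Z (vv a d)) (Z (vv b c)); rewrite -!/(vv _ _) (vvC _ _ d c).
  by move=> r1 r2 n1 n2 n3 n4 n5 n6 pl'; exact: (three_term_alg n1 n2 n3 n4 n5 n6 r1 r2 pl').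
- move=> i j k l u m I J em eI eJ.
  have u4 := u; move: u4; rewrite /= !inE !negb_or => /and4P [/and3P [nij _ _] _ nkl _].
  have ij : adm i j by exact: adm_neq.
  have kl : adm k l by exact: adm_neq.
  have mem : b4 I J =i [:: i; j; k; l].
    move=> t; rewrite /b4 !inE.
    by case: (end_cases ij eI) => -[-> ->]; case: (end_cases kl eJ) => -[-> ->]; do 4!case: (t == _).
  have ub : uniq (b4 I J) by rewrite (eq_uniq (_ : size _ = size [:: i; j; k; l]) mem).
  have -> : y (W4 s u) m = ev (X2 I J).
    rewrite /X2 hev /InteriorTransfer.co; case: (sumbool_of_bool (uniq (b4 I J))) => [u'|e]; last by case/negP: (negbT e).
    by apply: coords_ext; [exact/esym/W4_perm|rewrite em].
  rewrite -!evx -!rmorphM; apply: tr => F z e pl nz he.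
  rewrite !rmorphM (ev_X2 he ub) (Y_uniq hI0 he u ij kl) !(ev_X1 hj he) eI eJ (W4_perm s ub u mem).
  have := zc0 hI0 hj nz (vs i j); have := zc0 hI0 hj nz (vs k l).
  move: (zc I0 z (vs i j)) (zc I0 z (vs k l)) (mono _ _)^-1 => z1 z2 z3 n2 n1.
  transitivity ((z1 / z1) * (z2 / z2) * (z I * z J * z3)); first by rewrite !divff // !mul1r.
  by ring.
- move=> i j k l ij kl h; rewrite /YY /YB (_ : uniq _ = false) ?h; last first.
    by case/orP: h => /eqP ->; rewrite /= !inE eqxx ?orbT ?andbF.
  by rewrite rmorphB !rmorphM !evext.
- move=> v; rewrite /x -[RHS](y1 (W1 v)); apply: coords_ext; first by rewrite hI0.
  by rewrite /= hj.
- by move=> w m I em ew; rewrite /x; apply: coords_ext; [apply: val_inj|].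
Qed.

End Facts.
End CoordinateRelations.

(** * Ultrametrics from patterns of zeros *)

Module ZeroPatterns.
Import Blocks HeightUltrametric UltrametricTree UltrametricPavings.
Lemma four1 (ab ac ad bd cd : nat) : (ab <= bd \/ ad <= bd -> ac <= ad \/ cd <= ad ->
  ab < ac -> ad < ac -> cd < ac -> ab + cd < ac + bd)%N.
Proof. by case=> h1 [] h2 h3 h4 h5; lia. Qed.

Lemma four2 (ab ac bc bd cd : nat) : (ab <= ac \/ bc <= ac -> cd <= bc \/ bd <= bc ->
  bc < bd -> cd < bd -> ab < bd -> ab + cd < ac + bd)%N.
Proof. by case=> h1 [] h2 h3 h4 h5; lia. Qed.

Section ZeroPattern.
Variables (N : nat) (s : 'I_N -> nat) (K : realType).
Notation adm := (adm s).
Variables (o : 'I_N) (Z : 'I_N -> 'I_N -> 'I_N -> 'I_N -> bool).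
Hypotheses (S1 : forall i j k l, Z j i k l = Z i j k l) (S2 : forall i j k l, Z i j l k = Z i j k l)
  (S3 : forall i j k l, adm i j -> adm k l -> Z k l i j = Z i j k l)
  (ME : forall i j k l, adm i j -> adm k l -> (i == k) || (i == l) || (j == k) || (j == l) -> Z i j k l = false)
  (A1 : forall i j k l, uniq [:: i; j; k; l] -> Z i j k l -> Z i k j l -> False)
  (H1 : forall a b c e, c != o -> b != o -> e != o -> adm a b -> adm a c -> adm a e ->
     Z a b e o -> Z a b c o || Z a c e o || Z a e b o)
  (H2 : forall a b c d, b != o -> c != o -> adm a b -> adm c d -> adm a c -> adm b d ->
     (Z a b c d || Z a c b o || Z c o d b) = (Z a b c o || Z c d o b || Z a c b d))
  (H4 : forall b d e, b != o -> d != o -> e != o -> adm o o -> adm b d -> adm b e ->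
     (Z o o b d || Z b e d o) = (Z o o b e || Z b d e o)).

Lemma A1g i j k l : adm i j -> adm k l -> adm i k -> adm j l -> Z i j k l -> Z i k j l -> False.
Proof.
move=> ij kl ik jl h1 h2; have [u|nu] := boolP (uniq [:: i; j; k; l]); first exact: A1 u h1 h2.
move: nu; rewrite /= !inE !negb_or !negb_and !negbK.
have n1 : ~~ ((i == k) || (i == l) || (j == k) || (j == l)) by apply/negP => h; rewrite (ME ij kl h) in h1.
have n2 : ~~ ((i == j) || (i == l) || (k == j) || (k == l)) by apply/negP => h; rewrite (ME ik jl h) in h2.
move: n1 n2; rewrite !negb_or => /andP [/andP [/andP [q1 q2] q3] q4] /andP [/andP [/andP [q5 q6] q7] q8].
by rewrite (negPf q1) (negPf q2) (negPf q3) (negPf q4) (negPf q5) (negPf q8).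
Qed.

(** [Z a b e o] is to mean that [e] leaves the branch of [a] before [b] does, so the depth of the
    pair [ab] is measured by counting such blocks. *)
Definition sepset a b : {set 'I_N} := [set e | (e != o) && Z a b e o].

(** The depth of the double of [o]: zero if some pair avoiding [o] gives a nonzero value, one if all
    such pairs give zero, and zero if there is no such pair. *)
Definition Uoo : nat :=
  if [exists p : 'I_N * 'I_N, [&& p.1 != o, p.2 != o, adm p.1 p.2 & ~~ Z o o p.1 p.2]] then 0%N
  else if [exists p : 'I_N * 'I_N, [&& p.1 != o, p.2 != o & adm p.1 p.2]] then 1%N else 0%N.

Definition Uz a b : nat :=
  if (a == o) && (b == o) then Uoo else if (a == o) || (b == o) then 0%N
  else if adm a b then #|sepset a b| else N.

Lemma Uz_sym a b : Uz a b = Uz b a.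
Proof.
have e : sepset a b = sepset b a by apply/setP => e; rewrite !inE S1.
by rewrite /Uz (andbC (a == o)) (orbC (a == o)) (adm_sym s a b) e.
Qed.

Lemma Uz_o a : a != o -> Uz a o = 0%N.
Proof. by move=> /negPf h; rewrite /Uz h eqxx. Qed.

Lemma Uz_ne a b : a != o -> b != o -> adm a b -> Uz a b = #|sepset a b|.
Proof. by move=> /negPf ha /negPf hb ab; rewrite /Uz ha hb ab. Qed.

Lemma Z_ne a b e : e != o -> b != o -> adm a b -> Z a b e o -> e != a /\ e != b.
Proof.
move=> eo bo ab h; have eo' := adm_neq s eo.
by split; apply/negP => /eqP ee; subst e; rewrite ME ?eqxx ?orbT in h.
Qed.

(** Of the three alternatives offered by [H1], one is excluded by hypothesis and one because two
    pairings of the same blocks cannot vanish together. *)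
Lemma T1 a b c e : a != o -> b != o -> c != o -> e != o -> adm a b -> adm a c ->
  Z a b e o -> ~~ Z a c e o -> Z a b c o.
Proof.
move=> ao bo co eo ab ac h h'; have [ea eb] := Z_ne eo bo ab h.
have ae : adm a e by apply: adm_neq; rewrite eq_sym.
have := H1 co bo eo ab ac ae h; rewrite (negPf h') orbF => /orP [//|h2].
by case: (@A1g a b e o ab (adm_neq s eo) ae (adm_neq s bo) h h2).
Qed.

(** Together with [Q2], this orders the sets [sepset a b], for fixed [a], into a chain as prescribed
    by [Z a b c o]. *)
Lemma Q1 a b c : a != o -> b != o -> c != o -> adm a b -> adm a c -> ~~ Z a b c o -> (Uz a b <= Uz a c)%N.
Proof.
move=> ao bo co ab ac h; rewrite !Uz_ne //; apply: subset_leq_card; apply/fintype.subsetP => e.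
rewrite !inE => /andP [eo he]; rewrite eo /=; apply: contraNT h => h'; exact: (T1 ao bo co eo ab ac he h').
Qed.

Lemma Q2 a b c : a != o -> b != o -> c != o -> adm a b -> Z a b c o -> (Uz a c < Uz a b)%N.
Proof.
move=> ao bo co ab h; have [ca cb] := Z_ne co bo ab h.
have ac : adm a c by apply: adm_neq; rewrite eq_sym.
rewrite !Uz_ne //; apply: proper_card; apply/properP; split.
  apply/fintype.subsetP => e; rewrite !inE => /andP [eo he]; rewrite eo /=; apply: contraT => h'.
  have h2 := T1 ao co bo eo ac ab he h'.
  by case: (@A1g a b c o ab (adm_neq s co) ac (adm_neq s bo) h h2).
exists c; first by rewrite inE co h.
by rewrite inE co (@ME a c c o ac (adm_neq s co)) // eqxx ?orbT.
Qed.

Lemma Uz_le a b : a != o -> b != o -> (Uz a b <= N)%N.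
Proof.
move=> /negPf ao /negPf bo; rewrite /Uz ao bo /=; case: ifP => // _.
by rewrite -[leqRHS]card_ord max_card.
Qed.

(** If both inequalities failed, [Q1] would give [Z a b c o] and [Z c b a o], two pairings of the
    same four blocks vanishing together. *)
Lemma Uz_ultra a b c : (Uz a b <= Uz a c)%N || (Uz b c <= Uz a c)%N.
Proof.
have [ao|ao] := eqVneq a o; have [co|co] := eqVneq c o.
- subst a c; have [->|bo] := eqVneq b o; first by rewrite leqnn.
  by rewrite (Uz_o bo) leq0n orbT.
- subst a; have [->|bo] := eqVneq b o; first by rewrite leqnn orbT.
  by rewrite (Uz_sym o b) (Uz_o bo).
- subst c; have [->|bo] := eqVneq b o; first by rewrite leqnn.
  by rewrite (Uz_o bo) orbT.
have [bo|bo] := eqVneq b o; first by subst b; rewrite (Uz_o ao).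
have [ac|nac] := boolP (adm a c); last first.
  by have -> : Uz a c = N; [rewrite /Uz (negPf ao) (negPf co) (negPf nac)|rewrite Uz_le].
have [ab|nab] := boolP (adm a b); last first.
  have -> : b = a by apply/eqP; apply: contraNT nab => h; apply: adm_neq; rewrite eq_sym.
  by rewrite leqnn orbT.
have [bc|nbc] := boolP (adm b c); last first.
  have -> : b = c by apply/eqP; apply: contraNT nbc => h; apply: adm_neq.
  by rewrite leqnn.
have [h|h] := boolP (Z a b c o); last by rewrite (Q1 ao bo co ab ac h).
have cb : adm c b by rewrite adm_sym. have ca : adm c a by rewrite adm_sym.
have ba : adm b a by rewrite adm_sym.
have [h'|h'] := boolP (Z c b a o); last by rewrite (Uz_sym b c) (Uz_sym a c) (Q1 co bo ao cb ca h') orbT.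
rewrite S1 in h; rewrite S1 in h'.
by case: (@A1g b a c o ba (adm_neq s co) bc (adm_neq s ao) h h').
Qed.

Let u3 a b c : (Uz a b <= Uz a c)%N \/ (Uz b c <= Uz a c)%N.
Proof. by apply/orP; exact: Uz_ultra. Qed.

Lemma half a b c d : a != o -> b != o -> c != o -> d != o -> adm a b -> adm c d -> adm a c -> adm b d -> adm a d -> adm b c ->
  ~~ Z a c b d -> Z a c b o -> Z a c d o -> False.
Proof.
move=> ao bo co do_ ab cd ac bd ad bc n h1 h2.
have [ca cb da dc db] : [/\ adm c a, adm c b, adm d a, adm d c & adm d b] by rewrite !(adm_sym s _ a) !(adm_sym s _ b) !(adm_sym s _ c); split; rewrite // adm_sym.
have ob : adm o b by rewrite adm_sym adm_neq. have od : adm o d by rewrite adm_sym adm_neq.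
have := H2 bo co ab cd ac bd; rewrite h1 orbT (negPf n) orbF => /esym /orP [k|k].
  exact: (@A1g a b c o ab (adm_neq s co) ac (adm_neq s bo) k h1).
have := H2 do_ co ad cb ac db; rewrite h2 orbT (S2 a c b d) in n *; rewrite (negPf n) orbF => /esym /orP [k'|k'].
  exact: (@A1g a d c o ad (adm_neq s co) ac (adm_neq s do_) k' h2).
rewrite S2 in k; rewrite S2 in k'.
exact: (@A1g c d b o cd (adm_neq s bo) cb (adm_neq s do_) k k').
Qed.

(** Four instances of [H2] turn a zero at [ac | bd] into zeros against [o], which [Q1] and [Q2] read
    as comparisons of depths. The ultrametric inequalities relate these to the sums, and [half]
    closes the converse. *)
Lemma Wmain a b c d : a != o -> b != o -> c != o -> d != o -> adm a b -> adm c d -> adm a c -> adm b d ->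
  adm a d -> adm b c -> Z a c b d = (Uz a b + Uz c d < Uz a c + Uz b d)%N.
Proof.
move=> ao bo co do_ ab cd ac bd ad bc.
have [ca cb] : adm c a /\ adm c b by rewrite !(adm_sym s c).
have [da dc] : adm d a /\ adm d c by rewrite !(adm_sym s d).
have [db ba] : adm d b /\ adm b a by rewrite (adm_sym s d) (adm_sym s b a).
have q x y z : x != o -> y != o -> z != o -> adm x y -> adm x z -> Z x y z o = (Uz x z < Uz x y)%N.
  move=> xo yo zo xy xz; apply/idP/idP; first exact: Q2.
  by apply: contraTT => h; rewrite -leqNgt; exact: Q1.
have A := q a c b ao co bo ac ab; have A' := q c a b co ao bo ca cb.
have Bz := q a c d ao co do_ ac ad; have B' := q c a d co ao do_ ca cd.
have C := q b d c bo do_ co bd bc; have C' := q d b c do_ bo co db dc.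
have D := q b d a bo do_ ao bd ba; have D' := q d b a do_ bo ao db da.
rewrite (S1 a c) in A'; rewrite (S1 a c) in B'; rewrite (S1 b d) in C'; rewrite (S1 b d) in D'.
have sy := Uz_sym; rewrite ?(sy c a) ?(sy c b) ?(sy d b) ?(sy d c) ?(sy d a) ?(sy b a) in A A' Bz B' C C' D D' *.
have t1 := u3 b a d; have t2 := u3 b c d; have t3 := u3 a c b; have t4 := u3 c a b; have t5 := u3 a c d; have t6 := u3 c a d.
have t7 := u3 a b c; have t8 := u3 a d c; have t9 := u3 a d b; have t10 := u3 a b d; have t11 := u3 c d b; have t12 := u3 c b d.
rewrite ?(sy c a) ?(sy c b) ?(sy d b) ?(sy d c) ?(sy d a) ?(sy b a) in t1 t2 t3 t4 t5 t6 t7 t8 t9 t10 t11 t12.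
have P1 : (Z a c b o /\ Z a c d o) \/ (Z b d c o /\ Z b d a o) -> (Uz a b + Uz c d < Uz a c + Uz b d)%N.
  move=> [[h1 h2]|[h1 h2]].
    have h3 := h1; have h4 := h2; rewrite A in h1; rewrite Bz in h2; rewrite B' in h4.
    exact: (four1 t1 t5 h1 h2 h4).
  have h3 := h1; have h4 := h2; rewrite C in h1; rewrite C' in h3; rewrite D in h2.
  exact: (four2 t7 t11 h1 h3 h2).
have P2 : (Uz a b + Uz c d < Uz a c + Uz b d)%N -> (Z a c b o /\ Z a c d o) \/ (Z b d c o /\ Z b d a o).
  have eA : (Uz a c <= Uz a b)%N = (Uz a c <= Uz b c)%N by rewrite (leqNgt (Uz a c) (Uz a b)) (leqNgt (Uz a c) (Uz b c)) -A A'.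
  have eB : (Uz a c <= Uz a d)%N = (Uz a c <= Uz c d)%N by rewrite (leqNgt (Uz a c) (Uz a d)) (leqNgt (Uz a c) (Uz c d)) -Bz B'.
  have eC : (Uz b d <= Uz b c)%N = (Uz b d <= Uz c d)%N by rewrite (leqNgt (Uz b d) (Uz b c)) (leqNgt (Uz b d) (Uz c d)) -C C'.
  have eD : (Uz b d <= Uz a b)%N = (Uz b d <= Uz a d)%N by rewrite (leqNgt (Uz b d) (Uz a b)) (leqNgt (Uz b d) (Uz a d)) -D D'.
  move=> lt; suff : (Z a c b o && Z a c d o) || (Z b d c o && Z b d a o).
    by move=> /orP [/andP [k1 k2]|/andP [k1 k2]]; [left|right].
  rewrite A Bz C D; apply: contraT; rewrite negb_or !negb_and -!leqNgt => /andP [/orP k1 /orP k2].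
  have z : False; last by [].
  move: lt; apply/negP; rewrite -leqNgt; case: k1 => k1; case: k2 => k2.
  - by rewrite leq_add // -eC.
  - case: t6 => h; first by rewrite addnC leq_add.
    by rewrite leq_add //; apply: leq_trans h; rewrite -eD.
  - case: t3 => h; first by rewrite leq_add // -eC.
    by rewrite addnC leq_add //; [apply: leq_trans h|rewrite -eB].
  - by rewrite addnC leq_add // -eB.
apply/idP/idP => [h|/P2].
  apply: P1; have n1 : ~~ Z a b c d by apply/negP => h'; exact: (@A1g a b c d ab cd ac bd h' h).
  have n2 : ~~ Z a d b c.
    apply/negP => h'; rewrite S2 in h'; rewrite S2 in h; exact: (@A1g a c d b ac db ad cb h h').
  have ob : adm o b by rewrite adm_sym adm_neq.
  have e1 := H2 bo co ab cd ac bd; rewrite h orbT (negPf n1) orFb in e1.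
  have e2 := H2 bo ao cb ad ca bd; rewrite (S1 a c b d) h orbT in e2.
  have n3 : Z c b a d = false by apply/negbTE; rewrite S1 (S3 ad bc).
  rewrite n3 orFb (S1 a c) in e2.
  have e3 := H2 do_ co ad cb ac db; rewrite (S2 a c b d) h orbT in e3.
  have n4 : Z a d c b = false by apply/negbTE; rewrite S2.
  rewrite n4 orFb in e3.
  have e4 := H2 do_ ao cd ab ca db; rewrite (S1 a c d b) (S2 a c b d) h orbT in e4.
  have n5 : Z c d a b = false by apply/negbTE; rewrite (S3 ab cd).
  rewrite n5 orFb (S1 a c) in e4.
  have co' := adm_neq s co; have ao' := adm_neq s ao.
  have f1 : Z c o d b = Z b d c o by transitivity (Z d b c o); [exact: S3 db co'|exact: S1].
  have f2 : Z a o d b = Z b d a o by transitivity (Z d b a o); [exact: S3 db ao'|exact: S1].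
  have f3 : Z c o b d = Z b d c o := S3 bd co'.
  have f4 : Z a o b d = Z b d a o := S3 bd ao'.
  rewrite f1 in e1; rewrite f2 in e2; rewrite f3 in e3; rewrite f4 in e4.
  move: e1 e2 e3 e4; clear; case: (Z a c b o); case: (Z a c d o); case: (Z b d c o); case: (Z b d a o) => //=; tauto.
move=> [[h1 h2]|[h1 h2]]; apply: contraT => n.
  by case: (@half a b c d).
by case: (@half b a d c) => //; rewrite (S3 ac bd).
Qed.

(** The double of [o] is governed by the choice of [Uoo]; [H4] transports the zero from one pair
    avoiding [o] to another sharing a block with it. *)
Lemma WOO b d : b != o -> d != o -> adm o o -> adm b d -> Z o o b d = (0 < Uz o o + Uz b d)%N.
Proof.
move=> bo do_ oo bd; have Ubd := Uz_ne bo do_ bd.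
have Uo : Uz o o = Uoo by rewrite /Uz eqxx.
apply/idP/idP => h; last first.
  have [/existsP [e]|none] := boolP [exists e, e \in sepset b d].
    rewrite inE => /andP [eo he]; have [eb ed] := Z_ne eo do_ bd he.
    have be : adm b e by apply: adm_neq; rewrite eq_sym.
    have := H4 bo do_ eo oo bd be; rewrite he orbT => /orP [//|h2].
    by case: (@A1g b d e o bd (adm_neq s eo) be (adm_neq s do_) he h2).
  have z : #|sepset b d| = 0%N.
    apply: eq_card0 => e; apply/negbTE; move: none; rewrite negb_exists => /forallP /(_ e).
    by [].
  move: h; rewrite Ubd z addn0 Uo /Uoo; case: ifP => // /negbT; rewrite negb_exists => /forallP /(_ (b, d)).
  by rewrite /= bo do_ bd /= negbK.
rewrite Uo Ubd lt0n addn_eq0 negb_and; apply: contraT; rewrite negb_or !negbK => /andP [/eqP u0 /eqP /cards0_eq S0].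
have noZ e : e != o -> ~~ Z b d e o.
  by move=> eo; have : e \notin sepset b d by [rewrite S0 finset.in_set0|rewrite S0 inE]; rewrite inE eo.
have prop e : e != o -> adm b e -> Z o o b e.
  by move=> eo be; have := H4 bo do_ eo oo bd be; rewrite h (negPf (noZ e eo)) orbF => <-.
move: u0; rewrite /Uoo; case: ifP => [/existsP [[a b'] /and4P [/= ao b'o ab' nz]] _|]; last first.
  by case: ifP => // /negbT; rewrite negb_exists => /forallP /(_ (b, d)); rewrite /= bo do_ bd.
have [ba|nba] := boolP (adm b a); last first.
  have e : b = a by apply/eqP; apply: contraNT nba => k; exact: adm_neq.
  by subst a; rewrite (prop b' b'o ab') in nz.
have [bb'|nbb'] := boolP (adm b b'); last first.
  have e : b = b' by apply/eqP; apply: contraNT nbb' => k; exact: adm_neq.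
  by subst b'; rewrite S2 (prop a ao ba) in nz.
have ab : adm a b by rewrite adm_sym. have b'b : adm b' b by rewrite adm_sym.
have b'a : adm b' a by rewrite adm_sym.
have := H4 ao bo b'o oo ab ab'; rewrite S2 (prop a ao ba) (negPf nz) /= => /esym k1.
have := H4 b'o bo ao oo b'b b'a; rewrite (S2 o o b b') (prop b' b'o bb') (S2 o o a b') (negPf nz) /= => /esym k2.
rewrite S1 in k1; rewrite S1 in k2.
by case: (@A1g b a b' o ba (adm_neq s b'o) bb' (adm_neq s ao) k1 k2).
Qed.

Lemma Wall a b c d : adm a b -> adm c d -> adm a c -> adm b d -> Z a c b d = (Uz a b + Uz c d < Uz a c + Uz b d)%N.
Proof.
move=> ab cd ac bd.
have sy := Uz_sym.
have dg x y : (Uz x y <= Uz x x)%N by case/orP: (Uz_ultra x y x); rewrite ?(sy y x).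
have [m|] := boolP ((a == b) || (a == d) || (c == b) || (c == d)).
  rewrite ME //; apply/esym/negbTE; rewrite -leqNgt.
  case/orP: m => [/orP [/orP []|]|] /eqP e; subst.
  - have := dg b c; have := dg b d; have := u3 c b d; rewrite (sy c b); clear; lia.
  - by rewrite (sy d c) (sy b d) addnC.
  - by [].
  - have := dg d a; have := dg d b; have := u3 a d b; rewrite (sy d a) (sy d b) (sy b d); clear; lia.
rewrite !negb_or => /andP [/andP [/andP [nab nad] ncb] ncd].
have ad := adm_neq s nad; have cb := adm_neq s ncb.
have bc : adm b c by rewrite adm_sym.
have q x y z : x != o -> y != o -> z != o -> adm x y -> adm x z -> Z x y z o = (Uz x z < Uz x y)%N.
  move=> xo yo zo xy xz; apply/idP/idP; first exact: Q2.
  by apply: contraTT => h; rewrite -leqNgt; exact: Q1.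
have [eao|ao] := eqVneq a o.
  subst a; have bo : b != o by rewrite eq_sym. have do_ : d != o by rewrite eq_sym.
  have [eco|co] := eqVneq c o.
    by subst c; rewrite WOO // (sy o b) (sy o d) (Uz_o bo) (Uz_o do_).
  have oc : adm o c by []. 
  rewrite (sy o b) (sy o c) !Uz_o // !add0n -(S3 oc bd) S2 S1 (sy c d) (sy b d).
  by rewrite q // adm_sym.
have [eco|co] := eqVneq c o.
  subst c; have bo : b != o by rewrite eq_sym. have do_ : d != o by rewrite eq_sym.
  rewrite (sy o d) !Uz_o // addn0 add0n -(S3 ac bd) (sy a b) q //.
  by rewrite adm_sym.
have [ebo|bo] := eqVneq b o.
  subst b; have [edo|do_] := eqVneq d o.
    by subst d; rewrite -(S3 ac bd) WOO // (Uz_o ao) (Uz_o co) (addnC (Uz a c)).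
  by rewrite (sy o d) !Uz_o // add0n addn0 S2 S1 (sy a c) q // adm_sym.
have [edo|do_] := eqVneq d o.
  by subst d; rewrite !Uz_o // !addn0 q.
exact: Wmain.
Qed.

Definition Ur a b : K := (Uz a b)%:R.

Lemma Ur_ultra : ultra s o Ur.
Proof.
split.
- by move=> a b; rewrite /Ur Uz_sym.
- by move=> a b; rewrite /Ur ler0n.
- by move=> a b c; rewrite /Ur !ler_nat; exact: u3.
- by move=> a ao; rewrite /Ur Uz_o.
have [/existsP [p0 hp0]|none] := boolP [exists p : 'I_N * 'I_N, [&& p.1 != o, p.2 != o & adm p.1 p.2]].
  left; case: (@arg_minnP _ p0 (fun p : 'I_N * 'I_N => [&& p.1 != o, p.2 != o & adm p.1 p.2]) (fun p => Uz p.1 p.2) hp0).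
  move=> [i j] /and3P [/= io jo ij] mn; exists i, j; split=> //; rewrite /Ur.
  suff -> : Uz i j = 0%N by [].
  rewrite Uz_ne //; apply: eq_card0 => e; apply/negbTE/negP; rewrite inE => /andP [eo he].
  have [ei ej] := Z_ne eo jo ij he; have := Q2 io jo eo ij he.
  by rewrite ltnNge (mn (i, e)) //= io eo adm_neq // eq_sym.
right=> i j io jo; apply/negP => ij; move/negP: none; apply; apply/existsP; exists (i, j).
by rewrite /= io jo.
Qed.

Lemma Ur_oo : (forall i j, i != o -> j != o -> ~~ adm i j) -> Ur o o = 0.
Proof.
move=> h; rewrite /Ur /Uz eqxx /= /Uoo.
have n (Q : 'I_N -> 'I_N -> bool) : [exists p : 'I_N * 'I_N, [&& p.1 != o, p.2 != o, adm p.1 p.2 & Q p.1 p.2]] = false.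
  by apply/negbTE/negP => /existsP [[i j] /and4P [/= io jo ij _]]; move: (h i j io jo); rewrite ij.
rewrite (n (fun i j => ~~ Z o o i j)); case: ifP => // /existsP [[i j] /and3P [/= io jo ij]].
by move: (h i j io jo); rewrite ij.
Qed.

Lemma Ur_pos a b c d : adm a b -> adm c d -> adm a c -> adm b d ->
  (Ur a c + Ur b d <= Ur a b + Ur c d) = ~~ Z a c b d.
Proof. by move=> ab cd ac bd; rewrite Wall // /Ur -!natrD ler_nat -leqNgt. Qed.

End ZeroPattern.
End ZeroPatterns.

(** * The canonical toric point near a given point *)

Module CanonicalPoint.
Import ZariskiCovers SheafGluing Blocks AffineCharts Cells CellHulls PointwiseClosure PavingQuads HeightUltrametric UltrametricTree DualCones UltrametricPavings ReducedRelations ChartEquations MonomialSets Correspondence InteriorForms InteriorTransfer CoordinateRelations ZeroPatterns.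
Import numFieldTopology.Exports.
Local Opaque delta.

Lemma pM (T k : comUnitRingType) (p : {rmorphism T -> k}) :
  (forall a : k, a != 0 -> a \is a GRing.unit) ->
  forall a b, (p (a * b) == 0) = (p a == 0) || (p b == 0).
Proof.
move=> hk a b; rewrite rmorphM; have [->|h] := eqVneq (p a) 0; first by rewrite mul0r eqxx.
by rewrite -[X in _ == X](mulr0 (p a)) (inj_eq (mulrI (hk _ h))).
Qed.

Lemma prod_pM (T k : comUnitRingType) (p : {rmorphism T -> k}) (I : finType) (P : pred I) (f : I -> T) :
  (forall a : k, a != 0 -> a \is a GRing.unit) ->
  (forall i, P i -> p (f i) != 0) -> p (\prod_(i | P i) f i) != 0.
Proof.
move=> hk h; apply: (big_ind (fun a => p a != 0)) => //; first by rewrite rmorph1 oner_eq0.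
by move=> a b ha hb; rewrite pM // negb_or ha.
Qed.

Section Canon.
Variables (N : nat) (s : 'I_N -> nat).
Hypotheses (s_gt0 : forall t, (0 < s t)%N) (n_ge2 : (2 <= \sum_(t < N) s t)%N).
Variable K : realType.
Notation vs := (vs s_gt0 n_ge2).
Notation adm := (adm s).
Notation vI := (vI s_gt0 n_ge2).
Notation vv := (vv s_gt0 n_ge2).
Notation W1 := (W1 s_gt0 n_ge2).
Notation M1 := (M1 s_gt0 n_ge2).
Notation cr := (cr s_gt0 n_ge2).
Notation pairs3 := (pairs3 s_gt0 n_ge2).
Notation RP := (RP s_gt0 n_ge2).
Notation degm := (degm s_gt0 n_ge2).
Notation Gdeg := (Gdeg s_gt0 n_ge2).
Notation theta := (theta s_gt0 n_ge2).
Notation base := (base K).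
Notation Quad := ('I_N * 'I_N * ('I_N * 'I_N))%type.
Notation chr := {ffun VS s -> int}.

Lemma dc0 (P : {set {set VS s}}) : dualcone K P 0.
Proof.
split; first exact: charA0.
by move=> v _; rewrite big1 // => i _; rewrite ffunE mul0r.
Qed.

(** This and the next two cocycle identities between cross ratios are the source of the hypotheses
    [H1], [H2] and [H4] on patterns of zeros. *)
Lemma crH1 a b c e o : cr ((a, b), (e, o)) = cr ((a, b), (c, o)) + cr ((a, c), (e, o)).
Proof.
rewrite !crE; move: (delta (vs a b)) (delta (vs e o)) (delta (vs a e)) (delta (vs b o)) (delta (vs c o)) (delta (vs a c)) => *.
ffring.
Qed.
Lemma crH2 a b c d o : cr ((a, b), (c, d)) = cr ((a, b), (c, o)) + cr ((c, d), (o, b)).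
Proof.
rewrite !crE (vs_sym _ _ o b) (vs_sym _ _ d b).
move: (delta (vs a b)) (delta (vs c d)) (delta (vs a c)) (delta (vs b d)) (delta (vs c o)) (delta (vs b o)) => *.
ffring.
Qed.
Lemma crH4 b d e o : cr ((o, o), (b, d)) = cr ((o, o), (b, e)) + cr ((b, d), (e, o)).
Proof.
rewrite !crE (vs_sym _ _ d o) (vs_sym _ _ e o).
move: (delta (vs o o)) (delta (vs b d)) (delta (vs o b)) (delta (vs o d)) (delta (vs b e)) (delta (vs o e)) => *.
ffring.
Qed.

Variables (I0 : VS s -> idx2 s) (hI0 : forall v, vI (I0 v) = v).
Notation e1 := (e1 s_gt0 n_ge2 I0).
Notation e2 := (e2 s_gt0 n_ge2 I0).

Lemma loop_vv i j k l : adm i j -> adm k l -> (i == j) || (k == l) ->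
  [/\ pd (vv (e1 i j) (e2 i j)) (vv (e1 k l) (e2 k l)) = pd (vs i j) (vs k l),
      pd (vv (e1 i j) (e1 k l)) (vv (e2 i j) (e2 k l)) = pd (vs i k) (vs j l)
    & pd (vv (e1 i j) (e2 k l)) (vv (e2 i j) (e1 k l)) = pd (vs i k) (vs j l)].
Proof.
move=> ij kl h; rewrite /ReducedRelations.vv; have sj := vs_sym s_gt0 n_ge2 j i; have sl := vs_sym s_gt0 n_ge2 l k.
case: (e12P hI0 ij) => -[-> ->]; case: (e12P hI0 kl) => -[-> ->];
  (split; rewrite ?sj ?sl //; case/orP: h => /eqP e; subst; first [by []|by rewrite pdC]).
Qed.

Section WithFacts.
Variables (T : comUnitRingType) (y : mcoords (@Gset N s) T) (x : idx2 s -> T)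
  (Y : 'I_N -> 'I_N -> 'I_N -> 'I_N -> T).
Arguments y : clear implicits.
Hypothesis F : facts s_gt0 n_ge2 I0 y x Y.

Lemma Yxm_perm i j k l i' j' k' l' (u : uniq [:: i; j; k; l]) (m : Gset (W4 s u)) I J :
  perm_eq [:: i; j; k; l] [:: i'; j'; k'; l'] -> sval m = d2 I J ->
  vI I = vs i' j' -> vI J = vs k' l' -> y _ m = Y i' j' k' l' * (x I * x J).
Proof.
move=> hp; have u' : uniq [:: i'; j'; k'; l'] by rewrite -(perm_uniq hp).
have mem : [:: i'; j'; k'; l'] =i [:: i; j; k; l] by move=> t; rewrite (perm_mem hp).
move: m; rewrite -(W4_perm s u' u mem) => m em eI eJ.
exact: (Yxm F em eI eJ).
Qed.

Lemma yW4 a b c d (u : uniq [:: bl a; bl b; bl c; bl d]) (m : Gset (W4 s u)) :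
  exists I J, sval m = d2 I J /\
  [\/ pd (vI I) (vI J) = pd (vv a b) (vv c d) /\ y _ m = Y (bl a) (bl b) (bl c) (bl d) * (x I * x J),
      pd (vI I) (vI J) = pd (vv a c) (vv b d) /\ y _ m = Y (bl a) (bl c) (bl b) (bl d) * (x I * x J)
    | pd (vI I) (vI J) = pd (vv a d) (vv b c) /\ y _ m = Y (bl a) (bl d) (bl b) (bl c) * (x I * x J)].
Proof.
have s4 : (\sum_t sval (W4 s u) t = 4)%N.
  by rewrite /=; under eq_bigr do rewrite ffunE; exact: sum_mem4.
have [I [J [em hw]]] := inG2 s_gt0 n_ge2 s4 (asboolW (svalP m)).
have /(W4_deg s_gt0 n_ge2 u) sx : forall t, nat_of_bool (t \in [:: bl a; bl b; bl c; bl d]) = (vco (vI I) t + vco (vI J) t)%N.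
  by move=> t; rewrite -hw /= ffunE.
have := u; rewrite /= !inE !negb_or => /and4P [/and3P [n1 n2 n3] /andP [n4 n5] n6 _].
have ab : adm (bl a) (bl b) by exact: adm_neq.
have ac : adm (bl a) (bl c) by exact: adm_neq.
have ad : adm (bl a) (bl d) by exact: adm_neq.
have bc : adm (bl b) (bl c) by exact: adm_neq.
have bd : adm (bl b) (bl d) by exact: adm_neq.
have cd : adm (bl c) (bl d) by exact: adm_neq.
exists I, J; split=> //; case: (six_cases sx) => -[[eI eJ]|[eI eJ]].
- constructor 1; split; first by rewrite eI eJ.
  by exact: (Yxm_perm (perm_refl _) em eI eJ).
- constructor 1; split; first by rewrite eI eJ pdC.
  by rewrite -(Ysym3 F ab cd); exact: (Yxm_perm (perm4_2 _ _ _ _) em eI eJ).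
- constructor 2; split; first by rewrite eI eJ.
  by exact: (Yxm_perm (perm4_3 _ _ _ _) em eI eJ).
- constructor 2; split; first by rewrite eI eJ pdC.
  by rewrite -(Ysym3 F ac bd); exact: (Yxm_perm (perm4_4 _ _ _ _) em eI eJ).
- constructor 3; split; first by rewrite eI eJ.
  by exact: (Yxm_perm (perm4_5 _ _ _ _) em eI eJ).
- constructor 3; split; first by rewrite eI eJ pdC.
  by rewrite -(Ysym3 F ad bc); exact: (Yxm_perm (perm4_6 _ _ _ _) em eI eJ).
Qed.

Lemma epair i j : adm i j -> exists a b, [/\ bl a = i, bl b = j & ext x a b \is a GRing.unit].
Proof.
move=> ij; have xe : ext x (e1 i j) (e2 i j) = 1.
  by rewrite -(Yx0 F (vs i j)) -ext_idx.
case: (e12P hI0 ij) => -[h1 h2]; first by exists (e1 i j), (e2 i j); rewrite h1 h2 xe unitr1.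
by exists (e2 i j), (e1 i j); rewrite h1 h2 ext_anti xe unitrN1.
Qed.

Section Value.
Variables (z1 : tpt s K T) (rp : RP z1 x) (th : theta z1 x y).
Notation P1 := (tp_pav z1).

(** When a block is doubled, two of the three pairings have the same degree. The reduced Pluecker
    relation at the reference indices, whose coordinates are 1, then expresses the cross ratio by
    the minor [Y]. *)
Lemma loop_value i j k l : adm i j -> adm k l -> (i == j) || (k == l) ->
  (dualcone K P1 (pd (vs i j) (vs k l) - pd (vs i k) (vs j l)) ->
     tp_val z1 (pd (vs i j) (vs k l) - pd (vs i k) (vs j l)) = Y i j k l) /\
  (dualcone K P1 (pd (vs i k) (vs j l) - pd (vs i j) (vs k l)) ->
     tp_val z1 (pd (vs i k) (vs j l) - pd (vs i j) (vs k l)) * Y i j k l = 1).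
Proof.
move=> ij kl h; have [l1 l2 l3] := loop_vv ij kl h.
have xe a b : ext x (e1 a b) (e2 a b) = 1 by rewrite -(Yx0 F (vs a b)) -ext_idx.
rewrite (Yloop F ij kl h); move: l1 l2 l3 (xe i j) (xe k l).
move: (e1 i j) (e2 i j) (e1 k l) (e2 k l) => A1 A2 B1 B2.
move: (pd (vs i j) (vs k l)) (pd (vs i k) (vs j l)) => v w l1 l2 l3 xA xB.
have rpg g : base P1 (pairs3 A1 A2 B1 B2) g -> tp_val z1 (v - g) -
   tp_val z1 (w - g) * (ext x A1 B1 * ext x A2 B2) + tp_val z1 (w - g) * (ext x A1 B2 * ext x A2 B1) = 0.
  by move=> hb; have := rp hb; rewrite /ReducedRelations.plE l1 l2 l3 xA xB !mulr1.
move: (ext x A1 B1) (ext x A2 B2) (ext x A1 B2) (ext x A2 B1) rpg => f1 f2 f3 f4 rpg.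
split=> dc.
  have hb : base P1 (pairs3 A1 A2 B1 B2) w.
    split; first by rewrite /ReducedRelations.pairs3 l2 !inE eqxx orbT.
    by move=> g; rewrite /ReducedRelations.pairs3 l1 l2 l3 !inE => /or3P [] /eqP -> //; rewrite subrr; exact: dc0.
  have := rpg _ hb; rewrite subrr (tp_0 z1) !mul1r; move: (tp_val z1 _) => t e.
  by rewrite -[t]subr0 -e; ring.
have hb : base P1 (pairs3 A1 A2 B1 B2) v.
  split; first by rewrite /ReducedRelations.pairs3 l1 !inE eqxx.
  by move=> g; rewrite /ReducedRelations.pairs3 l1 l2 l3 !inE => /or3P [] /eqP -> //; rewrite subrr; exact: dc0.
have := rpg _ hb; rewrite subrr (tp_0 z1); move: (tp_val z1 _) => t e.
by rewrite -[RHS]subr0 -e; ring.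
Qed.

(** The hypothesis and the tropical relation make [ae | bd] the least of the three pairings, so
    [theta] makes its coordinate a unit and the others multiples of it. *)
Lemma cr_value_uniq a b e d (u : uniq [:: bl a; bl b; bl e; bl d]) :
  dualcone K P1 (pd (vv a b) (vv e d) - pd (vv a e) (vv b d)) ->
  Y (bl a) (bl e) (bl b) (bl d) \is a GRing.unit /\
  tp_val z1 (pd (vv a b) (vv e d) - pd (vv a e) (vv b d)) * Y (bl a) (bl e) (bl b) (bl d) =
  Y (bl a) (bl b) (bl e) (bl d).
Proof.
move=> h; have := u; rewrite /= !inE !negb_or => /and4P [/and3P [n1 n2 n3] /andP [n4 n5] n6 _].
have ab : adm (bl a) (bl b) by exact: adm_neq.
have ae : adm (bl a) (bl e) by exact: adm_neq.
have ad : adm (bl a) (bl d) by exact: adm_neq.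
have be : adm (bl b) (bl e) by exact: adm_neq.
have bd : adm (bl b) (bl d) by exact: adm_neq.
have ed : adm (bl e) (bl d) by exact: adm_neq.
have h' : dualcone K P1 (pd (vv a d) (vv b e) - pd (vv a e) (vv b d)).
  apply: dualconeI.
    have q1 : cr_adm s ((bl a, bl d), (bl e, bl b)).
      by rewrite /cr_adm /= ad ae (adm_sym s (bl e)) be (adm_sym s (bl d)) bd.
    by have := charA_cr s_gt0 n_ge2 q1; rewrite crE' (vs_sym _ _ (bl e) (bl b)) (vs_sym _ _ (bl d) (bl b)).
  move=> v cv; have := dualconeE h cv; rewrite !pairingD !pairingN !pairing_pd !subr_ge0 => k1.
  have [k2|//] := cone_quad_min s_gt0 n_ge2 (tp_ok z1) cv ab ed ae bd ad be.
  exact: le_trans k1 k2.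
have eS : Gdeg (W4 s u) = pairs3 a b e d by apply/funext => g; apply/propext; exact: Gdeg4.
have hb : base P1 (Gdeg (W4 s u)) (pd (vv a e) (vv b d)).
  rewrite eS; split; first by rewrite /ReducedRelations.pairs3 !inE eqxx orbT.
  by move=> g; rewrite /ReducedRelations.pairs3 !inE => /or3P [] /eqP -> //; rewrite subrr; exact: dc0.
have [A Au hA] := theta_rebase th hb.
have mk v w : (v, w) \in six (vv a b) (vv e d) (vv a e) (vv b d) (vv a d) (vv b e) ->
    exists m : Gset (W4 s u), sval m = d2 (I0 v) (I0 w).
  move=> /(W4_deg s_gt0 n_ge2 u) hvw.
  have hG : inG (sval (W4 s u)) (d2 (I0 v) (I0 w)).
    by apply: (@inG_d2 _ _ s_gt0 n_ge2) => t; rewrite /= ffunE hvw !hI0.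
  by exists (mkG hG).
have [|m1 em1] := mk (vv a e) (vv b d); first by rewrite /six !inE eqxx orbT.
have [|m2 em2] := mk (vv a b) (vv e d); first by rewrite /six !inE eqxx.
have y1 : y _ m1 = Y (bl a) (bl e) (bl b) (bl d).
  by rewrite (Yxm_perm (perm4_3 _ _ _ _) em1 (hI0 _) (hI0 _)) !(Yx0 F) !mulr1.
have y2 : y _ m2 = Y (bl a) (bl b) (bl e) (bl d).
  by rewrite (Yxm_perm (perm_refl _) em2 (hI0 _) (hI0 _)) !(Yx0 F) !mulr1.
have := hA m1; rewrite y1 em1 degm_d2 !hI0 subrr (tp_0 z1) mono_d2 !(Yx0 F) !mulr1 => ->; split=> //.
by have := hA m2; rewrite y2 em2 degm_d2 !hI0 mono_d2 !(Yx0 F) !mulr1 => ->; rewrite mulrC.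
Qed.

(** A point related to [y] must take on each regular cross ratio the quotient prescribed by [y];
    this is the source of uniqueness. *)
Lemma cr_value q : cr_adm s q -> dualcone K P1 (cr q) ->
  Ym Y q \is a GRing.unit /\ tp_val z1 (cr q) * Ym Y q = Yp Y q.
Proof.
case: q => [[a b] [e d]] /and4P [/= ab ed ae bd]; rewrite crE' /Ym /Yp /= => dc.
have [be|be] := eqVneq b e.
  subst e; rewrite subrr (tp_0 z1) mul1r (Ymeet F ab bd) ?unitr1 //; by rewrite eqxx !orbT.
have [da|da] := eqVneq a d.
  subst d; rewrite (vs_sym _ _ e a) (vs_sym _ _ b a) pdC subrr (tp_0 z1) mul1r.
  by rewrite (Ymeet F ae bd) ?(Ymeet F ab ed) ?unitr1 // eqxx !orbT.
have [h|h] := boolP ((a == e) || (b == d)).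
  have [_ /(_ dc) t1] := loop_value ae bd h.
  split; first by apply/unitrPr; eexists; rewrite mulrC; exact: t1.
  by rewrite t1 (Ymeet F ab ed) //; case/orP: h => ->; rewrite ?orbT.
have [h'|h'] := boolP ((a == b) || (e == d)).
  have [/(_ dc) t1 _] := loop_value ab ed h'.
  by rewrite t1 (Ymeet F ae bd) ?unitr1 ?mulr1 //; case/orP: h' => ->; rewrite ?orbT.
have u : uniq [:: a; b; e; d].
  move: h h'; rewrite /= !inE !negb_or => /andP [-> ->] /andP [-> ->].
  by rewrite be da.
have [a' ea] : exists a' : 'I_(tot s), bl a' = a by apply: bl_surj.
have [b' eb] : exists a' : 'I_(tot s), bl a' = b by apply: bl_surj.
have [e' ee] : exists a' : 'I_(tot s), bl a' = e by apply: bl_surj.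
have [d' ed'] : exists a' : 'I_(tot s), bl a' = d by apply: bl_surj.
subst a b e d; exact: (cr_value_uniq u dc).
Qed.
End Value.

Section Residue.
Variables (k : comUnitRingType) (p : {rmorphism T -> k}).
Hypotheses (hk : forall a : k, a != 0 -> a \is a GRing.unit)
  (y1 : forall w, exists m : Gset w, y _ m = 1).
Variable o : 'I_N.
Definition Zp i j l m := p (Y i j l m) == 0.
Let ZS1 i j l m : Zp j i l m = Zp i j l m. Proof. by rewrite /Zp (Ysym1 F). Qed.
Let ZS2 i j l m : Zp i j m l = Zp i j l m. Proof. by rewrite /Zp (Ysym2 F). Qed.
Let ZS3 i j l m : adm i j -> adm l m -> Zp l m i j = Zp i j l m.
Proof. by move=> h1 h2; rewrite /Zp (Ysym3 F). Qed.
Let ZM i j l m : adm i j -> adm l m -> (i == l) || (i == m) || (j == l) || (j == m) -> Zp i j l m = false.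
Proof. by move=> h1 h2 h; rewrite /Zp (Ymeet F h1 h2 h) rmorph1 oner_eq0. Qed.

Lemma rel3 q1 q2 q3 : cr_adm s q1 -> cr_adm s q2 -> cr_adm s q3 -> cr q1 = cr q2 + cr q3 ->
  Yp Y q1 * (Ym Y q2 * Ym Y q3) = (Yp Y q2 * Yp Y q3) * Ym Y q1.
Proof.
move=> h1 h2 h3 e.
have a1 : all (cr_adm s) [:: q1] by rewrite /= h1.
have a2 : all (cr_adm s) [:: q2; q3] by rewrite /= h2 h3.
have a3 : \sum_(q <- [:: q1]) cr q = \sum_(q <- [:: q2; q3]) cr q by rewrite big_seq1 big_cons big_seq1.
have b1 (f : Quad -> T) q : \prod_(r <- [:: q]) f r = f q by rewrite big_seq1.
have b2 (f : Quad -> T) q q' : \prod_(r <- [:: q; q']) f r = f q * f q' by rewrite big_cons big_seq1.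
by have := Yval F a1 a2 a3; rewrite (b1 (Yp Y)) (b1 (Ym Y)) (b2 (Yp Y)) (b2 (Ym Y)).
Qed.

(** If two pairings vanished, the Pluecker relation at indices with invertible coordinates would
    kill the third, whereas some coordinate of that degree equals 1. *)
Let ZA i j l m : uniq [:: i; j; l; m] -> Zp i j l m -> Zp i l j m -> False.
Proof.
move=> u; have := u; rewrite /= !inE !negb_or => /and4P [/and3P [n1 n2 n3] /andP [n4 n5] n6 _].
have im : adm i m by exact: adm_neq.
have jl : adm j l by exact: adm_neq.
have [a [d [ea ed xad]]] := epair im; have [b [c [eb ec xbc]]] := epair jl.
subst i j l m => /eqP h1 /eqP h2.
have ub : uniq [:: a; b; c; d] by apply: (@map_uniq _ _ (@bl N s)).
have h3 : p (Y (bl a) (bl d) (bl b) (bl c)) = 0.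
  have := congr1 p (Yrp F ub).
  rewrite rmorph0 rmorphD rmorphB (rmorphM p (Y (bl a) (bl b) (bl c) (bl d))) (rmorphM p (Y (bl a) (bl c) (bl b) (bl d))).
  rewrite h1 h2 !mul0r subrr add0r => /eqP; rewrite !pM //.
  have px t : t \is a GRing.unit -> (p t == 0) = false.
    by move=> ht; apply/negP => /eqP e; have := rmorph_unit p ht; rewrite e unitr0.
  by rewrite (px _ xad) (px _ xbc) !orbF => /eqP.
have [m ym] := y1 (W4 s u); have [I [J [em h]]] := yW4 m.
have : p 1 = 0 by rewrite -ym; case: h => -[_ ->]; rewrite (rmorphM p) ?h1 ?h2 ?h3 mul0r.
by move/eqP; rewrite rmorph1 oner_eq0.
Qed.
Let ZH1 a b c e : c != o -> b != o -> e != o -> adm a b -> adm a c -> adm a e ->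
  Zp a b e o -> Zp a b c o || Zp a c e o || Zp a e b o.
Proof.
move=> co bo eo ab ac ae; have ad i : i != o -> adm i o by exact: adm_neq.
have := @rel3 ((a, b), (e, o)) ((a, b), (c, o)) ((a, c), (e, o)).
rewrite /cr_adm /= ab ac ae !ad // => /(_ isT isT isT (crH1 _ _ _ _ _)).
rewrite /Yp /Ym /= => /(congr1 (fun t => p t == 0)); rewrite !pM // -!/(Zp _ _ _ _) => e0 z.
by move: e0; rewrite z /= => <-.
Qed.
Let ZH2 a b c d : b != o -> c != o -> adm a b -> adm c d -> adm a c -> adm b d ->
  (Zp a b c d || Zp a c b o || Zp c o d b) = (Zp a b c o || Zp c d o b || Zp a c b d).
Proof.
move=> bo co ab cd ac bd; have ad i : i != o -> adm i o by exact: adm_neq.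
have := @rel3 ((a, b), (c, d)) ((a, b), (c, o)) ((c, d), (o, b)).
rewrite /cr_adm /= ab cd ac bd (adm_sym s o b) (adm_sym s d b) bd !ad // => /(_ isT isT isT (crH2 _ _ _ _ _)).
by rewrite /Yp /Ym /= => /(congr1 (fun t => p t == 0)); rewrite !pM // -!/(Zp _ _ _ _) orbA.
Qed.
Let ZH4 b d e : b != o -> d != o -> e != o -> adm o o -> adm b d -> adm b e ->
  (Zp o o b d || Zp b e d o) = (Zp o o b e || Zp b d e o).
Proof.
move=> bo dn eo oo bd be; have ad i : i != o -> adm i o by exact: adm_neq.
have da i : i != o -> adm o i by move=> h; rewrite adm_sym ad.
have := @rel3 ((o, o), (b, d)) ((o, o), (b, e)) ((b, d), (e, o)).
rewrite /cr_adm /= oo bd be !da // !ad // => /(_ isT isT isT (crH4 _ _ _ _)).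
rewrite /Yp /Ym /= => /(congr1 (fun t => p t == 0)); rewrite !pM // -!/(Zp _ _ _ _).
by rewrite (ZM (da _ bo) (da _ eo)) ?eqxx // (ZM (da _ bo) (da _ dn)) ?eqxx //= orbF.
Qed.

Let U := Ur s K o Zp.
Let ZA' i j l m : adm i j -> adm l m -> adm i l -> adm j m -> Zp i j l m -> Zp i l j m -> False.
Proof. by move=> ij lm il jm; exact: (@A1g N s Zp ZM ZA i j l m ij lm il jm). Qed.
Let hU : ultra s o U.
Proof. by apply: Ur_ultra; first [exact: ZS1|exact: ZS2|exact: ZS3|exact: ZM|exact: ZA|exact: ZH1|exact: ZH2|exact: ZH4]. Qed.
Let Uoo' : (forall i j, i != o -> j != o -> ~~ adm i j) -> U o o = 0.
Proof. by move=> h; apply: Ur_oo; first [exact: h|exact: ZS1|exact: ZS2|exact: ZS3|exact: ZM|exact: ZA|exact: ZH1|exact: ZH2|exact: ZH4]. Qed.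
Let Upos a b c d : adm a b -> adm c d -> adm a c -> adm b d -> (U a c + U b d <= U a b + U c d) = ~~ Zp a c b d.
Proof. by move=> *; apply: Ur_pos; first [assumption|exact: ZS1|exact: ZS2|exact: ZS3|exact: ZM|exact: ZA|exact: ZH1|exact: ZH2|exact: ZH4]. Qed.
Definition qgood (q : Quad) := cr_adm s q && (p (Ym Y q) != 0).
(** Inverting this product makes every cross ratio whose denominator is nonzero at the point regular
    on a whole neighbourhood. *)
Definition hh : T := \prod_(q : Quad | qgood q) Ym Y q.
Lemma hh0 : p hh != 0.
Proof. by apply: prod_pM => // q /andP []. Qed.

Let PP := upaving s_gt0 n_ge2 U.
Let PPok : paving K PP.
Proof. exact: (upaving_paving s_gt0 n_ge2 hU Uoo'). Qed.
Let PP_cone : exists2 u0 : VS s -> K, cone PP u0 & forall a b, adm a b -> u0 (vs a b) = U a b.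
Proof.
have hv a b : adm a b -> hgt s_gt0 n_ge2 o U (vs a b) = U a b by move=> ab; apply: hgt_vs.
by exists (hgt s_gt0 n_ge2 o U) => //; apply: (upaving_cone hU).
Qed.
(** The ultrametric is built so that a cross ratio is nonnegative exactly when its denominator does
    not vanish at the point. *)
Let PP_dual m : dualcone K PP m <-> exists2 L, all qgood L & m = \sum_(q <- L) cr q.
Proof.
have [u0 c0 h0] := PP_cone.
have e q : cr_pos s U q = qgood q.
  rewrite /cr_pos /qgood; case: q => [[a b] [c d]]; apply: andb_id2l => /and4P [/= h1 h2 h3 h4].
  by rewrite Upos.
have D := dualconeP PPok hU c0 h0 m; split=> [/D.1 [L hL ->]|[L hL eL]]; first by exists L; rewrite // -(eq_all e).
by apply/D; exists L; rewrite // (eq_all e).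
Qed.

Section Target.
Variables (T' : comUnitRingType) (c : {rmorphism T -> T'}) (hc : c hh \is a GRing.unit).
Lemma Ym_unit q : qgood q -> c (Ym Y q) \is a GRing.unit.
Proof. by move=> hq; move: hc; rewrite /hh (bigD1 q) //= rmorphM unitrM => /andP []. Qed.
Definition qval (L : seq Quad) : T' := \prod_(q <- L) (c (Yp Y q) / c (Ym Y q)).
Lemma qval_unit L : all qgood L -> c (\prod_(q <- L) Ym Y q) \is a GRing.unit.
Proof.
elim: L => [|q L IH] /=; first by rewrite big_nil rmorph1 unitr1.
by move=> /andP [hq /IH hL]; rewrite big_cons rmorphM unitrM Ym_unit.
Qed.
Lemma qvalE L : all qgood L -> qval L * c (\prod_(q <- L) Ym Y q) = c (\prod_(q <- L) Yp Y q).
Proof.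
elim: L => [|q L IH] /=; first by rewrite /qval !big_nil rmorph1 mulr1.
move=> /andP [hq /IH hL]; rewrite /qval !big_cons !rmorphM -hL mulrACA divrK //.
exact: Ym_unit.
Qed.
Lemma qval_uniq L L' : all qgood L -> all qgood L' ->
  \sum_(q <- L) cr q = \sum_(q <- L') cr q -> qval L = qval L'.
Proof.
move=> hL hL' e; apply: (mulIr (qval_unit hL)); apply: (mulIr (qval_unit hL')).
have ga M : all qgood M -> all (cr_adm s) M by apply: sub_all => q /andP [].
rewrite qvalE // mulrAC qvalE // -!rmorphM; congr (c _).
exact: (Yval F (ga _ hL) (ga _ hL') e).
Qed.
(** The multiplicative extension of the prescribed values of cross ratios; by [qval_uniq], hence by
    [Yval], the chosen decomposition does not matter. *)
Definition chi (m : chr) : T' :=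
  if pselect (exists2 L, all qgood L & m = \sum_(q <- L) cr q) is left h
  then qval (s2val (cid2 h)) else 0.
Lemma chiE L : all qgood L -> chi (\sum_(q <- L) cr q) = qval L.
Proof.
move=> hL; rewrite /chi; case: pselect => [h|[]]; last by exists L.
by case: (cid2 h) => L' h1 h2 /=; apply: qval_uniq.
Qed.
Lemma chi0 : chi 0 = 1.
Proof. by have := chiE (L := [::]) isT; rewrite /qval !big_nil. Qed.
Lemma chiD m m' : dualcone K PP m -> dualcone K PP m' -> chi (m + m') = chi m * chi m'.
Proof.
move=> /PP_dual [L hL ->] /PP_dual [L' hL' ->]; rewrite -big_cat !chiE ?all_cat ?hL //.
by rewrite /qval big_cat.
Qed.
Let zc : tpt s K T' := Tpt PPok chi0 chiD.

Lemma zc_cr q : qgood q -> dualcone K PP (cr q) /\ chi (cr q) * c (Ym Y q) = c (Yp Y q).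
Proof.
move=> hq; split; first by apply/PP_dual; exists [:: q]; rewrite /= ?hq // big_seq1.
have := chiE (L := [:: q]); rewrite big_seq1 /= hq /qval big_seq1 => -> //.
by rewrite divrK ?Ym_unit.
Qed.

Let three a b e d := exists g0 C,
 [/\ C \is a GRing.unit, base PP (pairs3 a b e d) g0,
   C * chi (pd (vv a b) (vv e d) - g0) = c (Y (bl a) (bl b) (bl e) (bl d)),
   C * chi (pd (vv a e) (vv b d) - g0) = c (Y (bl a) (bl e) (bl b) (bl d))
 & C * chi (pd (vv a d) (vv b e) - g0) = c (Y (bl a) (bl d) (bl b) (bl e))].

(** A pairing with nonzero value at the point has the least degree, and its value becomes a unit,
    which serves as the factor [C]. *)
Lemma zc_three0 a b e d : uniq [:: a; b; e; d] -> ~~ Zp (bl a) (bl b) (bl e) (bl d) -> three a b e d.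
Proof.
rewrite /= !inE !negb_or => /and4P [/and3P [n1 n2 n3] /andP [n4 n5] n6 _] nz.
have ab := adm_bl n1; have ae := adm_bl n2; have ad := adm_bl n3.
have be := adm_bl n4; have bd := adm_bl n5; have ed := adm_bl n6.
have g2 : qgood ((bl a, bl e), (bl b, bl d)) by rewrite /qgood /cr_adm /= ab ae bd ed.
have g3 : qgood ((bl a, bl d), (bl b, bl e)).
  by rewrite /qgood /cr_adm /Ym /= ab ad be (adm_sym s (bl d)) ed (Ysym2 F).
have [k2 v2] := zc_cr g2; have [k3 v3] := zc_cr g3.
rewrite !crE' in k2 v2 k3 v3; rewrite (vs_sym _ _ (bl d) (bl e)) in k3 v3.
rewrite /Ym /Yp /= (Ysym2 F) in v3.
exists (pd (vv a b) (vv e d)), (c (Y (bl a) (bl b) (bl e) (bl d))); split.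
- exact: (Ym_unit g2).
- split; first by rewrite /ReducedRelations.pairs3 !inE eqxx.
  by move=> g; rewrite /ReducedRelations.pairs3 !inE => /or3P [] /eqP -> //; rewrite subrr; exact: dc0.
- by rewrite subrr chi0 mulr1.
- by rewrite mulrC; exact: v2.
- by rewrite mulrC; exact: v3.
Qed.

(** Of any two pairings at least one is nonzero at the point, so [zc_three0] applies after a
    permutation. *)
Lemma zc_three a b e d : uniq [:: a; b; e; d] -> three a b e d.
Proof.
move=> u; have [h|] := boolP (Zp (bl a) (bl b) (bl e) (bl d)); last exact: zc_three0.
have u' : uniq [:: a; e; b; d].
  by rewrite -(perm_uniq (perm4_3 a b e d)).
have nz : ~~ Zp (bl a) (bl e) (bl b) (bl d).
  move: u; rewrite /= !inE !negb_or => /and4P [/and3P [n1 n2 n3] /andP [n4 n5] n6 _].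
  by apply/negP; apply: ZA' h; exact: adm_bl.
have [g0 [C [cu hb v1 v2 v3]]] := zc_three0 u' nz.
have eS : pairs3 a e b d = pairs3 a b e d by apply/funext => g; exact: pairs3_23.
rewrite eS in hb; exists g0, C; split=> //.
by rewrite (vvC _ _ b e) v3 (Ysym2 F).
Qed.

Lemma zc_RP : RP zc (c \o x).
Proof.
apply: RP_sorted => a b e d ab be ed; have u := sorted_uniq n_ge2 ab be ed.
have [g0 [C [cu hb v1 v2 v3]]] := zc_three u; exists g0, C; split=> //.
rewrite /ReducedRelations.plE /= !ext_map mulrDr mulrBr !(mulrA C) v1 v2 v3.
by rewrite -!rmorphM -rmorphB -rmorphD (Yrp F u) rmorph0.
Qed.

Lemma zc_theta : theta zc (c \o x) (fun w m => c (y _ m)).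
Proof.
move=> w; have [[v [ew hw]]|[a [b [e [d [u [-> hw]]]]]]] := G_struct s_gt0 n_ge2 w.
  exists 1, (delta v); split; rewrite ?unitr1 //.
    split.
      have [m _] : exists m : Gset w, True by apply: Gset_ex.
      by have [I [em eI]] := hw m; exists m; rewrite em degm_d1 eI.
    move=> g [m ->]; have [I [em eI]] := hw m; rewrite em degm_d1 eI subrr; exact: dc0.
  move=> m; have [I [em eI]] := hw m; rewrite (Yxy F em) ?eI //.
  by rewrite em degm_d1 eI subrr (tp_0 zc) mono_d1 !mul1r.
have ua : uniq [:: a; b; e; d] by apply: (@map_uniq _ _ (@bl N s)).
have [g0 [C [cu hb v1 v2 v3]]] := zc_three ua; exists C, g0; split=> //.
  have -> // : Gdeg (W4 s u) = pairs3 a b e d by apply/funext => g; apply/propext; exact: Gdeg4.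
move=> m; have [I [J [em h]]] := yW4 m; rewrite em degm_d2 mono_d2 /=.
by case: h => -[-> ->]; rewrite !rmorphM ?v1 ?v2 ?v3.
Qed.

(** Cross ratios regular on the chart of [z1] have invertible denominators, so they are regular on
    the canonical chart with the prescribed values. The inclusion of dual cones gives the reverse
    inclusion of closed cones by [dual_closure]. *)
Lemma zc_uniq (z1 : tpt s K T) : RP z1 x -> theta z1 x y -> tsub (tres c z1) zc.
Proof.
move=> rp th; have [o1 [U1 [hU1 [u1 c1 h1]]]] := paving_ultra s_gt0 n_ge2 (tp_ok z1).
have D m := dualconeP (tp_ok z1) hU1 c1 h1 m.
have key L : all (cr_pos s U1) L -> [/\ all qgood L, c (tp_val z1 (\sum_(q <- L) cr q)) = qval L
    & dualcone K (tp_pav z1) (\sum_(q <- L) cr q)].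
  elim: L => [|q L IH] /=.
    by rewrite /qval !big_nil (tp_0 z1) rmorph1; split=> //; exact: dc0.
  move=> /andP [hq /IH [g1 v1 d1]]; have aq : cr_adm s q by case/andP: hq.
  have dq : dualcone K (tp_pav z1) (cr q) by apply/D; apply: crspan_cr.
  have [uq vq] := cr_value rp th aq dq.
  have gq : qgood q.
    by rewrite /qgood aq /=; apply/negP => /eqP e; have := rmorph_unit p uq; rewrite e unitr0.
  rewrite /qval !big_cons gq; split=> //; last exact: dualconeD.
  by rewrite tp_D // rmorphM v1 -vq rmorphM mulrK ?Ym_unit.
split=> [u' hu'|m /D [L hL ->]] /=; last by have [gL vL _] := key L hL; rewrite chiE.
suff hd : forall m, dualcone K (tp_pav z1) m -> 0 <= pairing m u'.
  by first [exact: (dual_closure (tp_ok z1) hd)|exact: (dual_closure s_gt0 n_ge2 (tp_ok z1) hd)].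
move=> m /D [L hL ->]; have [gL _ _] := key L hL.
have dP : dualcone K PP (\sum_(q <- L) cr q) by apply/PP_dual; exists L.
exact: (dP.2 u' hu').
Qed.

Lemma zc_ex : exists z : tpt s K T', [/\ RP z (c \o x), theta z (c \o x) (fun w m => c (y _ m))
  & forall z1 : tpt s K T, RP z1 x -> theta z1 x y -> tsub (tres c z1) z].
Proof. by exists zc; split; [exact: zc_RP|exact: zc_theta|exact: zc_uniq]. Qed.
End Target.

Lemma canon_ex : exists2 h : T, p h != 0 & forall (T' : comUnitRingType) (c : {rmorphism T -> T'}),
  c h \is a GRing.unit -> exists z : tpt s K T', [/\ RP z (c \o x), theta z (c \o x) (fun w m => c (y _ m))
  & forall z1 : tpt s K T, RP z1 x -> theta z1 x y -> tsub (tres c z1) z].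
Proof. by exists hh; [exact: hh0|move=> T' c hc; exact: zc_ex]. Qed.
End Residue.
End WithFacts.

(* Near every point, the pattern of vanishing of the normalised coordinates of y
   determines an ultrametric, whose paving carries the only point of the toric
   variety that can induce y. *)
Lemma canonical (R : comUnitRingType) (y : mcoords (@Gset N s) R) (j0 : forall w : Cset s, Gset w) :
  (forall f, mf_vanish (@imageM N s) f -> mf_eval f y = 0) ->
  (forall v, sval (j0 (W1 v)) = d1 (I0 v)) -> (forall w, y _ (j0 w) = 1) ->
  let x := fun I => y _ (M1 I) in
  locp (fun T (c : {rmorphism R -> T}) => exists z : tpt s K T,
    [/\ RP z (c \o x), theta z (c \o x) (fun w m => c (y _ m))
      & forall z1 : tpt s K R, RP z1 x -> theta z1 x y -> tsub (tres c z1) z]).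
Proof.
move=> hy hj y1 x; have [Y F] := coord_facts hI0 hy hj y1.
have [[o _] _] := adm_ex s_gt0 n_ge2.
apply: locp_max => k p hk _.
have y1' w : exists m, y w m = 1 by exists (j0 w).
have [h h0 hQ] := canon_ex F p hk y1' o.
by exists h => // T c hc; exact: hQ.
Qed.
End Canon.
End CanonicalPoint.

(** * Assembly of the isomorphism *)

Module IsoAssembly.
Import ZariskiCovers SheafGluing Blocks AffineCharts Cells CellHulls PointwiseClosure PavingQuads HeightUltrametric UltrametricTree DualCones UltrametricPavings ReducedRelations ChartEquations MonomialSets Correspondence InteriorForms FormsVanishing InteriorTransfer CoordinateRelations ZeroPatterns CanonicalPoint.
Import numFieldTopology.Exports.
Local Opaque delta.

(** The factor of proportionality is a global expression obtained from a unimodularity relation, so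
    local factors are its restrictions. *)
Lemma Pr_sep (J : Type) (R : comUnitRingType) (a b : Pr_pre J R) : loc_eq a b -> zeq a b.
Proof.
move=> h; have [f uf H] := loc_eq_locp h; move: H; case: a b {h} => [a ha] [b hb] H.
have [l [al el]] := ha tt; have [l' [bl' el']] := hb tt; rewrite /= in el el'.
have [u eu] : exists u, u = \sum_(j <- l) al j * b j by eexists.
have [v ev] : exists v, v = \sum_(j <- l') bl' j * a j by eexists.
have loc (T : comUnitRingType) (c : {rmorphism R -> T}) : in_cover f c -> forall j, c (b j) = c u * c (a j).
  move=> cf; have [t tu ht] := H T c cf; rewrite /= in ht.
  have -> : c u = t; last by [].
  rewrite eu; transitivity (t * c (\sum_(j <- l) al j * a j)); last by rewrite el rmorph1 mulr1.
  by rewrite !rmorph_sum mulr_sumr; apply: eq_bigr => j _; rewrite !rmorphM ht mulrCA.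
have uv : u * v = 1.
  apply/eqP; rewrite -subr_eq0; apply/eqP; apply: (local0 uf) => T c cf.
  rewrite rmorphB rmorph1 rmorphM; have -> : c u * c v = c 1; last by rewrite rmorph1 subrr.
  rewrite -el' ev !rmorph_sum mulr_sumr; apply: eq_bigr => j _.
  by rewrite !rmorphM (loc T c cf) mulrCA.
exists u; first by apply/unitrPr; exists v.
move=> j /=; apply/eqP; rewrite -subr_eq0; apply/eqP; apply: (local0 uf) => T c cf.
by rewrite rmorphB rmorphM (loc T c cf) subrr.
Qed.

Lemma sh_endo_zunit (F : zfun) (R : comUnitRingType) (a : endo F R) (x : F R) :
  zeq (sh_endo a (zunit x)) (zunit (a R idfun x)).
Proof. by move=> T c p q; apply/loc_base/zeq_sym/en_res. Qed.

Arguments zunit_res {F R T} c a.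
Arguments sh_endo_zunit {F R} a x.

Section Assembly.
Variables (N : nat) (s : 'I_N -> nat).
Hypotheses (s_gt0 : forall t, (0 < s t)%N) (n_ge2 : (2 <= \sum_(t < N) s t)%N).
Variable K : realType.
Notation vs := (vs s_gt0 n_ge2).
Notation vI := (vI s_gt0 n_ge2).
Notation vv := (vv s_gt0 n_ge2).
Notation W1 := (W1 s_gt0 n_ge2).
Notation M1 := (M1 s_gt0 n_ge2).
Notation RP := (RP s_gt0 n_ge2).
Notation degm := (degm s_gt0 n_ge2).
Notation Gdeg := (Gdeg s_gt0 n_ge2).
Notation theta := (theta s_gt0 n_ge2).
Notation base := (base K).
Notation co := (co s_gt0 n_ge2).
Notation b4 := (@b4 N s).
Notation Co := (idx2 s + idx2 s * idx2 s)%type.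

(** Indexes C by a finite type, so that conditions on all its members can be met on one cover. *)
Lemma co_surj (w : Cset s) : exists c : Co, tag (co c) = w.
Proof.
have [[v [ew hw]]|[a [b [e [d [u [-> hw]]]]]]] := G_struct s_gt0 n_ge2 w.
  have [I eI] := idx_ex s_gt0 n_ge2 v; exists (inl I) => /=; apply: val_inj.
  by rewrite /= eI; exact/esym.
have [m _] : exists m : Gset (W4 s u), True by apply: Gset_ex.
have [I [J [em sx]]] := hw m; exists (inr (I, J)).
have := u; rewrite /= !inE !negb_or => /and4P [/and3P [n1 n2 n3] /andP [n4 n5] n6 _].
have ab := adm_neq s n1; have ae := adm_neq s n2; have ad := adm_neq s n3.
have be := adm_neq s n4; have bd := adm_neq s n5; have ed := adm_neq s n6.
have mem : b4 I J =i [:: bl a; bl b; bl e; bl d].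
  have ec i j L : adm s i j -> vI L = vs i j -> forall t,
      (t == bl (sval L).1) || (t == bl (sval L).2) = (t == i) || (t == j).
    move=> ij eL t; case: (end_cases ij eL) => -[-> ->] //; exact: orbC.
  move=> t; rewrite /InteriorTransfer.b4 !inE orbA.
  case: (six_cases sx) => -[[eI eJ]|[eI eJ]];
  rewrite ?(ec _ _ _ ab eI) ?(ec _ _ _ ae eI) ?(ec _ _ _ ad eI) ?(ec _ _ _ be eI) ?(ec _ _ _ bd eI) ?(ec _ _ _ ed eI)
     ?(ec _ _ _ ab eJ) ?(ec _ _ _ ae eJ) ?(ec _ _ _ ad eJ) ?(ec _ _ _ be eJ) ?(ec _ _ _ bd eJ) ?(ec _ _ _ ed eJ);
  by do 4!case: (t == _).
have ub : uniq (b4 I J) by rewrite (eq_uniq (_ : size _ = size [:: bl a; bl b; bl e; bl d]) mem).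
rewrite /InteriorTransfer.co; case: (sumbool_of_bool (uniq (b4 I J))) => [u'|e0] /=; last by rewrite ub in e0.
exact: W4_perm.
Qed.

Lemma RP_res' (R T : comUnitRingType) (c : {rmorphism R -> T}) (z : tpt s K R) x :
  RP z x -> RP (tres c z) (c \o x).
Proof. exact: RP_res. Qed.
Arguments RP_res' {R T} c {z x} h.
Lemma RP_torus' (R : comUnitRingType) (mu : torus s R) (z : tpt s K R) x :
  RP z x -> RP (tact mu z) (fun I => wscale mu I * x I).
Proof. exact: RP_torus. Qed.
Arguments RP_torus' {R} mu {z x} h.

Definition ycoords (R : comUnitRingType) := forall w : Cset s, Pr_pre (Gset w) R.

Lemma Y_norm (R : comUnitRingType) (y : ycoords R) :
  locp (fun T (c : {rmorphism R -> T}) => exists j0 : forall w, Gset w,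
     forall w, c (sval (y w) (j0 w)) \is a GRing.unit).
Proof.
apply: locp_max => k p hk _.
have ex w : exists m, p (sval (y w) m) != 0.
  case: (y w) => v hv; have [l [a e]] := hv tt; apply: contrapT => /forallNP h.
  have /eqP : p 1 = 0.
    rewrite -e rmorph_sum big1 // => j _; rewrite rmorphM.
    by have /negP := h j; rewrite negbK => /eqP -> ; rewrite mulr0.
  by rewrite rmorph1 oner_eq0.
pose j0 w := projT1 (cid (ex w)); have hj w : p (sval (y w) (j0 w)) != 0 := projT2 (cid (ex w)).
exists (\prod_(c : Co) sval (y (tag (co c))) (j0 (tag (co c)))); first by apply: prod_pM => // c _; exact: hj.
move=> T c hc; exists j0 => w; have [i <-] := co_surj w.
by move: hc; rewrite (bigD1 i) //= rmorphM unitrM => /andP [].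
Qed.

Lemma x_units (R : comUnitRingType) (x : wedge_pre s R) :
  locp (fun T (c : {rmorphism R -> T}) => exists I0 : VS s -> idx2 s,
     (forall v, vI (I0 v) = v) /\ forall v, c (sval x (I0 v)) \is a GRing.unit).
Proof.
apply: locp_max => k p hk _.
have ex v : exists I, vI I = v /\ p (sval x I) != 0.
  have [l [a e]] := proj2_sig x v; apply: contrapT => /forallNP h.
  have /eqP : p 1 = 0.
    rewrite -e rmorph_sum big1 // => j; rewrite (inI_vI s_gt0 n_ge2) => /eqP ev; rewrite rmorphM.
    have [-> |n0] := eqVneq (p (sval x j)) 0; first by rewrite mulr0.
    by case: (h j); split.
  by rewrite rmorph1 oner_eq0.
pose I0 v := projT1 (cid (ex v)); have hj v : vI (I0 v) = v /\ p (sval x (I0 v)) != 0 := projT2 (cid (ex v)).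
exists (\prod_v sval x (I0 v)); first by apply: prod_pM => // v _; exact: (hj v).2.
move=> T c hc; exists I0; split=> v; first exact: (hj v).1.
by move: hc; rewrite (bigD1 v) //= rmorphM unitrM => /andP [].
Qed.

Lemma theta_y (R : comUnitRingType) (z : tpt s K R) x (y y' : mcoords (@Gset N s) R) :
  (forall w, exists2 u, u \is a GRing.unit & forall m, y' w m = u * y w m) -> theta z x y -> theta z x y'.
Proof.
move=> h th w; have [a [g0 [au hb e]]] := th w; have [u uu hu] := h w.
by exists (u * a), g0; split; rewrite ?unitrM ?uu // => m; rewrite hu e !mulrA.
Qed.

Definition OM (R : comUnitRingType) (z : toric_pre s K R) (x : wedge_pre s R)
  (h : RP z (sval x)) : Omega_mod s K R := exist _ (zunit z, zunit x) (omega_pt_zunit h).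

Lemma Om_eq (R : comUnitRingType) (p q : Omega s K R) :
  zeq p q -> @zeq (Omega_mod s K) R p q.
Proof.
move=> [h1 h2]; exists (torus1 s R); split.
  apply: (zeq_trans (zeq_sym h1)); apply: zeq_sym; apply: sh_endo_id => T c z; exact: tact_id.
apply: (zeq_trans (zeq_sym h2)); apply: zeq_sym; apply: sh_endo_id => T c z; exact: wact_id.
Qed.

Lemma OM_zunit_eq (R : comUnitRingType) (z z' : toric_pre s K R) (x x' : wedge_pre s R) h h' :
  zeq z z' -> zeq x x' -> zeq (zunit (@OM R z x h)) (zunit (@OM R z' x' h')).
Proof.
by move=> hz hx; apply/zunit_loc_eq/loc_base/Om_eq; split; apply/zunit_loc_eq/loc_base.
Qed.

Arguments OM_zunit_eq {R z z' x x' h h'} ez ex : rename.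

Lemma OM_res (R T : comUnitRingType) (c : {rmorphism R -> T}) (z : toric_pre s K R) (x : wedge_pre s R)
  (h : RP z (sval x)) (h' : RP (zres c z : toric_pre s K T) (sval (zres c x : wedge_pre s T))) :
  zeq (zres c (zunit (OM h))) (zunit (OM h')).
Proof.
apply: zeq_trans (zunit_res c _) _; apply/zunit_loc_eq/loc_base/Om_eq.
by split; exact: zunit_res.
Qed.

Arguments OM_res {R T} c {z x} h h'.

Lemma OM_torus (R : comUnitRingType) (mu : torus s R) (z : toric_pre s K R) (x : wedge_pre s R)
  (h : RP z (sval x)) (h' : RP (tact mu z) (sval (wact mu x))) :
  zeq (zunit (OM h)) (zunit (OM h')).
Proof.
have e1 : @zeq (toric s K) R (sh_endo (tact_endo K mu) (zunit z)) (zunit (tact mu z : toric_pre s K R)).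
  apply: zeq_trans (sh_endo_zunit _ _) _; apply/zunit_loc_eq/loc_base.
  by apply: rst_step; apply: tglue_ext.
have e2 : @zeq (wedge s) R (sh_endo (wact_endo mu) (zunit x)) (zunit (wact mu x : wedge_pre s R)).
  apply: zeq_trans (sh_endo_zunit _ _) _; apply/zunit_loc_eq/loc_base.
  by exists 1; rewrite ?unitr1 // => I /=; rewrite mul1r.
by apply/zunit_loc_eq/loc_base; exists mu; split; [exact: (zeq_sym e1)|exact: (zeq_sym e2)].
Qed.

Arguments OM_torus {R mu z x} h h'.

Definition dat (R : comUnitRingType) (X : Mn s R) (D : Omega_bar s K R) (z : toric_pre s K R)
    (x : wedge_pre s R) (y : ycoords R) : Prop :=
  exists h : RP z (sval x), [/\ zeq D (zunit (OM h)), forall w, zeq (sval X w) (zunit (y w))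
    & theta z (sval x) (fun w => sval (y w))].
Definition rel0 (R : comUnitRingType) (X : Mn s R) (D : Omega_bar s K R) : Prop :=
  exists z x y, dat X D z x y.

Lemma dat_res (R T : comUnitRingType) (c : {rmorphism R -> T}) X D z x y :
  @dat R X D z x y -> @dat T (zres c X) (zres c D) (zres c z) (zres c x) (fun w => zres c (y w)).
Proof.
move=> [h [hD hX th]].
have h' : RP (zres c z : toric_pre s K T) (sval (zres c x : wedge_pre s T)) := RP_res' c h.
exists h'; split.
- exact: zeq_trans (zres_eq c hD) (OM_res c h h').
- by move=> w; exact: zeq_trans (zres_eq c (hX w)) (zunit_res c _).
- exact: (theta_res c th).
Qed.

Lemma rel0_res (R T : comUnitRingType) (c : {rmorphism R -> T}) X D :
  @rel0 R X D -> @rel0 T (zres c X) (zres c D).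
Proof. by move=> [z [x [y h]]]; do 3!eexists; exact: (dat_res c h). Qed.

Lemma rel0_eq (R : comUnitRingType) (X X' : Mn s R) (D D' : Omega_bar s K R) :
  zeq X X' -> zeq D D' -> rel0 X D -> rel0 X' D'.
Proof.
move=> eX eD [z [x [y [h [hD hX th]]]]]; exists z, x, y, h; split=> //.
  exact: zeq_trans (zeq_sym eD) hD.
by move=> w; exact: zeq_trans (zeq_sym (eX w)) (hX w).
Qed.

(** The coordinates are scaled to equal 1 at [j0 w]; the linear ones among them form [xn], to which
    every related [x] can be moved by the torus. *)
Definition yn (R : comUnitRingType) (y : ycoords R) (j0 : forall w, Gset w) : mcoords (@Gset N s) R :=
  fun w m => (sval (y w) (j0 w))^-1 * sval (y w) m.
Definition xn (R : comUnitRingType) (y : ycoords R) (j0 : forall w, Gset w) : idx2 s -> R :=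
  fun I => yn y j0 (M1 I).

Lemma gset1 v (m : Gset (W1 v)) : exists I, sval m = d1 I /\ vI I = v.
Proof.
have s2 : (\sum_t sval (W1 v) t = 2)%N.
  by rewrite /=; under eq_bigr do rewrite ffunE; exact: vco_sum.
have [I [em hw]] := inG1 s_gt0 n_ge2 s2 (asboolW (svalP m)).
by exists I; split=> //; apply: vcoP => t; rewrite -hw /= ffunE.
Qed.

Section Normalised.
Variables (R : comUnitRingType) (y : ycoords R) (j0 : forall w : Cset s, Gset w).
Hypothesis hj0 : forall w, sval (y w) (j0 w) \is a GRing.unit.

Lemma yn_u w : exists2 u, u \is a GRing.unit & forall m, yn y j0 m = u * sval (y w) m.
Proof. by exists (sval (y w) (j0 w))^-1; rewrite ?unitrV. Qed.
Lemma yn_u' w : exists2 u, u \is a GRing.unit & forall m, sval (y w) m = u * yn y j0 m.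
Proof. by exists (sval (y w) (j0 w)) => // m; rewrite /yn mulVKr. Qed.

Lemma xn_I0 : exists I0 : VS s -> idx2 s, [/\ forall v, vI (I0 v) = v,
   forall v, sval (j0 (W1 v)) = d1 (I0 v) & forall v, xn y j0 (I0 v) = 1].
Proof.
pose I0 v := projT1 (cid (gset1 (j0 (W1 v)))).
have hI v : sval (j0 (W1 v)) = d1 (I0 v) /\ vI (I0 v) = v := projT2 (cid (gset1 (j0 (W1 v)))).
exists I0; split=> v; [exact: (hI v).2|exact: (hI v).1|].
have [e1 e2] := hI v; rewrite /xn.
have -> : yn y j0 (M1 (I0 v)) = yn y j0 (j0 (W1 v)).
  by apply: (@coords_ext N s R (yn y j0)); [rewrite e2|rewrite e1].
by rewrite /yn mulVr.
Qed.

(** In each degree [v] the linear coordinates are the [x_I] up to a unit depending only on [v];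
    these units form the torus element that moves [x] onto [xn]. *)
Lemma dat_norm X D z x : @dat R X D z x y -> exists (z' : toric_pre s K R) (x' : wedge_pre s R) h',
  [/\ zeq D (zunit (@OM R z' x' h')), sval x' = xn y j0 & theta z' (xn y j0) (yn y j0)].
Proof.
move=> [h [hD hX th]]; have th' : theta z (sval x) (yn y j0) := theta_y yn_u th.
have ha v : exists2 a, a \is a GRing.unit & forall I, vI I = v -> xn y j0 I = a * sval x I.
  have [a [g0 [au hb e]]] := th' (W1 v); exists a => // I eI; subst v.
  have [m eg] := hb.1; have [J [em eJ]] := gset1 m.
  rewrite /xn e /= degm_d1 mono_d1 eg em degm_d1 eJ subrr.
  by rewrite (tp_0 z) mulr1.
pose mu : torus s R := exist (fun nu : VS s -> R => forall v, nu v \is a GRing.unit)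
   (fun v => s2val (cid2 (ha v))) (fun v => s2valP (cid2 (ha v))).
have ex : sval (wact mu x) = xn y j0.
  apply/funext => I /=; rewrite (wscaleE s_gt0 n_ge2) /= -(s2valP' (cid2 (ha (vI I)))) //.
have h' : RP (tact mu z) (sval (wact mu x)) := RP_torus' mu h.
exists (tact mu z), (wact mu x), h'; split=> //.
  exact: zeq_trans hD (OM_torus h h').
by rewrite -ex; exact: (theta_torus mu th').
Qed.

Lemma canon_at (X : Mn s R) : (forall w, zeq (sval X w) (zunit (y w))) ->
  locp (fun T (c : {rmorphism R -> T}) => exists z : tpt s K T,
    [/\ RP z (c \o xn y j0), theta z (c \o xn y j0) (fun w m => c (yn y j0 m))
      & forall z1 : tpt s K R, RP z1 (xn y j0) -> theta z1 (xn y j0) (yn y j0) -> tsub (tres c z1) z]).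
Proof.
move=> hX; have [I0 [hI0 hj _]] := xn_I0; apply: (canonical K hI0 _ hj).
  move=> f hf; have [e he] := mf_scale f.
  have -> := he R (fun w => (sval (y w) (j0 w))^-1) (fun w => sval (y w)) (yn y j0) (fun w j => erefl).
  rewrite (_ : mf_eval f _ = 0) ?mulr0 //.
  apply: ((proj2_sig X) R idfun y _ f hf) => w.
  exact: zeq_trans (@zres_id _ _ idfun _ (fun=> erefl)) (hX w).
by move=> w; rewrite /yn mulVr.
Qed.
End Normalised.

Lemma reduced_pt_eq (R : comUnitRingType) (x x' : zprod (fun w => Pr (Gset w)) R) :
  zeq x x' -> reduced_pt (@imageM N s) x -> reduced_pt (@imageM N s) x'.
Proof.
move=> e h T c y hy; apply: (h T c) => w; exact: zeq_trans (zres_eq c (e w)) (hy w).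
Qed.

Lemma Mn_sep : zsep (Mn s).
Proof. by apply: zsub_sep; apply: zprod_sep => w; exact: sheafify_sep. Qed.

Lemma Mn_glue : zglue (Mn s).
Proof.
apply: zsub_glue.
- by apply: zprod_glue => w; exact: sheafify_glue.
- by move=> R x x'; exact: reduced_pt_eq.
- move=> R x [f uf H] T c y hy g hg; apply: (local0 (unit_ideal_map c uf)) => U d df.
  have cf := in_cover_map1 df.
  rewrite -mf_map; apply: (H U _ cf U idfun (fun w => zres d (y w)) _ g hg) => w.
  apply: zeq_trans (@zres_id _ _ idfun _ (fun=> erefl)) _.
  apply: zeq_trans (zres_comp1 c d _) _.
  exact: zeq_trans (zres_eq d (hy w)) (zunit_res d _).
Qed.

Lemma tsub_teq (R : comUnitRingType) (z z' : tpt s K R) : tsub z z' -> teq z z'.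
Proof.
move=> [h1 h2]; apply: rst_step; exists z'; split=> //.
by apply/seteqP; split=> [u hu|u []//]; split=> //; exact: h1.
Qed.

(** After normalisation both toric points are related to the same coordinates, so near every point
    both coincide with the canonical one. *)
Lemma rel0_fun (R : comUnitRingType) (X : Mn s R) (D D' : Omega_bar s K R) :
  rel0 X D -> rel0 X D' -> zeq D D'.
Proof.
move=> [z [x [y h1]]] [z' [x' [y' [h' [hD' hX' th']]]]].
have [_ [_ hX _]] := h1.
have h2 : dat X D' z' x' y.
  exists h'; split=> //; apply: theta_y th' => w.
  have : zeq (y' w) (y w).
    by apply: Pr_sep; apply: loc_eq_zunit; exact: zeq_trans (zeq_sym (hX' w)) (hX w).
  by move=> [u uu e]; exists u.
apply: sheafify_sep; apply: (locp_imp _ (Y_norm y)) => T c [j0 hj0].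
pose yT : ycoords T := fun w => zres c (y w).
have hj1 : forall w, sval (yT w) (j0 w) \is a GRing.unit by exact: hj0.
have {h1} h1 : dat (zres c X) (zres c D) (zres c z) (zres c x) yT := dat_res c h1; have {h2} h2 : dat (zres c X) (zres c D') (zres c z') (zres c x') yT := dat_res c h2.
have [_ [_ hXT _]] := h1.
have [z1 [x1 [k1 [hD1 e1 t1]]]] := dat_norm hj1 h1.
have [z2 [x2 [k2 [hD2 e2 t2]]]] := dat_norm hj1 h2.
apply: sheafify_sep; apply: (locp_imp _ (canon_at hj1 hXT)) => U d [zc [_ _ un]].
have r1 : RP z1 (xn yT j0) by rewrite -e1.
have r2 : RP z2 (xn yT j0) by rewrite -e2.
have q1 : RP (zres d z1 : toric_pre s K U) (sval (zres d x1 : wedge_pre s U)) := RP_res' d k1.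
have q2 : RP (zres d z2 : toric_pre s K U) (sval (zres d x2 : wedge_pre s U)) := RP_res' d k2.
apply: zeq_trans (zres_eq d hD1) _; apply: zeq_sym; apply: zeq_trans (zres_eq d hD2) _; apply: zeq_sym.
apply: zeq_trans (OM_res d k1 q1) _; apply: zeq_sym; apply: zeq_trans (OM_res d k2 q2) _; apply: zeq_sym.
apply: OM_zunit_eq.
  exact: rst_trans (tsub_teq (un _ r1 t1)) (rst_sym _ _ _ _ (tsub_teq (un _ r2 t2))).
by exists 1; rewrite ?unitr1 // => I /=; rewrite mul1r e1 e2.
Qed.

(** Points in one orbit have representatives that agree, on a cover, up to gluing, scaling and the
    torus action, and each of these preserves [theta]. *)
Lemma orbit_coords (R : comUnitRingType) (mu : torus s R) (z z' : toric_pre s K R) (x x' : wedge_pre s R)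
    (y y' : ycoords R) :
  zeq (zunit z') (sh_endo (tact_endo K mu) (zunit z)) -> zeq (zunit x') (sh_endo (wact_endo mu) (zunit x)) ->
  theta z (sval x) (fun w => sval (y w)) -> theta z' (sval x') (fun w => sval (y' w)) ->
  forall w, zeq (zunit (y w)) (zunit (y' w)).
Proof.
move=> hz hx th th' w.
have lz := loc_eq_zunit (zeq_trans hz (sh_endo_zunit _ _)).
have lx := loc_eq_zunit (zeq_trans hx (sh_endo_zunit _ _)).
apply: sheafify_sep; apply: (locp_imp _ (locp_and (loc_eq_locp lz) (loc_eq_locp lx))) => T c [ez ex].
have [u uu hu] := zeq_sym ex.
have t1 := theta_res c (theta_torus (torus_res idfun mu) th).
have t2 := (theta_teq s_gt0 n_ge2 _ _ ez).2 t1.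
have t3 := theta_scale uu hu t2.
have [u' uu' e] := theta_uniq t3 (theta_res c th') w.
apply: zeq_trans (zunit_res c _) _; apply: zeq_sym; apply: zeq_trans (zunit_res c _) _; apply: zeq_sym.
by apply/zunit_loc_eq/loc_base; exists u'.
Qed.

Lemma rel0_inj (R : comUnitRingType) (X X' : Mn s R) (D : Omega_bar s K R) :
  rel0 X D -> rel0 X' D -> zeq X X'.
Proof.
move=> [z [x [y h1]]] [z' [x' [y' h2]]].
have [k1 [hD _ _]] := h1; have [k2 [hD' _ _]] := h2.
have lo := loc_eq_zunit (zeq_trans (zeq_sym hD) hD').
apply: Mn_sep; apply: (locp_imp _ (loc_eq_locp lo)) => T c [mu [o1 o2]].
have [_ [_ hX t1]] := dat_res c h1; have [_ [_ hX' t2]] := dat_res c h2.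
move=> w; apply: zeq_trans (hX w) _; apply: zeq_trans (zeq_sym (hX' w)).
apply: (orbit_coords (mu := mu) _ _ t1 t2).
  apply: zeq_trans (zeq_sym (zunit_res c z')) _; apply: zeq_trans o1 _.
  exact: (@sh_endo_eq _ T (tact_endo K mu) _ _ (zunit_res c z)).
apply: zeq_trans (zeq_sym (zunit_res c x')) _; apply: zeq_trans o2 _.
exact: (@sh_endo_eq _ T (wact_endo mu) _ _ (zunit_res c x)).
Qed.

Lemma exD_trans (R : comUnitRingType) (X : Mn s R) :
  locp (fun T (c : {rmorphism R -> T}) => locp (fun U (d : {rmorphism T -> U}) =>
     exists D, rel0 (zres d (zres c X)) D)) ->
  locp (fun T (c : {rmorphism R -> T}) => exists D, rel0 (zres c X) D).
Proof.
move=> h; apply: locp_trans.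
  move=> T c d e [D hD]; exists D; apply: rel0_eq hD; [exact: zres_ext|exact: zeq_refl].
apply: (locp_imp _ h) => T c; apply: locp_imp => U d [D hD]; exists D.
by apply: rel0_eq hD; [apply: zeq_sym; exact: zres_comp1|exact: zeq_refl].
Qed.

Lemma exX_trans (R : comUnitRingType) (D : Omega_bar s K R) :
  locp (fun T (c : {rmorphism R -> T}) => locp (fun U (d : {rmorphism T -> U}) =>
     exists X, rel0 X (zres d (zres c D)))) ->
  locp (fun T (c : {rmorphism R -> T}) => exists X, rel0 X (zres c D)).
Proof.
move=> h; apply: locp_trans.
  move=> T c d e [X hX]; exists X; apply: rel0_eq hX; [exact: zeq_refl|exact: zres_ext].
apply: (locp_imp _ h) => T c; apply: locp_imp => U d [X hX]; exists X.
by apply: rel0_eq hX; [exact: zeq_refl|apply: zeq_sym; exact: zres_comp1].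
Qed.

(** The canonical toric point and the normalised linear coordinates form the required point; the
    latter are unimodular because in each degree one of them is 1. *)
Lemma exD_norm (R : comUnitRingType) (X : Mn s R) (y : ycoords R) (j0 : forall w : Cset s, Gset w) :
  (forall w, sval (y w) (j0 w) \is a GRing.unit) -> (forall w, zeq (sval X w) (zunit (y w))) ->
  locp (fun T (c : {rmorphism R -> T}) => exists D, rel0 (zres c X) D).
Proof.
move=> hj0 hX; have [I0 [hI0 _ x1]] := xn_I0 hj0.
apply: (locp_imp _ (canon_at hj0 hX)) => T c [z [rp th _]].
have xu v : unimodular (inI v) (c \o xn y j0).
  exists [:: I0 v], (fun=> 1); rewrite big_cons big_nil (inI_vI s_gt0 n_ge2) hI0 eqxx /=.
  by rewrite x1 rmorph1 mulr1 addr0.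
pose x : wedge_pre s T := exist _ (c \o xn y j0) xu.
have h : RP (z : toric_pre s K T) (sval x) by [].
exists (zunit (OM h)), z, x, (fun w => zres c (y w)), h; split.
- exact: zeq_refl.
- by move=> w; exact: zeq_trans (zres_eq c (hX w)) (zunit_res c _).
- apply: theta_y th => w; have [u uu e] := yn_u' hj0 w.
  by exists (c u); rewrite ?rmorph_unit // => m /=; rewrite e rmorphM.
Qed.

Lemma exD (R : comUnitRingType) (X : Mn s R) :
  locp (fun T (c : {rmorphism R -> T}) => exists D, rel0 (zres c X) D).
Proof.
apply: exD_trans.
have hf : locp (fun T (c : {rmorphism R -> T}) => forall i : Co,
    exists a : Pr_pre (Gset (tag (co i))) T, zeq (zres c (sval X (tag (co i)))) (zunit a)).
  by apply: locp_fin => i; exact: zunit_surj.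
apply: (locp_imp _ hf) => T c H.
have {}H w : exists a : Pr_pre (Gset w) T, zeq (zres c (sval X w)) (zunit a).
  by have [i <-] := co_surj w; exact: H.
pose y w := projT1 (cid (H w)); have hy w : zeq (sval (zres c X) w) (zunit (y w)) := projT2 (cid (H w)).
apply: exD_trans; apply: (locp_imp _ (Y_norm y)) => U d [j0 hj0].
apply: (@exD_norm U _ (fun w => zres d (y w)) j0 hj0) => w.
exact: zeq_trans (zres_eq d (hy w)) (zunit_res d _).
Qed.

(** The least degree is attained by a monomial in the coordinates assumed invertible, so each family
    of divided monomials is unimodular and defines a point of projective space; [theta_vanish]
    places it in [Mn]. *)
Lemma exX_units (R : comUnitRingType) (z : toric_pre s K R) (x : wedge_pre s R) (h : RP z (sval x))
    (I0 : VS s -> idx2 s) : (forall v, vI (I0 v) = v) -> (forall v, sval x (I0 v) \is a GRing.unit) ->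
  exists X, rel0 X (zunit (OM h)).
Proof.
move=> hI0 hx.
have hb w := Gdeg_base s_gt0 n_ge2 w (tp_ok z).
pose g0 w := projT1 (cid (hb w)); have hg w : base (tp_pav z) (Gdeg w) (g0 w) := projT2 (cid (hb w)).
pose yv w (m : Gset w) := tp_val z (degm (sval m) - g0 w) * mono (sval x) (sval m).
have yu w : exists m : Gset w, yv w m \is a GRing.unit.
  have [m0 eg] := (hg w).1.
  have [m [em um]] : exists m : Gset w, degm (sval m) = degm (sval m0) /\ mono (sval x) (sval m) \is a GRing.unit.
    have [[v [ew hw]]|[a [b [e [d [u [ew hw]]]]]]] := G_struct s_gt0 n_ge2 w.
      have [I [em eI]] := hw m0.
      have hG : inG (sval w) (d1 (I0 v)).
        by apply: (@inG_d1 _ _ s_gt0 n_ge2) => t; rewrite ew ffunE hI0.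
      by exists (mkG hG); rewrite /= em !degm_d1 hI0 eI mono_d1.
    have [I [J [em sx]]] := hw m0; move/(W4_deg s_gt0 n_ge2 u): sx => sx.
    have hG : inG (sval w) (d2 (I0 (vI I)) (I0 (vI J))).
      by apply: (@inG_d2 _ _ s_gt0 n_ge2) => t; rewrite ew /= ffunE sx !hI0.
    by exists (mkG hG); rewrite /= em !degm_d2 !hI0 mono_d2 unitrM !hx.
  by exists m; rewrite /yv em -eg subrr (tp_0 z) mul1r.
have yp w (b : unit) : unimodular (fun _ : Gset w => true) (yv w).
  have [m um] := yu w; exists [:: m], (fun=> (yv w m)^-1).
  by rewrite big_seq1 mulVr.
pose y w : Pr_pre (Gset w) R := exist _ (yv w) (yp w).
have th : theta z (sval x) (fun w => sval (y w)).
  by move=> w; exists 1, (g0 w); split; rewrite ?unitr1 // => m; rewrite /= /yv mul1r.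
have red : reduced_pt (@imageM N s) (fun w => zunit (y w) : Pr (Gset w) R).
  move=> T c y1 hy1 f hf.
  have e1 w : exists2 u, u \is a GRing.unit & forall m, sval (y1 w) m = u * c (yv w m).
    have : zeq (zres c (y w)) (y1 w).
      by apply: Pr_sep; apply: loc_eq_zunit; exact: zeq_trans (zeq_sym (zunit_res c _)) (hy1 w).
    by move=> [u uu e]; exists u.
  have t1 : theta (tres c z) (c \o sval x) (fun w => sval (y1 w)) := theta_y e1 (theta_res c th).
  apply: (theta_vanish (RP_res' c h) t1 hI0 _ hf) => v /=; exact: rmorph_unit.
pose X : Mn s R := exist _ _ red.
by exists X, z, x, y, h; split=> // [|w]; exact: zeq_refl.
Qed.

Lemma exX (R : comUnitRingType) (D : Omega_bar s K R) :
  locp (fun T (c : {rmorphism R -> T}) => exists X, rel0 X (zres c D)).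
Proof.
apply: exX_trans; apply: (locp_imp _ (zunit_surj D)) => T c [p hp].
apply: exX_trans.
apply: (locp_imp _ (locp_and (zunit_surj (sval p).1) (zunit_surj (sval p).2))) => U d [[z hz] [x hx]].
have h : RP z (sval x) := @omega_pt_RP _ _ s_gt0 n_ge2 K U (zres d (p : Omega s K T)) z x hz hx.
have eD : zeq (zres d (zres c D)) (zunit (OM h)).
  apply: zeq_trans (zres_eq d hp) _; apply: zeq_trans (zunit_res d _) _.
  by apply/zunit_loc_eq/loc_base/Om_eq; split.
apply: (locp_imp _ (x_units x)) => V e [I0 [hI0 hx0]].
have h' : RP (zres e z : toric_pre s K V) (sval (zres e x : wedge_pre s V)) := RP_res' e h.
have [X rX] := exX_units h' hI0 hx0; exists X; apply: rel0_eq rX; first exact: zeq_refl.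
exact: zeq_sym (zeq_trans (zres_eq e eD) (OM_res e h h')).
Qed.

Lemma Mn_Omega_bar_iso : ziso (Mn s) (Omega_bar s K).
Proof.
have rTh R (X : Mn s R) (D : Omega_bar s K R) : rel0 X D ->
    locp (fun T (c : {rmorphism R -> T}) => rel0 (zres c X) (zres c D)).
  by move=> h; apply: locp_all => T c; exact: rel0_res.
apply: (ziso_of_rel Mn_sep Mn_glue (@sheafify_sep _) (@sheafify_glue _)
  (Th := fun R X D => locp (fun T (c : {rmorphism R -> T}) => rel0 (zres c X) (zres c D)))).
- move=> R T c X D h; have := locp_res c h; apply: locp_imp => U d.
  by apply: rel0_eq; exact: zres_comp1.
- by move=> R X X' D D' eX eD; apply: locp_imp => T c; apply: rel0_eq; exact: zres_eq.
- move=> R X D D' h h'; apply: sheafify_sep; apply: (locp_imp _ (locp_and h h')) => T c [r r'].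
  exact: rel0_fun r r'.
- move=> R X X' D h h'; apply: Mn_sep; apply: (locp_imp _ (locp_and h h')) => T c [r r'].
  exact: rel0_inj r r'.
- by move=> R X; apply: (locp_imp _ (exD X)) => T c [D r]; exists D; exact: rTh.
- by move=> R D; apply: (locp_imp _ (exX D)) => T c [X r]; exists X; exact: rTh.
Qed.
End Assembly.
End IsoAssembly.

Import IsoAssembly.

Theorem theorem1p4 (K : realType) (N : nat) (s : 'I_N -> nat)
    (s_gt0 : forall t, (0 < s t)%N) (n_ge2 : (2 <= \sum_(t < N) s t)%N) :
  ziso (Mn s) (Omega_bar s K).
Proof. exact: (Mn_Omega_bar_iso s_gt0 n_ge2 K). Qed.
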